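(* Let $X\subseteq\mathbb{P}^r$ be a quasi-projective variety of dimension $n\ge 1$ and let $k\geq 1$. There exists a nonempty open subset $\mathbf{U}_{\tau^k}$ of $X$ contained in $\mathbf{U}_k$ with the following property: for each point $x\in\mathbf{U}_{\tau^k}$ there exists a nonempty open subset $U_x$ of $\mathbf{T}^k_x(X)$ such that for every point $y\in U_x$, $\tau^k(X)$ is nonsingular at $y$ and $$\operatorname{Im}f_{k+1,x,y}=\frac{T_y(\tau^k(X))}{T_y(\mathbf{T}^k_x(X))}.$$ In particular, $$\dim\tau^k(X)=\dim\mathbf{T}^k_x(X)+\operatorname{rank}f_{k+1,x,y}.$$
   Context: Work over $\mathbb{C}$; a variety is separated, reduced, irreducible, of finite type over $\mathbb{C}$. Let $L=\mathcal{O}_X(1)$, $V=H^0(\mathbb{P}^r,\mathcal{O}_{\mathbb{P}^r}(1))$, so $\mathbb{P}^r=\mathbb{P}(V)$ is the space of lines in $V^*$; for $y\in\mathbb{P}^r$ let $\hat y\subset V^*$ be the corresponding line. For $k\ge 0$ let $P^k(L)=pr_{1,*}\big((\mathcal{O}_{X\times X}/I_\Delta^{k+1})\otimes pr_2^*L\big)$ be the sheaf of $k$-th order principal parts, with universal differential operator $d^k_L:L\to P^k(L)$ induced by $pr_2$. The Taylor series map is $\alpha_k:V\otimes\mathcal{O}_X\to P^k(L)$, $T\otimes a\mapsto a\,d^k_L(T|_X)$; put $P_k=(\operatorname{Im}\alpha_k)\otimes L^*$. Let $\mathbf{U}_k$ be the maximal open subset of $X$ contained in the nonsingular locus on which $P^i(L)/(P_i\otimes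 L)$ is locally free of constant rank for all $i\le k$. The $k$-th projective tangent space is $\mathbf{T}^k_x(X)=\mathbb{P}(P_k\otimes L\otimes k(x))\subseteq\mathbb{P}^r$, with corresponding linear subspace $\widehat{\mathbf{T}}^k_x(X)\subseteq V^*$. The $k$-th tangent variety $\tau^k(X)$ is the Zariski closure of $\bigcup_{x\in\mathbf{U}_k}\mathbf{T}^k_x(X)$. On $\mathbf{U}_k$, $P_k^*\otimes L^*$ is a subbundle of $V^*\otimes\mathcal{O}_X$ with fibre $\widehat{\mathbf{T}}^k_x(X)$ at $x$. A local vector field $\partial$ acts on $V^*\otimes\mathcal{O}_X$ by $\mathrm{id}\otimes\partial$. For $x\in\mathbf{U}_k$, $u\in T_x(X)$, $v\in\widehat{\mathbf{T}}^k_x(X)$, choose a local vector field $\partial_u$ with $\partial_u(x)=u$ and a local section $B_v$ of $P_k^*\otimes L^*$ with $B_v(x)=v$; then $f_{k+1,x}(u,v)=\partial_u(B_v)(x)\bmod\widehat{\mathbf{T}}^k_x(X)$ (independent of choices) defines a bilinear map $f_{k+1,x}:T_x(X)\times\widehat{\mathbf{T}}^k_x(X)\to V^*/\widehat{\mathbf{T}}^k_x(X)$. For $y\in\mathbf{T}^k_x(X)$, so $\hat y\subseteq\widehat{\mathbf{T}}^k_x(X)$, define the linear map $$f_{k+1,x,y}:T_x(X)\to\operatorname{Hom}(\hat y,V^*/\widehat{\mathbf{T}}^k_x(X)),\quad u\mapsto f_{k+1,x}(u,\cdot)|_{\hat y}.$$ The equality of subspaces takes place in $\operatorname{Hom}(\hat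 y,V^*/\widehat{\mathbf{T}}^k_x(X))=T_y(\mathbb{P}^r)/T_y(\mathbf{T}^k_x(X))$, using the canonical identification of the normal space at $y$ of the linear subspace $\mathbf{T}^k_x(X)\subseteq\mathbb{P}^r$. *)

(* Defs.v *)
(* Varieties over the complex numbers R[i], R : realType, are treated through
   their closed points in projective space; opens, closed sets and dimensions
   are those of the Zariski topology. *)
From HB Require Import structures.
From mathcomp Require Import all_boot all_order all_algebra.
From mathcomp Require Import complex.
From mathcomp Require Import boolp classical_sets reals.
From mathcomp Require Import mpoly.

Set Implicit Arguments.
Unset Strict Implicit.
Unset Printing Implicit Defensive.

Import GRing.Theory Num.Theory.
Local Open Scope ring_scope.
Local Open Scope classical_set_scope.

Section LinearAlgebra.
Variables (K : fieldType) (vT : vectType K).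
Implicit Type U : {vspace vT}.

(* The linear subspace with a given set of elements. *)
Definition vspace_of (A : set vT) : {vspace vT} :=
  xget 0%VS [set U : {vspace vT} | forall v, v \in U <-> A v].

Lemma mem_vspace_of (A : set vT) :
    A 0 -> (forall (c : K) u v, A u -> A v -> A (c *: u + v)) ->
  forall v, v \in vspace_of A <-> A v.
Proof.
move=> A0 Alin.
apply: (@xgetPex _ 0%VS [set U : {vspace vT} | forall v, v \in U <-> A v]).
pose P n := `[< exists2 U : {vspace vT},
                  \dim U = n & forall v, v \in U -> A v >].
have P0 : exists n, P n.
  exists 0%N; apply/asboolP; exists 0%VS; first by rewrite dimv0.
  by move=> v; rewrite memv0 => /eqP ->.
have Pb n : P n -> (n <= \dim {:vT})%N.
  by case/asboolP => U <- _; apply/dimvS/subvf.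
case: (ex_maxnP P0 Pb) => n /asboolP[U dU UA] nmax.
exists U => v; split=> [|Av]; first exact: UA.
apply: contrapT => /negP vU.
have /nmax : P (\dim (<[v]> + U)%VS).
  apply/asboolP; exists (<[v]> + U)%VS => // w.
  by case/memv_addP => _ /vlineP[c ->] [u /UA Au ->]; apply: Alin.
rewrite -dU leqNgt => /negP; apply.
rewrite ltnNge; apply/negP => led; move/negP: vU; apply.
have /eqP -> : U == (<[v]> + U)%VS by rewrite eqEdim addvSr led.
exact: (subvP (addvSl _ _) _ (memv_line v)).
Qed.

(* The quotient space vT / U, modelled by a complement of U; the pair
   (quo U, quo_proj U) is characterized by the two lemmas below. *)
Definition quo U : vectType K := subvs_of (U^C)%VS.

Definition quo_proj U : 'Hom(vT, quo U) :=
  (linfun (vsproj (U^C)%VS) \o daddv_pi (U^C)%VS U)%VF.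

Definition quo_lift U : 'Hom(quo U, vT) := linfun vsval.

Lemma quo_liftK U : cancel (quo_lift U) (quo_proj U).
Proof.
have cap0 : ((U^C)%VS :&: U = 0)%VS by rewrite capvC capv_compl.
move=> q; rewrite /quo_proj /quo_lift comp_lfunE !(lfunE vsval) /=.
rewrite (lfunE (vsproj _)) /= daddv_pi_id ?subvsP //.
exact: vsvalK.
Qed.

Lemma ker_quo_proj U v : (quo_proj U v == 0) = (v \in U).
Proof.
have cap0 : ((U^C)%VS :&: U = 0)%VS by rewrite capvC capv_compl.
have cap0' : (U :&: (U^C)%VS = 0)%VS by rewrite capv_compl.
rewrite /quo_proj comp_lfunE (lfunE (vsproj _)); apply/eqP/idP => [|vU].
  move/(congr1 vsval); rewrite vsprojK ?memv_pi // linear0 => p0.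
  rewrite -(@daddv_pi_add _ _ _ _ v cap0) ?p0 ?add0r ?memv_pi //.
  by rewrite addvC addv_complf memvf.
have : daddv_pi (U^C)%VS U v + daddv_pi U (U^C)%VS v = v.
  by apply: daddv_pi_add => //; rewrite addvC addv_complf memvf.
rewrite (daddv_pi_id cap0' vU) -[X in _ = X]add0r => /addIr ->.
by rewrite linear0.
Qed.

Lemma quo_proj_lift U T w : (U <= T)%VS ->
  quo_proj T (quo_lift U (quo_proj U w)) = quo_proj T w.
Proof.
move=> UT; apply/eqP; rewrite -subr_eq0 -linearB ker_quo_proj.
by apply: (subvP UT); rewrite -ker_quo_proj linearB /= quo_liftK subrr.
Qed.

End LinearAlgebra.

Section PostComposition.
Variables (K : fieldType) (aT rT sT : vectType K) (g : 'Hom(rT, sT)).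

(* Hom(aT, g) : Hom(aT, rT) -> Hom(aT, sT) *)
Definition postcomp : 'Hom('Hom(aT, rT), 'Hom(aT, sT)) :=
  linfun (fun f : 'Hom(aT, rT) => (g \o f)%VF).

Lemma postcompE f : postcomp f = (g \o f)%VF.
Proof.
have lin : linear (fun f : 'Hom(aT, rT) => (g \o f)%VF).
  by move=> c f1 f2; rewrite comp_lfunDr comp_lfunZr.
pose h := GRing.isLinear.Build _ _ _ _ _ lin.
pose p : {linear 'Hom(aT, rT) -> 'Hom(aT, sT)} :=
  HB.pack (fun f : 'Hom(aT, rT) => (g \o f)%VF) h.
exact: (lfunE p f).
Qed.
End PostComposition.

Section NormalSpace.
Variables (K : fieldType) (vT : vectType K) (U T : {vspace vT}).

(* For a line U contained in T, this is the natural map from the tangent space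
   Hom(U, vT / U) of P(vT) at the point U to the normal space Hom(U, vT / T) of
   P(T) at U.  Its kernel is the tangent space of P(T) at U (lemma
   tangent_linear_subvariety), so the image of a subspace S containing that
   tangent space is the quotient of S by it. *)
Definition normal_proj :
    'Hom('Hom(subvs_of U, quo U), 'Hom(subvs_of U, quo T)) :=
  postcomp _ (quo_proj T \o quo_lift U)%VF.

Lemma normal_projE phi u :
  normal_proj phi u = quo_proj T (quo_lift U (phi u)).
Proof. by rewrite /normal_proj postcompE !comp_lfunE. Qed.

Lemma limg_normal_proj : (U <= T)%VS -> limg normal_proj = fullv.
Proof.
move=> UT; apply/eqP; rewrite eqEsubv subvf /=; apply/subvP => psi _.
pose phi : 'Hom(subvs_of U, quo U) := (quo_proj U \o (quo_lift T \o psi))%VF.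
suff -> : psi = normal_proj phi by rewrite memv_img ?memvf.
apply/lfunP => u; rewrite normal_projE /phi (comp_lfunE (quo_proj _)) (comp_lfunE (quo_lift _)).
by rewrite quo_proj_lift // quo_liftK.
Qed.

End NormalSpace.


Section ProjectiveSpace.
Variables (R : realType) (r : nat).
Notation C := R[i].

(* dualV is V^*, formV is V = H^0(P^r, O(1)). *)
Definition dualV : vectType C := 'rV[C]_r.+1.
Definition formV : vectType C := 'Hom(dualV, C^o).

Definition pt := {y : {vspace dualV} | \dim y == 1%N}.
Definition line (y : pt) : {vspace dualV} := val y.

(* Homogeneous coordinates of a point. *)
Definition hcoord (y : pt) : set dualV := [set v | v \in line y /\ v != 0].

Definition ev (F : {mpoly C[r.+1]}) (v : dualV) : C :=
  F.@[fun i => (v : 'rV[C]_r.+1) ord0 i].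

Definition is_homog (d : nat) (F : {mpoly C[r.+1]}) : Prop :=
  F \is d.-homog.

Definition zeros (S : set {mpoly C[r.+1]}) : set pt :=
  [set y | forall F, S F -> forall v, v \in line y -> ev F v = 0].

Definition zclosed (Z : set pt) : Prop :=
  exists2 S : set {mpoly C[r.+1]},
    forall F, S F -> exists d, is_homog d F & Z = zeros S.

Definition zopen (O : set pt) : Prop := zclosed (~` O).

Definition open_in (X W : set pt) : Prop :=
  exists2 O, zopen O & W = X `&` O.

Definition zclosure (A : set pt) : set pt := smallest zclosed A.

Definition zirreducible (X : set pt) : Prop :=
  X !=set0 /\ forall Z1 Z2, zclosed Z1 -> zclosed Z2 ->
    X `<=` Z1 `|` Z2 -> X `<=` Z1 \/ X `<=` Z2.

Definition quasi_projective_variety (X : set pt) : Prop :=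
  zirreducible X /\ exists2 Z, zclosed Z & open_in Z X.

(* g is represented on W by F / G, with F and G of the same degree. *)
Definition fraction_on (W : set pt) (g : pt -> C) (F G : {mpoly C[r.+1]}) :=
  (exists2 d, is_homog d F & is_homog d G) /\
  forall y v, W y -> hcoord y v -> ev G v != 0 /\ g y = ev F v / ev G v.

(* g restricts to a section over W of the structure sheaf, W being an open
   subset of a quasi-projective variety. *)
Definition regular (W : set pt) (g : pt -> C) : Prop :=
  forall x, W x -> exists O F G,
    [/\ zopen O, O x & fraction_on (W `&` O) g F G].

(* W is an open neighbourhood of x in X. *)
Definition nbhd_in (X : set pt) (x : pt) (W : set pt) : Prop :=
  open_in X W /\ W x.

Definition regular_at (X : set pt) (x : pt) (g : pt -> C) : Prop :=
  exists2 W, nbhd_in X x W & regular W g.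

(* The dimension of a variety is the transcendence degree of its function
   field, whose elements are represented by the regular functions on nonempty
   open subsets. *)
Definition alg_independent (W : set pt) (d : nat) (g : 'I_d -> pt -> C) :=
  forall P : {mpoly C[d]}, (forall y, W y -> P.@[fun i => g i y] = 0) -> P = 0.

Definition trdeg_ge (Y : set pt) (d : nat) : Prop :=
  exists W (g : 'I_d -> pt -> C),
    [/\ open_in Y W, W !=set0, forall i, regular W (g i)
      & alg_independent W g].

Definition has_dim (Y : set pt) (d : nat) : Prop :=
  trdeg_ge Y d /\ ~ trdeg_ge Y d.+1.

(* The differential of F at v, in the direction u. *)
Definition differential (F : {mpoly C[r.+1]}) (v u : dualV) : C :=
  \sum_(i < r.+1) ev (mderiv i F) v * (u : 'rV[C]_r.+1) ord0 i.

Definition tangentP (y : pt) : vectType C :=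
  'Hom(subvs_of (line y), quo (line y)).

Definition lift_tangent (y : pt) (phi : tangentP y) (v : subvs_of (line y)) :
  dualV := quo_lift (line y) (phi v).

Definition tangent (Y : set pt) (y : pt) : {vspace tangentP y} :=
  vspace_of [set phi : tangentP y |
    forall d F, is_homog d F ->
      (forall z v, Y z -> v \in line z -> ev F v = 0) ->
      forall v, differential F (vsval v) (lift_tangent phi v) = 0].

Definition nonsingular_at (Y : set pt) (y : pt) : Prop :=
  Y y /\ has_dim Y (\dim (tangent Y y)).

Definition linear_subvariety (T : {vspace dualV}) : set pt :=
  [set y | (line y <= T)%VS].

(* The product P^r x P^r. *)

Definition bihomog (a b : nat) (F : dualV -> dualV -> C) : Prop :=
  exists m (A B : 'I_m -> {mpoly C[r.+1]}),
    [/\ forall i, is_homog a (A i), forall i, is_homog b (B i)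
      & forall v w, F v w = \sum_i ev (A i) v * ev (B i) w].

Definition zclosed2 (Z : set (pt * pt)) : Prop :=
  exists2 S : set (dualV -> dualV -> C),
    forall F, S F -> exists a b, bihomog a b F
    & Z = [set p | forall F, S F -> forall v w,
             v \in line p.1 -> w \in line p.2 -> F v w = 0].

Definition zopen2 (O : set (pt * pt)) : Prop := zclosed2 (~` O).

Definition open_in_square (X : set pt) (W : set (pt * pt)) : Prop :=
  exists2 O, zopen2 O & W = (X `*` X) `&` O.

Definition nbhd_in_square (X : set pt) (x : pt) (W : set (pt * pt)) : Prop :=
  open_in_square X W /\ W (x, x).

Definition regular2 (W : set (pt * pt)) (a : pt -> pt -> C) : Prop :=
  forall p, W p -> exists O d e F G,
    [/\ zopen2 O, O p, bihomog d e F, bihomog d e G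
      & forall y z v w, W (y, z) -> O (y, z) -> hcoord y v -> hcoord z w ->
          G v w != 0 /\ a y z = F v w / G v w].

(* Sections over W of pr_2^* O(1): such a section t assigns to (y, z) the
   linear form t y on the line of z. *)
Definition regular2L (W : set (pt * pt)) (t : pt -> dualV -> C) : Prop :=
  forall p, W p -> exists O d e F G,
    [/\ zopen2 O, O p, bihomog d e.+1 F, bihomog d e G
      & forall y z v w, W (y, z) -> O (y, z) -> hcoord y v -> hcoord z w ->
          G v w != 0 /\ t y w = F v w / G v w].

End ProjectiveSpace.

Arguments pt : clear implicits.
Arguments dualV : clear implicits.
Arguments formV : clear implicits.

Section PrincipalParts.
Variables (R : realType) (r : nat) (X : set (pt R r)).
Notation C := R[i].
Notation V := (formV R r).
Notation dV := (dualV R r).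
Implicit Types (x y : pt R r) (k : nat).

(* P^k(L) is supported on the diagonal, so its stalk at x is the stalk of
   pr_2^* L at (x, x) modulo the action of I_Delta^(k+1); O_X acts through the
   first factor.  The germs of pr_2^* L at (x, x): *)
Definition section_at x (t : pt R r -> dV -> C) : Prop :=
  exists2 W, nbhd_in_square X x W & regular2L W t.

(* The germ of t at (x, x) belongs to I_Delta^m (pr_2^* L). *)
Definition in_diag_power (m : nat) x (t : pt R r -> dV -> C) : Prop :=
  exists W N (a : 'I_N -> 'I_m -> pt R r -> pt R r -> C)
    (s : 'I_N -> pt R r -> dV -> C),
    [/\ nbhd_in_square X x W,
        forall i j, regular2 W (a i j),
        forall i j y, W (y, y) -> a i j y y = 0,
        forall i, regular2L W (s i)
      & forall y z w, W (y, z) -> hcoord z w ->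
          t y w = \sum_i (\prod_j a i j y z) * s i y w].

(* The section of pr_2^* L inducing d^k_L (T|_X). *)
Definition dL (T : V) (y : pt R r) (w : dV) : C := T w.

(* Equality in the stalk at x of P^k(L). *)
Definition eq_pp k x (t t' : pt R r -> dV -> C) : Prop :=
  in_diag_power k.+1 x (fun y w => t y w - t' y w).

(* Membership in the stalk at x of Im alpha_k. *)
Definition in_im_alpha k x (t : pt R r -> dV -> C) : Prop :=
  exists N (a : 'I_N -> pt R r -> C) (T : 'I_N -> V),
    (forall j, regular_at X x (a j)) /\
    eq_pp k x t (fun y w => \sum_j a j y * dL (T j) y w).

(* P^i(L) / (P_i (x) L) is the cokernel of alpha_i; it is free of rank rho on
   W when sections e_1, ..., e_rho induce a basis of each stalk over W. *)
Definition coker_free_on i rho (W : set (pt R r)) : Prop :=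
  exists e : 'I_rho -> pt R r -> dV -> C,
    (exists2 W2, open_in_square X W2 /\ (forall y, W y -> W2 (y, y))
       & forall j, regular2L W2 (e j)) /\
    forall y, W y ->
      (forall t, section_at y t ->
         exists2 c : 'I_rho -> pt R r -> C,
           forall j, regular_at X y (c j)
           & in_im_alpha i y (fun z w => t z w - \sum_j c j z * e j z w)) /\
      (forall c : 'I_rho -> pt R r -> C,
         (forall j, regular_at X y (c j)) ->
         in_im_alpha i y (fun z w => \sum_j c j z * e j z w) ->
         exists2 W', nbhd_in X y W' & forall j z, W' z -> c j z = 0).

Definition coker_locally_free i rho (W : set (pt R r)) : Prop :=
  forall x, W x ->
    exists W', [/\ nbhd_in X x W', W' `<=` W & coker_free_on i rho W'].

(* The largest open subset with the given property, as the union of all of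
   them; the ranks agree on overlaps since X is irreducible. *)
Definition Uk k : set (pt R r) :=
  [set x | exists W, [/\ nbhd_in X x W, forall y, W y -> nonsingular_at X y
     & forall i, (i <= k)%N -> exists rho, coker_locally_free i rho W]].

(* Kernel of V -> (P_k (x) L) (x) k(x) = (Im alpha_k)_x / m_x (Im alpha_k)_x. *)
Definition fibre_ker k x : set V :=
  [set T | exists N (a : 'I_N -> pt R r -> C) (S : 'I_N -> V),
     (forall j, regular_at X x (a j) /\ a j x = 0) /\
     eq_pp k x (dL T) (fun y w => \sum_j a j y * dL (S j) y w)].

(* The dual of (P_k (x) L) (x) k(x), as a subspace of V^*. *)
Definition That k x : {vspace dV} :=
  vspace_of [set v : dV | forall T : V, fibre_ker k x T -> T v = 0].

Definition Tk k x : set (pt R r) := linear_subvariety (That k x).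

Definition tau k : set (pt R r) :=
  zclosure [set y | exists2 x, Uk k x & Tk k x y].

(* D restricts to a derivation of the sheaf of regular functions on W. *)
Definition vector_field (W : set (pt R r))
    (D : (pt R r -> C) -> pt R r -> C) : Prop :=
  forall W' g h, open_in X W' -> W' `<=` W -> regular W' g -> regular W' h ->
    [/\ regular W' (D g),
        (forall y, W' y -> g y = h y) -> forall y, W' y -> D g y = D h y,
        forall (c : C) y, W' y -> D (fun z => c * g z + h z) y = c * D g y + D h y
      & forall y, W' y -> D (fun z => g z * h z) y = g y * D h y + h y * D g y].

(* D(x) = u: the derivative of F / G at x along u is given by the quotient
   rule, in homogeneous coordinates v of x. *)
Definition value_at (D : (pt R r -> C) -> pt R r -> C) x (u : tangentP x) :=
  forall W g F G, nbhd_in X x W -> fraction_on W g F G ->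
    forall v : subvs_of (line x), v != 0 ->
      D g x = (differential F (vsval v) (lift_tangent u v) * ev G (vsval v)
               - ev F (vsval v) * differential G (vsval v) (lift_tangent u v))
              / ev G (vsval v) ^+ 2.

Definition local_field_at x (u : tangentP x)
    (D : (pt R r -> C) -> pt R r -> C) : Prop :=
  (exists2 W, nbhd_in X x W & vector_field W D) /\ value_at D u.

(* The coordinates of a local section of V^* (x) O_X. *)
Definition coordV (B : pt R r -> dV) (j : 'I_r.+1) : pt R r -> C :=
  fun y => (B y : 'rV[C]_r.+1) ord0 j.

(* A local section around x, with value v at x, of the subbundle
   P_k^* (x) L^* of V^* (x) O_X on Uk k. *)
Definition local_section_at k x (v : dV) (B : pt R r -> dV) : Prop :=
  (exists W, [/\ nbhd_in X x W, W `<=` Uk k, forall j, regular W (coordV B j)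
     & forall y, W y -> B y \in That k y]) /\ B x = v.

(* The action of id (x) D on V^* (x) O_X. *)
Definition act (D : (pt R r -> C) -> pt R r -> C) (B : pt R r -> dV) :
  pt R r -> dV := fun y => \row_j D (coordV B j) y.

Definition fund_form k x (u : tangentP x) (v : dV) : quo (That k x) :=
  let D := xget (fun _ _ => 0) [set D | local_field_at u D] in
  let B := xget (fun _ => 0) [set B | local_section_at k x v B] in
  quo_proj (That k x) (act D B x).

Definition fund_form_at k x y :
    'Hom(subvs_of (tangent X x), 'Hom(subvs_of (line y), quo (That k x))) :=
  linfun (fun u => linfun (fun v => fund_form k (vsval u) (vsval v))).

End PrincipalParts.

Section LinearTangent.
Variables (R : realType) (r : nat).
Notation C := R[i].
Notation dV := (dualV R r).

Let differential_along (F : {mpoly C[r.+1]}) (v u : dV) :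
  exists2 p : {poly C}, forall c, p.[c] = ev F (v + c *: u)
                      & (p^`()).[0] = differential F v u.
Proof.
elim/mpolyind: F => [|a m F _ _ [p p1 p2]].
  exists 0 => [c|]; first by rewrite horner0 /ev meval0.
  rewrite deriv0 horner0 /differential big1 // => i _.
  by rewrite linear0 /ev meval0 mul0r.
suff [q q1 q2] : exists2 q : {poly C},
    forall c, q.[c] = ev 'X_[m] (v + c *: u)
    & (q^`()).[0] = differential 'X_[m] v u.
  exists (a *: q + p) => [c|].
    by rewrite hornerD hornerZ q1 p1 /ev mevalD mevalZ.
  rewrite derivD derivZ hornerD hornerZ q2 p2 /differential mulr_sumr.
  rewrite -big_split /=; apply: eq_bigr => i _.
  by rewrite linearD /= linearZ /= /ev mevalD mevalZ mulrDl mulrA.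
clear a F p p1 p2.
pose P (F0 : {mpoly C[r.+1]}) := exists2 q : {poly C},
    forall c, q.[c] = ev F0 (v + c *: u) & (q^`()).[0] = differential F0 v u.
have P1 : P 1.
  exists 1 => [c|]; first by rewrite hornerC /ev meval1.
  rewrite derivC horner0 /differential big1 // => i _.
  by rewrite -mpolyC1 mderivC /ev meval0 mul0r.
have PM F1 F2 : P F1 -> P F2 -> P (F1 * F2).
  move=> [p1 e1 d1] [p2 e2 d2]; exists (p1 * p2) => [c|].
    by rewrite hornerM e1 e2 /ev mevalM.
  rewrite derivM hornerD !hornerM d1 d2 e1 e2 scale0r addr0.
  rewrite /differential mulr_suml mulr_sumr -big_split /=.
  apply: eq_bigr => i _; rewrite mderivM /ev mevalD !mevalM mulrDl mulrA.
  by congr (_ + _); rewrite mulrAC.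
have PX i : P 'X_i.
  exists ((((v : 'rV[C]_r.+1) ord0 i)%:P + (u : 'rV[C]_r.+1) ord0 i *: 'X) : {poly C}) => [c|].
    by rewrite hornerD hornerC hornerZ hornerX /ev mevalXU !mxE mulrC.
  rewrite derivD derivC add0r derivZ derivX hornerZ hornerC mulr1.
  rewrite /differential (bigD1 i) //= big1 ?addr0 => [|j /negPf ji].
    have U0 : (U_(i) - U_(i))%MM = 0%MM :> 'X_{1..r.+1}.
      by apply/mnmP => j; rewrite mnmBE subnn mnm0E.
    by rewrite mderivX mnmE eqxx U0 scale1r mpolyX0 /ev meval1 mul1r.
  by rewrite mderivX mnmE eq_sym ji scale0r /ev meval0 mul0r.
rewrite -/(P _) mpolyXE_id; apply: (big_ind P) => // i _.
by elim: (m i) => [|d IH]; rewrite ?expr0 // exprS; apply: PM.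
Qed.

Let differentialD (F : {mpoly C[r.+1]}) (v : dV) (c : C) (u1 u2 : dV) :
  differential F v (c *: u1 + u2) =
  c * differential F v u1 + differential F v u2.
Proof.
rewrite /differential mulr_sumr -big_split; apply: eq_bigr => i _ /=.
by rewrite !mxE mulrDr mulrCA.
Qed.

Lemma mem_tangent (Y : set (pt R r)) (y : pt R r) (phi : tangentP y) :
  phi \in tangent Y y <->
  forall d F, is_homog d F ->
    (forall z v, Y z -> v \in line z -> ev F v = 0) ->
    forall v, differential F (vsval v) (lift_tangent phi v) = 0.
Proof.
apply: mem_vspace_of => [d F _ _ v|c p1 p2 h1 h2 d F hF FY v] /=.
  rewrite /lift_tangent zero_lfunE linear0 /differential big1 // => i _.
  by rewrite mxE mulr0.
rewrite /lift_tangent add_lfunE scale_lfunE linearP differentialD.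
by rewrite (h1 d F hF FY) (h2 d F hF FY) mulr0 addr0.
Qed.

Lemma tangent_linear_subvariety (T : {vspace dV}) (y : pt R r) :
  linear_subvariety T y ->
  tangent (linear_subvariety T) y = lker (normal_proj (line y) T).
Proof.
move=> yT; apply/vspaceP => phi; rewrite memv_ker.
have kerP : (normal_proj (line y) T phi == 0) <->
    forall v, lift_tangent phi v \in T.
  split=> [/eqP p0 v|pT].
    by rewrite -ker_quo_proj -normal_projE p0 zero_lfunE.
  apply/eqP/lfunP => v; rewrite normal_projE zero_lfunE.
  by apply/eqP; rewrite ker_quo_proj; apply: pT.
apply/idP/idP => [/mem_tangent tp|/kerP pT].
  apply/kerP => v; set u := lift_tangent phi v.
  rewrite -ker_quo_proj; apply/eqP.
  rewrite (coord_vbasis (memvf (quo_proj T u))) big1 // => j _.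
  pose l (w : dV) : C := coord (vbasis fullv) j (quo_proj T w).
  suff -> : coord (vbasis fullv) j (quo_proj T u) = 0 by rewrite scale0r.
  pose F : {mpoly C[r.+1]} :=
    \sum_(i < r.+1) l (delta_mx ord0 i : 'rV_r.+1) *: 'X_i.
  have evF w : ev F w = l w.
    have -> : w = \sum_i (w : 'rV_r.+1) ord0 i *: (delta_mx ord0 i : 'rV_r.+1).
      exact: row_sum_delta.
    rewrite /l !linear_sum /ev raddf_sum /=; apply: eq_bigr => i _.
    by rewrite mevalZ mevalXU linearZ linearZ /= -row_sum_delta mulrC.
  have dF : differential F (vsval v) u = l u.
    have dX i : mderiv i F = (l (delta_mx ord0 i : 'rV_r.+1))%:MP.
      rewrite /F raddf_sum (bigD1 i) //= big1 ?addr0 => [|k /negPf ki].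
        have U0 : (U_(i) - U_(i))%MM = 0%MM :> 'X_{1..r.+1}.
          by apply/mnmP => k; rewrite mnmBE subnn mnm0E.
        by rewrite linearZ /= mderivX mnmE eqxx U0 scale1r mpolyX0 -mul_mpolyC mulr1.
      by rewrite linearZ /= mderivX mnmE ki scale0r scaler0.
    rewrite -evF /differential /ev raddf_sum /=; apply: eq_bigr => i _.
    by rewrite dX mevalC mevalZ mevalXU.
  rewrite -/(l u) -dF; apply: (tp 1%N F) => [|z w /subvP zT /zT wT].
    apply: rpred_sum => i _; apply: rpredZ; rewrite dhomogX; exact/eqP/mdeg1.
  have : quo_proj T w == 0 by rewrite ker_quo_proj.
  by rewrite evF /l => /eqP ->; rewrite linear0.
apply/mem_tangent => d F hF FT v.
have FT0 w : w \in T -> ev F w = 0.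
  move=> wT; have [->|w0] := eqVneq w 0.
    by apply: (FT y) => //; apply: mem0v.
  have lw : \dim <[w]>%VS == 1%N by rewrite dim_vline w0.
  pose z : pt R r := exist (fun U : {vspace dV} => \dim U == 1%N) <[w]>%VS lw.
  have zT : linear_subvariety T z by rewrite /linear_subvariety /line /= -memvE.
  by apply: (FT z w zT); rewrite /line /= memv_line.
have [p p1 <-] := differential_along F (vsval v) (lift_tangent phi v).
suff -> : p = 0 by rewrite deriv0 horner0.
apply/eqP/contraT => p0; pose s := [seq i%:R : C | i <- iota 0 (size p)].
have : (size s < size p)%N.
  apply: max_poly_roots => //.
    apply/allP => _ /mapP[i _ ->]; rewrite rootE p1; apply/eqP/FT0.
    by rewrite rpredD ?rpredZ ?pT //; apply: (subvP yT); apply: subvsP.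
  by rewrite map_inj_uniq ?iota_uniq // => i j /eqP; rewrite eqr_nat => /eqP.
by rewrite size_map size_iota ltnn.
Qed.

End LinearTangent.

(* Main.v *)
(* Irreducible sets are described, in an affine chart, by a generic point over
   an extension L of C: the dimension is the rank of the space of values at
   that point of the derivations of L over C, which extend from subfields.

   At a nonsingular point the products of increments of local coordinates are
   a basis of the principal parts (Taylor expansion), so That X k x is spanned
   by the rows of a matrix P(x) of Taylor coefficients, exactly where P(x) has
   its generic rank.  The fundamental form then sends (u, c P(x)) to
   c (d_u P)(x) modulo the rows of P(x).

   The variety tau^k(X) is the closure of the set of the points [c P(x)].
   A tangent vector at the generic point of tau^k(X) is the value of a
   derivation of the function field, which extends to the field of the
   parameters (x, c); hence the tangent space of the cone over tau^k(X) at a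
   general point c P(x) is spanned by the rows of P(x) and by the vectors
   c (d_u P)(x), u tangent to X at x.  Modulo the rows of P(x) this is the
   image of the fundamental form. *)
Require Import Defs.
From HB Require Import structures.
From mathcomp Require Import all_boot all_order all_algebra.
From mathcomp Require Import generic_quotient ring_quotient fraction.
From mathcomp Require Import complex.
From mathcomp Require Import boolp classical_sets reals.
From mathcomp Require Import ring zify mpoly.

Set Implicit Arguments.
Unset Strict Implicit.
Unset Printing Implicit Defensive.

Import Order.TTheory GRing.Theory Num.Theory.
Local Open Scope ring_scope.
Local Open Scope classical_set_scope.

Notation mv v := (meval (fun i => v ord0 i)).
Notation mh iota v := (mmap iota (fun i => v ord0 i)).

(** A generic statement is always carried by a polynomial that is nonzero at a generic point: ranks
    can only drop under specialization, and a nonzero minor spreads a generic rank over a principal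
    open set. The equality of the two spaces at [y] comes from one inclusion and a rank count. The
    vectors c' P(x) + c (d_u P)(x) are tangent to the cone at every point. At the generic point
    their span contains the tangent space of the affine slice of tau^k(X), and also the point
    itself, which lies outside that tangent space. Its rank is therefore strictly larger; the strict
    inequality survives on an open set and forces equality wherever the tangent space has its
    generic rank. Local freeness of the cokernels enters through ranks: the Taylor matrix has its
    generic rank on all of [Uk]. So a form that vanishes on the spaces [That] over a small open set
    vanishes on those over all of [Uk], although several charts are involved. Since [x] is chosen
    before [y], the parameter c is frozen to define the open set of the [x], then recovered linearly
    from [y] to define the open set of the [y]. *)

Lemma mpoly_ring_ind (R : comNzRingType) n (P : {mpoly R[n]} -> Prop) :
  (forall c, P c%:MP) -> (forall i, P 'X_i) ->
  (forall p q, P p -> P q -> P (p + q)) ->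
  (forall p q, P p -> P q -> P (p * q)) -> forall p, P p.
Proof.
move=> PC PX PD PM; have P1 : P 1 by rewrite -mpolyC1.
elim/mpolyind => [|c m p _ _ Pp]; first by rewrite -mpolyC0.
apply: (PD) => //; rewrite -mul_mpolyC; apply: (PM) => //.
rewrite mpolyXE_id; apply: (big_ind P) => // i _.
by elim: (m i) => [|d IH]; rewrite ?expr0 // exprS; apply: PM.
Qed.

Lemma mhM (C L : comNzRingType) (iota : {rmorphism C -> L}) n (v : 'rV[L]_n)
  (P Q : {mpoly C[n]}) : mh iota v (P * Q) = mh iota v P * mh iota v Q.
Proof. exact: rmorphM. Qed.

Lemma mh1 (C L : comNzRingType) (iota : {rmorphism C -> L}) n (v : 'rV[L]_n) :
  mh iota v 1 = 1.
Proof. exact: rmorph1. Qed.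

Lemma mhX (C L : comNzRingType) (iota : {rmorphism C -> L}) n (v : 'rV[L]_n) i :
  mh iota v 'X_i = v ord0 i.
Proof. by rewrite mmapX mmap1U. Qed.

(** * Differentials and derivations *)

Section Polynomials.
Variable F : numFieldType.

Lemma poly_eq0_forall (p : {poly F}) : (forall s, p.[s] = 0) -> p = 0.
Proof.
move=> p0; apply/eqP/contraT => pN0.
have : (size [seq i%:R : F | i <- iota 0 (size p)] < size p)%N.
  apply: max_poly_roots => //.
    by apply/allP => _ /mapP[i _ ->]; rewrite rootE p0.
  by rewrite map_inj_uniq ?iota_uniq // => i j /eqP; rewrite eqr_nat => /eqP.
by rewrite size_map size_iota ltnn.
Qed.

Definition dder n (p : {mpoly F[n]}) (v u : 'rV[F]_n) : F :=
  \sum_i mv v p^`M(i) * u ord0 i.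

Lemma dder_lin n (p : {mpoly F[n]}) v c u1 u2 :
  dder p v (c *: u1 + u2) = c * dder p v u1 + dder p v u2.
Proof.
rewrite /dder mulr_sumr -big_split; apply: eq_bigr => i _ /=.
by rewrite !mxE mulrDr mulrCA.
Qed.

Lemma dder0 n (p : {mpoly F[n]}) v : dder p v 0 = 0.
Proof. by rewrite /dder big1 // => i _; rewrite mxE mulr0. Qed.

Lemma dderD n (p q : {mpoly F[n]}) v u :
  dder (p + q) v u = dder p v u + dder q v u.
Proof.
by rewrite /dder -big_split; apply: eq_bigr => i _; rewrite mderivD mevalD mulrDl.
Qed.

Lemma dderC n c (v u : 'rV[F]_n) : dder c%:MP v u = 0.
Proof. by rewrite /dder big1 // => i _; rewrite mderivC meval0 mul0r. Qed.

Lemma dderM n (p q : {mpoly F[n]}) v u :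
  dder (p * q) v u = dder p v u * mv v q + mv v p * dder q v u.
Proof.
rewrite /dder mulr_suml mulr_sumr -big_split; apply: eq_bigr => i _ /=.
by rewrite mderivM mevalD !mevalM mulrDl mulrA; congr (_ + _); rewrite mulrAC.
Qed.

Lemma mderivXU n i j : ('X_i : {mpoly F[n]})^`M(j) = (i == j)%:R.
Proof.
rewrite mderivX mnmE; case: eqP => [->|_]; last by rewrite scale0r.
rewrite scale1r; have -> : (U_(j) - U_(j))%MM = 0%MM.
  by apply/mnmP => l; rewrite mnmBE subnn mnm0E.
by rewrite mpolyX0.
Qed.

Lemma dderX n i (v u : 'rV[F]_n) : dder 'X_i v u = u ord0 i.
Proof.
rewrite /dder (bigD1 i) //= big1 ?addr0 => [|j ji].
  by rewrite mderivXU eqxx meval1 mul1r.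
by rewrite mderivXU eq_sym (negPf ji) meval0 mul0r.
Qed.

(** A differential depends only on the restriction to a line, so two polynomials that agree along a
    line through [v] have the same derivative there even if they differ elsewhere. This is how a
    polynomial is later exchanged for its homogenization. *)
Lemma dder_line n (p : {mpoly F[n]}) (v u : 'rV[F]_n) :
  exists2 q : {poly F}, forall s, q.[s] = mv (v + s *: u) p
    & (q^`()).[0] = dder p v u.
Proof.
elim/mpoly_ring_ind: p => [c|i|p1 p2 [q1 h1 d1] [q2 h2 d2]|p1 p2 [q1 h1 d1] [q2 h2 d2]].
- exists c%:P => [s|]; first by rewrite hornerC mevalC.
  by rewrite derivC horner0 dderC.
- exists ((v ord0 i)%:P + u ord0 i *: 'X) => [s|].
    by rewrite hornerD hornerC hornerZ hornerX mevalXU !mxE mulrC.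
  by rewrite derivD derivC add0r derivZ derivX hornerZ hornerC mulr1 dderX.
- by exists (q1 + q2) => [s|]; rewrite ?derivD hornerD ?mevalD ?h1 ?h2 // d1 d2 dderD.
- exists (q1 * q2) => [s|]; first by rewrite hornerM mevalM h1 h2.
  rewrite derivM hornerD !hornerM d1 d2 dderM -[v]addr0 -(scale0r u).
  by rewrite -h1 -h2 scale0r addr0.
Qed.

Lemma mderiv_eq0 n (p : {mpoly F[n]}) :
  (forall i, p^`M(i) = 0) -> p = (p@_0%MM)%:MP.
Proof.
move=> d0; apply/mpolyP => m; rewrite mcoeffC.
have [->|m0] := eqVneq m 0%MM; first by rewrite mulr1.
rewrite ?(negPf m0) mulr0.
have [i mi] : exists i, m i != 0%N.
  apply/existsP; apply: contraT; rewrite negb_exists => /forallP h.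
  by case/eqP: m0; apply/mnmP => i; rewrite mnm0E; apply/eqP; rewrite -[_ == _]negbK.
have := congr1 (mcoeff (m - U_(i))%MM) (d0 i).
rewrite mcoeff_deriv mcoeff0 submK; last first.
  by apply/mnm_lepP => j; rewrite mnm1E; case: eqP => // <-; rewrite lt0n.
by move/eqP; rewrite mulrn_eq0 /= => /eqP.
Qed.

Lemma msize_mderiv n (p : {mpoly F[n]}) i : p != 0 -> (msize p^`M(i) < msize p)%N.
Proof.
move=> p0; rewrite [msize p]mpolySpred // ltnS [msize _]msizeE.
apply/bigmax_leqP_seq => m + _; rewrite mcoeff_msupp mcoeff_deriv => h.
have : (m + U_(i))%MM \in msupp p.
  by rewrite mcoeff_msupp; apply: contraNneq h => ->; rewrite mul0rn.
move/(msize_mdeg_lt); rewrite mdegD mdeg1 addn1 => h2.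
by rewrite -ltnS -mpolySpred.
Qed.

(** By induction on the size all derivatives of [p] vanish, so in characteristic zero [p] is a
    constant of the class. The typical class is the set of algebraic relations of a family. *)
Lemma mderiv_ind n (P : {mpoly F[n]} -> Prop) :
  (forall p, P p -> forall i, P p^`M(i)) ->
  (forall c, P c%:MP -> c = 0) -> forall p, P p -> p = 0.
Proof.
move=> PD PC p; have [s] := ubnP (msize p); elim: s p => // s IH p ps Pp.
apply/eqP/contraT => p0.
have d0 i : p^`M(i) = 0.
  apply: IH; last exact: PD.
  by rewrite -ltnS; apply: leq_trans ps; rewrite ltnS; apply: msize_mderiv.
have pE := mderiv_eq0 d0; case/eqP: p0; move: Pp; rewrite pE => /PC ->.
by rewrite mpolyC0.
Qed.

Lemma meval_eq0_forall n (p : {mpoly F[n]}) : (forall v : 'rV_n, mv v p = 0) -> p = 0.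
Proof.
move: p; apply: (@mderiv_ind n (fun p => forall v : 'rV_n, mv v p = 0)) => [p p0 i v|c c0].
  have [q q1] := dder_line p v (delta_mx ord0 i).
  rewrite (@poly_eq0_forall q) => [|s]; last by rewrite q1 p0.
  rewrite deriv0 horner0 /dder (bigD1 i) //= big1 => [|j /negPf ji].
    by rewrite addr0 mxE !eqxx mulr1.
  by rewrite mxE ji mulr0.
by have := c0 0; rewrite mevalC.
Qed.

End Polynomials.

(** * Extension of derivations to a larger field in characteristic zero *)

Section ExtendDerivation.
Variable L : fieldType.
Hypothesis char0 : forall n, n.+1%:R != 0 :> L.
Implicit Types (G : set (L * L)) (a b : L * L) (p q : {poly L}).

(* The graph of a derivation on a subring, i.e. a subring of the dual numbers
   over L meeting the ideal of nilpotents trivially. *)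
Definition dgraph G :=
  [/\ G (1, 0), forall a b, G a -> G b -> G (a.1 - b.1, a.2 - b.2),
      forall a b, G a -> G b -> G (a.1 * b.1, a.1 * b.2 + a.2 * b.1)
    & forall c : L, G (0, c) -> c = 0].

(** [cf G p q] says that the polynomial p + eps q over the dual numbers has its coefficients in [G];
    [E p q x y] is the coefficient of eps in its value at x + eps y. *)
Let cf G p q := forall i, G (p`_i, q`_i).
Let E p q (x y : L) := q.[x] + p^`().[x] * y.

Lemma dgraph0 G : dgraph G -> G (0, 0).
Proof. by case=> G1 GB _ _; have := GB _ _ G1 G1; rewrite /= !subrr. Qed.

Lemma dgraphN G a : dgraph G -> G a -> G (- a.1, - a.2).
Proof.
move=> dG Ga; case: (dG) => _ GB _ _.
by have := GB _ _ (dgraph0 dG) Ga; rewrite /= !sub0r.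
Qed.

Lemma dgraphD G a b : dgraph G -> G a -> G b -> G (a.1 + b.1, a.2 + b.2).
Proof.
move=> dG Ga Gb; case: (dG) => _ GB _ _.
by have := GB _ _ Ga (dgraphN dG Gb); rewrite /= !opprK.
Qed.

Lemma dgraph_nat G a n : dgraph G -> G a -> G (a.1 *+ n, a.2 *+ n).
Proof.
move=> dG Ga; elim: n => [|n IH]; first by rewrite !mulr0n; exact: dgraph0.
by rewrite !mulrS; apply: (dgraphD dG Ga IH).
Qed.

Let cf_deriv G p q : dgraph G -> cf G p q -> cf G p^`() q^`().
Proof. by move=> dG c i; rewrite !coef_deriv; apply: (dgraph_nat _ dG (c i.+1)). Qed.

Let cfB G p q p' q' : dgraph G -> cf G p q -> cf G p' q' -> cf G (p - p') (q - q').
Proof. by case=> _ GB _ _ c c' i; rewrite !coefB; apply: (GB _ _ (c i) (c' i)). Qed.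

Let cfM G p q p' q' : dgraph G -> cf G p q -> cf G p' q' ->
  cf G (p * p') (p * q' + q * p').
Proof.
move=> dG c c' i; have GM := let: And4 _ _ GM _ := dG in GM.
rewrite coefD !coefM -big_split /=.
apply: (big_ind2 (fun x y => G (x, y))) => [|x1 y1 x2 y2 h1 h2|j _].
- exact: dgraph0.
- exact: (dgraphD dG h1 h2).
- exact: (GM _ _ (c j) (c' (i - j)%N)).
Qed.


Let cf_C G (a b : L) : dgraph G -> G (a, b) -> cf G a%:P b%:P.
Proof. by move=> dG Gab i; rewrite !coefC; case: eqP => // _; apply: dgraph0. Qed.

Let cf_X G n : dgraph G -> cf G 'X^n 0.
Proof.
move=> dG i; rewrite coefXn coef0; case: eqP => _ /=; last exact: dgraph0.
by case: dG.
Qed.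

Let E_M p q p' q' x y :
  E (p * p') (p * q' + q * p') x y = p.[x] * E p' q' x y + p'.[x] * E p q x y.
Proof.
by rewrite /E derivM !hornerE; ring.
Qed.

Let E_B p q p' q' x y : E (p - p') (q - q') x y = E p q x y - E p' q' x y.
Proof. by rewrite /E derivB !hornerE mulrBl opprD addrACA. Qed.

(** The value [y] at [x] has to make [E] vanish on every relation of [x]. If there is no nonzero
    relation, 0 will do. Otherwise a relation [p0] of least degree determines [y]: its derivative is
    nonzero at [x] by minimality and characteristic zero, and the other relations follow by
    pseudo-division by [p0]. *)
Lemma dgraph_step G x : dgraph G ->
  exists y G', [/\ dgraph G', G `<=` G' & G' (x, y)].
Proof.
move=> dG; have [G1 GB GM G0] := dG.
have [y yE] : exists y, forall p q, cf G p q -> p.[x] = 0 -> E p q x y = 0.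
  pose Q n := `[< exists p q, [/\ cf G p q, p.[x] = 0, p != 0 & size p = n] >].
  have [exQ|nQ] := pselect (exists n, Q n); last first.
    exists 0 => p q c px; have p0 : p = 0.
      apply/eqP/contraT => p0; case: nQ; exists (size p); apply/asboolP.
      by exists p, q.
    rewrite /E p0 deriv0 horner0 mul0r addr0.
    suff -> : q = 0 by rewrite horner0.
    by apply/polyP => i; rewrite coef0; apply: G0; have := c i; rewrite p0 coef0.
  case: (ex_minnP exQ) => n /asboolP[p0 [q0 [c0 p0x p0N p0n]]] nmin.
  have min p q : cf G p q -> p.[x] = 0 -> (size p < n)%N -> p = 0.
    move=> c px; apply: contraTeq => pN; rewrite -leqNgt; apply: nmin.
    by apply/asboolP; exists p, q.
  have d0 : p0^`().[x] != 0.
    apply/eqP => d0; have : p0^`() = 0.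
      by apply: (min _ _ (cf_deriv dG c0) d0); rewrite -p0n lt_size_deriv.
    move=> /polyP p0d; case/eqP: (p0N).
    have p0C : p0 = (p0`_0)%:P.
      apply/polyP => -[|i]; rewrite coefC //=.
      have := p0d i; rewrite coef_deriv coef0 -mulr_natr => /eqP.
      by rewrite mulf_eq0 (negPf (char0 i)) orbF => /eqP.
    by move: p0x; rewrite p0C hornerC => ->.
  exists (- q0.[x] / p0^`().[x]).
  set y := _ / _.
  have E0 : E p0 q0 x y = 0 by rewrite /E /y mulrC divfK // subrr.
  move=> p q; have [s] := ubnP (size p); elim: s p q => // s IH p q ps c px.
  have [p00|pN] := eqVneq p 0.
    suff -> : q = 0 by rewrite /E p00 deriv0 !horner0 mul0r addr0.
    by apply/polyP => i; rewrite coef0; apply: G0; have := c i; rewrite p00 coef0.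
  have np : (n <= size p)%N by rewrite leqNgt; apply: contraNN pN => /(min _ _ c px) ->.
  (* Pseudo-division: crossing the leading coefficients and shifting [p0] by ['X^k] cancels the
     leading term of [p], while [E] is only multiplied by the leading coefficient of [p0]. *)
  pose k := (size p - size p0)%N.
  have c1 := cf_C dG (c0 (size p0).-1); have c2 := cf_C dG (c (size p).-1).
  have := cfB dG (cfM dG c1 c) (cfM dG c2 (cfM dG (cf_X k dG) c0)).
  set pp := _ - _; set qq := _ - _ => cc.
  have sp : (size pp < size p)%N.
    have sp0 : (0 < size p)%N by rewrite size_poly_gt0.
    have sp00 : (0 < size p0)%N by rewrite size_poly_gt0.
    rewrite -[X in (_ < X)%N](prednK sp0) ltnS; apply/leq_sizeP => j.
    rewrite leq_eqVlt => /orP[/eqP <-|lj].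
      rewrite /pp coefB !coefCM coefXnM.
      have -> : ((size p).-1 < k)%N = false.
        by apply/negbTE; rewrite -leqNgt /k; lia.
      have -> : ((size p).-1 - k)%N = (size p0).-1.
        by rewrite /k; lia.
      by rewrite mulrC subrr.
    have sj : (size p <= j)%N by rewrite -(prednK sp0).
    rewrite /pp coefB !coefCM coefXnM; rewrite (nth_default _ sj) mulr0 sub0r.
    case: ifP => _; rewrite ?mulr0 ?oppr0 // [p0`_ _]nth_default ?mulr0 ?oppr0 //.
    have := np; rewrite -p0n /k; move: sj; move: (size p) (size p0) => u w; lia.
  have ppx : pp.[x] = 0 by rewrite /pp hornerD hornerN !hornerM px p0x !mulr0 subrr.
  have := IH _ _ (leq_trans sp ps) cc ppx.
  have -> : E pp qq x y = p0`_(size p0).-1 * E p q x y.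
    by rewrite /pp /qq E_B !E_M !hornerC hornerM px p0x E0; ring.
  move/eqP; rewrite mulf_eq0 => /orP[|/eqP//].
  by rewrite -/(lead_coef p0) lead_coef_eq0 (negPf p0N).
(* The subring of the dual numbers generated by [G] and the pair (x, y). *)
pose G' := [set z | exists p q, cf G p q /\ z = (p.[x], E p q x y)].
exists y, G'; split.
- split.
  + exists 1, 0; split; last by rewrite /E derivC !hornerE ?mul0r ?addr0.
    by rewrite -(expr0 'X); apply: cf_X.
  + move=> _ _ [p [q [c ->]]] [p' [q' [c' ->]]] /=.
    by exists (p - p'), (q - q'); split; [exact: cfB | rewrite E_B hornerD hornerN].
  + move=> _ _ [p [q [c ->]]] [p' [q' [c' ->]]] /=.
    exists (p * p'), (p * q' + q * p'); split; first exact: cfM.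
    by rewrite E_M hornerM [p'.[x] * _]mulrC.
  + by move=> b [p [q [c [p0 ->]]]]; apply: yE.
- move=> [a b] Gab; exists a%:P, b%:P; split; first exact: cf_C.
  by rewrite /E derivC !hornerE ?mul0r ?addr0.
- exists 'X, 0; split; first by rewrite -(expr1 'X); apply: cf_X.
  by rewrite /E derivX !hornerE ?mul1r ?add0r.
Qed.

(** By Zorn's lemma there is a maximal graph containing [G0]. It is total by [dgraph_step], and
    single-valued because it meets the nilpotents trivially. *)
Lemma dgraph_extend G0 : dgraph G0 -> exists D : L -> L,
  [/\ forall x y, D (x + y) = D x + D y,
      forall x y, D (x * y) = x * D y + D x * y
    & forall z, G0 z -> D z.1 = z.2].
Proof.
(* Adding [G0] inside the predicate takes care of the empty chain, whose bound is then [G0]. *)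
move=> dG0; pose P (G : set (L * L)) := dgraph (G `|` G0).
have [F FP Ftot|G [dG Gmax]] := @Zorn_bigcup _ P.
  have [[X0 FX0]|nF] := pselect (exists X, F X); last first.
    rewrite /P (_ : \bigcup_(X in F) X = set0) ?set0U //.
    by rewrite -subset0 => z [X FX _]; apply: nF; exists X.
  have com (a b : L * L) : (\bigcup_(X in F) X `|` G0) a -> (\bigcup_(X in F) X `|` G0) b ->
      exists X, [/\ F X, (X `|` G0) a & (X `|` G0) b].
    move=> [[X FX Xa]|Ga] [[Y FY Yb]|Gb].
    - have [XY|YX] := Ftot _ _ FX FY.
        by exists Y; split => //; left => //; apply: XY.
      by exists X; split => //; left => //; apply: YX.
    - by exists X; split => //; [left | right].
    - by exists Y; split => //; [right | left].
    - by exists X0; split => //; right.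
  have up X (z : L * L) : F X -> (X `|` G0) z -> (\bigcup_(X in F) X `|` G0) z.
    by move=> FX [Xz|Gz]; [left; exists X | right].
  split.
  - by right; case: dG0.
  - move=> a b /com h /h[X [FX Xa Xb]]; apply: (up X _ FX).
    by case: (FP _ FX) => _ h' _ _; apply: h'.
  - move=> a b /com h /h[X [FX Xa Xb]]; apply: (up X _ FX).
    by case: (FP _ FX) => _ _ h' _; apply: h'.
  - move=> b Gb; have [X [FX Xb _]] := com _ _ Gb Gb.
    by case: (FP _ FX) => _ _ _; apply.
pose G1 := G `|` G0.
have tot x : exists y, G1 (x, y).
  have [y [G' [dG' GG' G'xy]]] := dgraph_step x dG.
  exists y; apply: contrapT => nxy; apply: (Gmax G').
    split; first by move=> z Gz; apply: GG'; left.
    by move=> /(_ _ G'xy) Gxy; apply: nxy; left.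
  rewrite /P (_ : G' `|` G0 = G') // setUidl //.
  by move=> z Gz; apply: GG'; right.
have [D DG] := choice tot.
have [G11 GB GM GU] := dG.
have uniqD (u v : L) : G1 (u, v) -> D u = v.
  move=> Guv; have := GB _ _ (DG u) Guv; rewrite /= subrr => /GU /eqP.
  by rewrite subr_eq0 => /eqP.
exists D; split.
- by move=> u v; apply: uniqD; apply: (dgraphD dG (DG u) (DG v)).
- by move=> u v; apply: uniqD; apply: (GM _ _ (DG u) (DG v)).
- by move=> [a b] Gab; apply: uniqD; right.
Qed.

Section Derivation.
Variables (C : numFieldType) (iota : {rmorphism C -> L}).

Record derivation (D : L -> L) : Prop := Derivation {
  derD : forall x y, D (x + y) = D x + D y;
  derM : forall x y, D (x * y) = x * D y + D x * y;
  derC : forall c, D (iota c) = 0 }.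

Definition hder n (P : {mpoly C[n]}) (eta u : 'rV[L]_n) : L :=
  \sum_i mh iota eta P^`M(i) * u ord0 i.

Lemma hderD n (P Q : {mpoly C[n]}) eta u :
  hder (P + Q) eta u = hder P eta u + hder Q eta u.
Proof.
by rewrite /hder -big_split; apply: eq_bigr => i _; rewrite mderivD mmapD mulrDl.
Qed.

Lemma hderB n (P Q : {mpoly C[n]}) eta u :
  hder (P - Q) eta u = hder P eta u - hder Q eta u.
Proof.
by rewrite /hder -sumrB; apply: eq_bigr => i _; rewrite mderivB mmapB mulrBl.
Qed.

Lemma hderM n (P Q : {mpoly C[n]}) eta u :
  hder (P * Q) eta u = hder P eta u * mh iota eta Q + mh iota eta P * hder Q eta u.
Proof.
rewrite /hder mulr_suml mulr_sumr -big_split; apply: eq_bigr => i _ /=.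
by rewrite mderivM mmapD !rmorphM mulrDl mulrA; congr (_ + _); rewrite mulrAC.
Qed.

Lemma hderC n c (eta u : 'rV[L]_n) : hder c%:MP eta u = 0.
Proof. by rewrite /hder big1 // => i _; rewrite mderivC mmap0 mul0r. Qed.

Lemma hderX n i (eta u : 'rV[L]_n) : hder 'X_i eta u = u ord0 i.
Proof.
rewrite /hder (bigD1 i) //= big1 ?addr0 => [|j ji].
  by rewrite mderivXU eqxx rmorph1 mul1r.
by rewrite mderivXU eq_sym (negPf ji) mmap0 mul0r.
Qed.

Lemma hder_lin n (P : {mpoly C[n]}) eta c u1 u2 :
  hder P eta (c *: u1 + u2) = c * hder P eta u1 + hder P eta u2.
Proof.
rewrite /hder mulr_sumr -big_split; apply: eq_bigr => i _ /=.
by rewrite !mxE mulrDr mulrCA.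
Qed.

Lemma hder0 n (P : {mpoly C[n]}) eta : hder P eta 0 = 0.
Proof. by rewrite /hder big1 // => i _; rewrite mxE mulr0. Qed.

Lemma der_mmap D n (P : {mpoly C[n]}) (eta : 'rV[L]_n) : derivation D ->
  D (mh iota eta P) = hder P eta (\row_i D (eta ord0 i)).
Proof.
move=> [dD dM dC]; elim/mpoly_ring_ind: P => [c|i|P Q hP hQ|P Q hP hQ].
- by rewrite mmapC dC hderC.
- by rewrite mhX hderX mxE.
- by rewrite mmapD dD hP hQ hderD.
- by rewrite rmorphM dM hP hQ hderM addrC.
Qed.

(** The pairs (value, differential along [u]) of polynomials at [eta] form a graph over C[eta];
    tangency of [u] to all relations of [eta] is its single-valuedness. *)
Lemma der_extend n (eta u : 'rV[L]_n) :
  (forall P : {mpoly C[n]}, mh iota eta P = 0 -> hder P eta u = 0) ->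
  exists2 D, derivation D & forall i, D (eta ord0 i) = u ord0 i.
Proof.
move=> uT.
pose G0 := [set z | exists P : {mpoly C[n]}, z = (mh iota eta P, hder P eta u)].
have [|D [DD DM DG]] := @dgraph_extend G0.
  split.
  - by exists 1; rewrite rmorph1 -mpolyC1 hderC.
  - move=> _ _ [P ->] [Q ->] /=; exists (P - Q).
    by rewrite rmorphB hderB.
  - move=> _ _ [P ->] [Q ->] /=; exists (P * Q).
    by rewrite rmorphM hderM addrC.
  - by move=> b [P [/esym/uT -> ->]].
exists D.
  split=> // c; apply: (DG (iota c, 0)); exists c%:MP.
  by rewrite mmapC hderC.
move=> i; apply: (DG (eta ord0 i, u ord0 i)); exists 'X_i.
by rewrite mhX hderX.
Qed.

End Derivation.
End ExtendDerivation.

Lemma fraction_quotient (A : idomainType) (x : {fraction A}) :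
  exists2 ab : A * A, ab.2 != 0 & x = tofrac ab.1 / tofrac ab.2.
Proof.
have [y ->] : exists y : {ratio A}, x = \pi_{fraction A}%qT y.
  by exists (repr x); rewrite reprK.
case: y => -[a b] /= b0; exists (a, b) => //=.
apply: (@mulIf _ (tofrac b)); first by rewrite tofrac_eq0.
rewrite divfK ?tofrac_eq0 //.
have tE c : tofrac c = (\pi_{fraction A} (Ratio c 1))%qT by rewrite piE.
rewrite !tE; apply: etrans (esym (FracField.pi_mul _ _)) _; apply/eqmodP.
rewrite /= FracField.equivfE /FracField.mulf /=.
by rewrite !numden_Ratio ?mulr1 ?oner_neq0 //= mulrC.
Qed.

(** * Generic points *)

Section GenericPoint.
Variables (C : fieldType) (m : nat) (Z : set 'rV[C]_m).

Definition prime_set := Z !=set0 /\ forall P Q : {mpoly C[m]},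
  (forall z, Z z -> mv z (P * Q) = 0) ->
  (forall z, Z z -> mv z P = 0) \/ (forall z, Z z -> mv z Q = 0).

Definition generic (L : fieldType) (iota : {rmorphism C -> L}) (zeta : 'rV[L]_m) :=
  forall P : {mpoly C[m]}, mh iota zeta P = 0 <-> forall z, Z z -> mv z P = 0.

Section Quotient.
Hypothesis primeZ : prime_set.

Definition vanishing : {pred {mpoly C[m]}} :=
  fun P => `[< forall z, Z z -> mv z P = 0 >].

Fact vanishing_idealr : idealr_closed vanishing.
Proof.
split=> [||a P Q].
- by apply/asboolP => z _; rewrite meval0.
- apply/negP => /asboolP h; have [[z Zz] _] := primeZ.
  by have := h z Zz; rewrite meval1 => /eqP; rewrite oner_eq0.
- move=> /asboolP hP /asboolP hQ; apply/asboolP => z Zz.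
  by rewrite mevalD mevalM hP ?hQ // mulr0 addr0.
Qed.

HB.instance Definition _ := isIdealr.Build {mpoly C[m]} vanishing vanishing_idealr.

Fact vanishing_prime : prime_idealr_closed vanishing.
Proof.
move=> P Q /asboolP PQ; have [_ /(_ P Q PQ)[h|h]] := primeZ.
  by apply/orP; left; apply/asboolP.
by apply/orP; right; apply/asboolP.
Qed.

HB.instance Definition _ :=
  isPrimeIdealrClosed.Build {mpoly C[m]} vanishing vanishing_prime.

Local Open Scope quotient_scope.
Local Notation Q := {ideal_quot vanishing}.

(** Inverses in the coordinate ring are chosen classically, only to give it the structure of
    integral domain from which a fraction field is built. *)
Definition coord_unit : pred Q := fun x => `[< exists y, y * x = 1 >].
Definition coord_inv (x : Q) : Q :=
  if pselect (exists y, y * x = 1) is left h then projT1 (cid h) else x.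

Fact coord_mulVx : {in coord_unit, left_inverse 1 coord_inv *%R}.
Proof.
move=> x /asboolP h; rewrite /coord_inv; case: pselect => // h'.
exact: projT2 (cid h').
Qed.

Fact coord_unitP x y : y * x = 1 -> coord_unit x.
Proof. by move=> yx; apply/asboolP; exists y. Qed.

Fact coord_inv_out : {in [predC coord_unit], coord_inv =1 id}.
Proof.
move=> x; rewrite inE /= => /asboolPn h; rewrite /coord_inv.
by case: pselect.
Qed.

HB.instance Definition _ := GRing.ComNzRing_hasMulInverse.Build Q
  coord_mulVx coord_unitP coord_inv_out.

HB.instance Definition _ := GRing.ComUnitRing_isIntegral.Build Q
  (@Quotient.rquot_IdomainAxiom _ vanishing).

Let A : idomainType := Q.
Let L : fieldType := {fraction A}.

(** The field of fractions of the coordinate ring, with the classes of the coordinates. The second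
    clause records that [zeta] generates this field, as needed for clearing denominators. *)
Lemma generic_point_subproof : exists (L : fieldType) (iota : {rmorphism C -> L})
    (zeta : 'rV[L]_m), generic iota zeta /\
  forall x : L, exists P Q, mh iota zeta Q != 0 /\ x = mh iota zeta P / mh iota zeta Q.
Proof.
pose h' : {rmorphism {mpoly C[m]} -> L} := [the {rmorphism _ -> _} of (@tofrac A) \o \pi_Q].
pose iota : {rmorphism C -> L} := [the {rmorphism _ -> _} of h' \o @mpolyC m C].
pose zeta : 'rV[L]_m := \row_i h' 'X_i.
have hE P : mh iota zeta P = h' P.
  elim/mpoly_ring_ind: P => [c|i|P P' hP hP'|P P' hP hP'].
  - by rewrite mmapC.
  - by rewrite mhX mxE.
  - by rewrite mmapD [RHS]rmorphD hP hP'.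
  - by rewrite mhM hP hP'; apply/esym/rmorphM.
have h0 P : h' P = 0 <-> forall z, Z z -> mv z P = 0.
  rewrite /h' /=; split.
    move/eqP; rewrite tofrac_eq0 -(rmorph0 \pi_Q) -Quotient.idealrBE subr0.
    by move/asboolP.
  move=> hz; apply/eqP; rewrite tofrac_eq0 -(rmorph0 \pi_Q) -Quotient.idealrBE subr0.
  exact/asboolP.
exists L, iota, zeta; split=> [P|x]; first by rewrite hE.
have [[a b] /= b0 ->] := fraction_quotient x.
exists (repr a), (repr b); rewrite !hE /h' /= !reprK; split => //.
by rewrite tofrac_eq0.
Qed.

End Quotient.
End GenericPoint.

(** * Tangent spaces and dimension of affine sets *)

Section Matrices.
Variable F : fieldType.

Lemma unit_minor p q (M : 'M[F]_(p, q)) :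
  exists (f : 'I_(\rank M) -> 'I_p) (g : 'I_(\rank M) -> 'I_q),
    mxsub f g M \in unitmx.
Proof.
set B := rowsub (maxrankfun M) M.
have Bfull : row_full B^T by rewrite /row_full mxrank_tr; apply: maxrowsub_free.
exists (maxrankfun M), (fullrankfun Bfull).
have := fullrowsub_unit Bfull; rewrite -unitmx_tr trmx_mxsub trmxK /B.
by rewrite -mxsubcr.
Qed.

Lemma unit_minor_rank p q s (M : 'M[F]_(p, q)) (f : 'I_s -> 'I_p) (g : 'I_s -> 'I_q) :
  mxsub f g M \in unitmx -> (s <= \rank M)%N.
Proof.
rewrite -row_full_unit => /eqP <-; rewrite mxsubrc.
apply: leq_trans (mxrankS (rowsub_sub _ _)) _.
rewrite -mxrank_tr -[X in (_ <= X)%N]mxrank_tr trmx_mxsub.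
exact/mxrankS/rowsub_sub.
Qed.

Lemma minor_row_free p q (M : 'M[F]_(p, q)) (g : 'I_p -> 'I_q) :
  colsub g M \in unitmx -> row_free M.
Proof.
by move=> u; rewrite /row_free eqn_leq rank_leq_row /= (unit_minor_rank (f := id) u).
Qed.

Lemma minor_rowsub p q s (M : 'M[F]_(p, q)) (f : 'I_s -> 'I_p) (g : 'I_s -> 'I_q) :
  mxsub f g M \in unitmx -> \rank M = s -> (M <= rowsub f M)%MS.
Proof.
move=> u rM; have := rowsub_sub f M => /mxrank_leqif_sup [_ <-].
rewrite eqn_leq mxrankS ?rowsub_sub //= rM.
by rewrite mxsubcr in u; have /eqP -> := minor_row_free u.
Qed.

(** [S] need not be a subspace: the rows of [B] are members of [S] itself, so that finitely many
    actual equations can be extracted from the differentials of all of them. *)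
Lemma max_row_family N (S : set 'rV[F]_N) :
  exists m (B : 'M[F]_(m, N)), [/\ forall i, S (row i B), row_free B
    & forall v, S v -> (v <= B)%MS].
Proof.
pose P m := `[< exists B : 'M[F]_(m, N), (forall i, S (row i B)) /\ row_free B >].
have P0 : exists m, P m.
  exists 0%N; apply/asboolP; exists 0; split; first by case.
  by rewrite /row_free mxrank0.
have Pb m : P m -> (m <= N)%N.
  by case/asboolP => B [_ /eqP <-]; apply: rank_leq_col.
case: (ex_maxnP P0 Pb) => m /asboolP[B [BS Bf]] mmax.
exists m, B; split => // v Sv; apply: contraT => vB.
suff /mmax : P (m + 1)%N by rewrite addn1 ltnn.
apply/asboolP; exists (col_mx B v); split.
  move=> i; rewrite -(splitK i); case: (split i) => j /=.
    by rewrite rowKu.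
  by rewrite rowKd (_ : row j v = v) //; apply/rowP => l; rewrite mxE ord1.
rewrite /row_free eqn_leq rank_leq_row /=.
apply: (@leq_trans (\rank B).+1); first by rewrite (eqP Bf) addn1.
suff : (B < col_mx B v)%MS by rewrite ltmxErank => /andP[].
by rewrite ltmxE col_mx_sub submx_refl vB -addsmxE addsmxSl.
Qed.

Definition linear_set N (S : set 'rV[F]_N) :=
  S 0 /\ forall c u v, S u -> S v -> S (c *: u + v).

Definition span_of N (S : set 'rV[F]_N) : 'M[F]_N :=
  xget 0 [set B | forall v, (v <= B)%MS <-> S v].

Lemma linear_set_sub N (S : set 'rV[F]_N) p (B : 'M[F]_(p, N)) (w : 'rV_N) :
  linear_set S -> (forall i, S (row i B)) -> (w <= B)%MS -> S w.
Proof.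
move=> [S0 SD] BS /submxP[D ->]; rewrite mulmx_sum_row.
apply: (big_ind S) => // [u v Su Sv|i _]; first by rewrite -[u]scale1r; apply: SD.
by rewrite -[_ *: _]addr0; apply: SD.
Qed.

Lemma span_ofP N (S : set 'rV[F]_N) : linear_set S ->
  forall v, (v <= span_of S)%MS <-> S v.
Proof.
move=> linS; apply: (@xgetPex _ 0 [set B | forall v, (v <= B)%MS <-> S v]).
have [m [B [BS Bf SB]]] := max_row_family S.
exists <<B>>%MS => v; rewrite genmxE; split; last exact: SB.
exact: linear_set_sub.
Qed.

End Matrices.

(** * Generic ranks, generic tangent space and algebraic independence *)

Section Generic.
Variables (C : numFieldType) (N : nat) (A : set 'rV[C]_N).
Variables (L : fieldType) (iota : {rmorphism C -> L}) (eta : 'rV[L]_N).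
Hypothesis gen : generic A iota eta.

Local Notation "P '@'" := (mh iota eta P) (at level 2, format "P '@'").
Local Notation vanish P := (forall z, A z -> mv z P = 0).

Lemma gen_char0 n : n.+1%:R != 0 :> L.
Proof. by rewrite -(rmorph_nat iota) fmorph_eq0 pnatr_eq0. Qed.

Lemma gen_neq0 (P : {mpoly C[N]}) a : A a -> mv a P != 0 -> P@ != 0.
Proof. by move=> Aa; apply: contraNneq => /gen h; apply/eqP/h. Qed.

Lemma gen_point (P : {mpoly C[N]}) : P@ != 0 -> exists2 a, A a & mv a P != 0.
Proof.
move=> P0; apply: contrapT => h; case/eqP: P0; apply/gen => z Az.
by apply: contrapT => /eqP zP; apply: h; exists z.
Qed.

Lemma gen_dense (P Q : {mpoly C[N]}) : Q@ != 0 ->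
  (forall a, A a -> mv a Q != 0 -> mv a P = 0) -> P@ = 0.
Proof.
move=> Q0 h; suff : (Q * P)@ = 0.
  by rewrite mhM => /eqP; rewrite mulf_eq0 (negPf Q0) => /eqP.
apply/gen => a Aa; rewrite mevalM.
by have [->|/(h a Aa) ->] := eqVneq (mv a Q) 0; rewrite ?mul0r ?mulr0.
Qed.

(** A minor that is nonzero at [a] is a polynomial not vanishing on [A], hence nonzero at the
    generic point. *)
Lemma rank_point_le p q (M : 'M[{mpoly C[N]}]_(p, q)) a : A a ->
  (\rank (map_mx (mv a) M) <= \rank (map_mx (mmap iota (fun i => eta ord0 i)) M))%N.
Proof.
move=> Aa; have [f [g]] := unit_minor (map_mx (mv a) M).
rewrite -map_mxsub unitmxE unitfE det_map_mx => /(gen_neq0 Aa) => h.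
apply: (@unit_minor_rank _ _ _ _ _ f g).
by rewrite -map_mxsub unitmxE unitfE det_map_mx.
Qed.

Lemma rank_point_eq p q (M : 'M[{mpoly C[N]}]_(p, q)) :
  let s := \rank (map_mx (mmap iota (fun i => eta ord0 i)) M) in
  exists (f : 'I_s -> 'I_p) (g : 'I_s -> 'I_q),
  (\det (mxsub f g M))@ != 0 /\
  forall a, A a -> mv a (\det (mxsub f g M)) != 0 ->
    mxsub f g (map_mx (mv a) M) \in unitmx /\ \rank (map_mx (mv a) M) = s.
Proof.
move=> s; have [f [g u]] := unit_minor (map_mx (mmap iota (fun i => eta ord0 i)) M).
exists f, g; split.
  by move: u; rewrite -map_mxsub unitmxE unitfE det_map_mx.
move=> a Aa Qa; have u' : mxsub f g (map_mx (mv a) M) \in unitmx.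
  by rewrite -map_mxsub unitmxE unitfE det_map_mx.
split=> //; apply/eqP; rewrite eqn_leq rank_point_le //=.
exact: unit_minor_rank u'.
Qed.

(* Tangent space of A at a, and at its generic point. *)
Definition tsp (a : 'rV[C]_N) : 'M[C]_N :=
  span_of [set u | forall P, vanish P -> dder P a u = 0].

Definition gtsp : 'M[L]_N :=
  span_of [set u | forall P, vanish P -> hder iota P eta u = 0].

Lemma tspP a (u : 'rV_N) : (u <= tsp a)%MS <-> forall P, vanish P -> dder P a u = 0.
Proof.
apply: (@span_ofP _ _ [set u | forall P, vanish P -> dder P a u = 0]).
split=> [P _|c u1 u2 h1 h2 P hP]; first exact: dder0.
by rewrite dder_lin h1 // h2 // mulr0 addr0.
Qed.

Lemma gtspP (u : 'rV_N) :
  (u <= gtsp)%MS <-> forall P, vanish P -> hder iota P eta u = 0.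
Proof.
apply: (@span_ofP _ _ [set u | forall P, vanish P -> hder iota P eta u = 0]).
split=> [P _|c u1 u2 h1 h2 P hP]; first exact: hder0.
by rewrite hder_lin h1 // h2 // mulr0 addr0.
Qed.

(** Tangency at the generic point is the condition for [u] to define a derivation of C[eta]; it then
    extends to [L], even when [L] is larger than C(eta). *)
Lemma gtsp_der (u : 'rV_N) : (u <= gtsp)%MS ->
  exists2 D, derivation iota D & forall i, D (eta ord0 i) = u ord0 i.
Proof.
move=> /gtspP uT; apply: (der_extend gen_char0) => P /gen.
exact: uT.
Qed.

Lemma der_gtsp D : derivation iota D -> (\row_i D (eta ord0 i) <= gtsp)%MS.
Proof.
move=> dD; apply/gtspP => P /gen P0; rewrite -(der_mmap P eta dD) P0.
by have := derD dD 0 0; rewrite addr0 => /eqP; rewrite addrC -subr_eq subrr => /eqP.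
Qed.

Local Notation e := (\rank gtsp).

Definition jac m (psi : 'I_m -> {mpoly C[N]}) : 'M[{mpoly C[N]}]_(m, N) :=
  \matrix_(l, j) (psi l)^`M(j).

Lemma mul_jac m (psi : 'I_m -> {mpoly C[N]}) (a u : 'rV[C]_N) :
  u *m (map_mx (mv a) (jac psi))^T = \row_l dder (psi l) a u.
Proof. by apply/rowP => l; rewrite !mxE; apply: eq_bigr => j _; rewrite !mxE mulrC. Qed.

Lemma mul_gjac m (psi : 'I_m -> {mpoly C[N]}) (u : 'rV_N) :
  u *m (map_mx (mmap iota (fun i => eta ord0 i)) (jac psi))^T
  = \row_l hder iota (psi l) eta u.
Proof. by apply/rowP => l; rewrite !mxE; apply: eq_bigr => j _; rewrite !mxE mulrC. Qed.

Lemma gjac_rank m (psi : 'I_m -> {mpoly C[N]}) : (forall l, vanish (psi l)) ->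
  (e + \rank (map_mx (mmap iota (fun i => eta ord0 i)) (jac psi)) <= N)%N.
Proof.
move=> hpsi; rewrite -[X in (_ + X)%N]mxrank_tr; apply: mulmx0_rank_max.
apply/row_matrixP => i; rewrite row_mul mul_gjac row0.
apply/rowP => l; rewrite !mxE; by have /gtspP := row_sub i gtsp; apply; apply: hpsi.
Qed.

(** A basis of the span of the differentials at [a] of all equations is extracted from these
    differentials; [tsp A a] is the annihilator of that span. *)
Lemma cotangent_family (a : 'rV[C]_N) : exists m (psi : 'I_m -> {mpoly C[N]}),
  [/\ forall l, vanish (psi l), row_free (map_mx (mv a) (jac psi))
    & (m + \rank (tsp a) = N)%N].
Proof.
pose dP (P : {mpoly C[N]}) : 'rV[C]_N := \row_j mv a P^`M(j).
have [m [B [BS Bf SB]]] := max_row_family [set v | exists2 P, vanish P & v = dP P].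
have /choice[psi hpsi] : forall l, exists P, vanish P /\ row l B = dP P.
  by move=> l; have [P h1 h2] := BS l; exists P.
have BE : B = map_mx (mv a) (jac psi).
  by apply/row_matrixP => l; rewrite (hpsi l).2; apply/rowP => j; rewrite !mxE.
exists m, psi; split=> [l||]; [exact: (hpsi l).1 | by rewrite -BE |].
suff -> : \rank (tsp a) = \rank (kermx B^T).
  by rewrite mxrank_ker mxrank_tr (eqP Bf) subnKC // -(eqP Bf) rank_leq_col.
apply/eqmx_rank/rV_eqP => u; rewrite sub_kermx; apply/idP/idP.
  move=> /tspP uT; rewrite BE mul_jac; apply/eqP/rowP => l; rewrite !mxE.
  exact: uT (hpsi l).1.
move=> /eqP uB; apply/tspP => P hP.
have /submxP[D dE] : (dP P <= B)%MS by apply: SB; exists P.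
suff <- : (u *m (dP P)^T) ord0 ord0 = dder P a u.
  by rewrite dE trmx_mul mulmxA uB mul0mx mxE.
by rewrite mxE; apply: eq_bigr => j _; rewrite !mxE mulrC.
Qed.

(** Equations with independent differentials at [a] keep them independent at the generic point,
    where they annihilate [gtsp]. *)
Lemma tsp_rank_ge a : A a -> (e <= \rank (tsp a))%N.
Proof.
move=> Aa; have [m [psi [hpsi fpsi mE]]] := cotangent_family a.
have h1 := rank_point_le (jac psi) Aa; have h2 := gjac_rank hpsi.
rewrite (eqP fpsi) in h1; lia.
Qed.

(** Finitely many equations span the conormal space at the generic point. Where a maximal minor of
    their jacobian is nonzero they bound the tangent space from above, and [tsp_rank_ge] bounds it
    from below. *)
Lemma tsp_rank_generic :
  exists2 Q, Q@ != 0 & forall a, A a -> mv a Q != 0 -> \rank (tsp a) = e.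
Proof.
pose dP (P : {mpoly C[N]}) : 'rV[L]_N := \row_j P^`M(j)@.
have [m [B [BS Bf SB]]] := max_row_family [set v | exists2 P, vanish P & v = dP P].
have /choice[psi hpsi] : forall l, exists P, vanish P /\ row l B = dP P.
  by move=> l; have [P h1 h2] := BS l; exists P.
have BE : B = map_mx (mmap iota (fun i => eta ord0 i)) (jac psi).
  by apply/row_matrixP => l; rewrite (hpsi l).2; apply/rowP => j; rewrite !mxE.
have kB : (N - m <= e)%N.
  rewrite -(eqP Bf) -[\rank B]mxrank_tr -mxrank_ker; apply/mxrankS/rV_subP => u.
  rewrite sub_kermx => /eqP uB; apply/gtspP => P hP.
  have /submxP[D dE] : (dP P <= B)%MS by apply: SB; exists P.
  suff <- : (u *m (dP P)^T) ord0 ord0 = hder iota P eta u.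
    by rewrite dE trmx_mul mulmxA uB mul0mx mxE.
  by rewrite mxE; apply: eq_bigr => j _; rewrite !mxE mulrC.
have [f [g [Q0 QP]]] := rank_point_eq (jac psi).
exists (\det (mxsub f g (jac psi))) => // a Aa /(QP a Aa)[_ rk].
apply/eqP; rewrite eqn_leq tsp_rank_ge // andbT.
rewrite -BE (eqP Bf) in rk.
have : (\rank (tsp a) + \rank (map_mx (mv a) (jac psi))^T <= N)%N.
  apply: mulmx0_rank_max; apply/row_matrixP => i; rewrite row_mul mul_jac row0.
  by apply/rowP => l; rewrite !mxE; have /tspP := row_sub i (tsp a); apply; have [] := hpsi l.
by rewrite mxrank_tr rk; lia.
Qed.

(** Independent elements g_j admit derivations D_i with D_i g_j = delta_ij. The values of the D_i at
    [eta] are independent vectors of [gtsp]: a combination that kills [eta] kills every fraction in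
    [eta], hence every g_j. *)
Lemma alg_indep_le d (g : 'rV[L]_d) :
  (forall i, exists P Q, Q@ != 0 /\ g ord0 i = P@ / Q@) ->
  (forall P : {mpoly C[d]}, mh iota g P = 0 -> P = 0) -> (d <= e)%N.
Proof.
move=> gE ind.
have /choice[D hD] : forall i : 'I_d, exists D : L -> L,
    derivation iota D /\ forall j, D (g ord0 j) = (i == j)%:R.
  move=> i; have [|D dD hD] := @der_extend L gen_char0 C iota d g (delta_mx ord0 i).
    by move=> P /ind ->; rewrite -mpolyC0 hderC.
  by exists D; split => // j; rewrite hD mxE eqxx eq_sym.
pose W : 'M[L]_(d, N) := \matrix_(i, j) D i (eta ord0 j).
have WT : (W <= gtsp)%MS.
  apply/row_subP => i; rewrite (_ : row i W = \row_j D i (eta ord0 j)); last first.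
    by apply/rowP => j; rewrite !mxE.
  exact: der_gtsp (hD i).1.
rewrite -[d](_ : \rank W = d) ?mxrankS //; apply/eqP.
apply: inj_row_free => c cW; apply/rowP => j; rewrite mxE.
pose Dc x := \sum_i c ord0 i * D i x.
have dDc : derivation iota Dc.
  split=> [x y|x y|x].
  - rewrite /Dc -big_split; apply: eq_bigr => i _; rewrite (derD (hD i).1) mulrDr //.
  - rewrite /Dc mulr_sumr mulr_suml -big_split; apply: eq_bigr => i _ /=.
    by rewrite (derM (hD i).1); ring.
  - by rewrite /Dc big1 // => i _; rewrite (derC (hD i).1) mulr0.
have Dceta P : Dc P@ = 0.
  rewrite (der_mmap P eta dDc) /hder big1 // => i _; rewrite mxE.
  have /matrixP/(_ ord0 i) := cW; rewrite !mxE /Dc => h.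
  rewrite [X in _ * X](_ : _ = 0) ?mulr0 // -[RHS]h.
  by apply: eq_bigr => l _; rewrite !mxE.
have [P [Q [Q0 gPQ]]] := gE j.
have := derM dDc Q@ (g ord0 j).
have -> : Q@ * g ord0 j = P@ by rewrite gPQ mulrC divfK.
rewrite !Dceta mul0r addr0 => /esym/eqP; rewrite mulf_eq0 (negPf Q0) /= => /eqP <-.
rewrite /Dc (bigD1 j) //= big1 ?addr0 => [|i ij]; rewrite (hD _).2 ?eqxx ?mulr1 //.
by rewrite (negPf ij) mulr0.
Qed.

End Generic.

(** * Local coordinates, dual vector fields and order of vanishing *)

Section LocalCoordinates.
Variables (C : numFieldType) (N : nat) (A : set 'rV[C]_N).
Variables (L : fieldType) (iota : {rmorphism C -> L}) (eta : 'rV[L]_N).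
Hypothesis gen : generic A iota eta.

Local Notation "P '@'" := (mh iota eta P) (at level 2, format "P '@'").
Local Notation vanish P := (forall z, A z -> mv z P = 0).
Local Notation gtsp := (gtsp A iota eta).
Local Notation e := (\rank gtsp).

(* Local coordinates psi_i (i < e), completed by equations of A. *)
Definition coord_at (a : 'rV[C]_N) (psi : 'I_N -> {mpoly C[N]}) :=
  (forall i : 'I_N, (e <= i)%N -> vanish (psi i)) /\ mv a (\det (jac psi)) != 0.

(** Where the tangent space has its generic rank, [cotangent_family] supplies N - e equations;
    linear forms complete their differentials at [a] to a basis. *)
Lemma coord_exists a : A a -> \rank (tsp A a) = e -> exists psi, coord_at a psi.
Proof.
move=> Aa ra; have [m [phi [phi0 phif mN]]] := cotangent_family A a.
rewrite ra in mN; set B := map_mx _ _ in phif.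
have [E Efull] : exists E : 'M[C]_(e, N), row_full (col_mx E B).
  have : exists E : 'M[C]_(\rank (B^C)%MS, N), row_full (col_mx E B).
    exists (row_base (B^C)%MS); rewrite -sub1mx -addsmxE addsmxC.
    rewrite (adds_eqmx (eqmx_refl B) (eq_row_base _)).
    by rewrite sub1mx; apply: addsmx_compl_full.
  suff -> : \rank (B^C)%MS = e by [].
  by rewrite mxrank_compl (eqP phif) -[in LHS]mN addKn.
have Nem : N = (e + m)%N by rewrite addnC mN.
pose psi (i : 'I_N) := match split (cast_ord Nem i) with
  | inl j => \sum_l E j l *: 'X_l : {mpoly C[N]} | inr l => phi l end.
exists psi; split.
  move=> i; rewrite /psi; case: splitP => [j /= ->|l _ _]; last exact: phi0.
  by rewrite leqNgt ltn_ord.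
rewrite -det_map_mx -unitfE -unitmxE -row_full_unit -sub1mx.
apply: (submx_trans (_ : 1%:M <= col_mx E B)%MS); first by rewrite sub1mx.
rewrite col_mx_sub; apply/andP; split; apply/row_subP => j.
  rewrite (_ : row j E = row (cast_ord (esym Nem) (lshift m j)) (map_mx (mv a) (jac psi))).
    exact: row_sub.
  apply/rowP => l; rewrite !mxE /psi cast_ordKV (unsplitK (inl j)).
  rewrite [_^`M(l)]raddf_sum raddf_sum (bigD1 l) //= big1 => [|i il].
    by rewrite mderivZ mevalZ mderivXU eqxx meval1 mulr1 addr0.
  by rewrite mderivZ mevalZ mderivXU (negPf il) meval0 mulr0.
rewrite (_ : row j B = row (cast_ord (esym Nem) (rshift e j)) (map_mx (mv a) (jac psi))).
  exact: row_sub.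
by apply/rowP => l; rewrite !mxE /psi cast_ordKV (unsplitK (inr j)).
Qed.

Implicit Types (psi : 'I_N -> {mpoly C[N]}) (P Q : {mpoly C[N]}).

(* The vector fields dual to the coordinates, multiplied by the jacobian. *)
Definition cder (psi : 'I_N -> {mpoly C[N]}) (i : 'I_N) (P : {mpoly C[N]}) :=
  \sum_j (\adj (jac psi)) j i * P^`M(j).

Lemma cderD psi i P Q : cder psi i (P + Q) = cder psi i P + cder psi i Q.
Proof. by rewrite /cder -big_split; apply: eq_bigr => j _; rewrite mderivD mulrDr. Qed.

Lemma cderM psi i P Q : cder psi i (P * Q) = cder psi i P * Q + P * cder psi i Q.
Proof.
rewrite /cder mulr_suml mulr_sumr -big_split; apply: eq_bigr => j _ /=.
by rewrite mderivM; ring.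
Qed.

Lemma cderC psi i c : cder psi i c%:MP = 0.
Proof. by rewrite /cder big1 // => j _; rewrite mderivC mulr0. Qed.

Lemma cder_psi psi i l : cder psi i (psi l) = (\det (jac psi)) *+ (l == i).
Proof.
have /matrixP/(_ l i) := mul_mx_adj (jac psi); rewrite !mxE => <-.
by apply: eq_bigr => j _; rewrite !mxE mulrC.
Qed.

Lemma cder_dual psi j l :
  \sum_i (\adj (jac psi)) j i * (psi i)^`M(l) = (\det (jac psi)) *+ (j == l).
Proof.
have /matrixP/(_ j l) := mul_adj_mx (jac psi); rewrite !mxE => <-.
by apply: eq_bigr => i _; rewrite !mxE.
Qed.

Definition cvec psi (i : 'I_N) (b : 'rV[C]_N) : 'rV[C]_N :=
  \row_j mv b ((\adj (jac psi)) j i).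

Lemma mv_cder psi i P (b : 'rV[C]_N) : mv b (cder psi i P) = dder P b (cvec psi i b).
Proof.
rewrite /cder /dder raddf_sum; apply: eq_bigr => j _ /=.
by rewrite mevalM [cvec _ _ _ _ _]mxE mulrC.
Qed.

Definition gvec psi (i : 'I_N) : 'rV[L]_N := \row_j ((\adj (jac psi)) j i)@.

Lemma mh_cder psi i P : (cder psi i P)@ = hder iota P eta (gvec psi i).
Proof.
rewrite /cder /hder raddf_sum; apply: eq_bigr => j _ /=.
by rewrite mhM [gvec _ _ _ _]mxE mulrC.
Qed.

Section AtPoint.
Variables (a : 'rV[C]_N) (psi : 'I_N -> {mpoly C[N]}).
Hypotheses (Aa : A a) (ca : coord_at a psi).

(** At the generic point the differentials of [psi] form a linear coordinate system. It sends [gtsp]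
    into the span of the first e basis vectors, hence onto it by dimension, and sends [gvec psi i]
    to a multiple of the i-th one. *)
Lemma gvec_tangent (i : 'I_N) : (i < e)%N -> (gvec psi i <= gtsp)%MS.
Proof.
move=> ie; have [psi0 Qa] := ca.
have Q0 : (\det (jac psi))@ != 0 by apply: (gen_neq0 gen Aa).
set W := map_mx (mmap iota (fun i => eta ord0 i)) (jac psi).
have Wu : W^T \in unitmx by rewrite unitmx_tr unitmxE unitfE det_map_mx.
have Wf : row_free W^T by rewrite row_free_unit.
rewrite -(submxMfree _ _ Wf).
have rk : \rank (gtsp *m W^T) = e by rewrite mxrankMfree.
have eN : (e <= N)%N by apply: rank_leq_row.
have sub : (gtsp *m W^T <= (pid_mx e : 'M[L]_N))%MS.
  apply/submxP; exists (gtsp *m W^T); apply/matrixP => s l.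
  rewrite [RHS]mxE (bigD1 l) //= big1 ?addr0 => [|j jl]; last first.
    by rewrite [pid_mx _ _ _]mxE (_ : (j == l :> nat) = false) ?mulr0 //; apply/negbTE.
  rewrite [pid_mx _ _ _]mxE eqxx /=; case: ltnP => le; rewrite ?mulr1 // mulr0.
  have -> : (gtsp *m W^T) s l = hder iota (psi l) eta (row s gtsp).
    by rewrite !mxE /hder; apply: eq_bigr => j _; rewrite !mxE mulrC.
  by have /gtspP := row_sub s gtsp; apply; apply: psi0.
have eqr : (gtsp *m W^T == (pid_mx e : 'M[L]_N))%MS.
  by rewrite -(mxrank_leqif_eq sub) rk rank_pid_mx.
rewrite (eqmxP eqr) mul_gjac.
rewrite (_ : \row_l _ = (\det (jac psi))@ *: delta_mx ord0 i); last first.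
  apply/rowP => l; rewrite !mxE eqxx /= -mh_cder cder_psi.
  by case: (l =P i) => _; rewrite ?mulr1n ?mulr1 ?mulr0n ?mulr0 ?mmap0.
apply: scalemx_sub; apply/submxP; exists (delta_mx ord0 i); apply/rowP => l.
rewrite [RHS]mxE (bigD1 i) //= big1 ?addr0 => [|j ji]; last first.
  by rewrite !mxE (negPf ji) andbF mul0r.
by rewrite !mxE !eqxx /= mul1r ie andbT eq_sym.
Qed.

(** Tangency at the generic point means that the ideal of [A] is preserved; so these fields are
    tangent at all points of [A], not only near [a]. *)
Lemma cder_vanish (i : 'I_N) P : (i < e)%N -> vanish P -> vanish (cder psi i P).
Proof.
move=> ie P0; apply/gen; rewrite mh_cder.
by have /gtspP := gvec_tangent ie; apply.
Qed.

Lemma cvec_tangent (i : 'I_N) b : (i < e)%N -> A b -> (cvec psi i b <= tsp A b)%MS.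
Proof.
by move=> ie Ab; apply/tspP => P P0; rewrite -mv_cder; apply: cder_vanish.
Qed.

Lemma coord_expand (b u : 'rV[C]_N) : A b -> (u <= tsp A b)%MS ->
  mv b (\det (jac psi)) *: u
  = \sum_(i < N | (i < e)%N) dder (psi i) b u *: cvec psi i b.
Proof.
move=> Ab /tspP uT; have [psi0 _] := ca.
apply/rowP => j; rewrite summxE mxE.
rewrite [RHS](_ : _ = \sum_i (dder (psi i) b u *: cvec psi i b) ord0 j); last first.
  rewrite [RHS](bigID (fun i : 'I_N => (i < e)%N)) /= [X in _ + X]big1 ?addr0 // => i.
  by rewrite -leqNgt => ie; rewrite (uT _ (psi0 _ ie)) scale0r mxE.
have -> : mv b (\det (jac psi)) * u ord0 j
    = \sum_l mv b ((\det (jac psi)) *+ (j == l)) * u ord0 l.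
  rewrite (bigD1 j) //= eqxx big1 ?addr0 // => l /negPf; rewrite eq_sym => ->.
  by rewrite meval0 mul0r.
under eq_bigr => l _ do rewrite -cder_dual raddf_sum mulr_suml.
rewrite exchange_big; apply: eq_bigr => i _ /=.
rewrite [RHS]mxE [cvec _ _ _ _ _]mxE /dder mulr_suml.
by apply: eq_bigr => l _; rewrite mevalM /=; ring.
Qed.

(** Relations stay relations when differentiated along the dual vector fields, which act on them as
    partial derivatives up to the jacobian; [mderiv_ind] concludes. *)
Lemma coord_indep d (w : 'I_d -> 'I_N) (P : {mpoly C[d]}) :
  injective w -> (forall i, w i < e)%N ->
  mh iota (\row_i (psi (w i))@) P = 0 -> P = 0.
Proof.
move=> winj we; have [_ Qa] := ca.
have Q0 : (\det (jac psi))@ != 0 by apply: (gen_neq0 gen Aa).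
pose S (P : {mpoly C[d]}) := mh iota (\row_i (psi (w i))@) P = 0.
move: P; apply: (@mderiv_ind _ _ S) => [P P0 i|c]; last first.
  by rewrite /S mmapC => /eqP; rewrite fmorph_eq0 => /eqP.
have [D dD Deta] := gtsp_der gen (gvec_tangent (we i)).
have := der_mmap P (\row_i (psi (w i))@) dD.
rewrite P0; have -> : D 0 = 0.
  by have := derD dD 0 0; rewrite addr0 => /eqP; rewrite addrC -subr_eq subrr => /eqP.
rewrite /hder (bigD1 i) //= big1 => [|l li].
  rewrite !mxE addr0 (der_mmap _ _ dD).
  have -> : \row_j D (eta ord0 j) = gvec psi (w i) by apply/rowP => j; rewrite mxE Deta.
  rewrite -mh_cder cder_psi eqxx mulr1n => /esym/eqP.
  by rewrite mulf_eq0 (negPf Q0) orbF => /eqP.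
rewrite !mxE (der_mmap _ _ dD).
have -> : \row_j D (eta ord0 j) = gvec psi (w i) by apply/rowP => j; rewrite mxE Deta.
by rewrite -mh_cder cder_psi (inj_eq winj) (negPf li) mulr0n mmap0 mulr0.
Qed.

(* Order of vanishing at b, in the directions tangent to A. *)
Section Order.
Variable b : 'rV[C]_N.
Hypotheses (Ab : A b) (Qb : mv b (\det (jac psi)) != 0).

Fixpoint vord k (P : {mpoly C[N]}) : Prop :=
  if k is k'.+1 then
    mv b P = 0 /\ forall i : 'I_N, (i < e)%N -> vord k' (cder psi i P)
  else True.

Lemma vordS k P : vord k.+1 P -> vord k P.
Proof.
elim: k P => // k IH P [P0 PD]; split=> // i ie.
exact/IH/PD.
Qed.

Lemma vordD k P Q : vord k P -> vord k Q -> vord k (P + Q).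
Proof.
elim: k P Q => // k IH P Q [P0 PD] [Q0 QD]; split; first by rewrite mevalD P0 Q0 addr0.
by move=> i ie; rewrite cderD; apply: IH; [apply: PD | apply: QD].
Qed.

Lemma vordM k G P : vord k P -> vord k (G * P).
Proof.
elim: k G P => // k IH G P vP; have [P0 PD] := vP; split.
  by rewrite mevalM P0 mulr0.
by move=> i ie; rewrite cderM; apply: vordD; apply: IH; [exact: vordS | apply: PD].
Qed.

Lemma vordM0 k G P : mv b G = 0 -> vord k P -> vord k.+1 (G * P).
Proof.
move=> G0; elim: k P => [|k IH] P vP; split; rewrite ?mevalM ?G0 ?mul0r // => i ie.
rewrite cderM; apply: vordD; first exact: vordM.
by have [_ PD] := vP; apply: IH; apply: PD.
Qed.

Lemma vord_vanish k P : vanish P -> vord k P.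
Proof.
elim: k P => // k IH P P0; split; first exact: P0.
by move=> i ie; apply: IH; apply: cder_vanish.
Qed.

Lemma vordN k P : vord k P -> vord k (- P).
Proof. by move=> vP; rewrite -mulN1r; apply: vordM. Qed.

Lemma vord_cancel k G P : mv b G != 0 -> vord k (G * P) -> vord k P.
Proof.
move=> G0; elim: k P => // k IH P vGP.
have vP : vord k P by apply/IH/vordS.
have [/eqP] := vGP; rewrite mevalM mulf_eq0 (negPf G0) => /eqP P0 GPD; split=> // i ie.
apply: IH; have := vordD (GPD i ie) (vordN (vordM (cder psi i G) vP)).
by rewrite cderM [X in X - _]addrC addrK.
Qed.

Lemma vord_prod m k (G : 'I_m -> {mpoly C[N]}) P : (k <= m)%N ->
  (forall j, mv b (G j) = 0) -> vord k ((\prod_j G j) * P).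
Proof.
move=> km G0; suff h : vord m ((\prod_j G j) * P).
  have down s R : vord (s + k) R -> vord k R by elim: s => // s IH /vordS; apply: IH.
  by apply: (down (m - k)%N); rewrite subnK.
elim: m G G0 {km} => [|m IH] G G0; first by [].
rewrite big_ord_recl -mulrA; apply: vordM0; first exact: G0.
by apply: IH => j; apply: G0.
Qed.

Lemma cder_comp d i (p : {mpoly C[d]}) (t : d.-tuple {mpoly C[N]}) :
  cder psi i (p \mPo t) = \sum_l (p^`M(l) \mPo t) * cder psi i (tnth t l).
Proof.
elim/mpoly_ring_ind: p => [c|j|p q hp hq|p q hp hq].
- rewrite comp_mpolyC cderC big1 // => l _.
  by rewrite mderivC comp_mpoly0 mul0r.
- rewrite comp_mpolyXU (bigD1 j) //= big1 => [|l lj].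
    by rewrite mderivXU eqxx comp_mpoly1 mul1r addr0 (tnth_nth 0).
  by rewrite mderivXU eq_sym (negPf lj) comp_mpoly0 mul0r.
- rewrite comp_mpolyD cderD hp hq -big_split; apply: eq_bigr => l _ /=.
  by rewrite mderivD comp_mpolyD mulrDl.
- rewrite rmorphM /= cderM hp hq mulr_suml mulr_sumr -big_split; apply: eq_bigr => l _ /=.
  by rewrite mderivM comp_mpolyD !rmorphM /=; ring.
Qed.

Definition ctuple d (w : 'I_d -> 'I_N) : d.-tuple {mpoly C[N]} :=
  [tuple psi (w i) - (mv b (psi (w i)))%:MP | i < d].

(** The dual vector fields differentiate a polynomial in the increments formally, up to the
    jacobian, which is a unit at [b]. Hence a nonzero polynomial of degree below [k] cannot vanish
    to order [k]. *)
Lemma vord_ctuple d (w : 'I_d -> 'I_N) k (p : {mpoly C[d]}) :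
  injective w -> (forall i, w i < e)%N ->
  vord k (p \mPo ctuple w) -> (msize p <= k)%N -> p = 0.
Proof.
move=> winj we; elim: k p => [|k IH] p.
  by rewrite leqn0 => _; rewrite msize_poly_eq0 => /eqP.
move=> [p0 pD] pk; have [//|pN] := eqVneq p 0.
have D0 i : p^`M(i) = 0.
  apply: IH; last by rewrite -ltnS; apply: leq_trans pk; apply: msize_mderiv.
  have := pD _ (we i); rewrite cder_comp (bigD1 i) //= big1 => [|l li].
    rewrite addr0 tnth_mktuple cderD -mpolyCN cderC addr0 cder_psi eqxx mulr1n mulrC.
    exact: vord_cancel.
  rewrite tnth_mktuple cderD -mpolyCN cderC addr0 cder_psi (inj_eq winj).
  by rewrite (negPf li) mulr0.
have pE := mderiv_eq0 D0; move: p0; rewrite pE comp_mpolyC mevalC => ->.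
by rewrite mpolyC0.
Qed.

End Order.
End AtPoint.
End LocalCoordinates.

(** * Charts of projective space *)

Section Homogenization.
Variables (F : numFieldType) (n : nat).

Lemma mv_scale d (P : {mpoly F[n]}) (c : F) (v : 'rV[F]_n) :
  P \is d.-homog -> mv (c *: v) P = c ^+ d * mv v P.
Proof.
move=> /dhomogP hP; rewrite !mevalE mulr_sumr; apply: eq_big_seq => m /hP.
rewrite /= => dm; rewrite [RHS]mulrCA; congr (_ * _).
under eq_bigr => i _ do rewrite mxE exprMn.
by rewrite big_split /= prodrXr; congr (_ ^+ _ * _); rewrite -dm mdegE.
Qed.

Lemma mv1_neq0 (v : 'rV[F]_n) : mv v 1 != 0.
Proof. by rewrite meval1 oner_neq0. Qed.

(** All degrees from [d] on are available, so that the degrees of two polynomials can be equalized.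
    Since [Q] vanishes off the chart, if [P] vanishes on the part of a set in the chart then [Q]
    vanishes on the whole set. *)
Lemma homogenize (i0 : 'I_n) (P : {mpoly F[n]}) : exists d, forall k,
  exists2 Q : {mpoly F[n]}, Q \is (d + k).-homog
    & forall v : 'rV_n, (v ord0 i0 != 0 ->
        mv v Q = v ord0 i0 ^+ (d + k) * mv ((v ord0 i0)^-1 *: v) P)
      /\ (v ord0 i0 = 0 -> mv v Q = 0).
Proof.
have hX m k : ('X_i0 : {mpoly F[n]}) ^+ k * 'X_m \is (k + 1).-homog.
  apply: dhomogM; last by rewrite dhomogX /= mdeg1.
  have h1 : ('X_i0 : {mpoly F[n]}) \is 1.-homog by rewrite dhomogX /= mdeg1.
  by have := dhomogMn k h1; rewrite mul1n.
elim/mpoly_ring_ind: P => [c|i|p q [d hd] [e he]|p q [d hd] [e he]].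
(* The degree is at least 1 even for a constant, so that [Q] vanishes where the coordinate does. *)
- exists 1%N => k; exists (c *: ('X_i0 ^+ k * 'X_i0)).
    by apply: rpredZ; rewrite addnC.
  move=> v; rewrite mevalZ mevalM rmorphXn /= mevalXU mevalC; split=> [v0|->].
    by rewrite -exprSr add1n mulrC.
  by rewrite !mulr0.
- exists 2%N => k; exists ('X_i0 ^+ k.+1 * 'X_i).
    by rewrite add2n -[k.+2]addn1; apply: hX.
  move=> v; rewrite mevalM rmorphXn /= !mevalXU mxE; split=> [v0|->].
    by rewrite add2n [in RHS]exprSr -mulrA mulVKf.
  by rewrite exprS !mul0r.
- exists (d + e)%N => k.
  have [P1 h1 e1] := hd (e + k)%N; have [P2 h2 e2] := he (d + k)%N.
  exists (P1 + P2); first by rewrite -addnA rpredD // addnCA.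
  move=> v; have [a1 b1] := e1 v; have [a2 b2] := e2 v; split=> v0.
    by rewrite !mevalD a1 // a2 // mulrDr -!addnA [(e + (d + k))%N]addnCA.
  by rewrite mevalD b1 // b2 // addr0.
- exists (d + e)%N => k.
  have [P1 h1 e1] := hd k; have [P2 h2 e2] := he 0%N.
  exists (P1 * P2).
    by rewrite (_ : (d + e + k = (d + k) + (e + 0))%N); [apply: dhomogM | lia].
  move=> v; have [a1 b1] := e1 v; have [a2 b2] := e2 v; split=> v0.
    rewrite !mevalM a1 // a2 // (_ : (d + e + k = (d + k) + (e + 0))%N); last by lia.
    by rewrite [in RHS]exprD mulrACA.
  by rewrite mevalM b1 // mul0r.
Qed.

Lemma homogenize_deg (i0 : 'I_n) (P : {mpoly F[n]}) : exists d,
  exists2 Q : {mpoly F[n]}, Q \is d.-homog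
    & forall v : 'rV_n, (v ord0 i0 != 0 ->
        mv v Q = v ord0 i0 ^+ d * mv ((v ord0 i0)^-1 *: v) P)
      /\ (v ord0 i0 = 0 -> mv v Q = 0).
Proof.
by have [d /(_ 0%N)[Q hQ QE]] := homogenize i0 P; exists (d + 0)%N, Q.
Qed.

Lemma homogenize_pair (i0 : 'I_n) (P P' : {mpoly F[n]}) : exists d Q Q',
  [/\ Q \is d.-homog, Q' \is d.-homog & forall v : 'rV_n, v ord0 i0 != 0 ->
    mv v Q = v ord0 i0 ^+ d * mv ((v ord0 i0)^-1 *: v) P /\
    mv v Q' = v ord0 i0 ^+ d * mv ((v ord0 i0)^-1 *: v) P'].
Proof.
have [d hd] := homogenize i0 P; have [e he] := homogenize i0 P'.
have [Q hQ QE] := hd e; have [Q' hQ' QE'] := he d.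
exists (d + e)%N, Q, Q'; split=> //; first by rewrite addnC.
move=> v v0; split; first exact: (QE v).1.
by rewrite addnC; apply: (QE' v).1.
Qed.

Lemma dder_eq_line (P Q : {mpoly F[n]}) (v u : 'rV[F]_n) :
  (forall s, mv (v + s *: u) P = mv (v + s *: u) Q) -> dder P v u = dder Q v u.
Proof.
move=> h; have [p hp <-] := dder_line P v u; have [q hq <-] := dder_line Q v u.
suff -> : p = q by [].
by apply/eqP; rewrite -subr_eq0; apply/eqP/poly_eq0_forall => s;
  rewrite hornerD hornerN hp hq h subrr.
Qed.

Lemma dder_euler d (P : {mpoly F[n]}) (v : 'rV[F]_n) :
  P \is d.-homog -> dder P v v = d%:R * mv v P.
Proof.
move=> hP; have [q hq <-] := dder_line P v v.
suff -> : q = mv v P *: ('X + 1) ^+ d.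
  rewrite derivZ hornerZ mulrC; congr (_ * _).
  rewrite deriv_exp derivD derivX derivC addr0 mul1r hornerMn horner_exp.
  by rewrite hornerD hornerX hornerC add0r expr1n.
apply/eqP; rewrite -subr_eq0; apply/eqP/poly_eq0_forall => s.
rewrite hornerD hornerN hq hornerZ horner_exp hornerD hornerX hornerC.
rewrite -{1}[v]scale1r -scalerDl (mv_scale _ _ hP) [1 + s]addrC.
by rewrite mulrC subrr.
Qed.

End Homogenization.

(** * Zariski topology and regular functions in an affine chart *)

Section Charts.
Variables (R : realType) (r : nat).
Notation C := R[i].
Notation N := r.+1.
Notation dV := (dualV R r).
Notation pnt := (pt R r).
Implicit Types (y z : pnt) (X W : set pnt) (i : 'I_N) (P Q : {mpoly C[N]}).

Lemma hcoord_line y (v : 'rV[C]_N) : hcoord y v -> line y = <[v : dV]>%VS.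
Proof.
move=> [vy v0]; apply/eqP; rewrite eq_sym eqEdim -memvE vy /=.
by rewrite (eqP (valP y)) dim_vline v0.
Qed.

Lemma hcoord_inj y z (v : 'rV[C]_N) : hcoord y v -> hcoord z v -> y = z.
Proof. by move=> /hcoord_line yv /hcoord_line zv; apply: val_inj; exact: etrans yv (esym zv). Qed.

Lemma line_scale y (v w : 'rV[C]_N) : hcoord y v -> w \in line y ->
  exists c, w = c *: v.
Proof. by move=> /hcoord_line ->; move/vlineP. Qed.

Lemma hcoordZ y (v : 'rV[C]_N) c : hcoord y v -> c != 0 -> hcoord y (c *: v).
Proof.
move=> [vy v0] c0; split; first exact: memvZ.
by rewrite scaler_eq0 negb_or c0.
Qed.

Lemma point_of (v : 'rV[C]_N) : v != 0 -> exists y, hcoord y v.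
Proof.
move=> v0; have lv : \dim <[v : dV]>%VS == 1%N by rewrite dim_vline v0.
exists (exist (fun U : {vspace dV} => \dim U == 1%N) <[v : dV]>%VS lv).
by split=> //; apply: memv_line.
Qed.

Definition rep y : 'rV[C]_N := vpick (line y).

Lemma hcoord_rep y : hcoord y (rep y).
Proof.
split; first exact: memv_pick.
apply/eqP => y0; have /eqP : vpick (line y) = 0 by [].
by rewrite vpick0 => /eqP l0; have := valP y; rewrite /= -/(line y) l0 dimv0.
Qed.

Definition chart i y : bool := rep y ord0 i != 0.
Definition nv i y : 'rV[C]_N := (rep y ord0 i)^-1 *: rep y.

Lemma chart_hcoord i y (v : 'rV[C]_N) : hcoord y v -> chart i y = (v ord0 i != 0).
Proof.
move=> yv; have [vy v0] := yv.
have [c vE] := line_scale (hcoord_rep y) vy.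
have c0 : c != 0 by apply: contraNneq v0 => c0; rewrite vE c0 scale0r.
by rewrite /chart vE mxE mulf_eq0 (negPf c0).
Qed.

Lemma chart_ex y : exists i, chart i y.
Proof.
have [_] := hcoord_rep y; rewrite /chart => y0; apply/existsP; apply: contraT.
rewrite negb_exists => /forallP h; case/eqP: y0; apply/rowP => i; rewrite [RHS]mxE.
by apply/eqP; rewrite -[_ == _]negbK.
Qed.

Lemma hcoord_nv i y : chart i y -> hcoord y (nv i y).
Proof. by move=> cy; apply: hcoordZ (hcoord_rep y) _; rewrite invr_eq0. Qed.

Lemma nv1 i y : chart i y -> nv i y ord0 i = 1.
Proof. by move=> cy; rewrite mxE mulVf. Qed.

Lemma nvE i y (v : 'rV[C]_N) : hcoord y v -> chart i y ->
  nv i y = (v ord0 i)^-1 *: v.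
Proof.
move=> yv cy; have [vy _] := yv; have [c vE] := line_scale (hcoord_nv cy) vy.
have c0 : c != 0.
  by apply: contraTneq cy => c0; rewrite (chart_hcoord _ yv) vE c0 scale0r mxE eqxx.
have : v ord0 i = c by rewrite vE mxE nv1 // mulr1.
by move=> ->; rewrite vE scalerA mulVf // scale1r.
Qed.

Lemma nv_eq i y (v : 'rV[C]_N) : hcoord y v -> v ord0 i = 1 ->
  chart i y /\ nv i y = v.
Proof.
move=> yv v1; have cy : chart i y by rewrite (chart_hcoord _ yv) v1 oner_neq0.
by rewrite (nvE yv cy) v1 invr1 scale1r.
Qed.

(** The slice of the cone over [X] by the hyperplane where coordinate i is 1. Keeping all r + 1
    coordinates lets the same polynomials serve as forms and as affine functions, at the price of
    the extra equation X_i - 1. *)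
Definition aff i X : set 'rV[C]_N := [set v | exists2 y, X y & chart i y /\ v = nv i y].

Lemma aff_nv i X y : X y -> chart i y -> aff i X (nv i y).
Proof. by move=> Xy cy; exists y. Qed.

Lemma affP i X (v : 'rV[C]_N) y : v ord0 i = 1 -> hcoord y v -> X y -> aff i X v.
Proof. by move=> v1 yv Xy; exists y => //; have [cy ->] := nv_eq yv v1. Qed.

Definition princ i Q : set pnt := [set y | chart i y /\ mv (nv i y) Q != 0].

Lemma princ1 i y : chart i y -> princ i 1 y.
Proof. by move=> cy; split; [exact: cy | exact: mv1_neq0]. Qed.

Lemma ev_line0 d (F : {mpoly C[N]}) y (v : 'rV[C]_N) : is_homog d F ->
  hcoord y v -> ev F v = 0 -> forall w, w \in line y -> ev F w = 0.
Proof.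
move=> hF yv F0 w /(line_scale yv)[c ->].
by rewrite /ev (mv_scale _ _ hF) -/(ev F v) F0 mulr0.
Qed.

Lemma zopen_homog (O : set pnt) : zopen O -> forall y, O y ->
  exists d F, [/\ is_homog d F, forall v, hcoord y v -> ev F v != 0
    & forall z v, hcoord z v -> ev F v != 0 -> O z].
Proof.
move=> [S hS OE] y Oy.
have : ~ (zeros S) y by rewrite -OE /=; apply.
move=> /existsNP[F] /not_implyP[SF] /existsNP[v] /not_implyP[vy Fv].
have [d hF] := hS F SF; exists d, F; split=> // [w yw|z w zw Fw].
  by apply/eqP => Fw; apply: Fv; apply: (ev_line0 hF yw).
apply: contrapT => nO; have : (zeros S) z by rewrite -OE.
by move=> /(_ F SF w zw.1) /eqP; rewrite (negPf Fw).
Qed.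

Lemma zopen_princ i (O : set pnt) y : zopen O -> O y -> chart i y ->
  exists2 Q, princ i Q y & princ i Q `<=` O.
Proof.
move=> oO Oy cy; have [d [F [hF Fy FO]]] := zopen_homog oO Oy.
exists F; first by split => //; apply: (Fy _ (hcoord_nv cy)).
by move=> z [cz Fz]; apply: (FO z _ (hcoord_nv cz)).
Qed.

Lemma homog_zopen d (F : {mpoly C[N]}) : is_homog d F ->
  zopen [set y | forall v, hcoord y v -> ev F v != 0].
Proof.
move=> hF; exists [set F]; first by move=> _ ->; exists d.
apply/seteqP; split=> [y /= h G ->|y /= h1 h2].
  move/existsNP: h => [v] /not_implyP[yv] /negP; rewrite negbK => /eqP.
  exact: (ev_line0 hF yv).
have yv := hcoord_rep y.
by have := h2 _ yv; rewrite (h1 F erefl _ yv.1) eqxx.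
Qed.

Lemma princ_open i Q : zopen (princ i Q).
Proof.
have [d [F hF FE]] := homogenize_deg i Q.
suff -> : princ i Q = [set y | forall v, hcoord y v -> ev F v != 0].
  exact: homog_zopen hF.
apply/seteqP; split=> [y [cy Qy] v yv|y h].
  have v0 : v ord0 i != 0 by rewrite -(chart_hcoord _ yv).
  rewrite /ev (FE v).1 // -(nvE yv cy) mulf_neq0 // expf_neq0 //.
have yv := hcoord_rep y; have := h _ yv; rewrite /ev.
have [v0|v0] := eqVneq (rep y ord0 i) 0; first by rewrite (FE _).2 // eqxx.
by rewrite (FE _).1 // mulf_eq0 negb_or => /andP[_ Qy]; split.
Qed.

Lemma zopenI (O O' : set pnt) : zopen O -> zopen O' -> zopen (O `&` O').
Proof.
move=> oO oO'.
exists [set F | (exists d, is_homog d F) /\ forall z v, hcoord z v -> ev F v != 0 -> (O `&` O') z].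
  by move=> F [hF _].
apply/seteqP; split=> [y nO F [[d hF] FO] v vy|y h [Oy O'y]].
  apply: contrapT => /eqP Fv; apply: nO; have yv := hcoord_rep y.
  apply: (FO y (rep y) yv); apply/eqP => F0.
  by case/eqP: Fv; apply: (ev_line0 hF yv F0).
have [d [F [hF Fy FO]]] := zopen_homog oO Oy.
have [e [G [hG Gy GO]]] := zopen_homog oO' O'y.
have yv := hcoord_rep y.
have : ev (F * G) (rep y) = 0.
  apply: (h (F * G)) => //; last exact: yv.1.
  split; first by exists (d + e)%N; apply: dhomogM.
  move=> z v zv; rewrite /ev mevalM mulf_eq0 negb_or => /andP[Fz Gz].
  by split; [apply: (FO z v) | apply: (GO z v)].
rewrite /ev mevalM => /eqP; rewrite mulf_eq0 => /orP[/eqP F0|/eqP G0].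
  by have := Fy _ yv; rewrite /ev F0 eqxx.
by have := Gy _ yv; rewrite /ev G0 eqxx.
Qed.

(** Closed sets are given by arbitrary families of forms; here all forms whose nonvanishing locus
    lies in [O] are taken. *)
Lemma zopen_local (O : set pnt) :
  (forall y, O y -> exists O', [/\ zopen O', O' y & O' `<=` O]) -> zopen O.
Proof.
move=> loc.
exists [set F | (exists d, is_homog d F) /\ forall z v, hcoord z v -> ev F v != 0 -> O z].
  by move=> F [hF _].
apply/seteqP; split=> [y nO F [[d hF] FO] v vy|y h Oy].
  apply: contrapT => /eqP Fv; apply: nO; have yv := hcoord_rep y.
  apply: (FO y (rep y) yv); apply/eqP => F0.
  by case/eqP: Fv; apply: (ev_line0 hF yv F0).
have [O' [oO' O'y O'O]] := loc y Oy.
have [d [F [hF Fy FO]]] := zopen_homog oO' O'y.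
have yv := hcoord_rep y; have /eqP := Fy _ yv; apply; apply: (h F) yv.1.
by split; [exists d | move=> z v zv Fz; apply/O'O/(FO z v)].
Qed.

Lemma zopenT : zopen (setT : set pnt).
Proof.
rewrite (_ : setT = [set y : pnt | forall v, hcoord y v -> ev 1 v != 0]).
  exact: (homog_zopen (dhomog1 _ _)).
by apply/seteqP; split=> // y _ v _; rewrite /ev meval1 oner_neq0.
Qed.

Lemma open_inT X : open_in X X.
Proof. by exists setT; [exact: zopenT | rewrite setIT]. Qed.

Lemma open_inI X W W' : open_in X W -> open_in X W' -> open_in X (W `&` W').
Proof.
move=> [O oO ->] [O' oO' ->]; exists (O `&` O'); first exact: zopenI.
by apply/seteqP; split=> [y [[Xy Oy] [_ O'y]]|y [Xy [Oy O'y]]].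
Qed.

Lemma nbhd_inI X x W W' : nbhd_in X x W -> nbhd_in X x W' -> nbhd_in X x (W `&` W').
Proof. by move=> [oW Wx] [oW' W'x]; split; [exact: open_inI|]. Qed.

Lemma nbhd_princ X x i W : nbhd_in X x W -> chart i x ->
  exists2 Q, princ i Q x & X `&` princ i Q `<=` W.
Proof.
move=> [[O oO ->] [Xx Ox]] cx; have [Q Qx QO] := zopen_princ oO Ox cx.
by exists Q => // y [Xy Qy]; split => //; apply: QO.
Qed.

Lemma princ_nbhd X x i Q : X x -> princ i Q x -> nbhd_in X x (X `&` princ i Q).
Proof. by move=> Xx Qx; split=> //; exists (princ i Q) => //; apply: princ_open. Qed.

Lemma princM i Q P : princ i (Q * P) = princ i Q `&` princ i P.
Proof.
apply/seteqP; split=> y; rewrite /princ /= mevalM mulf_eq0 negb_or.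
  by move=> [cy /andP[]].
by move=> [[cy ->] [_ ->]].
Qed.

Lemma open_in_sub X W : open_in X W -> W `<=` X.
Proof. by move=> [O _ ->] y []. Qed.

Lemma regular_princ i (W : set pnt) (g : pnt -> C) :
  (forall x, W x -> exists P Q, princ i Q x /\
    forall y, W y -> princ i Q y -> g y = mv (nv i y) P / mv (nv i y) Q) ->
  regular W g.
Proof.
move=> h x Wx; have [P [Q [Qx gE]]] := h x Wx.
have [d [F [G [hF hG FGE]]]] := homogenize_pair i P Q.
exists (princ i Q), F, G; split=> //; first exact: princ_open.
split; first by exists d.
move=> y v [Wy Qy] yv; have [cy Qy0] := Qy.
have v0 : v ord0 i != 0 by rewrite -(chart_hcoord _ yv).
have [FE GE] := FGE v v0; rewrite /ev FE GE -(nvE yv cy).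
have vd : v ord0 i ^+ d != 0 by rewrite expf_neq0.
split; first by rewrite mulf_neq0.
by rewrite invfM mulrACA divff // mul1r gE.
Qed.

Lemma regular_rep X x i (g : pnt -> C) : regular_at X x g -> chart i x ->
  exists P Q, princ i Q x /\
    forall y, X y -> princ i Q y -> g y = mv (nv i y) P / mv (nv i y) Q.
Proof.
move=> [W nW /(_ x nW.2)[O [F [G [oO Ox [[d [hF hG]] FG]]]]]] cx.
have [Q1 Q1x Q1W] := nbhd_princ nW cx.
have [Q2 Q2x Q2O] := zopen_princ oO Ox cx.
have Gy y : X y -> princ i (Q1 * Q2) y -> mv (nv i y) G != 0 /\ g y = mv (nv i y) F / mv (nv i y) G.
  rewrite princM => Xy [Q1y Q2y]; apply: (FG y) (hcoord_nv Q1y.1).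
  by split; [apply: Q1W | apply: Q2O].
have Xx : X x by apply: (open_in_sub nW.1 nW.2).
have Q12 : princ i (Q1 * Q2) x by rewrite princM.
exists (F * (Q1 * Q2)), (G * (Q1 * Q2)); split.
  by rewrite princM; split=> //; split=> //; apply: (Gy x Xx Q12).1.
move=> y Xy; rewrite princM => -[_ Qy]; have [G0 ->] := Gy y Xy Qy.
by rewrite !mevalM -mulf_div divff ?mulr1 //; have := Qy.2; rewrite !mevalM.
Qed.

Lemma regular_sub (W W' : set pnt) g : regular W g -> W' `<=` W -> regular W' g.
Proof.
move=> gW W'W x /W'W /gW [O [F [G [oO Ox [dFG h]]]]].
exists O, F, G; split=> //; split=> // y v [/W'W Wy Oy]; exact: h.
Qed.

Lemma regular_at_in X W g x : open_in X W -> W x -> regular W g -> regular_at X x g.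
Proof. by move=> oW Wx gW; exists W. Qed.

Lemma regularC W c : regular W (fun=> c).
Proof.
move=> x Wx; exists setT, c%:MP, 1; split=> //; first exact: zopenT.
split; first by exists 0%N; [rewrite -alg_mpolyC; apply: dhomogZ|]; apply: dhomog1.
by move=> y v _ _; rewrite /ev mevalC meval1 oner_neq0 divr1.
Qed.

Let regular_op W g h (op : C -> C -> C)
    (opP : {mpoly C[N]} -> {mpoly C[N]} -> {mpoly C[N]} -> {mpoly C[N]} -> {mpoly C[N]}) :
  (forall d e F G F' G', is_homog d F -> is_homog d G -> is_homog e F' ->
     is_homog e G' -> is_homog (d + e) (opP F G F' G')) ->
  (forall F G F' G' v, ev G v != 0 -> ev G' v != 0 ->
     op (ev F v / ev G v) (ev F' v / ev G' v) = ev (opP F G F' G') v / ev (G * G') v) ->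
  regular W g -> regular W h -> regular W (fun y => op (g y) (h y)).
Proof.
move=> hop opE gW hW x Wx.
have [O [F [G [oO Ox [[d [hF hG]] gE]]]]] := gW x Wx.
have [O' [F' [G' [oO' O'x [[e [hF' hG']] hE]]]]] := hW x Wx.
exists (O `&` O'), (opP F G F' G'), (G * G'); split=> //; first exact: zopenI.
split; first by exists (d + e)%N; [exact: hop | exact: dhomogM].
move=> y v [Wy [Oy O'y]] yv.
have [G0 ->] := gE y v (conj Wy Oy) yv; have [G0' ->] := hE y v (conj Wy O'y) yv.
by split; [rewrite /ev mevalM mulf_neq0 | exact: opE].
Qed.

Lemma regularD W g h : regular W g -> regular W h -> regular W (fun y => g y + h y).
Proof.
apply: (regular_op (opP := fun F G F' G' => F * G' + F' * G)).
  move=> d e F G F' G' hF hG hF' hG'; apply: dhomogD; first exact: dhomogM.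
  by rewrite /in_mem /= addnC; apply: dhomogM.
move=> F G F' G' v G0 G0'.
by rewrite (addf_div _ _ G0 G0') /ev mevalD !mevalM.
Qed.

Lemma regularM W g h : regular W g -> regular W h -> regular W (fun y => g y * h y).
Proof.
apply: (regular_op (opP := fun F G F' G' => F * F')).
  by move=> d e F G F' G' hF hG hF' hG'; apply: dhomogM.
by move=> F G F' G' v G0 G0'; rewrite mulf_div /ev !mevalM.
Qed.

End Charts.

Section Substitution.

(** [H] is the numerator of p(P/Q) with denominator Q^k. It is chosen before the field and the
    point, so that one polynomial serves at the generic point and at closed points. *)
Lemma frac_subst (C : comNzRingType) n d (P : 'I_d -> {mpoly C[n]}) (Q : {mpoly C[n]})
    (p : {mpoly C[d]}) : exists k H, forall (K : fieldType) (j : {rmorphism C -> K})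
    (zeta : 'rV[K]_n), mh j zeta Q != 0 ->
  mh j zeta H = mh j zeta Q ^+ k * mh j (\row_i (mh j zeta (P i) / mh j zeta Q)) p.
Proof.
elim/mpoly_ring_ind: p => [c|i|p q [k [H hH]] [l [G hG]]|p q [k [H hH]] [l [G hG]]].
- by exists 0%N, c%:MP => K j zeta Q0; rewrite !mmapC expr0 mul1r.
- by exists 1%N, (P i) => K j zeta Q0; rewrite mhX mxE expr1 mulrC divfK.
- exists (k + l)%N, (H * Q ^+ l + G * Q ^+ k) => K j zeta Q0.
  rewrite !mmapD !mhM !rmorphXn /= hH // hG // exprD.
  move: (_ ^+ k) (_ ^+ l) (mh _ _ p) (mh _ _ q) => x y u v; ring.
- exists (k + l)%N, (H * G) => K j zeta Q0.
  by rewrite !mhM hH // hG // exprD mulrACA.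
Qed.

Lemma mh_comp (C K : comNzRingType) (j : {rmorphism C -> K}) n d (t : d.-tuple {mpoly C[n]})
    (zeta : 'rV[K]_n) (p : {mpoly C[d]}) :
  mh j zeta (p \mPo t) = mh j (\row_i mh j zeta (tnth t i)) p.
Proof.
elim/mpoly_ring_ind: p => [c|i|p q hp hq|p q hp hq].
- by rewrite comp_mpolyC !mmapC.
- by rewrite comp_mpolyXU mhX mxE (tnth_nth 0).
- by rewrite comp_mpolyD !mmapD hp hq.
- by rewrite rmorphM /= !mhM hp hq.
Qed.

Lemma dim_rowspace (F : fieldType) n m (U : {vspace 'rV[F]_n}) (T : 'M[F]_(m, n)) :
  (forall v, v \in U <-> (v <= T)%MS) -> \dim U = \rank T.
Proof.
move=> UT; set B := row_base T.
pose f := linfun (mulmxr B : 'rV[F]_(\rank T) -> 'rV[F]_n).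
have fE w : f w = w *m B by rewrite lfunE.
have -> : U = limg f.
  apply/vspaceP => v; apply/idP/memv_imgP => [/UT|[w _ ->]].
    by rewrite -(eq_row_base T) => /submxP[w ->]; exists w; rewrite ?memvf ?fE.
  by apply/UT; rewrite fE -(eq_row_base T) submxMl.
have f0 : lker f == 0%VS.
  apply/lker0P => u v; rewrite !fE; apply: row_free_inj; exact: row_base_free.
rewrite limg_dim_eq; last by rewrite (eqP f0) capv0.
by rewrite dimvf /dim /= mul1n.
Qed.

Lemma dder_scale (F : numFieldType) n d (P : {mpoly F[n]}) c (v u : 'rV[F]_n) :
  P \is d.-homog -> dder P (c *: v) (c *: u) = c ^+ d * dder P v u.
Proof.
move=> hP; have [p hp <-] := dder_line P (c *: v) (c *: u); have [q hq <-] := dder_line P v u.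
suff -> : p = c ^+ d *: q by rewrite derivZ hornerZ.
apply/eqP; rewrite -subr_eq0; apply/eqP/poly_eq0_forall => s.
rewrite hornerD hornerN hornerZ hp hq scalerA [s * c]mulrC -scalerA -scalerDr.
by rewrite (mv_scale _ _ hP) subrr.
Qed.

Lemma flat_lin (F : fieldType) n (i : 'I_n) c (v w w' : 'rV[F]_n) :
  c *: w + w' - ((c *: w + w') ord0 i) *: v
  = c *: (w - (w ord0 i) *: v) + (w' - (w' ord0 i) *: v).
Proof. by apply/rowP => l; rewrite !mxE; ring. Qed.

Lemma flat_i (F : fieldType) n (i : 'I_n) (v w : 'rV[F]_n) :
  v ord0 i = 1 -> (w - (w ord0 i) *: v) ord0 i = 0.
Proof. by move=> v1; rewrite !mxE v1 mulr1 subrr. Qed.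

End Substitution.

(** * Dimension and tangent spaces computed in a chart *)

Section Dimension.
Variables (R : realType) (r : nat).
Notation C := R[i].
Notation N := r.+1.
Notation dV := (dualV R r).
Notation pnt := (pt R r).
Implicit Types (y z : pnt) (X W : set pnt) (i : 'I_N) (P Q : {mpoly C[N]}).

(** The part of [X] in chart i is Zariski dense in [X]. *)
Definition dense_chart i X := forall d F, is_homog d F ->
  (forall v : 'rV[C]_N, aff i X v -> ev F v = 0) ->
  forall y v, X y -> v \in line y -> ev F v = 0.

Lemma zclosed1 d (F : {mpoly C[N]}) : is_homog d F -> zclosed (zeros [set F] : set pnt).
Proof. by move=> hF; exists [set F] => // _ ->; exists d. Qed.

Lemma zeros1 d (F : {mpoly C[N]}) y (v : 'rV[C]_N) : is_homog d F -> hcoord y v ->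
  (zeros [set F] : set pnt) y <-> ev F v = 0.
Proof.
move=> hF yv; split=> [h|F0 _ -> w]; first exact: (h F erefl v yv.1).
exact: ev_line0 hF yv F0 w.
Qed.

(** Homogenizations vanish off the chart, so P Q = 0 on the slice covers [X] by two closed sets.
    Density is the same argument for the form and the coordinate X_i. *)
Lemma irreducible_prime i X : zirreducible X -> (exists2 y, X y & chart i y) ->
  prime_set (aff i X) /\ dense_chart i X.
Proof.
move=> [_ irrX] [y0 Xy0 cy0]; split.
  split=> [|P Q PQ]; first by exists (nv i y0); apply: aff_nv.
  have [d [F hF FE]] := homogenize_deg i P; have [e [G hG GE]] := homogenize_deg i Q.
  have van d' S H : is_homog d' H -> (forall v : 'rV[C]_N, v ord0 i != 0 ->
      mv v H = v ord0 i ^+ d' * mv ((v ord0 i)^-1 *: v) S) ->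
      X `<=` zeros [set H] -> forall z : 'rV[C]_N, aff i X z -> mv z S = 0.
    move=> hH HE XH _ [z Xz [cz ->]]; have zv := hcoord_nv cz.
    have /(zeros1 hH zv) := XH z Xz; rewrite /ev HE ?(nv1 cz) ?oner_neq0 //.
    by rewrite expr1n mul1r invr1 scale1r.
  have [y Xy|XF|XG] := irrX _ _ (zclosed1 hF) (zclosed1 hG).
  - have yv := hcoord_rep y.
    have [cy|/negbNE/eqP v0] := boolP (chart i y); last first.
      by left; apply/(zeros1 hF yv); rewrite /ev (FE _).2.
    have /eqP := PQ _ (aff_nv Xy cy); rewrite mevalM mulf_eq0 => /orP[|] /eqP h.
      by left; apply/(zeros1 hF yv); rewrite /ev (FE _).1 // -/(nv i y) h mulr0.
    by right; apply/(zeros1 hG yv); rewrite /ev (GE _).1 // -/(nv i y) h mulr0.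
  - by left; apply: (van _ _ _ hF) => // v v0; apply: (FE v).1.
  - by right; apply: (van _ _ _ hG) => // v v0; apply: (GE v).1.
move=> d F hF F0 y v Xy vy.
have hX : is_homog 1 ('X_i : {mpoly C[N]}) by rewrite /is_homog dhomogX /= mdeg1.
have [z Xz|XF|XX] := irrX _ _ (zclosed1 hF) (zclosed1 hX).
- have [cz|/negbNE/eqP v0] := boolP (chart i z).
    by left; apply/(zeros1 hF (hcoord_nv cz)); apply/F0/aff_nv.
  by right; apply/(zeros1 hX (hcoord_rep z)); rewrite /ev mevalXU.
- exact: (XF y Xy F erefl v vy).
- have /(zeros1 hX (hcoord_nv cy0)) := XX _ Xy0.
  by rewrite /ev mevalXU nv1 // => /eqP; rewrite oner_eq0.
Qed.

Lemma regular_mpoly d W (g : 'I_d -> pnt -> C) (p : {mpoly C[d]}) :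
  (forall l, regular W (g l)) -> regular W (fun y => p.@[fun l => g l y]).
Proof.
move=> gW; elim/mpoly_ring_ind: p => [c|l|p q hp hq|p q hp hq].
- by under eq_fun => y do rewrite mevalC; exact: regularC.
- by under eq_fun => y do rewrite mevalXU; exact: gW.
- by under eq_fun => y do rewrite mevalD; exact: regularD.
- by under eq_fun => y do rewrite mevalM; exact: regularM.
Qed.

Section Generic.
Variables (i : 'I_N) (X : set pnt) (L : fieldType) (iota : {rmorphism C -> L}).
Variable (eta : 'rV[L]_N).
Hypotheses (gen : generic (aff i X) iota eta) (dX : dense_chart i X).

Local Notation e := (\rank (gtsp (aff i X) iota eta)).

Lemma dense_point d (F : {mpoly C[N]}) y v : is_homog d F -> X y -> hcoord y v ->
  ev F v != 0 -> mh iota eta F != 0.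
Proof.
move=> hF Xy yv; apply: contraNneq => F0; apply/eqP.
by apply: (dX hF) yv.1 => // w Aw; have /gen := F0; apply.
Qed.

(** The point [y] may lie outside chart i: by density, a form that is nonzero at [y] is nonzero at
    the generic point. *)
Lemma open_meets_chart W y : open_in X W -> W y ->
  exists Q, mh iota eta Q != 0 /\ forall z, X z -> princ i Q z -> W z.
Proof.
move=> [O oO ->] [Xy Oy]; have [d [F [hF Fy FO]]] := zopen_homog oO Oy.
exists F; split; first exact: (dense_point hF Xy (hcoord_rep y) (Fy _ (hcoord_rep y))).
by move=> z Xz [cz Fz]; split=> //; apply: (FO z _ (hcoord_nv cz)).
Qed.

Lemma gen_princ Q : mh iota eta Q != 0 -> exists y, [/\ X y, princ i Q y & aff i X (nv i y)].
Proof. by move=> /(gen_point gen)[_ [y Xy [cy ->]] Qy]; exists y; split=> //; apply: aff_nv. Qed.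

Lemma gen_prod d (Q : 'I_d -> {mpoly C[N]}) :
  (forall l, mh iota eta (Q l) != 0) -> mh iota eta (\prod_l Q l) != 0.
Proof.
move=> Q0; apply: (big_ind (fun P => mh iota eta P != 0)) => // [|P P' h h'].
  by rewrite mh1 oner_neq0.
by rewrite mhM mulf_neq0.
Qed.

Lemma princ_prod d (Q : 'I_d -> {mpoly C[N]}) y l :
  princ i (\prod_l Q l) y -> princ i (Q l) y.
Proof. by rewrite (bigD1 l) //= princM => -[]. Qed.

Lemma regular_zero W h Q : open_in X W -> regular W h -> mh iota eta Q != 0 ->
  (forall y, W y -> princ i Q y -> h y = 0) -> forall y, W y -> h y = 0.
Proof.
move=> oW hW Q0 h0 y Wy; apply/eqP/contraT => hy.
have [O [F [G [oO Oy [[d [hF hG]] FG]]]]] := hW y Wy.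
have yv := hcoord_rep y.
have Fy : ev F (rep y) != 0.
  by have [G0 hE] := FG y _ (conj Wy Oy) yv; apply: contraNneq hy => F0; rewrite hE F0 mul0r.
have oW' : open_in X (W `&` (X `&` (O `&` [set z | forall v, hcoord z v -> ev F v != 0]))).
  apply: open_inI => //; exists (O `&` [set z | forall v, hcoord z v -> ev F v != 0]) => //.
  by apply: zopenI => //; apply: homog_zopen hF.
have Xy : X y by apply: (open_in_sub oW).
have [|Q' [Q'0 Q'W]] := open_meets_chart (y := y) oW'.
  split=> //; split=> //; split=> // v yv'; apply/eqP => F0; case/eqP: Fy.
  exact: (ev_line0 hF yv' F0) yv.1.
have QQ' : mh iota eta (Q * Q') != 0 by rewrite mhM mulf_neq0.
have [z [Xz]] := gen_princ QQ'.
rewrite princM => -[Qz Q'z] _.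
have [Wz [_ [Oz Fz]]] := Q'W z Xz Q'z.
have zv := hcoord_rep z; have [G0 hE] := FG z _ (conj Wz Oz) zv.
have /eqP := h0 z Wz Qz; rewrite hE mulf_eq0 invr_eq0 (negPf G0) orbF.
by rewrite (negPf (Fz _ zv)).
Qed.

(** Regular functions become fractions in [eta] with a common denominator, and independence on [W]
    passes to the generic point by density; then [alg_indep_le] applies. Conversely local
    coordinates at a general point are independent. *)
Lemma trdeg_aff d : trdeg_ge X d <-> (d <= e)%N.
Proof.
split=> [[W [g [oW [y0 Wy0] gW ind]]]|de].
  have [Q0 [Q00 Q0W]] := open_meets_chart oW Wy0.
  have [y1 [Xy1 Q0y1 Ay1]] := gen_princ Q00.
  have Wy1 := Q0W _ Xy1 Q0y1.
  have /choice[PQ hPQ] : forall l, exists PQ : {mpoly C[N]} * {mpoly C[N]},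
      princ i PQ.2 y1 /\ forall y, X y -> princ i PQ.2 y ->
        g l y = mv (nv i y) PQ.1 / mv (nv i y) PQ.2.
    move=> l; have [P [Q [Qy h]]] := regular_rep (regular_at_in oW Wy1 (gW l)) Q0y1.1.
    by exists (P, Q).
  have PQ0 l : mh iota eta (PQ l).2 != 0 by apply: (gen_neq0 gen Ay1); have [[]] := hPQ l.
  pose Q := \prod_l (PQ l).2; pose P l := (PQ l).1 * \prod_(m | m != l) (PQ m).2.
  have QE l : Q = (PQ l).2 * \prod_(m | m != l) (PQ m).2 by rewrite /Q (bigD1 l).
  have Q0' : mh iota eta Q != 0 by exact: gen_prod.
  have fracE (K : fieldType) (j : {rmorphism C -> K}) (zeta : 'rV[K]_N) l :
      mh j zeta Q != 0 -> mh j zeta (P l) / mh j zeta Q = mh j zeta (PQ l).1 / mh j zeta (PQ l).2.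
    rewrite (QE l) !mhM mulf_eq0 negb_or => /andP[h1 h2].
    by rewrite -mulf_div divff // mulr1.
  apply: (@alg_indep_le _ _ _ _ _ _ gen d (\row_l (mh iota eta (P l) / mh iota eta Q))).
    by move=> l; exists (P l), Q; rewrite mxE.
  move=> p p0; apply: ind; apply: (regular_zero (Q := Q0 * Q)) => //.
  - exact: regular_mpoly.
  - by rewrite mhM mulf_neq0.
  move=> y Wy; rewrite princM => -[_ Qy].
  have Xy := open_in_sub oW Wy.
  have [k [H HE]] := frac_subst P Q p.
  have := HE L iota eta Q0'; rewrite p0 mulr0 => /gen/(_ _ (aff_nv Xy Qy.1)) H0.
  have := HE C [the {rmorphism C -> C} of idfun] (nv i y) Qy.2.
  rewrite [LHS]H0 => /esym/eqP; rewrite mulf_eq0 expf_eq0 (negPf Qy.2) andbF /= => /eqP pE.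
  rewrite -[RHS]pE; apply: meval_eq => l.
  rewrite mxE (fracE C [the {rmorphism C -> C} of idfun] (nv i y)); last exact: Qy.2.
  exact: ((hPQ l).2 y Xy (princ_prod (Q := fun l => (PQ l).2) l Qy)).
have [Q Q0 QE] := tsp_rank_generic gen.
have [a Aa Qa] := gen_point gen Q0.
have [psi ca] := coord_exists Aa (QE a Aa Qa).
have eN : (e <= N)%N by apply: rank_leq_row.
pose w (l : 'I_d) : 'I_N := widen_ord (leq_trans de eN) l.
have winj : injective w by move=> l m /(congr1 val) h; apply: val_inj.
have we l : (w l < e)%N by exact: (leq_trans (ltn_ord l) de).
exists (X `&` princ i 1), (fun l y => mv (nv i y) (psi (w l))); split.
- by exists (princ i 1) => //; apply: princ_open.
- have [a' Aa' _] := gen_point gen Q0; have [z Xz [cz _]] := Aa'.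
  by exists z; exact: (conj Xz (princ1 cz)).
- move=> l; apply: (@regular_princ _ _ i) => x [Xx cx]; exists (psi (w l)), 1.
  by split=> // y' _ _; rewrite meval1 divr1.
move=> p p0.
apply: (coord_indep gen Aa ca winj we).
suff : mh iota eta (p \mPo [tuple psi (w l) | l < d]) = 0.
  rewrite mh_comp => h; rewrite -[RHS]h; congr (mmap _ _ p).
  by apply/funext => l; rewrite !mxE tnth_mktuple.
apply/gen => _ [y Xy [cy ->]].
rewrite comp_mpoly_meval -[RHS](p0 y (conj Xy (princ1 cy))).
by apply: meval_eq => l; rewrite tnth_mktuple.
Qed.

End Generic.
Lemma has_dim_aff i X (L : fieldType) (iota : {rmorphism C -> L}) (eta : 'rV[L]_N) :
  generic (aff i X) iota eta -> dense_chart i X ->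
  forall d, has_dim X d <-> d = \rank (gtsp (aff i X) iota eta).
Proof.
move=> gen dX d; rewrite /has_dim !(trdeg_aff gen dX); split=> [[h1 h2]|->].
  by apply/eqP; rewrite eqn_leq h1 leqNgt /=; apply/negP.
by split=> //; rewrite ltnn.
Qed.

Section Tangent.
Variables (i : 'I_N) (y : pnt).
Hypothesis cy : chart i y.

Definition nvl : subvs_of (line y) := vsproj (line y) (nv i y).

Lemma vsval_nvl : vsval nvl = nv i y.
Proof. by rewrite /nvl vsprojK //; have [] := hcoord_nv cy. Qed.

Lemma subvs_nvl (v : subvs_of (line y)) : exists c, v = c *: nvl.
Proof.
have [c vE] := line_scale (hcoord_nv cy) (subvsP v); exists c; apply: val_inj.
by rewrite /= vE -vsval_nvl.
Qed.

(* The representative, in the hyperplane where the coordinate i vanishes, of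
   a tangent vector at y. *)
Definition theta (phi : tangentP y) : 'rV[C]_N :=
  lift_tangent phi nvl - ((lift_tangent phi nvl : 'rV[C]_N) ord0 i) *: nv i y.

Lemma lift_tangentE (phi : tangentP y) :
  lift_tangent phi nvl = theta phi + ((lift_tangent phi nvl : 'rV[C]_N) ord0 i) *: nv i y.
Proof. by rewrite subrK. Qed.

Lemma theta_i phi : theta phi ord0 i = 0.
Proof. exact: flat_i (nv1 cy). Qed.

Lemma theta_is_linear : linear theta.
Proof.
move=> c p q; rewrite /theta /lift_tangent add_lfunE scale_lfunE linearP /=.
exact: flat_lin.
Qed.

HB.instance Definition _ := GRing.isLinear.Build _ _ _ _ theta theta_is_linear.

Lemma theta_inj : injective theta.
Proof.
apply: raddf_inj => phi /= th0; apply/lfunP => v; have [c ->] := subvs_nvl v.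
rewrite zero_lfunE linearZ /=; suff -> : phi nvl = 0 by rewrite scaler0.
rewrite -[phi nvl](@quo_liftK _ _ (line y)); apply/eqP; rewrite ker_quo_proj.
rewrite -/(lift_tangent phi nvl) lift_tangentE th0 add0r.
by apply: memvZ; have [] := hcoord_nv cy.
Qed.

Lemma theta_surj (u : 'rV[C]_N) : u ord0 i = 0 -> exists phi, theta phi = u.
Proof.
move=> u0.
pose f (v : subvs_of (line y)) : quo (line y) :=
  ((vsval v : 'rV[C]_N) ord0 i) *: quo_proj (line y) u.
have lin : linear f by move=> c v w; rewrite /f linearP /= !mxE scalerDl scalerA.
pose h := GRing.isLinear.Build _ _ _ _ f lin.
pose fl : {linear subvs_of (line y) -> quo (line y)} := HB.pack f h.
exists (linfun fl).
have fE : linfun fl nvl = quo_proj (line y) u.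
  by rewrite (lfunE fl) /= /f vsval_nvl nv1 // scale1r.
have lE : lift_tangent (linfun fl) nvl - u \in line y.
  rewrite -ker_quo_proj linearB /= /lift_tangent quo_liftK fE subrr //.
have [c cE] := line_scale (hcoord_nv cy) lE.
have {cE} cE : lift_tangent (linfun fl) nvl = u + c *: nv i y by rewrite -cE addrC subrK.
by rewrite /theta cE mxE u0 add0r mxE nv1 // mulr1 addrK.
Qed.

Lemma differentialE (F : {mpoly C[N]}) (v u : 'rV[C]_N) : differential F v u = dder F v u.
Proof. by []. Qed.

Lemma differential_lift d (F : {mpoly C[N]}) (phi : tangentP y) : is_homog d F ->
  ev F (nv i y) = 0 ->
  differential F (nv i y) (lift_tangent phi nvl) = dder F (nv i y) (theta phi).
Proof.
move=> hF F0; rewrite lift_tangentE addrC differentialE dder_lin.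
by rewrite (dder_euler _ hF) -/(ev F _) F0 !mulr0 add0r.
Qed.

(** By Euler's relation the component along [y] does not affect the differentials of forms vanishing
    at [y]. A polynomial and its homogenization agree on the slice, hence along the line through
    [nv i y] with direction [theta i phi]. *)
Lemma tangent_tsp X (phi : tangentP y) : X y ->
  phi \in tangent X y <-> (theta phi <= tsp (aff i X) (nv i y))%MS.
Proof.
move=> Xy; have yv := hcoord_nv cy; rewrite mem_tangent; split=> [h|/tspP h d F hF FX v].
  apply/tspP => P P0; have [d [F hF FE]] := homogenize_deg i P.
  have FX z v : X z -> v \in line z -> ev F v = 0.
    move=> Xz vz; apply: (ev_line0 hF (hcoord_rep z)) vz.
    have [cz|/negbNE/eqP z0] := boolP (chart i z); last by rewrite /ev (FE _).2.
    by rewrite /ev (FE _).1 // -/(nv i z) P0 ?mulr0 //; apply: aff_nv.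
  have := h d F hF FX nvl; rewrite vsval_nvl (differential_lift _ hF); last first.
    exact: FX Xy yv.1.
  move=> <-; apply: dder_eq_line => s.
  have s1 : (nv i y + s *: theta phi) ord0 i = 1.
    by rewrite mxE nv1 // mxE theta_i mulr0 addr0.
  by rewrite (FE _).1 s1 ?oner_neq0 // expr1n mul1r invr1 scale1r.
have FA (z : 'rV[C]_N) : aff i X z -> mv z F = 0.
  by move=> [z' Xz [cz ->]]; apply: (FX z' _ Xz); have [] := hcoord_nv cz.
have [c ->] := subvs_nvl v.
rewrite /lift_tangent !linearZ /= vsval_nvl.
rewrite differentialE (dder_scale _ _ _ hF) -/(lift_tangent phi nvl).
rewrite -differentialE (differential_lift _ hF); last exact: FX Xy yv.1.
by rewrite h ?mulr0.
Qed.

Lemma tsp_i X (u : 'rV[C]_N) : (u <= tsp (aff i X) (nv i y))%MS -> u ord0 i = 0.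
Proof.
move=> /tspP/(_ ('X_i - 1)) h; rewrite -[LHS](_ : dder ('X_i - 1) (nv i y) u = _).
  by apply: h => _ [z Xz [cz ->]]; rewrite mevalB mevalXU meval1 nv1 // subrr.
by rewrite dderD dderX -mpolyC1 -mpolyCN dderC addr0.
Qed.

Lemma dim_tangent X : X y -> \dim (tangent X y) = \rank (tsp (aff i X) (nv i y)).
Proof.
move=> Xy; pose T : 'Hom(tangentP y, dV) := linfun theta.
have TE phi : T phi = theta phi by rewrite lfunE.
rewrite -(limg_dim_eq (f := T)); last first.
  apply/eqP; rewrite -subv0; apply/subvP => phi; rewrite memv_cap memv_ker TE.
  by move=> /andP[_ /eqP p0]; rewrite memv0; apply/eqP/theta_inj; rewrite p0 raddf0.
apply: dim_rowspace => u; split.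
  by move=> /memv_imgP[phi /(tangent_tsp _ Xy) h ->]; rewrite TE.
move=> uT; have [phi pE] := theta_surj (tsp_i uT).
by apply/memv_imgP; exists phi; rewrite ?TE //; apply/(tangent_tsp _ Xy); rewrite pE.
Qed.

End Tangent.
End Dimension.

(** * Germs along the diagonal *)

Section Bihomogeneous.
Variables (R : realType) (r : nat).
Notation C := R[i].
Notation N := r.+1.
Notation dV := (dualV R r).
Notation pnt := (pt R r).
Implicit Types (y z : pnt) (X W : set pnt) (i : 'I_N) (P Q : {mpoly C[N]}).
Implicit Types (F G : dV -> dV -> C).

Lemma bihomog_fin (I : finType) a b (A B : I -> {mpoly C[N]}) :
  (forall l, is_homog a (A l)) -> (forall l, is_homog b (B l)) ->
  bihomog a b (fun v w => \sum_l ev (A l) v * ev (B l) w).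
Proof.
move=> hA hB; exists #|I|, (fun l => A (enum_val l)), (fun l => B (enum_val l)).
by split=> // v w; rewrite -(big_enum_val (fun l => ev (A l) v * ev (B l) w)).
Qed.

Lemma bihomog1 a b A B : is_homog a A -> is_homog b B ->
  bihomog a b (fun v w : dV => ev A v * ev B w : C).
Proof.
move=> hA hB; exists 1%N, (fun=> A), (fun=> B).
by split=> // v w; rewrite big_ord_recl big_ord0 addr0.
Qed.

Lemma bihomogD a b F G : bihomog a b F -> bihomog a b G ->
  bihomog a b (fun v w => F v w + G v w).
Proof.
move=> [m [A [B [hA hB FE]]]] [m' [A' [B' [hA' hB' GE]]]].
pose AA (l : 'I_m + 'I_m') := match l with inl l => A l | inr l => A' l end.
pose BB (l : 'I_m + 'I_m') := match l with inl l => B l | inr l => B' l end.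
have [||n [A1 [B1 [h1 h2 E]]]] := @bihomog_fin _ a b AA BB; try by case.
by exists n, A1, B1; split=> // v w; rewrite FE GE -E big_sumType.
Qed.

Lemma bihomogM a b a' b' F G : bihomog a b F -> bihomog a' b' G ->
  bihomog (a + a') (b + b') (fun v w => F v w * G v w).
Proof.
move=> [m [A [B [hA hB FE]]]] [m' [A' [B' [hA' hB' GE]]]].
pose AA (l : 'I_m * 'I_m') := A l.1 * A' l.2.
pose BB (l : 'I_m * 'I_m') := B l.1 * B' l.2.
have [||n [A1 [B1 [h1 h2 E]]]] := @bihomog_fin _ (a + a') (b + b') AA BB.
- by move=> l; exact: (dhomogM (hA l.1) (hA' l.2)).
- by move=> l; exact: (dhomogM (hB l.1) (hB' l.2)).
exists n, A1, B1; split=> // v w; rewrite FE GE -E mulr_suml.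
rewrite -(pair_bigA _ (fun l l' => ev (AA (l, l')) v * ev (BB (l, l')) w)).
apply: eq_bigr => l _; rewrite mulr_sumr; apply: eq_bigr => l' _.
by rewrite /ev !mevalM mulrACA.
Qed.

Lemma bihomog_scale a b F (c d : C) (v w : 'rV[C]_N) : bihomog a b F ->
  F (c *: v) (d *: w) = c ^+ a * d ^+ b * F v w.
Proof.
move=> [m [A [B [hA hB FE]]]]; rewrite !FE mulr_sumr; apply: eq_bigr => l _.
by rewrite /ev (mv_scale _ _ (hA l)) (mv_scale _ _ (hB l)) mulrACA.
Qed.

Lemma bihomog_lines0 a b F y z (v w : 'rV[C]_N) : bihomog a b F ->
  hcoord y v -> hcoord z w -> F v w = 0 ->
  forall v' w', v' \in line y -> w' \in line z -> F v' w' = 0.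
Proof.
move=> hF yv zw F0 v' w' /(line_scale yv)[c ->] /(line_scale zw)[d ->].
by rewrite (bihomog_scale _ _ _ _ hF) F0 mulr0.
Qed.

Definition dom2 F : set (pnt * pnt) :=
  [set p | forall v w, hcoord p.1 v -> hcoord p.2 w -> F v w != 0].

Lemma zopen2_bihomog (O : set (pnt * pnt)) : zopen2 O -> forall p, O p ->
  exists a b F, [/\ bihomog a b F, dom2 F p & dom2 F `<=` O].
Proof.
move=> [S hS OE] p Op.
set Z := [set _ | _] in OE.
have : ~ Z p by rewrite -OE /=; apply.
move=> /existsNP[F] /not_implyP[SF] /existsNP[v] /existsNP[w] /not_implyP[vp] /not_implyP[wp Fvw].
have [a [b hF]] := hS F SF; exists a, b, F; split=> // [v' w' pv pw|q Fq].
  by apply/eqP => F0; apply: Fvw; apply: (bihomog_lines0 hF pv pw F0).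
apply: contrapT => nO; have : Z q by rewrite -OE.
move=> /(_ F SF _ _ (hcoord_rep q.1).1 (hcoord_rep q.2).1) /eqP.
by rewrite (negPf (Fq _ _ (hcoord_rep _) (hcoord_rep _))).
Qed.

Lemma zopen2_local (O : set (pnt * pnt)) :
  (forall p, O p -> exists a b F, [/\ bihomog a b F, dom2 F p & dom2 F `<=` O]) -> zopen2 O.
Proof.
move=> loc.
exists [set F | (exists a b, bihomog a b F) /\ dom2 F `<=` O]; first by move=> F [hF _].
apply/seteqP; split=> [p nO F [[a [b hF]] FO] v w vp wp|p h Op].
  have pv := hcoord_rep p.1; have pw := hcoord_rep p.2.
  apply: (bihomog_lines0 hF pv pw) vp wp.
  apply: contrapT => /eqP F0; apply/nO/FO => v' w' pv' pw'.
  by apply/eqP => F0'; case/eqP: F0; apply: (bihomog_lines0 hF pv' pw' F0' pv.1 pw.1).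
have [a [b [F [hF Fp FO]]]] := loc p Op.
have /eqP := Fp _ _ (hcoord_rep p.1) (hcoord_rep p.2); apply.
by apply: h (hcoord_rep p.1).1 (hcoord_rep p.2).1; split=> //; exists a, b.
Qed.

Lemma dom2M F G p : dom2 (fun v w => F v w * G v w) p <-> dom2 F p /\ dom2 G p.
Proof.
split=> [h|[hF hG] v w pv pw]; last by rewrite mulf_neq0 ?hF ?hG.
by split=> v w pv pw; have := h v w pv pw; rewrite mulf_eq0 negb_or => /andP[].
Qed.

Lemma zopen2I (O O' : set (pnt * pnt)) : zopen2 O -> zopen2 O' -> zopen2 (O `&` O').
Proof.
move=> oO oO'; apply: zopen2_local => p [Op O'p].
have [a [b [F [hF Fp FO]]]] := zopen2_bihomog oO Op.
have [a' [b' [G [hG Gp GO]]]] := zopen2_bihomog oO' O'p.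
exists (a + a')%N, (b + b')%N, (fun v w => F v w * G v w); split.
- exact: bihomogM.
- exact/dom2M.
- by move=> q /dom2M[/FO Oq /GO O'q].
Qed.

Lemma is_homog1 : is_homog 0 (1 : {mpoly C[N]}).
Proof. exact: dhomog1. Qed.

Lemma ev1 (v : 'rV[C]_N) : ev 1 v = 1.
Proof. exact: meval1. Qed.

Lemma zopen2_fst (O : set pnt) : zopen O -> zopen2 [set p | O p.1].
Proof.
move=> oO; apply: zopen2_local => p Op; have [d [F [hF Fp FO]]] := zopen_homog oO Op.
exists d, 0%N, (fun v w => ev F v * ev 1 w); split.
- exact: (bihomog1 hF is_homog1).
- by move=> v w pv pw; rewrite ev1 mulr1; apply: Fp.
- move=> q h; apply: (FO _ _ (hcoord_rep q.1)).
  by have := h _ _ (hcoord_rep q.1) (hcoord_rep q.2); rewrite ev1 mulr1.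
Qed.

Lemma zopen2_snd (O : set pnt) : zopen O -> zopen2 [set p | O p.2].
Proof.
move=> oO; apply: zopen2_local => p Op; have [d [F [hF Fp FO]]] := zopen_homog oO Op.
exists 0%N, d, (fun v w => ev 1 v * ev F w); split.
- exact: (bihomog1 is_homog1 hF).
- by move=> v w pv pw; rewrite ev1 mul1r; apply: Fp.
- move=> q h; apply: (FO _ _ (hcoord_rep q.2)).
  by have := h _ _ (hcoord_rep q.1) (hcoord_rep q.2); rewrite ev1 mul1r.
Qed.

Lemma zopen2_slice (O : set (pnt * pnt)) y : zopen2 O -> zopen [set z | O (y, z)].
Proof.
move=> oO; apply: zopen_local => z Oz; have [a [b [F [hF Fp FO]]]] := zopen2_bihomog oO Oz.
have [m [A [B [hA hB FE]]]] := hF; have yv := hcoord_rep y.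
pose H := \sum_l ev (A l) (rep y) *: B l.
have hH : is_homog b H by apply: rpred_sum => l _; apply: rpredZ; apply: hB.
have HE w : ev H w = F (rep y) w.
  by rewrite FE /ev raddf_sum; apply: eq_bigr => l _ /=; rewrite mevalZ.
exists [set z | forall w, hcoord z w -> ev H w != 0]; split.
- exact: homog_zopen hH.
- by move=> w zw; rewrite HE; apply: Fp.
- move=> z' Hz'; apply: FO => v w yv' zw; apply/eqP => F0.
  have /eqP := Hz' w zw; apply; rewrite HE.
  exact: (bihomog_lines0 hF yv' zw F0 yv.1 zw.1).
Qed.

Lemma zopen2_diag (O : set (pnt * pnt)) : zopen2 O -> zopen [set y | O (y, y)].
Proof.
move=> oO; apply: zopen_local => y Oy; have [a [b [F [hF Fp FO]]]] := zopen2_bihomog oO Oy.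
have [m [A [B [hA hB FE]]]] := hF; have yv := hcoord_rep y.
pose H := \sum_l A l * B l.
have hH : is_homog (a + b) H by apply: rpred_sum => l _; apply: dhomogM; [apply: hA | apply: hB].
have HE w : ev H w = F w w.
  by rewrite FE /ev raddf_sum; apply: eq_bigr => l _ /=; rewrite mevalM.
exists [set z | forall w, hcoord z w -> ev H w != 0]; split.
- exact: homog_zopen hH.
- by move=> w zw; rewrite HE; apply: Fp.
- move=> z' Hz'; apply: FO => v w yv' zw; apply/eqP => F0.
  have /eqP := Hz' w zw; apply; rewrite HE.
  exact: (bihomog_lines0 hF yv' zw F0 zw.1 zw.1).
Qed.

End Bihomogeneous.

(** * Germs of regular functions on X and on X x X *)

Section Germs.
Variables (R : realType) (r : nat) (X : set (pt R r)).
Notation C := R[i].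
Notation N := r.+1.
Notation pnt := (pt R r).
Implicit Types (x y z : pnt) (i : 'I_N) (P Q : {mpoly C[N]}).

Definition near1 x (S : pnt -> Prop) := exists2 W, nbhd_in X x W & forall y, W y -> S y.
Definition near2 x (S : pnt -> pnt -> Prop) :=
  exists2 W, nbhd_in_square X x W & forall y z, W (y, z) -> S y z.

Lemma near1W x (S S' : pnt -> Prop) : (forall y, X y -> S y -> S' y) -> near1 x S -> near1 x S'.
Proof.
move=> h [W nW WS]; exists W => // y Wy; apply: h; last exact: WS.
exact: (open_in_sub nW.1).
Qed.

Lemma near1I x (S S' : pnt -> Prop) : near1 x S -> near1 x S' -> near1 x (fun y => S y /\ S' y).
Proof.
move=> [W nW WS] [W' nW' WS']; exists (W `&` W'); first exact: nbhd_inI.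
by move=> y [Wy W'y]; split; [apply: WS | apply: WS'].
Qed.

Lemma near1_self x S : near1 x S -> S x.
Proof. by move=> [W [_ Wx] WS]; apply: WS. Qed.

Lemma near1_princ x i Q : X x -> princ i Q x -> near1 x (princ i Q).
Proof. by move=> Xx Qx; exists (X `&` princ i Q); [exact: princ_nbhd | move=> y []]. Qed.

Lemma near1_near x S : near1 x S -> near1 x (fun y => near1 y S).
Proof. by move=> [W nW WS]; exists W => // y Wy; exists W => //; split => //; case: nW. Qed.

Lemma near1_fin x (I : finType) (S : I -> pnt -> Prop) : X x ->
  (forall l, near1 x (S l)) -> near1 x (fun y => forall l, S l y).
Proof.
move=> Xx h; suff : near1 x (fun y => forall l, l \in enum I -> S l y).
  by apply: near1W => y _ H l; apply: H; rewrite mem_enum.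
elim: (enum I) => [|l s IH].
  by exists X => //; split => //; apply: open_inT.
have := near1I (h l) IH; apply: near1W => y _ [Sl Hs] l'.
by rewrite inE => /orP[/eqP ->|/Hs].
Qed.

Lemma near2W x (S S' : pnt -> pnt -> Prop) :
  (forall y z, X y -> X z -> S y z -> S' y z) -> near2 x S -> near2 x S'.
Proof.
move=> h [W nW WS]; exists W => // y z Wy; have [[O _ WE] _] := nW.
have [] : (X `*` X) (y, z) by move: Wy; rewrite WE => -[].
by move=> Xy Xz; apply: h => //; apply: WS.
Qed.

Lemma nbhd2I x (W W' : set (pnt * pnt)) : nbhd_in_square X x W ->
  nbhd_in_square X x W' -> nbhd_in_square X x (W `&` W').
Proof.
move=> [[O oO ->] [XO Ox]] [[O' oO' ->] [_ O'x]]; split; last by split.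
exists (O `&` O'); first exact: zopen2I.
by apply/seteqP; split=> [p [[Xp Op] [_ O'p]]|p [Xp [Op O'p]]].
Qed.

Lemma near2I x (S S' : pnt -> pnt -> Prop) : near2 x S -> near2 x S' ->
  near2 x (fun y z => S y z /\ S' y z).
Proof.
move=> [W nW WS] [W' nW' WS']; exists (W `&` W'); first exact: nbhd2I.
by move=> y z [Wy W'y]; split; [apply: WS | apply: WS'].
Qed.

Lemma near2_fst x S : near1 x S -> near2 x (fun y z => S y).
Proof.
move=> [W [[O oO WE] Wx] WS]; move: Wx; rewrite WE => -[Xx Ox].
exists ((X `*` X) `&` [set p | O p.1]).
  by split; last by []; exists [set p | O p.1] => //; apply: zopen2_fst.
by move=> y z [[Xy _] Oy]; apply: WS; rewrite WE.
Qed.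

Lemma near2_snd x S : near1 x S -> near2 x (fun y z => S z).
Proof.
move=> [W [[O oO WE] Wx] WS]; move: Wx; rewrite WE => -[Xx Ox].
exists ((X `*` X) `&` [set p | O p.2]).
  by split; last by []; exists [set p | O p.2] => //; apply: zopen2_snd.
by move=> y z [[_ Xz] Oz]; apply: WS; rewrite WE.
Qed.

Lemma near2_diag x S : near2 x S -> near1 x (fun y => S y y).
Proof.
move=> [W [[O oO WE] Wx] WS]; move: Wx; rewrite WE => -[[Xx _] Ox].
exists (X `&` [set y | O (y, y)]).
  by split; last by []; exists [set y | O (y, y)] => //; apply: zopen2_diag.
by move=> y [Xy Oy]; apply: WS; rewrite WE.
Qed.

Lemma near2_slice x S : near2 x S -> near1 x (S x).
Proof.
move=> [W [[O oO WE] Wx] WS]; move: Wx; rewrite WE => -[[Xx _] Ox].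
exists (X `&` [set z | O (x, z)]).
  by split; last by []; exists [set z | O (x, z)] => //; apply: zopen2_slice.
by move=> z [Xz Oz]; apply: WS; rewrite WE.
Qed.

Lemma near2_near x S : near2 x S -> near1 x (fun y => near2 y S).
Proof.
move=> [W nW WS]; have [W1 nW1 h] := near2_diag (ex_intro2 _ _ W nW (fun y z (h : W (y, z)) => h)).
by exists W1 => // y W1y; exists W => //; split; [case: nW | apply: h].
Qed.

Lemma near2T x S : X x -> (forall y z, X y -> X z -> S y z) -> near2 x S.
Proof.
move=> Xx h; have nX : near1 x X by exists X => //; split; [exact: open_inT|].
by have := near2_fst nX; apply: near2W => y z Xy Xz _; apply: h.
Qed.

Lemma near2_fin x (I : finType) (S : I -> pnt -> pnt -> Prop) : X x ->
  (forall l, near2 x (S l)) -> near2 x (fun y z => forall l, S l y z).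
Proof.
move=> Xx h; suff : near2 x (fun y z => forall l, l \in enum I -> S l y z).
  by apply: near2W => y z _ _ H l; apply: H; rewrite mem_enum.
elim: (enum I) => [|l s IH]; first exact: near2T.
have := near2I (h l) IH; apply: near2W => y z _ _ [Sl Hs] l'.
by rewrite inE => /orP[/eqP ->|/Hs].
Qed.

(* Germs at (x, x) of regular functions on X x X. *)
Definition O2 x (a : pnt -> pnt -> C) := exists d e F G,
  [/\ bihomog d e F, bihomog d e G & near2 x (fun y z => forall v w,
        hcoord y v -> hcoord z w -> G v w != 0 /\ a y z = F v w / G v w)].

Lemma regular2_O2 x W a : nbhd_in_square X x W -> regular2 W a -> O2 x a.
Proof.
move=> nW /(_ (x, x) nW.2)[O [d [e [F [G [oO Ox hF hG FG]]]]]].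
exists d, e, F, G; split=> //; exists (W `&` ((X `*` X) `&` O)).
  apply: nbhd2I => //; split; first by exists O.
  by split=> //; case: nW => -[O' _ ->] [].
by move=> y z [Wyz [_ Oyz]] v w yv zw; apply: (FG y z v w Wyz Oyz).
Qed.

Lemma O2_regular2 x a : O2 x a -> exists2 W, nbhd_in_square X x W & regular2 W a.
Proof.
move=> [d [e [F [G [hF hG [W nW WS]]]]]]; exists W => // p Wp.
have [[O oO WE] _] := nW; exists O, d, e, F, G; split=> //; first by move: Wp; rewrite WE => -[].
by move=> y z v w Wyz _ yv zw; apply: (WS y z Wyz v w yv zw).
Qed.

Lemma regular2_sub W W' (a : pnt -> pnt -> C) : regular2 W a -> W' `<=` W -> regular2 W' a.
Proof.
move=> aW W'W p /W'W /aW[O [d [e [F [G [oO Op hF hG h]]]]]].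
by exists O, d, e, F, G; split=> // y z v w /W'W Wyz; apply: h.
Qed.

Lemma O2_eq x a b : near2 x (fun y z => a y z = b y z) -> O2 x a -> O2 x b.
Proof.
move=> ab [d [e [F [G [hF hG h]]]]]; exists d, e, F, G; split=> //.
by have := near2I ab h; apply: near2W => y z _ _ [<-].
Qed.

Lemma O2_near x a : O2 x a -> near1 x (fun y => O2 y a).
Proof.
move=> [d [e [F [G [hF hG h]]]]]; have := near2_near h; apply: near1W => y _ h'.
by exists d, e, F, G.
Qed.

Lemma O2D x a b : O2 x a -> O2 x b -> O2 x (fun y z => a y z + b y z).
Proof.
move=> [d [e [F [G [hF hG h]]]]] [d' [e' [F' [G' [hF' hG' h']]]]].
exists (d + d')%N, (e + e')%N, (fun v w => F v w * G' v w + F' v w * G v w), (fun v w => G v w * G' v w).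
split; [apply: bihomogD; first exact: bihomogM | exact: bihomogM |].
  by rewrite addnC [(e + _)%N]addnC; apply: bihomogM.
have := near2I h h'; apply: near2W => y z _ _ [FG FG'] v w yv zw.
have [G0 ->] := FG v w yv zw; have [G0' ->] := FG' v w yv zw.
by rewrite mulf_neq0 // (addf_div _ _ G0 G0').
Qed.

Lemma O2M x a b : O2 x a -> O2 x b -> O2 x (fun y z => a y z * b y z).
Proof.
move=> [d [e [F [G [hF hG h]]]]] [d' [e' [F' [G' [hF' hG' h']]]]].
exists (d + d')%N, (e + e')%N, (fun v w => F v w * F' v w), (fun v w => G v w * G' v w).
split; [exact: bihomogM | exact: bihomogM |].
have := near2I h h'; apply: near2W => y z _ _ [FG FG'] v w yv zw.
have [G0 ->] := FG v w yv zw; have [G0' ->] := FG' v w yv zw.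
by rewrite mulf_neq0 // mulf_div.
Qed.

Lemma O2_fst x g : regular_at X x g -> O2 x (fun y z => g y).
Proof.
move=> [W nW /(_ x nW.2)[O [F [G [oO Ox [[d [hF hG]] FG]]]]]].
exists d, 0%N, (fun v w => ev F v * ev 1 w), (fun v w => ev G v * ev 1 w); split.
- exact: (bihomog1 hF (is_homog1 _ _)).
- exact: (bihomog1 hG (is_homog1 _ _)).
have : near1 x (W `&` O).
  exists (W `&` (X `&` O)); last by move=> y [Wy []].
  apply: nbhd_inI => //; split; first by exists O.
  by split=> //; apply: (open_in_sub nW.1 nW.2).
move/near2_fst; apply: near2W => y z _ _ WOy v w yv _.
by rewrite ev1 !mulr1; apply: FG.
Qed.

Lemma O2_snd x g : regular_at X x g -> O2 x (fun y z => g z).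
Proof.
move=> [W nW /(_ x nW.2)[O [F [G [oO Ox [[d [hF hG]] FG]]]]]].
exists 0%N, d, (fun v w => ev 1 v * ev F w), (fun v w => ev 1 v * ev G w); split.
- exact: (bihomog1 (is_homog1 _ _) hF).
- exact: (bihomog1 (is_homog1 _ _) hG).
have : near1 x (W `&` O).
  exists (W `&` (X `&` O)); last by move=> y [Wy []].
  apply: nbhd_inI => //; split; first by exists O.
  by split=> //; apply: (open_in_sub nW.1 nW.2).
move/near2_snd; apply: near2W => y z _ _ WOz v w _ zw.
by rewrite ev1 !mul1r; apply: FG.
Qed.

Lemma regular_germC x c : X x -> regular_at X x (fun=> c).
Proof.
move=> Xx; exists X; last exact: regularC.
by split=> //; apply: open_inT.
Qed.

Lemma O2C x c : X x -> O2 x (fun y z => c).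
Proof. by move=> Xx; apply: (O2_fst (regular_germC c Xx)). Qed.

Lemma O2_prod x (I : Type) (s : seq I) (a : I -> pnt -> pnt -> C) : X x ->
  (forall l, O2 x (a l)) -> O2 x (fun y z => \prod_(l <- s) a l y z).
Proof.
move=> Xx h; elim: s => [|l s IH].
  by apply: O2_eq (O2C 1 Xx); apply: near2T => // y z _ _; rewrite big_nil.
apply: O2_eq (O2M (h l) IH); apply: near2T => // y z _ _; rewrite big_cons //.
Qed.

Lemma regular_eq x g h : near1 x (fun y => g y = h y) -> regular_at X x g -> regular_at X x h.
Proof.
move=> [W nW gh] [W' nW' gW']; exists (W `&` W'); first exact: nbhd_inI.
move=> y [Wy W'y]; have [O [F [G [oO Oy [dFG FG]]]]] := gW' y W'y.
exists O, F, G; split=> //; split=> // z v [[Wz W'z] Oz] zv.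
by rewrite -gh //; apply: FG.
Qed.

Lemma regular_germD x g h : regular_at X x g -> regular_at X x h ->
  regular_at X x (fun y => g y + h y).
Proof.
move=> [W nW gW] [W' nW' hW']; exists (W `&` W'); first exact: nbhd_inI.
apply: regularD; [apply: regular_sub gW _ | apply: regular_sub hW' _]; by move=> y [].
Qed.

Lemma regular_germM x g h : regular_at X x g -> regular_at X x h ->
  regular_at X x (fun y => g y * h y).
Proof.
move=> [W nW gW] [W' nW' hW']; exists (W `&` W'); first exact: nbhd_inI.
apply: regularM; [apply: regular_sub gW _ | apply: regular_sub hW' _]; by move=> y [].
Qed.

Lemma regular_germ_sum x (I : Type) (s : seq I) (g : I -> pnt -> C) : X x ->
  (forall l, regular_at X x (g l)) -> regular_at X x (fun y => \sum_(l <- s) g l y).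
Proof.
move=> Xx h; elim: s => [|l s IH].
  by under eq_fun => y do rewrite big_nil; apply: regular_germC.
by under eq_fun => y do rewrite big_cons; apply: regular_germD.
Qed.

Lemma regular_frac x i P Q : X x -> princ i Q x ->
  regular_at X x (fun y => mv (nv i y) P / mv (nv i y) Q).
Proof.
move=> Xx Qx; exists (X `&` princ i Q); first exact: princ_nbhd.
by apply: (regular_princ (i := i)) => y [Xy Qy]; exists P, Q.
Qed.

Lemma regular_poly x i P : X x -> chart i x -> regular_at X x (fun y => mv (nv i y) P).
Proof.
move=> Xx cx; apply: regular_eq (regular_frac P Xx (princ1 cx)).
by exists X => [|y Xy]; rewrite ?meval1 ?divr1 //; split=> //; apply: open_inT.
Qed.

Lemma O2_diag x a : O2 x a -> regular_at X x (fun y => a y y).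
Proof.
move=> [d [e [F [G [hF hG h]]]]]; have [W nW WFG] := near2_diag h.
have [m [A [B [hA hB FE]]]] := hF; have [m' [A' [B' [hA' hB' GE]]]] := hG.
exists W => // y Wy; exists setT, (\sum_l A l * B l), (\sum_l A' l * B' l).
split=> //; first exact: zopenT.
split; first by exists (d + e)%N; apply: rpred_sum => l _;
  [exact: (dhomogM (hA l) (hB l)) | exact: (dhomogM (hA' l) (hB' l))].
move=> z v [Wz _] zv; have [G0 E] := WFG z Wz v v zv zv.
have <- : F v v = ev (\sum_l A l * B l) v.
  by rewrite FE /ev raddf_sum; apply: eq_bigr => l _ /=; rewrite mevalM.
have <- // : G v v = ev (\sum_l A' l * B' l) v.
by rewrite GE /ev raddf_sum; apply: eq_bigr => l _ /=; rewrite mevalM.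
Qed.

Lemma O2_slice x a : O2 x a -> regular_at X x (a x).
Proof.
move=> [d [e [F [G [hF hG h]]]]]; have [W nW WFG] := near2_slice h.
have [m [A [B [hA hB FE]]]] := hF; have [m' [A' [B' [hA' hB' GE]]]] := hG.
exists W => // y Wy.
exists setT, (\sum_l ev (A l) (rep x) *: B l), (\sum_l ev (A' l) (rep x) *: B' l).
split=> //; first exact: zopenT.
split; first by exists e; apply: rpred_sum => l _; apply: rpredZ; [apply: hB | apply: hB'].
move=> z v [Wz _] zv; have [G0 E] := WFG z Wz _ v (hcoord_rep x) zv.
have <- : F (rep x) v = ev (\sum_l ev (A l) (rep x) *: B l) v.
  by rewrite FE /ev raddf_sum; apply: eq_bigr => l _ /=; rewrite mevalZ.
have <- // : G (rep x) v = ev (\sum_l ev (A' l) (rep x) *: B' l) v.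
by rewrite GE /ev raddf_sum; apply: eq_bigr => l _ /=; rewrite mevalZ.
Qed.

End Germs.

(** * Powers of the ideal of the diagonal *)

Section DiagonalPowers.
Variables (R : realType) (r : nat) (X : set (pt R r)).
Notation C := R[i].
Notation N := r.+1.
Notation pnt := (pt R r).
Notation germ := (pnt -> pnt -> C).
Implicit Types (x y z : pnt) (s a b : germ).

Definition Idiag x a := O2 X x a /\ near1 X x (fun y => a y y = 0).

(* The powers of the ideal of the diagonal in the local ring at (x, x). *)
Definition Ipow m x s := exists n (a : 'I_n -> 'I_m -> germ) (b : 'I_n -> germ),
  [/\ forall l j, Idiag x (a l j), forall l, O2 X x (b l)
    & near2 X x (fun y z => s y z = \sum_l (\prod_j a l j y z) * b l y z)].

Section AtPoint.
Variable x : pnt.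
Hypothesis Xx : X x.

Lemma Ipow_eq m s s' : near2 X x (fun y z => s y z = s' y z) -> Ipow m x s -> Ipow m x s'.
Proof.
move=> ss' [n [a [b [ha hb h]]]]; exists n, a, b; split=> //.
by have := near2I ss' h; apply: near2W => y z _ _ [<-].
Qed.

Lemma Ipow_ext m s s' : (forall y z, s y z = s' y z) -> Ipow m x s -> Ipow m x s'.
Proof. by move=> h; apply: Ipow_eq; apply: near2T. Qed.

Lemma Ipow_0 m : Ipow m x (fun _ _ => 0).
Proof.
exists 0%N, (fun _ _ _ _ => 0), (fun _ _ _ => 0); split; try by case.
by apply: near2T => // y z _ _; rewrite big_ord0.
Qed.

Lemma IpowD m s s' : Ipow m x s -> Ipow m x s' -> Ipow m x (fun y z => s y z + s' y z).
Proof.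
move=> [n [a [b [ha hb h]]]] [n' [a' [b' [ha' hb' h']]]].
exists (n + n')%N, (fun l => match split l with inl l => a l | inr l => a' l end),
  (fun l => match split l with inl l => b l | inr l => b' l end); split.
- by move=> l j; case: (split l).
- by move=> l; case: (split l).
have := near2I h h'; apply: near2W => y z _ _ [-> ->]; rewrite big_split_ord /=.
by congr (_ + _); apply: eq_bigr => l _; rewrite ?(unsplitK (inl l)) ?(unsplitK (inr l)).
Qed.

Lemma Ipow_prod m (a : 'I_m -> germ) b : (forall j, Idiag x (a j)) -> O2 X x b ->
  Ipow m x (fun y z => (\prod_j a j y z) * b y z).
Proof.
move=> ha hb; exists 1%N, (fun=> a), (fun=> b); split=> //.
by apply: near2T => // y z _ _; rewrite big_ord_recl big_ord0 addr0.
Qed.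

Lemma Ipow_ind m (S : germ -> Prop) :
  (forall s s', near2 X x (fun y z => s y z = s' y z) -> S s -> S s') ->
  S (fun _ _ => 0) -> (forall s s', S s -> S s' -> S (fun y z => s y z + s' y z)) ->
  (forall (a : 'I_m -> germ) b, (forall j, Idiag x (a j)) -> O2 X x b ->
     S (fun y z => (\prod_j a j y z) * b y z)) ->
  forall s, Ipow m x s -> S s.
Proof.
move=> Seq S0 SD Sp s [n [a [b [ha hb h]]]].
apply: (Seq (fun y z => \sum_l (\prod_j a l j y z) * b l y z)).
  by apply: near2W h => y z _ _ ->.
elim: n a b ha hb {h} => [|n IH] a b ha hb.
  by apply: Seq S0; apply: near2T => // y z _ _; rewrite big_ord0.
apply: Seq (SD _ _ (Sp _ _ (ha ord0) (hb ord0))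
  (IH (fun l => a (lift ord0 l)) (fun l => b (lift ord0 l)) _ _)) => //.
by apply: near2T => // y z _ _; rewrite big_ord_recl.
Qed.

Lemma Ipow_sum m (I : Type) (t : seq I) (s : I -> germ) :
  (forall l, Ipow m x (s l)) -> Ipow m x (fun y z => \sum_(l <- t) s l y z).
Proof.
move=> h; elim: t => [|l t IH].
  by apply: Ipow_ext (Ipow_0 m) => y z; rewrite big_nil.
by apply: Ipow_ext (IpowD (h l) IH) => y z; rewrite big_cons.
Qed.

Lemma IpowM m a s : O2 X x a -> Ipow m x s -> Ipow m x (fun y z => a y z * s y z).
Proof.
move=> ha; move: s; apply: Ipow_ind => [s s' ss'|||b c hb hc].
- by apply: Ipow_eq; apply: near2W ss' => y z _ _ ->.
- by apply: Ipow_ext (Ipow_0 m) => y z; rewrite mulr0.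
- by move=> s s' hs hs'; apply: Ipow_ext (IpowD hs hs') => y z; rewrite mulrDr.
- by apply: Ipow_ext (Ipow_prod hb (O2M ha hc)) => y z; rewrite mulrCA.
Qed.

Lemma IpowN m s : Ipow m x s -> Ipow m x (fun y z => - s y z).
Proof. by move=> h; apply: Ipow_ext (IpowM (O2C (-1) Xx) h) => y z; rewrite mulN1r. Qed.

Lemma IpowB m s s' : Ipow m x s -> Ipow m x s' -> Ipow m x (fun y z => s y z - s' y z).
Proof. by move=> h h'; apply: IpowD h (IpowN h'). Qed.

Lemma IpowI m a s : Idiag x a -> Ipow m x s -> Ipow m.+1 x (fun y z => a y z * s y z).
Proof.
move=> ha; move: s; apply: Ipow_ind => [s s' ss'|||b c hb hc].
- by apply: Ipow_eq; apply: near2W ss' => y z _ _ ->.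
- by apply: Ipow_ext (Ipow_0 m.+1) => y z; rewrite mulr0.
- by move=> s s' hs hs'; apply: Ipow_ext (IpowD hs hs') => y z; rewrite mulrDr.
have hab (j : 'I_m.+1) : Idiag x (if unlift ord0 j is Some j' then b j' else a).
  by case: (unlift ord0 j).
apply: Ipow_ext (Ipow_prod hab hc) => y z.
rewrite big_ord_recl unlift_none mulrA; congr (_ * _ * _).
by apply: eq_bigr => j _; rewrite liftK.
Qed.

Lemma Ipow_O2 s : O2 X x s -> Ipow 0 x s.
Proof.
move=> hs; have hn (j : 'I_0) : Idiag x (fun _ _ => 0) by case: j.
by apply: Ipow_ext (Ipow_prod hn hs) => y z; rewrite big_ord0 mul1r.
Qed.

Lemma Ipow1 a : Idiag x a -> Ipow 1 x a.
Proof.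
by move=> ha; apply: Ipow_ext (IpowI ha (Ipow_O2 (O2C 1 Xx))) => y z; rewrite mulr1.
Qed.

Lemma Ipow_prodM m n (a : 'I_m -> germ) s : (forall j, Idiag x (a j)) -> Ipow n x s ->
  Ipow (m + n) x (fun y z => (\prod_j a j y z) * s y z).
Proof.
elim: m a => [|m IH] a ha hs.
  by apply: Ipow_ext hs => y z; rewrite big_ord0 mul1r.
have := IpowI (ha ord0) (IH (fun j => a (lift ord0 j)) (fun j => ha _) hs).
by apply: Ipow_ext => y z; rewrite big_ord_recl mulrA.
Qed.

End AtPoint.

Lemma Ipow_near m x s : X x -> Ipow m x s -> near1 X x (fun y => Ipow m y s).
Proof.
move=> Xx [n [a [b [ha hb h]]]].
have h1 : near1 X x (fun y => forall lj : 'I_n * 'I_m, Idiag y (a lj.1 lj.2)).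
  apply: near1_fin => // lj; have [h1 h2] := ha lj.1 lj.2.
  by have := near1I (O2_near h1) (near1_near h2); apply: near1W.
have h2 := near1_fin Xx (fun l => O2_near (hb l)).
have := near1I (near1I h1 h2) (near2_near h); apply: near1W => y _ [[h1' h2'] h3].
by exists n, a, b; split=> // l j; apply: (h1' (l, j)).
Qed.

End DiagonalPowers.

(** * Taylor expansion at nonsingular points *)

Section Remainder.
Variables (F : numFieldType) (n : nat).
Implicit Types (P : {mpoly F[n]}) (v w : 'rV[F]_n).

Definition incrv P v w := mv w P - mv v P.
Definition remv P v w := incrv P v w - dder P v (w - v).

Lemma remvC c v w : remv c%:MP v w = 0.
Proof. by rewrite /remv /incrv dderC !mevalC !subrr. Qed.

Lemma remvX j v w : remv 'X_j v w = 0.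
Proof. by rewrite /remv /incrv dderX !mevalXU !mxE subrr. Qed.

Lemma remvD p q v w : remv p v w + remv q v w = remv (p + q) v w.
Proof. by rewrite /remv /incrv dderD !mevalD; ring. Qed.

Lemma remvM p q v w : mv v q * remv p v w + mv v p * remv q v w
  + incrv p v w * incrv q v w = remv (p * q) v w.
Proof. by rewrite /remv /incrv dderM !mevalM; ring. Qed.

Lemma dder_coord (psi : 'I_n -> {mpoly F[n]}) P v (u : 'rV[F]_n) :
  mv v (\det (jac psi)) * dder P v u =
  \sum_l mv v (cder psi l P) * dder (psi l) v u.
Proof.
rewrite /dder mulr_sumr.
transitivity (\sum_j \sum_l mv v (\det (jac psi) *+ (j == l)) * mv v P^`M(j) * u ord0 l).
  apply: eq_bigr => j _; rewrite (bigD1 j) //= eqxx mulr1n big1 ?addr0 ?mulrA // => l.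
  by rewrite eq_sym => /negPf ->; rewrite mulr0n meval0 !mul0r.
under eq_bigr => j _ do under eq_bigr => l _ do
  rewrite -cder_dual raddf_sum !mulr_suml.
rewrite exchange_big /=.
under eq_bigr => l _ do rewrite exchange_big /=.
rewrite exchange_big; apply: eq_bigr => m _ /=.
rewrite mulr_sumr; apply: eq_bigr => l _.
rewrite /cder raddf_sum mulr_suml; apply: eq_bigr => j _ /=.
by rewrite !mevalM; ring.
Qed.

Lemma prod_mnmD1 e (f : 'I_e -> F) (m : 'X_{1..e}) l :
  (\prod_j f j ^+ m j) * f l = \prod_j f j ^+ (m + U_(l))%MM j.
Proof.
under [RHS]eq_bigr => j _ do rewrite mnmDE mnm1E exprD.
rewrite big_split /=; congr (_ * _); rewrite (bigD1 l) //= eqxx expr1 big1 ?mulr1 //.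
by move=> j /negPf jl; rewrite eq_sym jl expr0.
Qed.

Lemma mul_divK (q u d : F) : q != 0 -> q * (u / q * d) = u * d.
Proof. by move=> q0; field. Qed.

Lemma prod_frac_clear k (p q : 'I_k -> F) (u v H E G : F) :
  (\prod_j q j) * v != 0 ->
  H * ((\prod_j q j) * v * E) * G * ((\prod_j (p j / q j)) * (u / v))
  = (\prod_j p j) * (u * H * G * E).
Proof.
rewrite prodf_div; move: (\prod_j p j) (\prod_j q j) => P Q.
by rewrite mulf_eq0 negb_or => /andP[Q0 v0]; field; apply/andP.
Qed.

(** The product of the [D l] occurs twice so that both sides vanish where some [D l] does; the
    factor [H] plays this part outside the set where the formula for [t] is known. The identity
    therefore holds without any condition on the point. *)
Lemma cleared_sum n' k (H t : F) (D u v b : 'I_n' -> F) (p q a : 'I_n' -> 'I_k -> F) :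
  (forall l, D l = (\prod_j q l j) * v l) ->
  (forall l, D l != 0 -> (forall j, a l j = p l j / q l j) /\ b l = u l / v l) ->
  (H != 0 -> t = \sum_l (\prod_j a l j) * b l) ->
  H * (\prod_l D l) * (\prod_l D l) * t
  = \sum_l (\prod_j p l j) * (u l * H * (\prod_l' D l') * \prod_(l' | l' != l) D l').
Proof.
move=> DE abE tE; have [->|H0] := eqVneq H 0.
  by rewrite !mul0r big1 // => l _; rewrite mulr0 !mul0r mulr0.
rewrite (tE H0) mulr_sumr; apply: eq_bigr => l _.
have DaE : \prod_l' D l' = D l * \prod_(l' | l' != l) D l' by rewrite (bigD1 l).
have [Dz|Dz] := eqVneq (D l) 0.
  by rewrite DaE Dz !(mul0r, mulr0).
have [aE ->] := abE l Dz; rewrite (eq_bigr _ (fun j _ => aE j)).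
rewrite {1}DaE DE prod_frac_clear -?DE //.
Qed.

End Remainder.

(** * Existence and uniqueness of Taylor expansions *)

Section Taylor.
Variables (R : realType) (r : nat) (X : set (pt R r)) (i : 'I_r.+1).
Notation C := R[i].
Notation N := r.+1.
Notation pnt := (pt R r).
Notation germ := (pnt -> pnt -> C).
Variables (L : fieldType) (iota : {rmorphism C -> L}) (eta : 'rV[L]_N).
Hypothesis gen : generic (aff i X) iota eta.
Notation e := (\rank (gtsp (aff i X) iota eta)).
Variables (a0 : 'rV[C]_N) (psi : 'I_N -> {mpoly C[N]}).
Hypotheses (Aa : aff i X a0) (ca : coord_at (aff i X) iota eta a0 psi).
Implicit Types (x y z : pnt) (s a b : germ) (P Q : {mpoly C[N]}).

Local Notation Q0 := (\det (jac psi)).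

Lemma O2_poly1 x P : X x -> chart i x -> O2 X x (fun y z => mv (nv i y) P).
Proof. by move=> Xx cx; apply: (O2_fst (regular_poly P Xx cx)). Qed.

Lemma O2_poly2 x P : X x -> chart i x -> O2 X x (fun y z => mv (nv i z) P).
Proof. by move=> Xx cx; apply: (O2_snd (regular_poly P Xx cx)). Qed.

Definition incr P : germ := fun y z => incrv P (nv i y) (nv i z).

Lemma Idiag_incr x P : X x -> chart i x -> Idiag X x (incr P).
Proof.
move=> Xx cx; split; last first.
  by exists X; [split=> //; exact: open_inT | move=> y _; rewrite /incr /incrv subrr].
apply: O2_eq (O2D (O2_poly2 P Xx cx) (O2M (O2C (-1) Xx) (O2_poly1 P Xx cx))).
by apply: near2T => // y z _ _; rewrite mulN1r.
Qed.

Definition rem P : germ := fun y z => remv P (nv i y) (nv i z).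

Lemma rem_Ipow x P : X x -> chart i x -> Ipow X 2 x (rem P).
Proof.
move=> Xx cx; elim/mpoly_ring_ind: P => [c|j|p q hp hq|p q hp hq].
- by apply: (Ipow_ext Xx) (Ipow_0 Xx 2) => y z; rewrite /rem remvC.
- by apply: (Ipow_ext Xx) (Ipow_0 Xx 2) => y z; rewrite /rem remvX.
- by apply: (Ipow_ext Xx) (IpowD hp hq) => y z; exact: remvD.
have h1 := IpowM Xx (O2_poly1 q Xx cx) hp.
have h2 := IpowM Xx (O2_poly1 p Xx cx) hq.
have h3 := IpowI Xx (Idiag_incr p Xx cx) (Ipow1 Xx (Idiag_incr q Xx cx)).
by apply: (Ipow_ext Xx) (IpowD (IpowD h1 h2) h3) => y z; exact: remvM.
Qed.

Lemma eN : (e <= N)%N. Proof. exact: rank_leq_row. Qed.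
Definition cw (l : 'I_e) : 'I_N := widen_ord eN l.

Lemma cw_inj : injective cw.
Proof. by move=> l m /(congr1 val) h; apply: val_inj. Qed.

Lemma cw_lt l : (cw l < e)%N. Proof. exact: (ltn_ord l). Qed.

Definition delta (l : 'I_e) : germ := incr (psi (cw l)).

(** Modulo the k-th power of the diagonal ideal, [s] lies in the ideal generated by the increments
    of the coordinates. *)
Definition Jset k x s := exists2 b : 'I_e -> germ, forall l, O2 X x (b l)
  & Ipow X k x (fun y z => s y z - \sum_l b l y z * delta l y z).

Section AtPoint.
Variable x : pnt.
Hypotheses (Xx : X x) (Qx : princ i Q0 x).
Let cx : chart i x := Qx.1.

Lemma Jset_eq k s s' : near2 X x (fun y z => s y z = s' y z) -> Jset k x s -> Jset k x s'.
Proof.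
move=> ss' [b hb h]; exists b => //; apply: Ipow_eq h.
by apply: near2W ss' => y z _ _ ->.
Qed.

Lemma Jset_D k s s' : Jset k x s -> Jset k x s' -> Jset k x (fun y z => s y z + s' y z).
Proof.
move=> [b hb h] [b' hb' h']; exists (fun l y z => b l y z + b' l y z).
  by move=> l; apply: O2D.
apply: (Ipow_ext Xx) (IpowD h h') => y z.
under [in RHS]eq_bigr => l _ do rewrite mulrDl.
by rewrite big_split /= opprD addrACA.
Qed.

Lemma Jset_M k a s : O2 X x a -> Jset k x s -> Jset k x (fun y z => a y z * s y z).
Proof.
move=> ha [b hb h]; exists (fun l y z => a y z * b l y z).
  by move=> l; apply: O2M.
apply: (Ipow_ext Xx) (IpowM Xx ha h) => y z.
by rewrite mulrBr mulr_sumr; congr (_ - _); apply: eq_bigr => l _; rewrite mulrA.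
Qed.

Lemma Jset_pow k s : Ipow X k x s -> Jset k x s.
Proof.
move=> h; exists (fun _ _ _ => 0) => [l|]; first exact: O2C.
by apply: (Ipow_ext Xx) h => y z; rewrite big1 ?subr0 // => l _; rewrite mul0r.
Qed.

(** First-order Taylor formula, with the differential of [P] written in the coordinates [psi]; those
    among them that are equations of [X] have zero increment. *)
Lemma Jset_incr P : Jset 2 x (incr P).
Proof.
pose c l : pnt -> C := fun y => mv (nv i y) (cder psi l P) / mv (nv i y) Q0.
have hc l : O2 X x (fun y z => c l y) by apply: (O2_fst (regular_frac _ Xx Qx)).
exists (fun l y z => c (cw l) y) => [l|]; first exact: hc.
have h1 := rem_Ipow P Xx cx.
have h2 := Ipow_sum Xx (index_enum _) (fun l => IpowM Xx (hc l) (rem_Ipow (psi l) Xx cx)).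
apply: Ipow_eq (IpowB Xx h1 h2).
have nQ := near1_princ Xx Qx.
apply: near2W (near2I (near2_fst nQ) (near2_snd nQ)) => y z Xy Xz [Qy Qz].
rewrite /rem /remv -addrA; congr (_ + _); rewrite -opprD; congr (- _).
have Q0y : mv (nv i y) Q0 != 0 := Qy.2.
have -> : dder P (nv i y) (nv i z - nv i y)
    = \sum_l c l y * dder (psi l) (nv i y) (nv i z - nv i y).
  apply: (mulfI Q0y); rewrite dder_coord mulr_sumr; apply: eq_bigr => l _.
  exact/esym/mul_divK.
rewrite -big_split /=.
under eq_bigr => l _ do rewrite -mulrDr addrC subrK.
rewrite (bigID (fun l : 'I_N => (l < e)%N)) /= [X in _ + X]big1 ?addr0; last first.
  move=> l; rewrite -leqNgt => le; have [psi0 _] := ca.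
  by rewrite /incrv !psi0 ?subrr ?mulr0 //; apply: aff_nv => //; [exact: Qy.1 | exact: Qz.1].
by rewrite (big_ord_narrow eN).
Qed.

(** Write a = F/G. Since F vanishes on the diagonal, F(y, z) = F(y, z) - F(y, y), a combination of
    increments of polynomials, to which [Jset_incr] applies. *)
Lemma Jset_Idiag2 a : Idiag X x a -> Jset 2 x a.
Proof.
move=> [[d [d' [F [G [hF hG FG]]]]] a0'].
have [m [A [B [hA hB FE]]]] := hF.
have nc : near1 X x (chart i).
  by apply: near1W (near1_princ Xx Qx) => y _ [].
pose Gi : germ := fun y z => (G (nv i y) (nv i z))^-1.
have hGi : O2 X x Gi.
  (* [Gi] is evaluated at normalized coordinates; for arbitrary ones homogeneity brings in the
     powers of the i-th coordinates. *)
  exists d, d', (fun v w => ev ('X_i ^+ d) v * ev ('X_i ^+ d') w), G; split=> //.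
    have hX k : is_homog k ('X_i ^+ k : {mpoly C[N]}).
      rewrite /is_homog -[X in X.-homog](mul1n k); apply: dhomogMn.
      by rewrite dhomogX /= mdeg1.
    exact: (bihomog1 (hX d) (hX d')).
  apply: near2W (near2I FG (near2I (near2_fst nc) (near2_snd nc))).
  move=> y z _ _ [h [cy cz]] v w yv zw; have [G0 _] := h v w yv zw; split=> //.
  have v0 : v ord0 i != 0 by rewrite -(chart_hcoord _ yv).
  have w0 : w ord0 i != 0 by rewrite -(chart_hcoord _ zw).
  rewrite /Gi (nvE yv cy) (nvE zw cz) (bihomog_scale _ _ _ _ hG).
  rewrite !invfM -!exprVn !invrK /ev !rmorphXn /= !mevalXU.
  by [].
have : Jset 2 x (fun y z => Gi y z * \sum_l mv (nv i y) (A l) * incr (B l) y z).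
  apply: Jset_M => //; elim: (index_enum _) => [|l t IH].
    by apply: Jset_eq (Jset_pow (Ipow_0 Xx 2)); apply: near2T => // y z _ _; rewrite big_nil.
  apply: Jset_eq (Jset_D (Jset_M (O2_poly1 (A l) Xx cx) (Jset_incr (B l))) IH).
  by apply: near2T => // y z _ _; rewrite big_cons.
apply: Jset_eq.
apply: near2W (near2I (near2I FG (near2_fst (near2_diag FG)))
  (near2I (near2I (near2_fst nc) (near2_snd nc)) (near2_fst a0'))).
move=> y z _ _ [[h hy] [[cy cz] ay]].
have yv := hcoord_nv cy; have zw := hcoord_nv cz.
have [G0 ->] := h _ _ yv zw; have [Gy ayE] := hy _ _ yv yv.
have F0 : F (nv i y) (nv i y) = 0.
  by have /eqP := ayE; rewrite ay eq_sym mulf_eq0 invr_eq0 (negPf Gy) orbF => /eqP.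
rewrite /Gi mulrC; congr (_ / _).
rewrite -[RHS]subr0 -[X in _ = _ - X]F0 !FE -sumrB; apply: eq_bigr => l _.
by rewrite /incr /incrv mulrBr.
Qed.

(** The remainder in I^(k+1) is a sum of products; expanding one factor of each modulo I^2 leaves an
    error in I^(k+2). *)
Lemma Jset_Idiag k a : Idiag X x a -> Jset k.+1 x a.
Proof.
move=> ha; elim: k => [|k [b hb h]]; first by apply/Jset_pow/Ipow1.
suff hJ s : Ipow X k.+1 x s -> Jset k.+2 x s.
  have [b' hb' h'] := hJ _ h.
  exists (fun l y z => b l y z + b' l y z); first by move=> l; apply: O2D.
  apply: (Ipow_ext Xx) h' => y z.
  under [in RHS]eq_bigr => l _ do rewrite mulrDl.
  by rewrite big_split /= opprD addrA.
move: s; apply: (Ipow_ind Xx) => [s s'|||c d hc hd].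
- exact: Jset_eq.
- exact: Jset_pow (Ipow_0 Xx _).
- exact: Jset_D.
have [f hf h2] := Jset_Idiag2 (hc ord0).
pose rest : germ := fun y z => (\prod_(j < k) c (lift ord0 j) y z) * d y z.
have hrest : O2 X x rest.
  by apply: O2M => //; apply: O2_prod => // j; have [] := hc (lift ord0 j).
exists (fun l y z => f l y z * rest y z); first by move=> l; apply: O2M.
have := Ipow_prodM Xx (fun j => hc (lift ord0 j)) (IpowM Xx hd h2).
rewrite addn2; apply: (Ipow_ext Xx) => y z; rewrite big_ord_recl /= mulrA.
rewrite -/(rest y z) mulrBr -mulrA -/(rest y z) [rest y z * _]mulrC; congr (_ - _).
by rewrite mulr_sumr; apply: eq_bigr => l _; rewrite mulrA [rest y z * _]mulrC.
Qed.

Definition dmon (m : 'X_{1..e}) : germ := fun y z => \prod_l delta l y z ^+ m l.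

(** The coefficients depend on the first variable only: they are the coordinates of the class of [s]
    as a section of an O_X-module. *)
Definition Tset k s := exists2 c : 'X_{1..e} -> pnt -> C, forall m, regular_at X x (c m)
  & Ipow X k x (fun y z => s y z - \sum_(m : 'X_{1..e < k}) c m y * dmon m y z).

Lemma Tset_eq k s s' : near2 X x (fun y z => s y z = s' y z) -> Tset k s -> Tset k s'.
Proof.
move=> ss' [c hc h]; exists c => //; apply: Ipow_eq h.
by apply: near2W ss' => y z _ _ ->.
Qed.

Lemma Tset_D k s s' : Tset k s -> Tset k s' -> Tset k (fun y z => s y z + s' y z).
Proof.
move=> [c hc h] [c' hc' h']; exists (fun m y => c m y + c' m y).
  by move=> m; apply: regular_germD.
apply: (Ipow_ext Xx) (IpowD h h') => y z.
under [in RHS]eq_bigr => l _ do rewrite mulrDl.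
by rewrite big_split /= opprD addrACA.
Qed.

Lemma Tset_pow k s : Ipow X k x s -> Tset k s.
Proof.
move=> h; exists (fun _ _ => 0) => [l|]; first exact: regular_germC.
by apply: (Ipow_ext Xx) h => y z; rewrite big1 ?subr0 // => l _; rewrite mul0r.
Qed.

Lemma Tset_sum k (I : Type) (t : seq I) (s : I -> germ) :
  (forall l, Tset k (s l)) -> Tset k (fun y z => \sum_(l <- t) s l y z).
Proof.
move=> h; elim: t => [|l t IH].
  by apply: Tset_eq (Tset_pow (Ipow_0 Xx k)); apply: near2T => // y z _ _; rewrite big_nil.
by apply: Tset_eq (Tset_D (h l) IH); apply: near2T => // y z _ _; rewrite big_cons.
Qed.

Lemma Tset_mon k (m : 'X_{1..e}) (c : pnt -> C) : (mdeg m < k)%N -> regular_at X x c ->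
  Tset k (fun y z => c y * dmon m y z).
Proof.
move=> mk hc; exists (fun m' => if m' == m then c else fun=> 0).
  by move=> m'; case: eqP => // _; apply: regular_germC.
apply: (Ipow_ext Xx) (Ipow_0 Xx k) => y z.
rewrite (bigD1 (BMultinom mk)) //= eqxx big1 ?addr0 ?subrr // => m' m'm.
rewrite ifN ?mul0r //; apply: contraNneq m'm => h; exact: val_inj.
Qed.

(** Once its diagonal value is subtracted, [s] is a combination of increments modulo I^(k+1).
    Expanding the coefficients modulo I^k suffices, since each is multiplied by an increment, which
    lies in I. *)
Lemma taylor k s : O2 X x s -> Tset k s.
Proof.
elim: k s => [|k IH] s hs.
  exists (fun _ _ => 0) => [l|]; first exact: regular_germC.
  apply: (Ipow_ext Xx) (Ipow_O2 Xx hs) => y z.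
  by rewrite big1 ?subr0 // => l _; rewrite mul0r.
have rs := O2_diag hs.
have ha : Idiag X x (fun y z => s y z - s y y).
  split; last by exists X; [split=> //; exact: open_inT | move=> y _; rewrite subrr].
  apply: O2_eq (O2D hs (O2M (O2C (-1) Xx) (O2_fst rs))).
  by apply: near2T => // y z _ _; rewrite mulN1r.
have [b hb h] := Jset_Idiag k ha.
have hdl l : Idiag X x (delta l) by apply: Idiag_incr.
have h0 : Tset k.+1 (fun y z => s y y * dmon 0%MM y z).
  by apply: Tset_mon => //; rewrite mdeg0.
have hl l : Tset k.+1 (fun y z => b l y z * delta l y z).
  have [c hc hT] := IH _ (hb l).
  have h1 := Tset_pow (IpowI Xx (hdl l) hT).
  have h2 : Tset k.+1 (fun y z => \sum_(m : 'X_{1..e < k}) c m y * dmon (m + U_(l))%MM y z).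
    apply: Tset_sum => m; apply: Tset_mon => //.
    by rewrite mdegD mdeg1 addn1 ltnS; apply: bmdeg.
  apply: Tset_eq (Tset_D h1 h2); apply: near2T => // y z _ _.
  rewrite mulrBr mulr_sumr addrAC -addrA [delta l y z * _]mulrC.
  rewrite -[RHS]addr0; congr (_ + _); rewrite -sumrB big1 // => m _.
  apply/eqP; rewrite subr_eq0; apply/eqP; rewrite mulrCA; congr (_ * _).
  by rewrite /dmon -prod_mnmD1 mulrC.
apply: Tset_eq (Tset_D h0 (Tset_D (Tset_sum (index_enum _) hl) (Tset_pow h))).
apply: near2T => // y z _ _; rewrite /dmon big1 ?mulr1 => [|l _]; last by rewrite mnm0E expr0.
by rewrite [X in _ + X]addrC subrK addrC subrK.
Qed.

(* The coefficients of the expansion are unique: fixing the first variable,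
   derivations along X lower the order of vanishing by one. *)
Lemma taylor_unique k (c : 'X_{1..e} -> pnt -> C) :
  Ipow X k x (fun y z => \sum_(m : 'X_{1..e < k}) c m y * dmon m y z) ->
  forall m, (mdeg m < k)%N -> c m x = 0.
Proof.
move=> [n [a [b [ha hb h]]]].
pose p : {mpoly C[e]} := \sum_(m : 'X_{1..e < k}) c m x *: 'X_[m].
have pc m : (mdeg m < k)%N -> p@_m = c m x.
  move=> mk; rewrite /p raddf_sum (bigD1 (BMultinom mk)) //= big1 => [|m' m'm].
    by rewrite mcoeffZ mcoeffX eqxx mulr1 addr0.
  rewrite mcoeffZ mcoeffX; case: eqP => [mm'|]; last by rewrite mulr0.
  by case/eqP: m'm; apply: val_inj.
suff p0 : p = 0 by move=> m mk; rewrite -pc // p0 mcoeff0.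
have pk : (msize p <= k)%N.
  apply: leq_trans (msize_sum _ _ _) _; apply/bigmax_leqP => m _.
  by apply: leq_trans (msizeZ_le _ _) _; rewrite msizeX; apply: bmdeg.
have Ax : aff i X (nv i x) := aff_nv Xx cx.
have Q0x : mv (nv i x) Q0 != 0 := Qx.2.
apply: (vord_ctuple Q0x cw_inj cw_lt _ pk).
have /choice[Pa hPa] : forall lj : 'I_n * 'I_k, exists PQ : {mpoly C[N]} * {mpoly C[N]},
    princ i PQ.2 x /\ forall y, X y -> princ i PQ.2 y ->
      a lj.1 lj.2 x y = mv (nv i y) PQ.1 / mv (nv i y) PQ.2.
  move=> lj; have [P [Q [Qx' E]]] := regular_rep (O2_slice (ha lj.1 lj.2).1) cx.
  by exists (P, Q).
have /choice[Pb hPb] : forall l : 'I_n, exists PQ : {mpoly C[N]} * {mpoly C[N]},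
    princ i PQ.2 x /\ forall y, X y -> princ i PQ.2 y ->
      b l x y = mv (nv i y) PQ.1 / mv (nv i y) PQ.2.
  by move=> l; have [P [Q [Qx' E]]] := regular_rep (O2_slice (hb l)) cx; exists (P, Q).
pose D l := (\prod_j (Pa (l, j)).2) * (Pb l).2.
have Dx l : mv (nv i x) (D l) != 0.
  rewrite mevalM rmorph_prod mulf_neq0 //; last by have [[]] := hPb l.
  by apply/prodf_neq0 => j _; have [[]] := hPa (l, j).
pose Da := \prod_l D l.
have Dax : mv (nv i x) Da != 0 by rewrite rmorph_prod; apply/prodf_neq0 => l _; exact: Dx.
have [W nW hW] := near2_slice h.
have [H Hx HW] := nbhd_princ nW cx.
have GG : mv (nv i x) (H * Da * Da) != 0.
  by rewrite !mevalM; exact: (mulf_neq0 (mulf_neq0 Hx.2 Dax) Dax).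
apply: (vord_cancel GG).
(* The right side of the membership in I^k at (x, z), cleared of denominators. Each term contains k
   factors that vanish at [x], hence has order at least k there. *)
pose S := \sum_l (\prod_j (Pa (l, j)).1) * ((Pb l).1 * H * Da * \prod_(l' | l' != l) D l').
have Pa0 l j : mv (nv i x) (Pa (l, j)).1 = 0.
  have [Qx' E] := hPa (l, j); have /eqP := near1_self (ha l j).2.
  rewrite E // mulf_eq0 invr_eq0 => /orP[/eqP //|/eqP h0].
  by have := Qx'.2; rewrite h0 eqxx.
have vS : vord (aff i X) iota eta psi (nv i x) k S.
  rewrite /S; apply: (big_ind (vord (aff i X) iota eta psi (nv i x) k)).
  - by apply: (vord_vanish gen Aa ca Ax) => z' _; rewrite meval0.
  - by move=> P Q; apply: vordD.
  - by move=> l _; apply: vord_prod.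
set pp := _ \mPo _.
suff : vord (aff i X) iota eta psi (nv i x) k (H * Da * Da * pp - S).
  by move=> h1; have := vordD h1 vS; rewrite subrK.
apply: (vord_vanish gen Aa ca Ax) => _ [z Xz [cz ->]].
have SE : mv (nv i z) S = \sum_l (\prod_j mv (nv i z) (Pa (l, j)).1) * (mv (nv i z) (Pb l).1
    * mv (nv i z) H * (\prod_l' mv (nv i z) (D l')) * \prod_(l' | l' != l) mv (nv i z) (D l')).
  rewrite /S raddf_sum; apply: eq_bigr => l _ /=.
  by rewrite !mevalM !rmorph_prod.
have ppE : mv (nv i z) pp = \sum_(m : 'X_{1..e < k}) c m x * dmon m x z.
  rewrite /pp comp_mpoly_meval /p raddf_sum; apply: eq_bigr => m _ /=.
  rewrite mevalZ mevalX; congr (_ * _); apply: eq_bigr => l _.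
  by rewrite tnth_mktuple mevalB mevalC.
have DaE : mv (nv i z) Da = \prod_l mv (nv i z) (D l) by rewrite rmorph_prod.
have DE l : mv (nv i z) (D l) = (\prod_j mv (nv i z) (Pa (l, j)).2) * mv (nv i z) (Pb l).2.
  by rewrite mevalM rmorph_prod.
rewrite mevalB SE !mevalM DaE ppE.
rewrite (cleared_sum (a := fun l j => a l j x z) (b := fun l => b l x z)
  (u := fun l => mv (nv i z) (Pb l).1) (p := fun l j => mv (nv i z) (Pa (l, j)).1) DE).
- exact: subrr.
- move=> l Dz; move: (Dz); rewrite DE mulf_eq0 negb_or => /andP[/prodf_neq0 h1 h2].
  split=> [j|]; last exact: ((hPb l).2 z Xz (conj cz h2)).
  exact: ((hPa (l, j)).2 z Xz (conj cz (h1 j isT))).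
- by move=> Hz; apply: hW; apply: HW; exact: (conj Xz (conj cz Hz)).
Qed.

End AtPoint.
End Taylor.

(** * Principal parts and osculating spaces *)

Section Sections.
Variables (R : realType) (r : nat) (X : set (pt R r)) (i : 'I_r.+1).
Notation C := R[i].
Notation N := r.+1.
Notation dV := (dualV R r).
Notation pnt := (pt R r).
Notation germ := (pnt -> pnt -> C).
Notation germL := (pnt -> dV -> C).
Implicit Types (x y z : pnt) (s : germ) (t : germL) (w : 'rV[C]_N).

(* Trivialization of O(1) on the chart: t is the section with coordinate s. *)
Definition repL x t s := near2 X x (fun y z => chart i z /\
  forall w, hcoord z w -> t y w = w ord0 i * s y z).

(** Sections of pr_2^* O(1) are functions of a vector [w], while [s] depends on the point below it;
    [y0] is the value when [w] is zero. *)
Definition ptof y0 (w : dV) : pnt := xget y0 [set z | hcoord z w].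

Lemma ptofE y0 z w : hcoord z w -> ptof y0 w = z.
Proof.
move=> zw; have h : hcoord (ptof y0 w) w by apply: (@xgetPex _ y0 [set z | hcoord z w]); exists z.
exact: hcoord_inj h zw.
Qed.

Lemma near2_chart x : X x -> chart i x -> near2 X x (fun y z => chart i y /\ chart i z).
Proof.
move=> Xx cx; have h : near1 X x (chart i).
  by apply: near1W (near1_princ Xx (princ1 cx)) => y _ [].
exact: near2I (near2_fst h) (near2_snd h).
Qed.

Lemma frac_scale_cancel (F : fieldType) (c u v : F) e : c != 0 -> v != 0 ->
  (c^-1 ^+ e.+1 * u) / (c^-1 ^+ e * v) = u / (v * c).
Proof.
move=> c0 v0; have k0 : c^-1 ^+ e != 0 by rewrite expf_neq0 // invr_eq0.
by rewrite exprS; move: (c^-1 ^+ e) k0 => k k0; field; rewrite c0 v0.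
Qed.

Lemma frac_scale (F : fieldType) (c u v : F) e : c != 0 -> v != 0 ->
  (c ^+ e.+1 * u) / (c ^+ e * v) = c * (u / v).
Proof.
move=> c0 v0; have k0 : c ^+ e != 0 by rewrite expf_neq0.
by rewrite exprS; move: (c ^+ e) k0 => k k0; field; rewrite k0 v0.
Qed.

Lemma regular2L_repL x t W : chart i x -> nbhd_in_square X x W -> regular2L W t ->
  exists2 s, O2 X x s & repL x t s.
Proof.
move=> cx nW /(_ _ nW.2)[O [d [e [F [G [oO Ox hF hG FG]]]]]].
have Xx : X x by case: nW => -[O' _ ->] [[]].
have nWO : near2 X x (fun y z => W (y, z) /\ O (y, z)).
  exists (W `&` ((X `*` X) `&` O)); last by move=> y z [Wyz [_ Oyz]].
  by apply: nbhd2I => //; split; [exists O|].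
have hX : is_homog 1 ('X_i : {mpoly C[N]}) by rewrite /is_homog dhomogX /= mdeg1.
exists (fun y z => t y (nv i z)).
  exists d, e.+1, F, (fun v w => G v w * (ev 1 v * ev 'X_i w)); split => //.
    by rewrite -[d]addn0 -[e.+1]addn1; apply: bihomogM hG (bihomog1 (is_homog1 _ _) hX).
  apply: near2W (near2I nWO (near2_chart Xx cx)) => y z _ _ [[Wyz Oyz] [cy cz]] v w yv zw.
  have [G0 _] := FG y z v w Wyz Oyz yv zw.
  have w0 : w ord0 i != 0 by rewrite -(chart_hcoord _ zw).
  rewrite ev1 mul1r; have -> : ev 'X_i w = w ord0 i := mevalXU _ _.
  split; first exact: mulf_neq0 G0 w0.
  have [_ ->] := FG y z v _ Wyz Oyz yv (hcoord_nv cz).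
  rewrite (nvE zw cz) -[v in LHS]scale1r (bihomog_scale _ _ _ _ hF) (bihomog_scale _ _ _ _ hG).
  by rewrite !expr1n !mul1r; apply: frac_scale_cancel.
apply: near2W (near2I nWO (near2_chart Xx cx)) => y z _ _ [[Wyz Oyz] [cy cz]]; split=> // w zw.
have yv := hcoord_rep y.
have [G0 ->] := FG y z _ w Wyz Oyz yv zw.
have [G1 ->] := FG y z _ _ Wyz Oyz yv (hcoord_nv cz).
have wE : w = w ord0 i *: nv i z.
  by rewrite (nvE zw cz) scalerA mulfV ?scale1r // -(chart_hcoord _ zw).
have w0 : w ord0 i != 0 by rewrite -(chart_hcoord _ zw).
rewrite [in LHS]wE -[rep y in LHS]scale1r (bihomog_scale _ _ _ _ hF) (bihomog_scale _ _ _ _ hG).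
rewrite !expr1n !mul1r; exact: frac_scale w0 G1.
Qed.

Lemma section_repL x t : chart i x -> section_at X x t -> exists2 s, O2 X x s & repL x t s.
Proof. by move=> cx [W nW tW]; apply: regular2L_repL nW tW. Qed.

Definition secL y0 s : germL := fun y w => (w : 'rV[C]_N) ord0 i * s y (ptof y0 w).

Lemma O2_secL x y0 s : O2 X x s ->
  exists2 W, nbhd_in_square X x W & regular2L W (secL y0 s).
Proof.
move=> [d [e [F [G [hF hG [W nW WFG]]]]]]; exists W => // p Wp.
have hX : is_homog 1 ('X_i : {mpoly C[N]}) by rewrite /is_homog dhomogX /= mdeg1.
have [[O oO WE] _] := nW.
exists O, d, e, (fun v w => F v w * (ev 1 v * ev 'X_i w)), G; split=> //.
- by move: Wp; rewrite WE => -[].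
- by rewrite -[d]addn0 -[e.+1]addn1; apply: bihomogM hF (bihomog1 (is_homog1 _ _) hX).
move=> y z v w Wyz _ yv zw; have [G0 E] := WFG y z Wyz v w yv zw; split=> //.
rewrite /secL (ptofE _ zw) E ev1 mul1r; have -> : ev 'X_i w = w ord0 i := mevalXU _ _.
by rewrite mulrC mulrAC.
Qed.

Lemma secL_repL x y0 s : X x -> chart i x -> repL x (secL y0 s) s.
Proof.
move=> Xx cx; apply: near2W (near2_chart Xx cx) => y z _ _ [_ cz]; split=> // w zw.
by rewrite /secL (ptofE _ zw).
Qed.

Lemma repL_B x t t' s s' : repL x t s -> repL x t' s' ->
  repL x (fun y w => t y w - t' y w) (fun y z => s y z - s' y z).
Proof.
move=> h h'; apply: near2W (near2I h h') => y z _ _ [[cz tE] [_ t'E]]; split=> // w zw.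
by rewrite mulrBr -tE // -t'E.
Qed.

Lemma repL_sum x (I : finType) (c : I -> pnt -> C) (t : I -> germL) (s : I -> germ) :
  X x -> chart i x -> (forall l, repL x (t l) (s l)) ->
  repL x (fun y w => \sum_l c l y * t l y w) (fun y z => \sum_l c l y * s l y z).
Proof.
move=> Xx cx h; apply: near2W (near2I (near2_chart Xx cx) (near2_fin Xx h)) => y z _ _ [[_ cz] hl].
split=> // w zw; rewrite mulr_sumr; apply: eq_bigr => l _.
by rewrite mulrCA -(hl l).2.
Qed.

Lemma nbhd2_fin x (I : finType) (S : I -> set (pnt * pnt) -> Prop) : X x ->
  (forall l W W', W' `<=` W -> S l W -> S l W') ->
  (forall l, exists2 W, nbhd_in_square X x W & S l W) ->
  exists2 W, nbhd_in_square X x W & forall l, S l W.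
Proof.
move=> Xx Ssub h; suff [W nW hW] : exists2 W, nbhd_in_square X x W & forall l, l \in enum I -> S l W.
  by exists W => // l; apply: hW; rewrite mem_enum.
elim: (enum I) => [|l t [W nW hW]].
  by have [W nW _] := near2T Xx (fun y z _ _ => Logic.I); exists W.
have [W' nW' SW'] := h l; exists (W `&` W'); first exact: nbhd2I.
move=> l'; rewrite inE => /orP[/eqP ->|/hW]; first by apply: Ssub SW'.
by apply: Ssub.
Qed.

Lemma regular2L_sub W W' t : W' `<=` W -> regular2L W t -> regular2L W' t.
Proof.
move=> W'W tW p /W'W /tW[O [d [e [F [G [oO Op hF hG h]]]]]].
by exists O, d, e, F, G; split=> // y z v w /W'W Wyz; apply: h.
Qed.

Lemma in_diag_powerP m x t s : X x -> chart i x -> repL x t s ->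
  in_diag_power X m x t <-> Ipow X m x s.
Proof.
move=> Xx cx ts; split=> [[W [n [a [b [nW aW a0 bW tE]]]]]|[n [a [b [ha hb sE]]]]].
  have /choice[sb hsb] : forall l, exists sb, O2 X x sb /\ repL x (b l) sb.
    by move=> l; have [sb h1 h2] := regular2L_repL cx nW (bW l); exists sb.
  have nW2 : near2 X x (fun y z => W (y, z)) by exists W.
  have ha l j : Idiag X x (a l j).
    split; first exact: regular2_O2 nW (aW l j).
    by apply: near1W (near2_diag nW2) => y _; apply: a0.
  exists n, a, sb; split=> //; first by move=> l; have [] := hsb l.
  have := near2I (near2I nW2 ts) (near2_fin Xx (fun l => (hsb l).2)).
  apply: near2W => y z _ _ [[Wyz [cz stE]] hb].
  have zw := hcoord_nv cz; have := stE _ zw; rewrite nv1 // mul1r => <-.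
  rewrite (tE y z _ Wyz zw); apply: eq_bigr => l _; congr (_ * _).
  by rewrite ((hb l).2 _ zw) nv1 // mul1r.
have [W1 nW1 h1] := @nbhd2_fin x _ (fun (lj : 'I_n * 'I_m) W => regular2 W (a lj.1 lj.2)) Xx
  (fun _ _ _ h h' => regular2_sub h' h) (fun lj => O2_regular2 (ha lj.1 lj.2).1).
have [W2 nW2 h2] := @nbhd2_fin x _ (fun l W => regular2L W (secL x (b l))) Xx
  (fun _ _ _ h h' => regular2L_sub h h') (fun l => O2_secL x (hb l)).
have [W3 nW3 h3] := near2_fin Xx (fun lj : 'I_n * 'I_m => near2_fst (ha lj.1 lj.2).2).
have [W4 nW4 h4] := near2I ts sE.
exists (W1 `&` W2 `&` (W3 `&` W4)), n, a, (fun l => secL x (b l)); split.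
- by apply: nbhd2I; apply: nbhd2I.
- by move=> l j; apply: regular2_sub (h1 (l, j)) _ => p [[]].
- by move=> l j y [_ [W3y _]]; apply: (h3 y y W3y (l, j)).
- by move=> l; apply: regular2L_sub (h2 l) => p [[]].
move=> y z w [_ [_ W4y]] zw; have [[_ tE] sE'] := h4 y z W4y.
rewrite tE // sE' mulr_sumr; apply: eq_bigr => l _.
by rewrite /secL (ptofE _ zw) mulrCA.
Qed.

End Sections.

(** * Linear systems with polynomial coefficients *)

Section MinorSection.

Lemma mul_rowsub_colsub (F : comNzRingType) p q s (M : 'M[F]_(p, q))
    (f : 'I_s -> 'I_p) (g : 'I_s -> 'I_q) :
  rowsub f M *m colsub g 1%:M = mxsub f g M.
Proof.
apply/matrixP => a b; rewrite !mxE (bigD1 (g b)) //= big1 => [|j jb].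
  by rewrite !mxE eqxx mulr1 addr0.
by rewrite !mxE (negPf jb) mulr0.
Qed.

(* Cramer's rule: a solution of the equations of the rows f of M, equal to
   det *: t when t is already a solution. *)
Definition minor_sol (F : comNzRingType) p q s (M : 'M[F]_(p, q))
    (f : 'I_s -> 'I_p) (g : 'I_s -> 'I_q) (t : 'cV[F]_q) : 'cV[F]_q :=
  \det (mxsub f g M) *: t
  - colsub g 1%:M *m (\adj (mxsub f g M) *m (rowsub f M *m t)).

Lemma minor_solP (F : comNzRingType) p q s (M : 'M[F]_(p, q)) f g t :
  rowsub f M *m @minor_sol F p q s M f g t = 0.
Proof.
rewrite /minor_sol mulmxBr -scalemxAr mulmxA mul_rowsub_colsub.
by rewrite mulmxA mul_mx_adj mul_scalar_mx subrr.
Qed.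

Lemma map_minor_sol (F K : comNzRingType) (h : {rmorphism F -> K}) p q s
    (M : 'M[F]_(p, q)) (f : 'I_s -> 'I_p) (g : 'I_s -> 'I_q) t :
  map_mx h (minor_sol M f g t) = minor_sol (map_mx h M) f g (map_mx h t).
Proof.
rewrite /minor_sol map_mxB map_mxZ !map_mxM map_mx_adj -det_map_mx.
by rewrite !map_mxsub map_mx1.
Qed.

Lemma rows_ker (F : fieldType) p q s n (M : 'M[F]_(p, q)) (f : 'I_s -> 'I_p)
    (g : 'I_s -> 'I_q) (t : 'M[F]_(q, n)) :
  mxsub f g M \in unitmx -> \rank M = s -> rowsub f M *m t = 0 -> M *m t = 0.
Proof.
move=> u rM t0; have /submxP[D ME] := minor_rowsub u rM.
by rewrite ME -mulmxA t0 mulmx0.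
Qed.

Lemma sub_ker_orth (F : fieldType) p q (M : 'M[F]_(p, q)) (v : 'rV[F]_q) :
  (v <= M)%MS <-> (forall t : 'cV[F]_q, M *m t = 0 -> v *m t = 0).
Proof.
split=> [/submxP[D ->] t Mt|h]; first by rewrite -mulmxA Mt mulmx0.
rewrite submxE; apply/eqP/matrixP => a b; rewrite [RHS]mxE.
have Mc : M *m col b (cokermx M) = 0 by rewrite colE mulmxA mulmx_coker mul0mx.
have := h _ Mc => /matrixP/(_ a ord0); rewrite [RHS]mxE => <-.
by rewrite !mxE; apply: eq_bigr => j _; rewrite !mxE.
Qed.

Lemma sum_swap (F : comNzRingType) n m (a : 'I_n -> F) (t : 'I_n -> 'I_m -> F) (v : 'I_m -> F) :
  \sum_l a l * (\sum_j v j * t l j) = \sum_j (\sum_l a l * t l j) * v j.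
Proof.
under eq_bigr => l _ do rewrite mulr_sumr.
rewrite exchange_big; apply: eq_bigr => j _; rewrite mulr_suml.
by apply: eq_bigr => l _; rewrite [v j * _]mulrC mulrA.
Qed.

Lemma sum_change (F : comNzRingType) q n (c : 'I_q -> F) (P : 'I_q -> 'I_n -> F)
    (b v : 'I_n -> F) (d : 'I_q -> F) :
  (\sum_a c a * d a - \sum_j b j * v j) + (\sum_j b j * (v j - \sum_a P a j * d a))
  = \sum_a (c a - \sum_j P a j * b j) * d a.
Proof.
under [X in _ + X = _]eq_bigr => j _ do rewrite mulrBr.
rewrite sumrB addrA subrK.
under [RHS]eq_bigr => a _ do rewrite mulrBl.
rewrite sumrB; congr (_ - _).
under eq_bigr => j _ do rewrite mulr_sumr.
rewrite exchange_big; apply: eq_bigr => a _; rewrite mulr_suml.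
by apply: eq_bigr => j _; rewrite mulrA [b j * _]mulrC.
Qed.

End MinorSection.

Section Forms.
Variables (R : realType) (r : nat).
Notation C := R[i].
Notation N := r.+1.
Notation dV := (dualV R r).
Notation V := (formV R r).

Definition tco (T : V) : 'cV[C]_N := \col_j T (delta_mx ord0 j : 'rV[C]_N).

Lemma tcoE (T : V) (w : 'rV[C]_N) : T w = \sum_j w ord0 j * tco T j ord0.
Proof.
rewrite [w in LHS]row_sum_delta linear_sum; apply: eq_bigr => j _.
by rewrite linearZ mxE.
Qed.

Lemma tco_mul (T : V) (w : 'rV[C]_N) : T w = (w *m tco T) ord0 ord0.
Proof. by rewrite tcoE mxE. Qed.

Lemma tform_ex (t : 'cV[C]_N) : exists T : V, tco T = t.
Proof.
pose f (w : dV) : C^o := ((w : 'rV[C]_N) *m t) ord0 ord0.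
have lin : linear f by move=> c v w; rewrite /f mulmxDl -scalemxAl !mxE.
pose h := GRing.isLinear.Build _ _ _ _ f lin.
pose fl : {linear dV -> C^o} := HB.pack f h.
exists (linfun fl); apply/colP => j; rewrite mxE (lfunE fl) /= /f.
by rewrite -rowE mxE.
Qed.

End Forms.

(** * Bases of principal parts and the matrix of the Taylor series map *)

Section PrincipalParts.
Variables (R : realType) (r : nat) (X : set (pt R r)) (i : 'I_r.+1).
Notation C := R[i].
Notation N := r.+1.
Notation dV := (dualV R r).
Notation V := (formV R r).
Notation pnt := (pt R r).
Notation germ := (pnt -> pnt -> C).
Notation germL := (pnt -> dV -> C).
Implicit Types (x y z : pnt) (s : germ) (t : germL) (w : 'rV[C]_N).

(** The germs [d] give a basis of the functions modulo I^k at all points of the principal open set.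
    Uniqueness is stated for values at one point; applied at all nearby points it determines the
    coefficients as germs. *)
Definition pp_basis k (Q : {mpoly C[N]}) q (d : 'I_q -> germ) :=
  forall y, X y -> princ i Q y ->
  [/\ forall a, O2 X y (d a),
      forall s, O2 X y s -> exists2 c : 'I_q -> pnt -> C, forall a, regular_at X y (c a)
        & Ipow X k y (fun y' z => s y' z - \sum_a c a y' * d a y' z)
    & forall c : 'I_q -> pnt -> C, Ipow X k y (fun y' z => \sum_a c a y' * d a y' z) ->
        forall a, c a y = 0].

Lemma pp_basis_exists (L : fieldType) (iota : {rmorphism C -> L}) (eta : 'rV[L]_N)
    (b0 : 'rV[C]_N) (psi : 'I_N -> {mpoly C[N]}) k :
  generic (aff i X) iota eta -> aff i X b0 -> coord_at (aff i X) iota eta b0 psi ->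
  exists q (d : 'I_q -> germ), pp_basis k (\det (jac psi)) d.
Proof.
move=> gen Ab cb; set e := \rank (gtsp (aff i X) iota eta).
pose I := 'X_{1..e < k}.
exists #|{: I}|, (fun a => dmon (X := X) (iota := iota) (eta := eta) psi (enum_val a : I)).
move=> y Xy Qy; split.
- move=> a; apply: O2_prod => // l.
  have hl : O2 X y (delta (X := X) (iota := iota) (eta := eta) psi l).
    by have [] := Idiag_incr (psi (cw l)) Xy Qy.1.
  elim: ((enum_val a : I) l) => [|m IH].
    by apply: O2_eq (O2C 1 Xy); apply: near2T => // y' z _ _; rewrite expr0.
  by apply: O2_eq (O2M hl IH); apply: near2T => // y' z _ _; rewrite exprS.
- move=> s hs; have [c hc h] := taylor cb Xy Qy k hs.
  exists (fun a => c (enum_val a : I)) => [a|]; first exact: hc.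
  apply: (Ipow_ext Xy) h => y' z; congr (_ - _).
  by rewrite -(big_enum_val (fun m : I => c m y' * dmon psi m y' z)).
(* The coefficients are reindexed by all multi-indices, with value 0 in degree [k] and above, the
   form in which [taylor_unique] takes them. *)
move=> c h a; pose c' (m : 'X_{1..e}) y' : C :=
  \sum_(b : 'I_#|{: I}|) if (enum_val b : I) == m :> 'X_{1..e} then c b y' else 0.
have c'E (b : 'I_#|{: I}|) y' : c' (enum_val b : I) y' = c b y'.
  rewrite /c' (bigD1 b) //= eqxx big1 ?addr0 // => b' b'b.
  by rewrite ifN //; apply: contraNneq b'b => /val_inj/enum_val_inj ->.
rewrite -c'E; apply: (taylor_unique gen Ab cb Xy Qy) (bmdeg _).
apply: (Ipow_ext Xy) h => y' z.
rewrite (big_enum_val (fun m : I => c' m y' * dmon psi m y' z)).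
by apply: eq_bigr => b _; rewrite c'E.
Qed.

Lemma near1_princ_ex x S : chart i x -> near1 X x S ->
  exists2 Q, princ i Q x & forall y, X y -> princ i Q y -> S y.
Proof.
move=> cx [W nW WS]; have [Q Qx QW] := nbhd_princ nW cx.
by exists Q => // y Xy Qy; apply: WS; apply: QW.
Qed.

Lemma princ_dvd Q Q' x : princ i (Q * Q') x -> princ i Q x.
Proof. by rewrite princM => -[]. Qed.

Lemma regular_common (I : finType) x (g : I -> pnt -> C) : X x -> chart i x ->
  (forall l, regular_at X x (g l)) -> exists (P : I -> {mpoly C[N]}) Q,
    princ i Q x /\ forall y, X y -> princ i Q y ->
      forall l, g l y = mv (nv i y) (P l) / mv (nv i y) Q.
Proof.
move=> Xx cx hg.
have /choice[PQ hPQ] : forall l, exists PQ : {mpoly C[N]} * {mpoly C[N]},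
    princ i PQ.2 x /\ forall y, X y -> princ i PQ.2 y ->
      g l y = mv (nv i y) PQ.1 / mv (nv i y) PQ.2.
  by move=> l; have [P [Q [Qx h]]] := regular_rep (hg l) cx; exists (P, Q).
pose Q := \prod_l (PQ l).2.
exists (fun l => (PQ l).1 * \prod_(m | m != l) (PQ m).2), Q; split.
  split=> //; rewrite rmorph_prod; apply/prodf_neq0 => l _.
  by have [[]] := hPQ l.
move=> y Xy [cy Qy] l; have QE : Q = (PQ l).2 * \prod_(m | m != l) (PQ m).2 by rewrite /Q (bigD1 l).
move: Qy; rewrite QE !mevalM mulf_eq0 negb_or => /andP[h1 h2].
by rewrite ((hPQ l).2 y Xy (conj cy h1)) -mulf_div divff // mulr1.
Qed.

Section Matrix.
Variables (k q : nat) (Q0 D : {mpoly C[N]}) (d : 'I_q -> germ) (P : 'M[{mpoly C[N]}]_(q, N)).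
Hypothesis bas : pp_basis k Q0 d.
Hypothesis DQ : forall y, princ i D y -> princ i Q0 y.

Let cf a j y : C := mv (nv i y) (P a j) / mv (nv i y) D.

(** Column j of P/D expands the j-th coordinate function in the basis [d], so P/D is the matrix of
    the Taylor series map on the chart. *)
Definition taylor_matrix := forall y, X y -> princ i D y -> forall j,
  Ipow X k y (fun y' z => nv i z ord0 j - \sum_a cf a j y' * d a y' z).

Hypothesis tay : taylor_matrix.

Lemma O2_nv y j : X y -> chart i y -> O2 X y (fun y' z => nv i z ord0 j).
Proof.
move=> Xy cy; apply: O2_eq (O2_poly2 'X_j Xy cy).
by apply: near2T => // y' z _ _; rewrite mevalXU.
Qed.

Lemma regular_cf a j y : X y -> princ i D y -> regular_at X y (cf a j).
Proof. by move=> Xy Dy; apply: regular_frac. Qed.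

(** A congruence modulo I^k between a combination of the basis and a combination of coordinate
    functions is the linear system c = (P/D) b. It holds near [y], because the congruence persists
    at nearby points and uniqueness applies at each of them. *)
Lemma Ipow_linear y (c : 'I_q -> pnt -> C) (b : 'I_N -> pnt -> C) : X y -> princ i D y ->
  (forall j, regular_at X y (b j)) ->
  Ipow X k y (fun y' z => \sum_a c a y' * d a y' z - \sum_j b j y' * nv i z ord0 j) <->
  near1 X y (fun y' => forall a, c a y' = \sum_j cf a j y' * b j y').
Proof.
move=> Xy Dy hb.
have h0 : Ipow X k y (fun y' z =>
    \sum_j b j y' * (nv i z ord0 j - \sum_a cf a j y' * d a y' z)).
  by apply: Ipow_sum => // j; apply: IpowM => //; [exact: O2_fst | exact: tay].
split=> [h|h].
  have h1 := IpowD h h0.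
  have h2 : Ipow X k y (fun y' z => \sum_a (c a y' - \sum_j cf a j y' * b j y') * d a y' z).
    by apply: (Ipow_ext Xy) h1 => y' z; apply: sum_change.
  have h3 := near1I (Ipow_near Xy h2) (near1_princ Xy Dy).
  apply: near1W h3 => y' Xy' [h4 Dy'] a.
  have [_ _ /(_ _ h4 a)/eqP] := bas Xy' (DQ Dy').
  by rewrite subr_eq0 => /eqP.
apply: Ipow_eq (IpowN Xy h0).
apply: near2W (near2_fst h) => y' z _ _ hc.
rewrite -[RHS]opprK; congr (- _); apply/eqP; rewrite -subr_eq0 opprK.
rewrite addrC (sum_change (fun a => c a y') (fun a j => cf a j y') (fun j => b j y')).
by rewrite big1 // => a _; rewrite hc subrr mul0r.
Qed.

Lemma repL_dL y (T : V) : X y -> chart i y ->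
  repL X i y (dL T) (fun y' z => \sum_j nv i z ord0 j * tco T j ord0).
Proof.
move=> Xy cy; apply: near2W (near2_chart Xy cy) => y' z _ _ [_ cz]; split=> // w zw.
have w0 : w ord0 i != 0 by rewrite -(chart_hcoord _ zw).
rewrite -tcoE (nvE zw cz) /dL.
have -> : T ((w ord0 i)^-1 *: w) = (w ord0 i)^-1 * T w by exact: linearZ.
by rewrite mulVKf.
Qed.

Lemma repL_forms y n (a : 'I_n -> pnt -> C) (T : 'I_n -> V) : X y -> chart i y ->
  repL X i y (fun y' w => \sum_l a l y' * dL (T l) y' w)
    (fun y' z => \sum_j (\sum_l a l y' * tco (T l) j ord0) * nv i z ord0 j).
Proof.
move=> Xy cy; have h := repL_sum a Xy cy (fun l => repL_dL (T l) Xy cy).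
apply: near2W h => y' z _ _ [cz tE]; split=> // w zw; rewrite tE //; congr (_ * _).
exact: (sum_swap (fun l => a l y') (fun l j => tco (T l) j ord0) (nv i z ord0)).
Qed.

Lemma in_im_alphaP y t (c : 'I_q -> pnt -> C) s n : k = n.+1 -> X y -> princ i D y ->
  repL X i y t s -> Ipow X k y (fun y' z => s y' z - \sum_a c a y' * d a y' z) ->
  in_im_alpha X n y t <->
  exists2 b : 'I_N -> pnt -> C, forall j, regular_at X y (b j)
    & near1 X y (fun y' => forall a, c a y' = \sum_j cf a j y' * b j y').
Proof.
move=> kn Xy Dy ts sc; have cy := Dy.1.
have key (b : 'I_N -> pnt -> C) : Ipow X k y (fun y' z => s y' z - \sum_j b j y' * nv i z ord0 j) <->
    Ipow X k y (fun y' z => \sum_a c a y' * d a y' z - \sum_j b j y' * nv i z ord0 j).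
  split=> h.
    have := IpowB Xy h sc; apply: (Ipow_ext Xy) => y' z.
    by rewrite opprB addrACA [- _ + _ in LHS]addrC addrACA subrr add0r.
  have := IpowD h sc; apply: (Ipow_ext Xy) => y' z.
  by rewrite addrC addrA subrK.
split=> [[m [a [T [ra]]]]|[b rb h]].
  rewrite /eq_pp -kn => /(in_diag_powerP k Xy cy (repL_B ts (repL_forms a T Xy cy))) h.
  have rb j : regular_at X y (fun y' => \sum_l a l y' * tco (T l) j ord0).
    by apply: regular_germ_sum => // l; apply: regular_germM => //; apply: regular_germC.
  exists (fun j y' => \sum_l a l y' * tco (T l) j ord0) => //.
  by apply/(Ipow_linear c Xy Dy rb)/key.
have /choice[T hT] : forall j : 'I_N, exists T : V, tco T = delta_mx j ord0.
  by move=> j; apply: tform_ex.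
exists N, b, T; split=> //; rewrite /eq_pp -kn.
apply/(in_diag_powerP k Xy cy (repL_B ts (repL_forms b T Xy cy))).
have := (key b).2 ((Ipow_linear c Xy Dy rb).2 h); apply: (Ipow_ext Xy) => y' z.
congr (_ - _); apply: eq_bigr => j _; congr (_ * _).
rewrite (bigD1 j) //= hT mxE !eqxx mulr1 big1 ?addr0 // => l lj.
by rewrite hT mxE eq_sym (negPf lj) mulr0.
Qed.

End Matrix.

Lemma taylor_matrix_exists k q (Q0 : {mpoly C[N]}) (d : 'I_q -> germ) x :
  pp_basis k Q0 d -> X x -> princ i Q0 x ->
  exists D (P : 'M[{mpoly C[N]}]_(q, N)), [/\ princ i D x,
    forall y, princ i D y -> princ i Q0 y & taylor_matrix k D d P].
Proof.
move=> bas Xx Qx; have cx := Qx.1.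
have /choice[c hc] : forall j, exists c : 'I_q -> pnt -> C,
    (forall a, regular_at X x (c a)) /\
    Ipow X k x (fun y' z => nv i z ord0 j - \sum_a c a y' * d a y' z).
  move=> j; have [_ h _] := bas x Xx Qx.
  by have [c h1 h2] := h _ (O2_nv j Xx cx); exists c.
have [P [Q [Qx' PQ]]] := regular_common (g := fun aj : 'I_q * 'I_N => c aj.2 aj.1) Xx cx
  (fun aj => (hc aj.2).1 aj.1).
have [Q' Q'x hQ'] := near1_princ_ex cx (near1_fin Xx (fun j => Ipow_near Xx (hc j).2)).
(* The congruences are known on the principal open set of [Q'], and the basis on that of [Q0]; both
   are put into the denominator, and the numerators are adjusted. *)
exists (Q * (Q' * Q0)), (\matrix_(a, j) (P (a, j) * (Q' * Q0))); split.
- by rewrite !princM; split; [exact: Qx' | split; [exact: Q'x | exact: Qx]].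
- by move=> y; rewrite !princM => -[_ []].
move=> y Xy Dy j; move: (Dy); rewrite !princM => -[Qy [Q'y Q0y]].
apply: Ipow_eq (hQ' y Xy Q'y j).
apply: near2W (near2_fst (near1_princ Xy Dy)) => y' z Xy' _ Dy'.
congr (_ - _); apply: eq_bigr => a _; congr (_ * _).
move: Dy'; rewrite !princM => -[Qy' [Q'y' Q0y']].
rewrite (PQ y' Xy' Qy' (a, j)) mxE !mevalM -mulf_div divff ?mulr1 //.
exact: mulf_neq0 Q'y'.2 Q0y'.2.
Qed.

End PrincipalParts.

Section MatrixFacts.

Lemma sum_frac_eq0 (F : fieldType) n (p b : 'I_n -> F) (D : F) : D != 0 ->
  \sum_j p j / D * b j = 0 -> \sum_j p j * b j = 0.
Proof.
move=> D0 h; apply: (mulfI (invr_neq0 D0)); rewrite mulr0 -[RHS]h mulr_sumr.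
by apply: eq_bigr => j _; rewrite mulrA [D^-1 * _]mulrC.
Qed.

Lemma sum_frac0 (F : fieldType) n (p b : 'I_n -> F) (D E : F) :
  \sum_j p j * b j = 0 -> \sum_j p j / D * (b j / E) = 0.
Proof.
move=> h; transitivity ((D^-1 * E^-1) * \sum_j p j * b j); last by rewrite h mulr0.
by rewrite mulr_sumr; apply: eq_bigr => j _; ring.
Qed.

Lemma rank_sum_cover (F : fieldType) q m n (E : 'M[F]_(q, m)) (B : 'M_(m, q))
    (M : 'M[F]_(q, n)) (A : 'M_(n, q)) :
  1%:M = E *m B + M *m A -> (q <= m + \rank M)%N.
Proof.
move=> h; rewrite -[q in (q <= _)%N](mxrank1 F) h.
apply: leq_trans (mxrank_add _ _) _; apply: leq_add.
  by apply: leq_trans (mxrankM_maxl _ _) _; apply: rank_leq_col.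
exact: mxrankM_maxl.
Qed.

(** Next to [E] place a maximal independent set of columns of [M]. There are more than q columns in
    all, hence a kernel vector, and its part on [E] is nonzero since the columns of [M] are
    independent. *)
Lemma column_relation (F : fieldType) q m n (E : 'M[F]_(q, m)) (M : 'M[F]_(q, n)) :
  (q < m + \rank M)%N ->
  exists (c : 'cV_m) (b : 'cV_n), c != 0 /\ E *m c = M *m b.
Proof.
move=> h; have [f [g u]] := unit_minor M.
set s := \rank M in f g u h *.
pose B := row_mx E (colsub g M).
have : kermx B^T != 0.
  rewrite -mxrank_eq0 mxrank_ker subn_eq0 -ltnNge.
  by apply: leq_ltn_trans (rank_leq_col _) _; rewrite ltnS ltnW || exact: h.
move=> /rowV0Pn[v /sub_kermxP vB v0].
have Bv : B *m v^T = 0 by rewrite -[B]trmxK -trmx_mul vB trmx0.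
pose c := usubmx v^T; pose b := dsubmx v^T.
have cb : E *m c + colsub g M *m b = 0 by rewrite -mul_row_col vsubmxK.
exists c, (- (colsub g 1%:M *m b)); split; last first.
  rewrite mulmxN mulmxA; apply/eqP; rewrite -addr_eq0 -[X in _ + X](_ : colsub g M *m b = _) ?cb //.
  by rewrite -[M in colsub g M]mulmx1 -mulmx_colsub.
apply: contraNneq v0 => c0; rewrite c0 mulmx0 add0r in cb.
have b0 : b = 0.
  have : rowsub f (colsub g M *m b) = 0 by rewrite cb; apply/matrixP => x y; rewrite !mxE.
  rewrite -mul_rowsub_mx -mxsubrc => h0.
  by rewrite -[b](mulKmx u) h0 mulmx0.
by rewrite -[v]trmxK -[v^T]vsubmxK -/c -/b c0 b0 col_mx0 trmx0.
Qed.

Lemma map_mv_const (F : comNzRingType) n p q (v : 'rV[F]_n) (t : 'M[F]_(p, q)) :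
  map_mx (mv v) (map_mx (@mpolyC n F) t) = t.
Proof. by apply/matrixP => a b; rewrite 2!mxE mevalC. Qed.

Lemma minor_solM (F : comNzRingType) p q s (M : 'M[F]_(p, q))
    (f : 'I_s -> 'I_p) (g : 'I_s -> 'I_q) (t : 'cV[F]_q) :
  M *m t = 0 -> minor_sol M f g t = \det (mxsub f g M) *: t.
Proof. by move=> h; rewrite /minor_sol mul_rowsub_mx h mxsub_const !mulmx0 subr0. Qed.

End MatrixFacts.

(** * Projective tangent spaces as row spaces *)

Section Rank.
Variables (R : realType) (r : nat) (X : set (pt R r)) (i : 'I_r.+1).
Notation C := R[i].
Notation N := r.+1.
Notation dV := (dualV R r).
Notation V := (formV R r).
Notation pnt := (pt R r).
Notation germ := (pnt -> pnt -> C).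
Notation germL := (pnt -> dV -> C).
Implicit Types (x y z : pnt) (s : germ) (t : germL) (w : 'rV[C]_N).
Variables (L : fieldType) (iota : {rmorphism C -> L}) (eta : 'rV[L]_N).
Hypothesis gen : generic (aff i X) iota eta.
Hypothesis gfrac : forall u : L, exists P Q,
  mh iota eta Q != 0 /\ u = mh iota eta P / mh iota eta Q.
Variables (k q : nat) (Q0 D : {mpoly C[N]}) (d : 'I_q -> germ) (P : 'M[{mpoly C[N]}]_(q, N)).
Hypothesis bas : pp_basis X i k.+1 Q0 d.
Hypothesis DQ : forall y, princ i D y -> princ i Q0 y.
Hypothesis tay : taylor_matrix X i k.+1 D d P.


Definition mat y : 'M[C]_(q, N) := map_mx (mv (nv i y)) P.
Definition rho := \rank (map_mx (mmap iota (fun i => eta ord0 i)) P).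

Lemma mat_rank_le y : X y -> chart i y -> (\rank (mat y) <= rho)%N.
Proof. by move=> Xy cy; apply: (rank_point_le gen); apply: aff_nv. Qed.

Lemma mat_mul y (b : 'cV[C]_N) a : (mat y *m b) a ord0 = \sum_j mv (nv i y) (P a j) * b j ord0.
Proof. by rewrite mxE; apply: eq_bigr => j _; rewrite mxE. Qed.

(** One direction evaluates the linear system at [y]. For the other, constancy of the rank near [y]
    lets the kernel vector [tco T] extend, by Cramer's rule, to a regular section b of the kernel of
    [P]. Then T and T - b have the same image, and the coefficients of T - b vanish at [y]. *)
Lemma fibre_kerP y (T : V) : X y -> princ i D y -> \rank (mat y) = rho ->
  fibre_ker X k y T <-> mat y *m tco T = 0.
Proof.
move=> Xy Dy rk; have cy := Dy.1; have D0 := Dy.2.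
split=> [[n [a [S [ha]]]]|MT].
  move/(in_diag_powerP k.+1 Xy cy (repL_B (repL_dL T Xy cy) (repL_forms a S Xy cy))) => h.
  pose b j y' : C := \sum_l a l y' * tco (S l) j ord0 - tco T j ord0.
  have rb j : regular_at X y (b j).
    apply: regular_germD; last exact: regular_germC.
    by apply: regular_germ_sum => // l; apply: regular_germM (ha l).1 (regular_germC _ Xy).
  have := (Ipow_linear bas DQ tay (fun _ _ => 0) Xy Dy rb).1.
  case=> [|W nW hW].
    apply: (Ipow_ext Xy) h => y' z; rewrite [X in _ = X - _]big1 => [|a' _]; last by rewrite mul0r.
    rewrite sub0r -[RHS]sumrN -sumrB; apply: eq_bigr => j _.
    by rewrite /b mulrBl opprB [tco T j ord0 * _]mulrC.
  apply/colP => a'; rewrite mat_mul [RHS]mxE.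
  have := hW y nW.2 a' => /esym/(sum_frac_eq0 D0) h0.
  rewrite -[RHS]oppr0 -[in RHS]h0 -sumrN; apply: eq_bigr => j _.
  rewrite /b big1 ?sub0r ?mulrN ?opprK // => l _.
  by rewrite (ha l).2 mul0r.
have [f [g u]] := unit_minor (mat y).
pose Q1 := \det (mxsub f g P).
have Q1y : princ i Q1 y.
  by split=> //; move: u; rewrite /mat -map_mxsub unitmxE unitfE det_map_mx.
pose B := minor_sol P f g (map_mx (@mpolyC N C) (tco T)).
have BE y' : map_mx (mv (nv i y')) B = minor_sol (mat y') f g (tco T).
  rewrite map_minor_sol; congr (minor_sol _ f g _).
  exact: map_mv_const.
pose b j y' : C := mv (nv i y') (B j ord0) / mv (nv i y') Q1.
have rb j : regular_at X y (b j) by apply: regular_frac.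
have /choice[S hS] : forall j : 'I_N, exists S : V, tco S = delta_mx j ord0.
  by move=> j; apply: tform_ex.
exists N, (fun j y' => tco T j ord0 - b j y'), S; split.
  move=> j; split.
    apply: regular_germD; first exact: regular_germC.
    apply: regular_eq (regular_germM (regular_germC (-1) Xy) (rb j)).
    by apply: near1W (near1_princ Xy Dy) => y' _ _; rewrite mulN1r.
  have -> : b j y = tco T j ord0.
    have h : mv (nv i y) (B j ord0) = mv (nv i y) Q1 * tco T j ord0.
      transitivity (map_mx (mv (nv i y)) B j ord0); first by rewrite [RHS]mxE.
      rewrite BE (minor_solM f g MT) (_ : \det _ = mv (nv i y) Q1).
        by rewrite [LHS]mxE.
      by rewrite /mat -map_mxsub det_map_mx.
    by rewrite /b h mulrAC divff ?mul1r //; exact: Q1y.2.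
  exact: subrr.
apply/(in_diag_powerP k.+1 Xy cy (repL_B (repL_dL T Xy cy) (repL_forms _ S Xy cy))).
have := (Ipow_linear bas DQ tay (fun _ _ => 0) Xy Dy rb).2.
case=> [|n [a' [b' [h1 h2 h3]]]].
  apply: near1W (near1I (near1_princ Xy Dy) (near1_princ Xy Q1y)) => y' Xy' [Dy' Q1y'] a.
  apply/esym; apply: (@sum_frac0 _ _ (fun j => mv (nv i y') (P a j)) (fun j => mv (nv i y') (B j ord0))).
  have u' : mxsub f g (mat y') \in unitmx.
    by rewrite /mat -map_mxsub unitmxE unitfE det_map_mx; exact: Q1y'.2.
  have rk' : \rank (mat y') = \rank (mat y).
    apply/eqP; rewrite eqn_leq; apply/andP; split; last exact: unit_minor_rank u'.
    exact: leq_trans (mat_rank_le Xy' Dy'.1) (eq_leq (esym rk)).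
  have := rows_ker u' rk' (minor_solP (mat y') f g (tco T)).
  rewrite -BE => /colP/(_ a); rewrite mat_mul [RHS]mxE => h0.
  by apply: etrans h0; apply: eq_bigr => j _; rewrite [in RHS]mxE.
have h : Ipow X k.+1 y (fun y' z => \sum_a (fun _ _ => 0) a y' * d a y' z
    - \sum_j b j y' * nv i z ord0 j) by exists n, a', b'.
apply: (Ipow_ext Xy) (IpowN Xy h) => y' z.
rewrite [X in - (X - _) = _]big1 => [|a _]; last by rewrite mul0r.
rewrite sub0r opprK -sumrB; apply: eq_bigr => j _.
have hSE l : tco (S l) j ord0 = (j == l)%:R by rewrite hS mxE eqxx andbT.
rewrite (bigD1 j) //= hSE eqxx mulr1 big1 => [|l lj]; last first.
  by rewrite hSE eq_sym (negPf lj) mulr0.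
by rewrite addr0 mulrBl [tco T j ord0 * _]mulrC opprB addrCA subrr addr0.
Qed.

Lemma That_rowspace y (v : 'rV[C]_N) : X y -> princ i D y -> \rank (mat y) = rho ->
  v \in That X k y <-> (v <= mat y)%MS.
Proof.
move=> Xy Dy rk; rewrite (@mem_vspace_of _ _ [set v : dV | forall T : V, fibre_ker X k y T -> T v = 0]).
- rewrite sub_ker_orth; split=> h.
    move=> t Mt; have [T hT] := tform_ex t.
    have /h : fibre_ker X k y T by apply/fibre_kerP => //; rewrite hT.
    rewrite tco_mul hT => h0; apply/matrixP => a b.
    by rewrite (ord1 a) (ord1 b) h0 mxE.
  by move=> T /(fibre_kerP T Xy Dy rk)/h h0; rewrite tco_mul h0 mxE.
- by move=> T _; rewrite linear0.
- by move=> c u u' hu hu' T hT; rewrite linearP /= (hu T hT) (hu' T hT) scaler0 addr0.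
Qed.

End Rank.

Lemma clear_denominators (L F : fieldType) n (iota : {rmorphism F -> L}) (eta : 'rV[L]_n) :
  (forall u : L, exists P Q, mh iota eta Q != 0 /\ u = mh iota eta P / mh iota eta Q) ->
  forall (I : finType) (u : I -> L), exists (P : I -> {mpoly F[n]}) Q,
    mh iota eta Q != 0 /\ forall l, mh iota eta (P l) = mh iota eta Q * u l.
Proof.
move=> gfrac I u.
have /choice[PQ hPQ] : forall l, exists PQ : {mpoly F[n]} * {mpoly F[n]},
    mh iota eta PQ.2 != 0 /\ u l = mh iota eta PQ.1 / mh iota eta PQ.2.
  by move=> l; have [P [Q h]] := gfrac (u l); exists (P, Q).
exists (fun l => (PQ l).1 * \prod_(m | m != l) (PQ m).2), (\prod_l (PQ l).2); split.
  apply: (big_ind (fun P => mh iota eta P != 0)) => // [|P P' h h'|l _].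
  - by rewrite mh1 oner_neq0.
  - by rewrite mhM mulf_neq0.
  - by have [] := hPQ l.
move=> l; have [Q0 ->] := hPQ l; rewrite [X in mh iota eta X * _](bigD1 l) //= !mhM.
by rewrite [RHS]mulrC mulrA divfK.
Qed.

Lemma delta_sum_sub (F : comNzRingType) q (a' : 'I_q) (x d : 'I_q -> F) s :
  - (s - \sum_a x a * d a) = (d a' - s) - \sum_a ((a == a')%:R - x a) * d a.
Proof.
under [in RHS]eq_bigr => a _ do rewrite mulrBl.
rewrite sumrB (bigD1 a' (F := fun a => (a == a')%:R * d a)) //= eqxx mul1r.
rewrite [X in _ - (_ + X - _)]big1 => [|a /negPf ->]; last by rewrite mul0r.
by rewrite addr0; ring.
Qed.

Lemma mv_sumM (F : comNzRingType) n (I : finType) (v : 'rV[F]_n) (A B : I -> {mpoly F[n]}) :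
  mv v (\sum_l A l * B l) = \sum_l mv v (A l) * mv v (B l).
Proof. by rewrite raddf_sum; apply: eq_bigr => l _; exact: mevalM. Qed.

Lemma mh_sumM (F L : comNzRingType) n (I : finType) (iota : {rmorphism F -> L})
    (eta : 'rV[L]_n) (A B : I -> {mpoly F[n]}) :
  mh iota eta (\sum_l A l * B l) = \sum_l mh iota eta (A l) * mh iota eta (B l).
Proof. by rewrite raddf_sum; apply: eq_bigr => l _; exact: mhM. Qed.

Lemma frac_relation (F : fieldType) m n (g p : 'I_m -> F) (P b : 'I_n -> F) (D E : F) :
  D != 0 -> \sum_j p j * g j = \sum_j P j * b j ->
  \sum_j g j * (p j / E) = \sum_j P j / D * (b j * D / E).
Proof.
move=> D0 h; transitivity ((\sum_j p j * g j) / E).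
  by rewrite mulr_suml; apply: eq_bigr => j _; rewrite mulrA [g j * _]mulrC.
rewrite h mulr_suml; apply: eq_bigr => j _.
by rewrite !mulrA; congr (_ / E); rewrite -!mulrA [D^-1 * _]mulrC mulfK.
Qed.

(** * Free cokernel implies generic rank *)

Section CokerRank.
Variables (R : realType) (r : nat) (X : set (pt R r)) (i : 'I_r.+1).
Notation C := R[i].
Notation N := r.+1.
Notation dV := (dualV R r).
Notation pnt := (pt R r).
Notation germ := (pnt -> pnt -> C).
Notation germL := (pnt -> dV -> C).
Implicit Types (x y z : pnt) (s : germ) (t : germL) (w : 'rV[C]_N).
Variables (L : fieldType) (iota : {rmorphism C -> L}) (eta : 'rV[L]_N).
Hypothesis gen : generic (aff i X) iota eta.
Hypothesis gfrac : forall u : L, exists P Q,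
  mh iota eta Q != 0 /\ u = mh iota eta P / mh iota eta Q.
Variables (k q : nat) (Q0 D : {mpoly C[N]}) (d : 'I_q -> germ) (P : 'M[{mpoly C[N]}]_(q, N)).
Hypothesis bas : pp_basis X i k.+1 Q0 d.
Hypothesis DQ : forall y, princ i D y -> princ i Q0 y.
Hypothesis tay : taylor_matrix X i k.+1 D d P.

Local Notation mat := (mat i P).
Local Notation rho := (rho iota eta P).

Lemma Ipow_comb m n (c : 'I_n -> pnt -> C) (se : 'I_n -> germ) (ce : 'I_q -> 'I_n -> pnt -> C) y :
  X y -> (forall j, regular_at X y (c j)) ->
  (forall j, Ipow X m y (fun y' z => se j y' z - \sum_a ce a j y' * d a y' z)) ->
  Ipow X m y (fun y' z => \sum_j c j y' * se j y' z
                          - \sum_a (\sum_j c j y' * ce a j y') * d a y' z).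
Proof.
move=> Xy rc h; have h' : Ipow X m y (fun y' z =>
    \sum_j c j y' * (se j y' z - \sum_a ce a j y' * d a y' z)).
  by apply: Ipow_sum => // j; apply: IpowM => //; apply: O2_fst.
apply: (Ipow_ext Xy) h' => y' z.
under eq_bigr => j _ do rewrite mulrBr.
rewrite sumrB; congr (_ - _); rewrite -(sum_swap (fun j => c j y') (fun j a => ce a j y')).
by apply: eq_bigr => j _; congr (_ * _); apply: eq_bigr => a _; rewrite mulrC.
Qed.

Lemma section_taylor y t : X y -> princ i D y -> section_at X y t ->
  exists2 s, repL X i y t s & exists2 c : 'I_q -> pnt -> C, forall a, regular_at X y (c a)
    & Ipow X k.+1 y (fun y' z => s y' z - \sum_a c a y' * d a y' z).
Proof.
move=> Xy Dy st; have [s hs ts] := section_repL Dy.1 st; exists s => //.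
by have [_ + _] := bas Xy (DQ Dy); apply.
Qed.

(** The m generators together with the image span the principal parts at [y], so q is at most m plus
    the rank at [y]. If m plus the generic rank exceeded q, a generic relation would contradict
    freeness. *)
Lemma coker_rank y m W : X y -> princ i D y -> nbhd_in X y W ->
  coker_free_on X k m W -> \rank (mat y) = rho.
Proof.
move=> Xy Dy nW [e [[W2 [oW2 WW2] eW2] he]]; have cy := Dy.1.
have [ge un] := he y nW.2.
have /choice[se hse] : forall j, exists s, repL X i y (e j) s /\
    exists2 c : 'I_q -> pnt -> C, forall a, regular_at X y (c a)
    & Ipow X k.+1 y (fun y' z => s y' z - \sum_a c a y' * d a y' z).
  move=> j; have [s h1 h2] : exists2 s, repL X i y (e j) s & _ := section_taylor Xy Dy
    (ex_intro2 _ _ W2 (conj oW2 (WW2 y nW.2)) (eW2 j)); first by exists s.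
have /choice[ce' hce'] : forall j, exists c : 'I_q -> pnt -> C, (forall a, regular_at X y (c a)) /\
    Ipow X k.+1 y (fun y' z => se j y' z - \sum_a c a y' * d a y' z).
  by move=> j; have [_ [c h1 h2]] := hse j; exists c.
pose ce a j := ce' j a.
have rce a j : regular_at X y (ce a j) by exact: (hce' j).1.
have hce j : Ipow X k.+1 y (fun y' z => se j y' z - \sum_a ce a j y' * d a y' z).
  exact: (hce' j).2.
have qle : (q <= m + \rank (mat y))%N.
  pose E : 'M[C]_(q, m) := \matrix_(a, j) ce a j y.
  have /choice[cb hcb] : forall a', exists cb : 'cV[C]_m * 'cV[C]_N,
      col a' 1%:M = E *m cb.1 + mat y *m cb.2.
    move=> a'; have [od _ _] := bas Xy (DQ Dy).
    have sd : section_at X y (secL i y (d a')) by exact: O2_secL.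
    have [c rc] := ge _ sd.
    have rs := repL_B (secL_repL y (d a') Xy cy) (repL_sum c Xy cy (fun j => (hse j).1)).
    have hI : Ipow X k.+1 y (fun y' z => (d a' y' z - \sum_j c j y' * se j y' z)
        - \sum_a ((a == a')%:R - \sum_j c j y' * ce a j y') * d a y' z).
      apply: (Ipow_ext Xy) (IpowN Xy (Ipow_comb Xy rc hce)) => y' z.
      exact: delta_sum_sub.
    move/(in_im_alphaP bas DQ tay erefl Xy Dy rs hI) => [b rb /near1_self hb].
    exists (\col_j c j y, \col_j (b j y / mv (nv i y) D)); apply/colP => a.
    transitivity ((a == a')%:R : C); first by rewrite 2!mxE.
    have /eqP := hb a; rewrite subr_eq => /eqP ->.
    rewrite [RHS]mxE [RHS]addrC; congr (_ + _).
      by rewrite mat_mul; apply: eq_bigr => j _; rewrite mxE mulrAC mulrA.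
    by rewrite mxE; apply: eq_bigr => j _; rewrite !mxE mulrC.
  apply: (@rank_sum_cover _ q m N E (\matrix_(j, a) (cb a).1 j ord0) (mat y)
    (\matrix_(j, a) (cb a).2 j ord0)).
  apply/matrixP => a a'; have /colP/(_ a) := hcb a'; rewrite [LHS]mxE => ->.
  rewrite [RHS]mxE [LHS]mxE; congr (_ + _); rewrite [LHS]mxE [RHS]mxE.
    by apply: eq_bigr => j _; congr (_ * _); rewrite [RHS]mxE.
  by apply: eq_bigr => j _; congr (_ * _); rewrite [RHS]mxE.
have mle := mat_rank_le gen P Xy cy.
(* This gives m + rho <= q <= m + rank of [mat y], while that rank is at most rho. *)
suff : ~~ (q < m + rho)%N by lia.
apply/negP => qlt.
have [PE [DE [DEy hPE]]] := regular_common (g := fun aj : 'I_q * 'I_m => ce aj.1 aj.2) Xy cy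
  (fun aj => rce aj.1 aj.2).
pose PM : 'M[{mpoly C[N]}]_(q, m) := \matrix_(a, j) PE (a, j).
(* A relation over [L] between the generators modulo the image. Cleared of denominators it has
   polynomial coefficients and holds on the whole chart, so freeness makes the coefficients of the
   generators vanish near [y], hence at the generic point. *)
have [c0 [b0 [c00 rel]]] := column_relation
  (map_mx (mmap iota (fun i => eta ord0 i)) PM) qlt.
have [G [H [H0 hG]]] := clear_denominators gfrac (fun l : 'I_m + 'I_N =>
  match l with inl j => c0 j ord0 | inr j => b0 j ord0 end).
have relp y' a : X y' -> chart i y' -> \sum_j mv (nv i y') (PM a j) * mv (nv i y') (G (inl j))
    = \sum_j mv (nv i y') (P a j) * mv (nv i y') (G (inr j)).
  move=> Xy' cy'; pose F := \sum_j PM a j * G (inl j) - \sum_j P a j * G (inr j).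
  have FE : mv (nv i y') F = \sum_j mv (nv i y') (PM a j) * mv (nv i y') (G (inl j))
      - \sum_j mv (nv i y') (P a j) * mv (nv i y') (G (inr j)).
    by rewrite /F mevalB !mv_sumM.
  apply/eqP; rewrite -subr_eq0 -FE; apply/eqP/(gen F).1; last exact: aff_nv.
  rewrite /F raddfB /= !mh_sumM.
  transitivity (mh iota eta H * ((map_mx (mmap iota (fun i => eta ord0 i)) PM *m c0) a ord0
     - (map_mx (mmap iota (fun i => eta ord0 i)) P *m b0) a ord0)).
    rewrite mulrBr; congr (_ - _); rewrite mxE mulr_sumr; apply: eq_bigr => j _.
      by rewrite hG [in RHS]mxE mulrCA.
    by rewrite hG [in RHS]mxE mulrCA.
  by rewrite rel subrr mulr0.
pose c j y' : C := mv (nv i y') (G (inl j)).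
have rc j : regular_at X y (c j) by exact: regular_poly.
have rs := repL_sum c Xy cy (fun j => (hse j).1).
have hI := Ipow_comb Xy rc hce.
have [|W' nW' hW'] := un c rc.
  apply/(in_im_alphaP bas DQ tay erefl Xy Dy rs hI).
  exists (fun j y' => mv (nv i y') (G (inr j) * D) / mv (nv i y') DE).
    by move=> j; apply: regular_frac.
  apply: near1W (near1I (near1_princ Xy Dy) (near1_princ Xy DEy)) => y' Xy' [Dy' DEy'] a.
  under [in RHS]eq_bigr => j _ do rewrite mevalM.
  under [in LHS]eq_bigr => j _ do rewrite (hPE y' Xy' DEy' (a, j)).
  apply: frac_relation Dy'.2 _; rewrite -relp //; last exact: Dy'.1.
  by apply: eq_bigr => j _; rewrite mxE.
have /cV0Pn[j cj0] := c00; case/negP: cj0.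
have [Q Qy QW] := nbhd_princ nW' cy.
have : mh iota eta (G (inl j)) = 0.
  apply: (gen_dense gen (gen_neq0 gen (aff_nv Xy cy) Qy.2)) => _ [z Xz [cz ->]] Qz.
  exact: (hW' j z (QW z (conj Xz (conj cz Qz)))).
by move/eqP; rewrite hG mulf_eq0 (negPf H0).
Qed.

End CokerRank.

Lemma sum_delta_family (F : comNzRingType) m q (h : 'I_m -> 'I_q) (c : 'I_m -> F) (u : 'I_q -> F) :
  \sum_a (\sum_j c j * (a == h j)%:R) * u a = \sum_j c j * u (h j).
Proof.
under eq_bigr => a _ do rewrite mulr_suml.
rewrite exchange_big; apply: eq_bigr => j _; rewrite (bigD1 (h j)) //= eqxx mulr1.
by rewrite big1 ?addr0 // => a /negPf ->; rewrite mulr0 mul0r.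
Qed.

Lemma sum_frac_solve (F : fieldType) n s (p : 'I_n -> F) (K : 'I_n -> 'I_s -> F) (c : 'I_s -> F)
    (D E : F) : D != 0 ->
  \sum_j p j / D * (\sum_l K j l * D / E * c l) = \sum_l (\sum_j p j * K j l) / E * c l.
Proof.
move=> D0; under eq_bigr => j _ do rewrite mulr_sumr.
rewrite exchange_big; apply: eq_bigr => l _; rewrite !mulr_suml; apply: eq_bigr => j _.
by rewrite !mulrA; congr (_ / E * _); rewrite -!mulrA [D^-1 * _]mulrC mulrA -mulrA mulfK.
Qed.

(** * The cokernel is free on a dense open set *)

Section CokerGeneric.
Variables (R : realType) (r : nat) (X : set (pt R r)) (i : 'I_r.+1).
Notation C := R[i].
Notation N := r.+1.
Notation dV := (dualV R r).
Notation pnt := (pt R r).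
Notation germ := (pnt -> pnt -> C).
Notation germL := (pnt -> dV -> C).
Implicit Types (x y z : pnt) (s : germ) (t : germL) (w : 'rV[C]_N).
Variables (L : fieldType) (iota : {rmorphism C -> L}) (eta : 'rV[L]_N).
Hypothesis gen : generic (aff i X) iota eta.
Variables (k q : nat) (Q0 D : {mpoly C[N]}) (d : 'I_q -> germ) (P : 'M[{mpoly C[N]}]_(q, N)).
Hypothesis bas : pp_basis X i k.+1 Q0 d.
Hypothesis DQ : forall y, princ i D y -> princ i Q0 y.
Hypothesis tay : taylor_matrix X i k.+1 D d P.

Local Notation cf a j := (fun y => mv (nv i y) (P a j) / mv (nv i y) D).
Local Notation mat := (mat i P).

(** Regularity is local, so the union of all open sets on which the sections are regular serves for
    the whole of [W]. *)
Lemma section_union (I : finType) (e : I -> germL) (W : set pnt) :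
  (forall y, W y -> forall l, exists2 W2, nbhd_in_square X y W2 & regular2L W2 (e l)) ->
  W `<=` X ->
  exists2 W2, open_in_square X W2 /\ (forall y, W y -> W2 (y, y))
    & forall l, regular2L W2 (e l).
Proof.
move=> h WX.
pose O : set (pnt * pnt) := [set p | exists O', [/\ zopen2 O', O' p &
  forall l, regular2L ((X `*` X) `&` O') (e l)]].
exists ((X `*` X) `&` O); first split.
- exists O => //; apply: zopen2_local => p [O' [oO' O'p rO']].
  have [a [b [F [hF Fp FO]]]] := zopen2_bihomog oO' O'p.
  by exists a, b, F; split=> // p' /FO O'p'; exists O'.
- move=> y Wy; split; first by split; apply: WX.
  have [W2 [[O' oO' W2E] W2y] rW2] := @nbhd2_fin _ _ X y _ (fun l W2 => regular2L W2 (e l)) (WX _ Wy)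
    (fun _ _ _ h1 h2 => regular2L_sub h1 h2) (h y Wy).
  exists O'; split=> //; first by move: W2y; rewrite W2E => -[].
  by move=> l; rewrite -W2E.
move=> l p [Xp [O' [oO' O'p /(_ l) rO']]].
have [O1 [a [b [F [G [oO1 O1p hF hG FG]]]]]] := rO' p (conj Xp O'p).
exists (O' `&` O1), a, b, F, G; split=> //; first exact: zopen2I.
by move=> y z v w [Xyz _] [O'yz O1yz]; apply: FG.
Qed.

(** Where a maximal minor of the Taylor matrix, with rows [f], is nonzero, the basis elements
    indexed by the other rows induce a basis of the cokernel. *)
Lemma coker_free_generic x0 : exists2 Q1, mh iota eta Q1 != 0 & exists m,
  coker_free_on X k m (X `&` princ i (D * Q1)).
Proof.
have [f [g [Q10 Q1P]]] := rank_point_eq gen P.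
set Q1 := \det _ in Q10 Q1P; exists Q1 => //.
pose S := [pred a | a \notin codom f].
pose h (j : 'I_#|S|) : 'I_q := enum_val j.
have hf a : (exists l, a = f l) \/ (exists j, a = h j).
  have [/codomP[l ->]|na] := boolP (a \in codom f); first by left; exists l.
  have aS : a \in S by rewrite inE.
  by right; exists (enum_rank_in aS a); rewrite /h enum_rankK_in.
have fh l j : (f l == h j) = false.
  by apply/negP => /eqP E; have := enum_valP j; rewrite -/(h j) -E inE codom_f.
have hinj : injective h by exact: enum_val_inj.
exists #|S|, (fun j => secL i x0 (d (h j))); split.
  apply: section_union => [y [Xy DQy] j|y []//].
  by have [od _ _] := bas Xy (DQ (princ_dvd DQy)); apply: O2_secL.
move=> y [Xy]; rewrite princM => -[Dy Q1y]; have cy := Dy.1.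
have re (c : 'I_#|S| -> pnt -> C) := repL_sum c Xy cy (fun j => secL_repL x0 (d (h j)) Xy cy).
split=> [t st|c rc].
  have [s ts [c rc hI]] := section_taylor bas DQ Xy Dy st.
  pose K := colsub g 1%:M *m \adj (mxsub f g P).
  have PK l l' : \sum_j P (f l) j * K j l' = Q1 *+ (l == l').
    transitivity ((rowsub f P *m K) l l').
      by rewrite [RHS]mxE; apply: eq_bigr => j _; congr (_ * _); rewrite [RHS]mxE.
    by rewrite /K mulmxA mul_rowsub_colsub mul_mx_adj [LHS]mxE.
  have mvPK y' l l' : \sum_j mv (nv i y') (P (f l) j) * mv (nv i y') (K j l')
      = mv (nv i y') Q1 *+ (l == l').
    transitivity (mv (nv i y') (\sum_j P (f l) j * K j l')); first by rewrite mv_sumM.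
    by rewrite PK; case: (l == l'); rewrite ?mulr0n ?meval0.
  (* Cramer's rule: (P/D) b equals [c] on the rows [f]; the difference on the other rows is [c']. *)
  pose b j y' : C := \sum_l mv (nv i y') (K j l) * mv (nv i y') D / mv (nv i y') Q1 * c (f l) y'.
  have rb j : regular_at X y (b j).
    apply: regular_germ_sum => // l; apply: regular_germM (rc (f l)).
    apply: regular_eq (regular_frac (K j l * D) Xy Q1y).
    by apply: near1W (near1_princ Xy Dy) => y' _ _; rewrite mevalM.
  pose c' j y' : C := c (h j) y' - \sum_l cf (h j) l y' * b l y'.
  have rc' j : regular_at X y (c' j).
    apply: regular_germD (rc _) _.
    have h1 : regular_at X y (fun y' => \sum_l cf (h j) l y' * b l y').
      by apply: regular_germ_sum => // l; apply: regular_germM (rb l); exact: regular_cf.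
    apply: regular_eq (regular_germM (regular_germC (-1) Xy) h1).
    by apply: near1W (near1_princ Xy Dy) => y' _ _; rewrite mulN1r.
  exists c' => //.
  have hI' : Ipow X k.+1 y (fun y' z => (s y' z - \sum_j c' j y' * d (h j) y' z)
      - \sum_a (c a y' - \sum_j c' j y' * (a == h j)%:R) * d a y' z).
    apply: (Ipow_ext Xy) hI => y' z.
    under [X in _ = _ - X]eq_bigr => a _ do rewrite mulrBl.
    rewrite sumrB (sum_delta_family h (fun j => c' j y') (fun a => d a y' z)).
    by rewrite opprB addrA subrK.
  apply/(in_im_alphaP bas DQ tay erefl Xy Dy (repL_B ts (re c')) hI').
  exists b => //; apply: near1W (near1I (near1_princ Xy Dy) (near1_princ Xy Q1y)).
  move=> y' Xy' [Dy' Q1y'] a; have [[l ->]|[j ->]] := hf a.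
    rewrite big1 ?subr0 => [|j _]; last by rewrite fh mulr0.
    rewrite sum_frac_solve; last exact: Dy'.2.
    under [RHS]eq_bigr => l' _ do rewrite mvPK.
    rewrite (bigD1 l) //= big1 ?addr0 => [|l' /negPf l'l].
      by rewrite eqxx divff ?mul1r //; exact: Q1y'.2.
    by rewrite eq_sym l'l mulr0n !mul0r.
  rewrite (bigD1 j) //= eqxx mulr1 big1 ?addr0 => [|j' jj']; last first.
    by rewrite (inj_eq hinj) eq_sym (negPf jj') mulr0.
  by rewrite /c' opprB addrC subrK.
have hI : Ipow X k.+1 y (fun y' z => (\sum_j c j y' * d (h j) y' z)
      - \sum_a (\sum_j c j y' * (a == h j)%:R) * d a y' z).
  apply: (Ipow_ext Xy) (Ipow_0 Xy k.+1) => y' z.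
  by rewrite (sum_delta_family h (fun j => c j y') (fun a => d a y' z)) subrr.
move/(in_im_alphaP bas DQ tay erefl Xy Dy (re c) hI) => [b rb hb].
have [W' nW' hW'] := near1I (near1I (near1_princ Xy Dy) (near1_princ Xy Q1y)) hb.
exists W' => // j z W'z; have [[Dz Q1z] hz] := hW' z W'z; have Xz := open_in_sub nW'.1 W'z.
have [u rk] := Q1P _ (aff_nv Xz Dz.1) Q1z.2.
have bz a : \sum_j c j z * (a == h j)%:R = (mat z *m (\col_l (b l z / mv (nv i z) D))) a ord0.
  by rewrite hz mat_mul; apply: eq_bigr => l _; rewrite mxE mulrAC mulrA.
have hr : rowsub f (mat z) *m (\col_l (b l z / mv (nv i z) D)) = 0.
  rewrite mul_rowsub_mx; apply/colP => l; rewrite [RHS]mxE [LHS]mxE -bz big1 // => j' _.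
  by rewrite fh mulr0.
have /colP/(_ (h j)) := rows_ker u rk hr.
rewrite -bz [RHS]mxE (bigD1 j) //= eqxx mulr1 big1 ?addr0 // => j' jj'.
by rewrite (inj_eq hinj) eq_sym (negPf jj') mulr0.
Qed.

End CokerGeneric.

(** * The open set Uk and matrices for the projective tangent spaces *)

Section Tangents.
Variables (R : realType) (r : nat) (X : set (pt R r)) (i : 'I_r.+1).
Notation C := R[i].
Notation N := r.+1.
Notation dV := (dualV R r).
Notation pnt := (pt R r).
Notation germ := (pnt -> pnt -> C).
Notation germL := (pnt -> dV -> C).
Implicit Types (x y z : pnt) (s : germ) (t : germL) (w : 'rV[C]_N).
Variables (L : fieldType) (iota : {rmorphism C -> L}) (eta : 'rV[L]_N).
Hypothesis gen : generic (aff i X) iota eta.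
Hypothesis gfrac : forall u : L, exists P Q,
  mh iota eta Q != 0 /\ u = mh iota eta P / mh iota eta Q.
Hypothesis dX : dense_chart i X.

Local Notation e := (\rank (gtsp (aff i X) iota eta)).

Lemma Ipow_diag m x s : Ipow X m.+1 x s -> s x x = 0.
Proof.
move=> [n [a [b [ha hb /near2_diag/near1_self ->]]]]; rewrite big1 // => l _.
by rewrite big_ord_recl (near1_self (ha l ord0).2) !mul0r.
Qed.

Lemma nonsingularP x : X x -> chart i x ->
  nonsingular_at X x <-> \rank (tsp (aff i X) (nv i x)) = e.
Proof.
move=> Xx cx; rewrite /nonsingular_at (has_dim_aff gen dX) (dim_tangent cx) //.
by split=> [[]|].
Qed.

Lemma coker_free_sub k m (W W' : set pnt) : W' `<=` W ->
  coker_free_on X k m W -> coker_free_on X k m W'.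
Proof.
move=> W'W [f [[W2 [oW2 WW2] fW2] h]]; exists f; split.
  by exists W2 => //; split=> // y /W'W; apply: WW2.
by move=> y /W'W; apply: h.
Qed.

Lemma taylor_data k x : X x -> chart i x -> nonsingular_at X x ->
  exists q (d : 'I_q -> germ) Q0 D (P : 'M[{mpoly C[N]}]_(q, N)),
  [/\ pp_basis X i k.+1 Q0 d, princ i D x, forall y, princ i D y -> princ i Q0 y
    & taylor_matrix X i k.+1 D d P].
Proof.
move=> Xx cx /(nonsingularP Xx cx) rx; have Ax := aff_nv Xx cx.
have [psi ca] := coord_exists Ax rx.
have [q [d bas]] := pp_basis_exists k.+1 gen Ax ca.
have Qx : princ i (\det (jac psi)) x by split=> //; case: ca.
have [D [P [Dx DQ tay]]] := taylor_matrix_exists bas Xx Qx.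
by exists q, d, (\det (jac psi)), D, P.
Qed.

Lemma Uk_generic k : exists2 Q, mh iota eta Q != 0 & forall y, X y -> princ i Q y -> Uk X k y.
Proof.
have [Qs Qs0 hQs] := tsp_rank_generic gen.
have [x0 [Xx0 Qsx0 Ax0]] := gen_princ gen Qs0.
have nsP y : X y -> princ i Qs y -> nonsingular_at X y.
  by move=> Xy Qsy; apply/(nonsingularP Xy Qsy.1)/hQs; [exact: aff_nv Xy Qsy.1 | exact: Qsy.2].
have /choice[Qf hQ] : forall k' : 'I_k.+1, exists Q, mh iota eta Q != 0 /\
    exists m, coker_free_on X k' m (X `&` princ i Q).
  move=> k'; have [q [d [Q0 [D [P [bas Dx DQ tay]]]]]] := taylor_data k' Xx0 Qsx0.1 (nsP x0 Xx0 Qsx0).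
  have [Q1 Q10 hm] := coker_free_generic gen bas DQ tay x0.
  exists (D * Q1); split=> //; rewrite mhM mulf_neq0 //.
  exact: (gen_neq0 gen Ax0 Dx.2).
pose Q := \prod_k' Qf k'.
have Q0 : mh iota eta Q != 0 by apply: gen_prod => k'; have [] := hQ k'.
exists (Qs * Q) => [|y Xy QQy]; first by rewrite mhM mulf_neq0.
exists (X `&` princ i (Qs * Q)); split; first exact: princ_nbhd.
  by move=> z [Xz]; rewrite princM => -[Qsz _]; apply: nsP.
move=> k' k'k; have [_ [m hm]] := hQ (inord k').
exists m => z Wz; exists (X `&` princ i (Qs * Q)); split=> //.
  by apply: princ_nbhd; case: Wz.
rewrite inordK // in hm; apply: coker_free_sub hm => z' [Xz']; rewrite princM => -[_ Qz'].
by split; [exact: Xz' | exact: (@princ_prod _ _ i k.+1 Qf z' (inord k') Qz')].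
Qed.

Lemma UkX k x : Uk X k x -> X x.
Proof. by move=> [W [nW _ _]]; apply: (open_in_sub nW.1 nW.2). Qed.

Lemma Uk_nonsingular k x : Uk X k x -> nonsingular_at X x.
Proof. by move=> [W [nW h _]]; apply: h nW.2. Qed.

Lemma Uk_open k : open_in X (Uk X k).
Proof.
exists [set x | exists W O, [/\ zopen O, O x, W = X `&` O & W `<=` Uk X k]].
  apply: zopen_local => x [W [O [oO Ox WE WU]]]; exists O; split=> //.
  by move=> y Oy; exists W, O.
apply/seteqP; split=> [x Ux|x [Xx [W [O [oO Ox -> WU]]]]]; last exact: WU.
split; first exact: UkX Ux.
have [W [nW h1 h2]] := Ux; have [[O oO WE] Wx] := nW.
exists W, O; split=> //; first by move: Wx; rewrite WE => -[].
by move=> y Wy; exists W; split=> //; case: nW.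
Qed.

(** [coker_rank] applies at every point [y] of [Uk] where the expansion is defined, so the matrix
    obtained at [x] describes [That] there without shrinking to an unknown open set. *)
Lemma That_matrix k x : Uk X k x -> chart i x ->
  exists q D (P : 'M[{mpoly C[N]}]_(q, N)), princ i D x /\
  forall y, Uk X k y -> princ i D y ->
    [/\ forall v : 'rV[C]_N, v \in That X k y <-> (v <= mat i P y)%MS,
        \rank (mat i P y) = rho iota eta P
      & exists2 v : 'rV[C]_N, v \in That X k y & v ord0 i != 0].
Proof.
move=> Ux cx.
have [q [d [Q0 [D [P [bas Dx DQ tay]]]]]] := taylor_data k (UkX Ux) cx (Uk_nonsingular Ux).
exists q, D, P; split=> // y Uy Dy; have Xy := UkX Uy.
have rk : \rank (mat i P y) = rho iota eta P.
  have [W [nW _ /(_ k (leqnn k))[m hm]]] := Uy; have [W' [nW' _ hW']] := hm y nW.2.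
  exact: (coker_rank gen gfrac bas DQ tay Xy Dy nW' hW').
have TE v := That_rowspace gen bas DQ tay v Xy Dy rk.
(* The i-th coordinate function is 1 on the chart, so its expansion restricted to the diagonal is
   nonzero, and so is column i of P(y). *)
split=> //; have := Ipow_diag (tay y Xy Dy i); rewrite (nv1 Dy.1) => /eqP.
rewrite subr_eq0 => /eqP h.
have [a Pa] : exists a, mv (nv i y) (P a i) != 0.
  apply: contrapT => h'; move: h; rewrite big1 => [/eqP|a _]; first by rewrite oner_eq0.
  have [->|Pa0] := eqVneq (mv (nv i y) (P a i)) 0; first by rewrite !mul0r.
  by case: h'; exists a.
exists (row a (mat i P y)); last by rewrite 2!mxE.
by apply/TE; apply: row_sub.
Qed.

End Tangents.

(** * The fundamental form *)

Section QuotientRule.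
Variables (F : numFieldType) (n : nat).
Implicit Types (P Q R : {mpoly F[n]}) (v u : 'rV[F]_n).

Lemma dderB P Q v u : dder (P - Q) v u = dder P v u - dder Q v u.
Proof. by rewrite /dder -sumrB; apply: eq_bigr => i _; rewrite mderivB mevalB mulrBl. Qed.

Definition qder P Q v u : F :=
  (dder P v u * mv v Q - mv v P * dder Q v u) / mv v Q ^+ 2.

Lemma qder_scale P Q R v u : mv v Q != 0 -> mv v R != 0 ->
  qder (P * R) (Q * R) v u = qder P Q v u.
Proof.
rewrite /qder !dderM !mevalM; move: (mv v P) (mv v Q) (mv v R) (dder P v u).
by move: (dder Q v u) (dder R v u) => a b p q s e q0 s0; field; rewrite q0 s0.
Qed.

Lemma qder_lin c P Q P' Q' v u : mv v Q != 0 -> mv v Q' != 0 ->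
  qder (c%:MP * P * Q' + P' * Q) (Q * Q') v u = c * qder P Q v u + qder P' Q' v u.
Proof.
rewrite /qder dderD !dderM mevalD !mevalM dderC mevalC.
move: (mv v P) (mv v Q) (mv v P') (mv v Q') (dder P v u) (dder P' v u).
by move: (dder Q v u) (dder Q' v u) => a b p q s t e f q0 t0; field; rewrite q0 t0.
Qed.

Lemma qder_mul P Q P' Q' v u : mv v Q != 0 -> mv v Q' != 0 ->
  qder (P * P') (Q * Q') v u
  = mv v P / mv v Q * qder P' Q' v u + mv v P' / mv v Q' * qder P Q v u.
Proof.
rewrite /qder !dderM !mevalM.
move: (mv v P) (mv v Q) (mv v P') (mv v Q') (dder P v u) (dder P' v u).
by move: (dder Q v u) (dder Q' v u) => a b p q s t e f q0 t0; field; rewrite q0 t0.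
Qed.

Lemma qder_eq P Q P' Q' v u : mv v Q != 0 -> mv v Q' != 0 ->
  mv v (P * Q' - P' * Q) = 0 -> dder (P * Q' - P' * Q) v u = 0 ->
  qder P Q v u = qder P' Q' v u.
Proof.
move=> q0 t0; rewrite mevalB !mevalM dderB !dderM /qder.
move: (mv v P) (mv v Q) q0 (mv v P') (mv v Q') t0 (dder P v u) (dder P' v u).
move: (dder Q v u) (dder Q' v u) => a b p q q0 s t t0 e f /eqP; rewrite subr_eq0 => /eqP h h2.
apply: (mulfI (mulf_neq0 (expf_neq0 2 q0) (expf_neq0 2 t0))).
have -> : q ^+ 2 * t ^+ 2 * ((e * q - p * a) / q ^+ 2) = t ^+ 2 * (e * q - p * a).
  by field; rewrite q0.
have -> : q ^+ 2 * t ^+ 2 * ((f * t - s * b) / t ^+ 2) = q ^+ 2 * (f * t - s * b).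
  by field; rewrite t0.
apply/eqP; rewrite -subr_eq0.
have -> : t ^+ 2 * (e * q - p * a) - q ^+ 2 * (f * t - s * b)
  = t * q * (e * t + p * b - (f * q + s * a)) + (t * a + q * b) * (s * q - p * t) by ring.
by rewrite h2 h subrr !mulr0 addr0.
Qed.

(* Euler's relation: only the class of u modulo v matters. *)
Lemma qder_homog d P Q v u c m : P \is d.-homog -> Q \is d.-homog -> c != 0 -> mv v Q != 0 ->
  qder P Q (c *: v) (c *: (u + m *: v)) = qder P Q v u.
Proof.
move=> hP hQ c0; rewrite /qder !(dder_scale _ _ _ hP) !(dder_scale _ _ _ hQ).
rewrite (mv_scale _ _ hP) (mv_scale _ _ hQ) [u + _]addrC !dder_lin (dder_euler _ hP) (dder_euler _ hQ).
have e0 : c ^+ d != 0 by rewrite expf_neq0.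
move: (mv v P) (mv v Q) (dder P v u) (dder Q v u) (d%:R : F) (c ^+ d) e0.
by move=> p q a b k e e0 q0; field; rewrite q0 e0.
Qed.

Lemma qder_horiz (i : 'I_n) d P Q P' Q' v u : v ord0 i = 1 -> u ord0 i = 0 ->
  (forall w : 'rV_n, w ord0 i != 0 -> mv w P' = w ord0 i ^+ d * mv ((w ord0 i)^-1 *: w) P /\
     mv w Q' = w ord0 i ^+ d * mv ((w ord0 i)^-1 *: w) Q) ->
  qder P' Q' v u = qder P Q v u.
Proof.
move=> v1 u0 h; have E s : mv (v + s *: u) P' = mv (v + s *: u) P /\
    mv (v + s *: u) Q' = mv (v + s *: u) Q.
  have w1 : (v + s *: u) ord0 i = 1 by rewrite !mxE v1 u0 mulr0 addr0.
  have w0 : (v + s *: u) ord0 i != 0 by rewrite w1 oner_neq0.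
  by have [-> ->] := h _ w0; rewrite w1 expr1n invr1 scale1r !mul1r.
have [eP eQ] := E 0; rewrite scale0r addr0 in eP eQ.
rewrite /qder eP eQ (dder_eq_line (fun s => (E s).1)) (dder_eq_line (fun s => (E s).2)) //.
Qed.

End QuotientRule.

Lemma frac_lin (F : fieldType) (c p q p' q' : F) : q != 0 -> q' != 0 ->
  c * (p / q) + p' / q' = (c * p * q' + p' * q) / (q * q').
Proof. by move=> q0 q'0; field; rewrite q0 q'0. Qed.

Lemma mv_frac_scale (F : fieldType) n (v : 'rV[F]_n) (P Q R : {mpoly F[n]}) :
  mv v R != 0 -> mv v (P * R) / mv v (Q * R) = mv v P / mv v Q.
Proof. by move=> R0; rewrite !mevalM -mulf_div divff // mulr1. Qed.

Lemma mv_frac_mul (F : fieldType) n (v : 'rV[F]_n) (P Q P' Q' : {mpoly F[n]}) :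
  mv v P / mv v Q * (mv v P' / mv v Q') = mv v (P * P') / mv v (Q * Q').
Proof. by rewrite !mevalM mulf_div. Qed.

Lemma mv_frac_lin (F : fieldType) n (v : 'rV[F]_n) c (P Q P' Q' : {mpoly F[n]}) :
  mv v Q != 0 -> mv v Q' != 0 -> c * (mv v P / mv v Q) + mv v P' / mv v Q'
  = mv v (c%:MP * P * Q' + P' * Q) / mv v (Q * Q').
Proof. by move=> q0 q'0; rewrite mevalD !mevalM mevalC; apply: frac_lin. Qed.

(** * Construction of local vector fields *)

Section LocalFields.
Variables (R : realType) (r : nat) (X : set (pt R r)) (i : 'I_r.+1).
Notation C := R[i].
Notation N := r.+1.
Notation pnt := (pt R r).
Implicit Types (x y z : pnt) (w : 'rV[C]_N).
Variables (L : fieldType) (iota : {rmorphism C -> L}) (eta : 'rV[L]_N).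
Hypothesis gen : generic (aff i X) iota eta.

Local Notation A := (aff i X).
Local Notation e := (\rank (gtsp A iota eta)).

Definition rep_at (g : pnt -> C) y (P Q : {mpoly C[N]}) := princ i Q y /\
  forall y', X y' -> princ i Q y' -> g y' = mv (nv i y') P / mv (nv i y') Q.

Lemma princ_mul P Q y : princ i P y -> princ i Q y -> princ i (P * Q) y.
Proof. by move=> hP hQ; rewrite princM; split. Qed.

Lemma rep_at_near g y P Q : rep_at g y P Q -> forall y', princ i Q y' -> rep_at g y' P Q.
Proof. by move=> [_ h] y' Qy'; split. Qed.

Lemma regular_rep_in W g y : open_in X W -> W y -> regular W g -> chart i y ->
  exists P Q, rep_at g y P Q /\ X `&` princ i Q `<=` W.
Proof.
move=> oW Wy gW cy; have rg : regular_at X y g by exists W.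
have [P [Q [Qy h]]] := regular_rep rg cy.
have nW : nbhd_in X y W by [].
have [Q1 Q1y Q1W] := nbhd_princ nW cy.
exists (P * Q1), (Q * Q1); split; last first.
  by move=> z [Xz]; rewrite princM => -[_ Q1z]; apply: Q1W.
split; first exact: princ_mul Qy Q1y.
move=> z Xz; rewrite princM => -[Qz Q1z].
by rewrite (mv_frac_scale _ _ Q1z.2); exact: h.
Qed.

(** The cross-multiplied difference of the two fractions is an equation of [A], which a tangent
    vector annihilates. *)
Lemma qder_unique g y P Q P' Q' xi : X y -> rep_at g y P Q -> rep_at g y P' Q' ->
  (xi <= tsp A (nv i y))%MS -> qder P Q (nv i y) xi = qder P' Q' (nv i y) xi.
Proof.
move=> Xy [Qy h] [Q'y h'] /tspP xiT; have Ay := aff_nv Xy Qy.1.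
have vF : forall z : 'rV[C]_N, A z -> mv z (P * Q' - P' * Q) = 0.
  apply/gen; apply: (gen_dense gen (Q := Q * Q')) => [|_ [z Xz [cz ->]] QQz].
    by rewrite mhM mulf_neq0 ?(gen_neq0 gen Ay) //; [exact: Qy.2 | exact: Q'y.2].
  have [Qz Q'z] : princ i Q z /\ princ i Q' z.
    by apply: (_ : (princ i Q `&` princ i Q') z); rewrite -princM; split.
  have := h z Xz Qz; rewrite (h' z Xz Q'z) mevalB !mevalM => /eqP.
  rewrite eqr_div; [|exact: Q'z.2 | exact: Qz.2] => /eqP ->.
  by rewrite subrr.
apply: qder_eq; [exact: Qy.2 | exact: Q'y.2 | exact: vF | exact: xiT].
Qed.

Section Field.
Variables (psi : 'I_N -> {mpoly C[N]}) (b0 : 'rV[C]_N) (kap : 'I_N -> C).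
Hypothesis Ab0 : A b0.
Hypothesis ca : coord_at A iota eta b0 psi.

Definition fieldv w : 'rV[C]_N := \sum_(l < N | (l < e)%N) kap l *: cvec psi l w.
Definition fieldp j : {mpoly C[N]} := \sum_(l < N | (l < e)%N) (kap l)%:MP * \adj (jac psi) j l.

Lemma fieldvE w j : fieldv w ord0 j = mv w (fieldp j).
Proof.
rewrite /fieldv /fieldp raddf_sum summxE; apply: eq_bigr => l _ /=.
by rewrite mevalM mevalC [LHS]mxE [X in _ * X]mxE.
Qed.

Lemma fieldv_tangent w : A w -> (fieldv w <= tsp A w)%MS.
Proof.
move=> Aw; apply: summx_sub => l le; apply: scalemx_sub.
exact: (cvec_tangent gen Ab0 ca).
Qed.

Definition fieldD P := \sum_j P^`M(j) * fieldp j.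

Lemma fieldDE w P : mv w (fieldD P) = dder P w (fieldv w).
Proof. by rewrite mv_sumM; apply: eq_bigr => j _; rewrite fieldvE. Qed.

(** The quotient rule along [fieldv], for any fraction representing [g] around [y]; the value is 0
    if there is none. Independence of the fraction comes from the tangency of [fieldv]. *)
Definition Dfield (g : pnt -> C) y : C := xget 0 [set c | exists P Q,
  rep_at g y P Q /\ c = qder P Q (nv i y) (fieldv (nv i y))].

Lemma DfieldE g y P Q : X y -> rep_at g y P Q ->
  Dfield g y = qder P Q (nv i y) (fieldv (nv i y)).
Proof.
move=> Xy h.
pose S : set C := [set c | exists P Q,
  rep_at g y P Q /\ c = qder P Q (nv i y) (fieldv (nv i y))].
have : S (Dfield g y).
  apply: (@xgetPex _ 0 S); exists (qder P Q (nv i y) (fieldv (nv i y))).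
  by exists P, Q.
move=> [P' [Q' [h' ->]]].
apply: (qder_unique Xy h' h); apply: fieldv_tangent; exact: aff_nv Xy h.1.1.
Qed.

Lemma Dfield_vector_field : vector_field X (X `&` princ i 1) Dfield.
Proof.
move=> W g h oW Wi gW hW.
have Wp y : W y -> X y /\ chart i y by move=> /Wi[Xy []].
split.
- apply: (regular_princ (i := i)) => y Wy; have [Xy cy] := Wp y Wy.
  have [P [Q [hPQ _]]] := regular_rep_in oW Wy gW cy.
  exists (fieldD P * Q - P * fieldD Q), (Q * Q); split; first by rewrite princM; split; exact: hPQ.1.
  move=> y' /Wp[Xy' _]; rewrite princM => -[Qy' _].
  rewrite (DfieldE Xy' (rep_at_near hPQ Qy')) /qder mevalB !mevalM !fieldDE.
  by rewrite expr2.
- move=> gh y Wy; have [Xy cy] := Wp y Wy.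
  have [P [Q [hPQ QW]]] := regular_rep_in oW Wy gW cy.
  have hPQ' : rep_at h y P Q.
    split=> [|z Xz Qz]; first exact: hPQ.1.
    by rewrite -(gh z (QW z (conj Xz Qz))); exact: hPQ.2.
  exact: etrans (DfieldE Xy hPQ) (esym (DfieldE Xy hPQ')).
- move=> c y Wy; have [Xy cy] := Wp y Wy.
  have [P [Q [hPQ _]]] := regular_rep_in oW Wy gW cy.
  have [P' [Q' [hPQ' _]]] := regular_rep_in oW Wy hW cy.
  rewrite (DfieldE Xy hPQ) (DfieldE Xy hPQ').
  rewrite -(qder_lin _ _ _ _ hPQ.1.2 hPQ'.1.2); apply: (DfieldE Xy).
  split; first exact: princ_mul hPQ.1 hPQ'.1.
  move=> z Xz; rewrite princM => -[Qz Q'z]; rewrite (hPQ.2 z Xz Qz) (hPQ'.2 z Xz Q'z).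
  exact: mv_frac_lin Qz.2 Q'z.2.
move=> y Wy; have [Xy cy] := Wp y Wy.
have [P [Q [hPQ _]]] := regular_rep_in oW Wy gW cy.
have [P' [Q' [hPQ' _]]] := regular_rep_in oW Wy hW cy.
rewrite (DfieldE Xy hPQ) (DfieldE Xy hPQ') (hPQ.2 y Xy hPQ.1) (hPQ'.2 y Xy hPQ'.1).
rewrite -(qder_mul _ _ _ hPQ.1.2 hPQ'.1.2); apply: (DfieldE Xy).
split; first exact: princ_mul hPQ.1 hPQ'.1.
move=> z Xz; rewrite princM => -[Qz Q'z]; rewrite (hPQ.2 z Xz Qz) (hPQ'.2 z Xz Q'z).
exact: mv_frac_mul.
Qed.

Lemma lift_tangent_scale x (u : tangentP x) (c : C) : chart i x ->
  exists m, lift_tangent u (c *: nvl i x) = c *: (theta i u + m *: nv i x).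
Proof.
move=> cx; exists ((lift_tangent u (nvl i x) : 'rV[C]_N) ord0 i).
rewrite /lift_tangent linearZ linearZ; congr (_ *: _); exact: lift_tangentE.
Qed.

Lemma Dfield_value x (u : tangentP x) : X x -> chart i x -> fieldv (nv i x) = theta i u ->
  value_at X Dfield u.
Proof.
move=> Xx cx E W g F G nW [[d hF hG] FG] v v0.
have [c vE] := subvs_nvl cx v.
have c0 : c != 0 by apply: contraNneq v0 => c0; rewrite vE c0 scale0r.
have [Q1 Q1x Q1W] := nbhd_princ nW cx.
have [G0 _] := FG x _ nW.2 (hcoord_nv cx).
have h : rep_at g x (F * Q1) (G * Q1).
  split; first exact: princ_mul (conj cx G0) Q1x.
  move=> z Xz; rewrite princM => -[Gz Q1z].
  have [_ ->] := FG z _ (Q1W z (conj Xz Q1z)) (hcoord_nv Gz.1).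
  by rewrite (mv_frac_scale _ _ Q1z.2).
rewrite (DfieldE Xx h) (qder_scale _ _ G0 Q1x.2) E.
have vV : vsval v = c *: nv i x by rewrite vE -(vsval_nvl cx).
have [m lE] := lift_tangent_scale u c cx.
rewrite vV vE lE; exact: esym (qder_homog (theta i u) m hF hG c0 G0).
Qed.

End Field.

End LocalFields.

(* Differentiation along u of b = beta P / Delta, modulo the rows of P. *)
Lemma frame_derivative (F : fieldType) s n (P dP : 'M[F]_(s, n)) (b db : 'rV[F]_n)
    (be dbe c : 'rV[F]_s) (E dE De dDe : F) (v : 'rV[F]_n) :
  De != 0 -> E != 0 -> De *: db + dDe *: b = dbe *m P + be *m dP ->
  b = E *: v -> v = c *m P -> be = (E * De) *: c ->
  ((E ^+ 2)^-1 *: (E *: db - dE *: b) - c *m dP <= P)%MS.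
Proof.
move=> De0 E0 h bE vE beE.
have -> : (E ^+ 2)^-1 *: (E *: db - dE *: b) - c *m dP
   = (E^-1 / De) *: dbe *m P - ((E^-1 / De * dDe * E + E^-1 * dE) *: c) *m P.
  have dbE : db = De^-1 *: (dbe *m P + be *m dP - dDe *: b).
    by rewrite -h addrK scalerA mulVf // scale1r.
  rewrite dbE beE bE vE -!scalemxAl.
  apply/rowP => j; rewrite !mxE.
  set x := \sum_j0 _; set y := \sum_j0 _; set z := \sum_j0 _.
  by field; rewrite De0 E0.
by rewrite -mulmxBl submxMl.
Qed.

Section MatrixDerivative.
Variables (F : numFieldType) (n : nat).
Implicit Types (v u : 'rV[F]_n).

Definition dmx p q (M : 'M[{mpoly F[n]}]_(p, q)) v u : 'M[F]_(p, q) :=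
  map_mx (fun P => dder P v u) M.

Lemma dder_sum (I : finType) (P : I -> {mpoly F[n]}) v u :
  dder (\sum_l P l) v u = \sum_l dder (P l) v u.
Proof.
apply: (big_morph (fun P => dder P v u)) => [P' Q|]; first exact: dderD.
by rewrite -[0](mpolyC0 n F) dderC.
Qed.

Lemma dmx_mul p q m (A : 'M[{mpoly F[n]}]_(p, q)) (B : 'M_(q, m)) v u :
  dmx (A *m B) v u = dmx A v u *m map_mx (mv v) B + map_mx (mv v) A *m dmx B v u.
Proof.
apply/matrixP => a b; rewrite [LHS]mxE [in LHS]mxE dder_sum [RHS]mxE.
rewrite [X in _ = X + _]mxE [X in _ = _ + X]mxE -big_split; apply: eq_bigr => l _.
by rewrite dderM /= [in RHS]mxE [X in _ = _ * X + _]mxE [X in _ = _ + X * _]mxE [X in _ = _ + _ * X]mxE.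
Qed.

End MatrixDerivative.

Lemma frame_solve (F : fieldType) s n (M : 'M[F]_(s, n)) (g : 'I_s -> 'I_n) (b : 'rV[F]_n) :
  (b <= M)%MS -> colsub g b *m \adj (colsub g M) *m M = \det (colsub g M) *: b.
Proof.
move=> /submxP[c ->]; rewrite -mulmx_colsub -[_ *m _ *m \adj _]mulmxA mul_mx_adj.
by rewrite mul_mx_scalar -scalemxAl.
Qed.

Lemma frame_coord (F : fieldType) s n (M : 'M[F]_(s, n)) (g : 'I_s -> 'I_n) (E : F) (c : 'rV[F]_s) :
  colsub g (E *: (c *m M)) *m \adj (colsub g M) = (E * \det (colsub g M)) *: c.
Proof.
rewrite scalemxAl -mulmx_colsub -mulmxA mul_mx_adj.
by rewrite mul_mx_scalar scalerA mulrC.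
Qed.

Lemma scale_subE (F : fieldType) n (x y z a b : F) (U W : 'rV[F]_n) j :
  U ord0 j = a -> W ord0 j = b -> (x *: (y *: U - z *: W)) ord0 j = x * (y * a - z * b).
Proof. by move=> <- <-; rewrite !mxE. Qed.

Lemma scale_addE (F : fieldType) n (y z a b : F) (U W : 'rV[F]_n) j :
  U ord0 j = a -> W ord0 j = b -> (y *: U + z *: W) ord0 j = y * a + z * b.
Proof. by move=> <- <-; rewrite !mxE. Qed.

Lemma quotient_comm (F : fieldType) (a b c d : F) :
  (a * b - c * d) / b ^+ 2 = (b ^+ 2)^-1 * (b * a - d * c).
Proof. by rewrite mulrC [a * b]mulrC [c * d]mulrC. Qed.

(** * Computation of the fundamental form in a frame *)

Section FundForm.
Variables (R : realType) (r : nat) (X : set (pt R r)) (i : 'I_r.+1).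
Notation C := R[i].
Notation N := r.+1.
Notation pnt := (pt R r).
Implicit Types (x y z : pnt) (w : 'rV[C]_N).
Variables (L : fieldType) (iota : {rmorphism C -> L}) (eta : 'rV[L]_N).
Hypothesis gen : generic (aff i X) iota eta.
Hypothesis dX : dense_chart i X.
Variable k : nat.

Local Notation A := (aff i X).

(** Prescribing the value of a field at [x] fixes its action at [x] on every regular germ, whence
    the independence of the field. *)
Lemma value_rep D x (u : tangentP x) g P Q : X x -> value_at X D u ->
  rep_at X i g x P Q -> D g x = qder P Q (nv i x) (theta i u).
Proof.
move=> Xx Du [Qx h]; have cx := Qx.1.
have [d [F [G [hF hG FG]]]] := homogenize_pair i P Q.
have FG' y (v : 'rV[C]_N) : princ i Q y -> hcoord y v ->
    ev G v != 0 /\ ev F v / ev G v = mv (nv i y) P / mv (nv i y) Q.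
  move=> Qy yv; have v0 : v ord0 i != 0 by rewrite -(chart_hcoord _ yv); exact: Qy.1.
  have [FE GE] := FG v v0; rewrite -(nvE yv Qy.1) in FE GE.
  split; first by rewrite /ev GE; exact: mulf_neq0 (expf_neq0 _ v0) Qy.2.
  by rewrite /ev FE GE -mulf_div divff ?mul1r // expf_neq0.
have fr : fraction_on (X `&` princ i Q) g F G.
  split; first by exists d.
  by move=> y v [Xy Qy] /(FG' y v Qy)[G0 ->]; split=> //; exact: h.
have n0 : nvl i x != 0.
  apply/eqP => n0; have := nv1 cx; rewrite -(vsval_nvl cx) n0 mxE => /eqP.
  by rewrite eq_sym oner_eq0.
rewrite (Du _ _ _ _ (princ_nbhd Xx Qx) fr _ n0) (vsval_nvl cx).
rewrite (lift_tangentE i u) -(qder_horiz (nv1 cx) (theta_i cx u) FG).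
have := qder_homog (theta i u) ((lift_tangent u (nvl i x) : 'rV[C]_N) ord0 i) hF hG
  (oner_neq0 _) (FG' x _ Qx (hcoord_nv cx)).1.
by rewrite !scale1r => <-.
Qed.

Lemma local_field_exists x (u : tangentP x) : X x -> chart i x -> nonsingular_at X x ->
  u \in tangent X x -> exists D, local_field_at X u D.
Proof.
move=> Xx cx nx ux; have Ax := aff_nv Xx cx.
have [psi ca] := coord_exists Ax ((nonsingularP gen dX Xx cx).1 nx).
have uT := (tangent_tsp cx u Xx).1 ux.
pose De := mv (nv i x) (\det (jac psi)).
(* Constant coefficients, taken from [coord_expand] at [x], so that the field takes the value [u]
   there. *)
pose kap l := dder (psi l) (nv i x) (theta i u) / De.
exists (Dfield X i iota eta psi kap); split.
  exists (X `&` princ i 1); last exact: (Dfield_vector_field gen kap Ax ca).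
  exact: princ_nbhd Xx (princ1 cx).
apply: (Dfield_value gen Ax ca Xx cx).
have De0 : De != 0 by case: ca.
apply: (can_inj (scalerK De0)); rewrite (coord_expand ca Ax uT) /fieldv scaler_sumr.
by apply: eq_bigr => l _; rewrite scalerA /kap mulrCA divff // mulr1.
Qed.

Section Frame.
Variables (Q0 : {mpoly C[N]}) (s : nat) (P : 'M[{mpoly C[N]}]_(s, N)) (g : 'I_s -> 'I_N).

Definition That_frame := forall y, X y -> princ i Q0 y ->
  [/\ Uk X k y, forall v : 'rV[C]_N, v \in That X k y <-> (v <= mat i P y)%MS
    & mv (nv i y) (\det (colsub g P)) != 0].

Hypothesis fr : That_frame.

Lemma local_section_exists x c : X x -> princ i Q0 x ->
  exists B, local_section_at X k x (c *m mat i P x) B.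
Proof.
move=> Xx Qx; exists (fun y => c *m mat i P y); split=> //.
exists (X `&` princ i Q0); split.
- exact: princ_nbhd.
- by move=> y [Xy Qy]; have [] := fr Xy Qy.
- move=> j; apply: (regular_princ (i := i)) => y [Xy Qy].
  exists (\sum_a (c ord0 a)%:MP * P a j), 1; split; first exact: princ1 Qy.1.
  move=> y' _ _; rewrite meval1 divr1 mv_sumM /coordV [LHS]mxE.
  by apply: eq_bigr => a _; rewrite mevalC [X in _ * X = _]mxE.
by move=> y [Xy Qy]; have [_ h _] := fr Xy Qy; apply/h; exact: submxMl.
Qed.

(** Any local section is a combination of the rows of [P] with rational coefficients. By Leibniz'
    rule the derivatives of these coefficients contribute only vectors of [That], so the class does
    not depend on the section. *)
Lemma act_frame x (u : tangentP x) D B c : X x -> princ i Q0 x -> u \in tangent X x ->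
  local_field_at X u D -> local_section_at X k x (c *m mat i P x) B ->
  act D B x - c *m dmx P (nv i x) (theta i u) \in That X k x.
Proof.
move=> Xx Qx ux [_ Du] [[W [nW WU BW BT]] Bx]; have cx := Qx.1.
have Ax := aff_nv Xx cx.
have [b [E1 [E1x bE1]]] := regular_common (g := fun j => coordV B j) Xx cx
  (fun j => ex_intro2 _ _ W nW (BW j)).
have [Q1 Q1x Q1W] := nbhd_princ nW cx.
have hrep j : rep_at X i (coordV B j) x (b j) E1 by split=> // y Xy Ey; apply: bE1.
pose E := E1; pose De := \det (colsub g P); pose bp : 'rV[{mpoly C[N]}]_N := \row_j b j.
pose be : 'rV[{mpoly C[N]}]_s := colsub g bp *m \adj (colsub g P).
have De0 : mv (nv i x) De != 0 by have [] := fr Xx Qx.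
have bB y : X y -> princ i E y -> map_mx (mv (nv i y)) bp = mv (nv i y) E *: (B y : 'rV[C]_N).
  move=> Xy Ey; apply/rowP => j; have := bE1 y Xy Ey j; rewrite /coordV => BE.
  rewrite [RHS]mxE BE mulrC divfK; last exact: Ey.2.
  by rewrite 2!mxE.
(* B = gamma P, where gamma is read off the columns g. *)
have rel y : X y -> princ i (E * (Q0 * Q1)) y ->
    map_mx (mv (nv i y)) (be *m P) = mv (nv i y) De *: map_mx (mv (nv i y)) bp.
  move=> Xy; rewrite !princM => -[Ey [Qy Q1y]].
  have [_ hT _] := fr Xy Qy.
  rewrite map_mxM map_mxM map_mx_adj !map_mxsub /De -det_map_mx map_mxsub.
  apply: frame_solve; rewrite (bB y Xy Ey); apply: scalemx_sub.
  by apply/hT; apply: BT; apply: Q1W.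
have relA j : forall v : 'rV[C]_N, A v -> mv v (b j * De - (be *m P) ord0 j) = 0.
  apply/gen; apply: (gen_dense gen (Q := E * (Q0 * Q1))) => [|_ [z Xz [cz ->]] QQz].
    exact: (gen_neq0 gen Ax (princ_mul E1x (princ_mul Qx Q1x)).2).
  have /rowP/(_ j) := rel z Xz (conj cz QQz).
  by rewrite [LHS]mxE [RHS]mxE 2![in RHS]mxE mevalB mevalM => ->; rewrite mulrC subrr.
have [_ hT _] := fr Xx Qx; apply/hT.
have dbE j : dmx bp (nv i x) (theta i u) ord0 j = dder (b j) (nv i x) (theta i u).
  by rewrite 2!mxE.
have mbE j : map_mx (mv (nv i x)) bp ord0 j = mv (nv i x) (b j) by rewrite 2!mxE.
have actE : act D B x = (mv (nv i x) E ^+ 2)^-1 *: (mv (nv i x) E *: dmx bp (nv i x) (theta i u)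
   - dder E (nv i x) (theta i u) *: map_mx (mv (nv i x)) bp).
  apply/rowP => j; rewrite [LHS]mxE (value_rep Xx Du (hrep j)) /qder.
  by rewrite (scale_subE _ _ _ (dbE j) (mbE j)) quotient_comm.
rewrite actE.
apply: (@frame_derivative _ s N (mat i P x) _ _ _ (map_mx (mv (nv i x)) be)
  (dmx be (nv i x) (theta i u)) c _ _ (mv (nv i x) De) (dder De (nv i x) (theta i u))
  (B x) De0 E1x.2).
- rewrite -dmx_mul; apply/rowP => j.
  have := (tspP _ _ _).1 ((tangent_tsp cx u Xx).1 ux) _ (relA j).
  rewrite dderB dderM => /eqP; rewrite subr_eq0 => /eqP h.
  by rewrite [RHS]mxE -h (scale_addE _ _ (dbE j) (mbE j)) mulrC [X in _ + X]mulrC.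
- exact: bB.
- exact: Bx.
rewrite /be map_mxM map_mx_adj !map_mxsub (bB x Xx E1x) Bx.
by rewrite frame_coord /De -det_map_mx map_mxsub.
Qed.

Lemma fund_formE x (u : tangentP x) c : X x -> princ i Q0 x -> u \in tangent X x ->
  fund_form X k u (c *m mat i P x) = quo_proj (That X k x) (c *m dmx P (nv i x) (theta i u)).
Proof.
move=> Xx Qx ux; have [Ux _ _] := fr Xx Qx.
have hD := local_field_exists Xx Qx.1 (Uk_nonsingular Ux) ux.
have hB := local_section_exists c Xx Qx.
rewrite /fund_form; apply/eqP; rewrite -subr_eq0 -linearB ker_quo_proj; apply: act_frame => //.
  exact: (@xgetPex _ (fun _ _ => 0) [set D | local_field_at X u D]).
exact: (@xgetPex _ (fun _ => 0) [set B | local_section_at X k x (c *m mat i P x) B]).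
Qed.

End Frame.

End FundForm.

(** * The tangent variety *)

Section PolySubstitution.
Variables (n d : nat).

Definition psub (F : comNzRingType) (p : {mpoly F[d]}) (G : 'I_d -> {mpoly F[n]}) : {mpoly F[n]} :=
  p \mPo [tuple G l | l < d].

Lemma mh_psub (F K : comNzRingType) (j : {rmorphism F -> K}) (zeta : 'rV[K]_n) p
    (G : 'I_d -> {mpoly F[n]}) :
  mh j zeta (psub p G) = mh j (\row_l mh j zeta (G l)) p.
Proof.
rewrite /psub mh_comp; congr (mmap _ _ p); apply/funext => l.
by rewrite !mxE tnth_mktuple.
Qed.

Lemma psubM (F : comNzRingType) p q (G : 'I_d -> {mpoly F[n]}) :
  psub (p * q) G = psub p G * psub q G.
Proof. exact: rmorphM. Qed.

Lemma mv_psub (F : comNzRingType) (v : 'rV[F]_n) p (G : 'I_d -> {mpoly F[n]}) :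
  mv v (psub p G) = mv (\row_l mv v (G l)) p.
Proof.
rewrite /psub; elim/mpoly_ring_ind: p => [c|i|p q hp hq|p q hp hq].
- by rewrite comp_mpolyC !mevalC.
- by rewrite comp_mpolyXU mevalXU mxE -tnth_nth tnth_mktuple.
- by rewrite comp_mpolyD !mevalD hp hq.
- by rewrite rmorphM /= !mevalM hp hq.
Qed.

Lemma dder_psub (F : numFieldType) (v u : 'rV[F]_n) p (G : 'I_d -> {mpoly F[n]}) :
  dder (psub p G) v u = dder p (\row_l mv v (G l)) (\row_l dder (G l) v u).
Proof.
rewrite /psub; elim/mpoly_ring_ind: p => [c|i|p q hp hq|p q hp hq].
- by rewrite comp_mpolyC !dderC.
- by rewrite comp_mpolyXU dderX mxE -tnth_nth tnth_mktuple.
- by rewrite comp_mpolyD !dderD hp hq.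
- by rewrite rmorphM /= !dderM hp hq -!/(psub _ G) !mv_psub.
Qed.

End PolySubstitution.

Lemma lin_poly_neq0 (F : fieldType) (a b : F) : b != 0 -> a%:P + b *: 'X != 0.
Proof.
move=> b0; apply/eqP => /(congr1 (fun p : {poly F} => p`_1)).
rewrite coef0 coefD coefC coefZ coefX mulr1 add0r => /eqP.
by rewrite (negPf b0).
Qed.

Lemma proj_rowE (F : fieldType) s n (c : 'rV[F]_s) (B : 'M_(s, n)) (u : 'rV[F]_n) i j :
  (u + (c *m B - (c *m B) ord0 i *: u)) ord0 j
  = u ord0 j + \sum_a c ord0 a * (B a j - B a i * u ord0 j).
Proof.
rewrite !mxE; congr (_ + _); rewrite mulr_suml -sumrB; apply: eq_bigr => a _.
by rewrite mulrBr mulrA.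
Qed.

Lemma flat_rowE (F : fieldType) n (u w : 'rV[F]_n) i : u ord0 i = 1 ->
  (u + (w - w ord0 i *: u)) ord0 i = 1.
Proof. by move=> u1; rewrite !mxE u1 mulr1 subrr addr0. Qed.

Lemma row_entry_neq0 (F : fieldType) n (v : 'rV[F]_n) i : v ord0 i != 0 -> v != 0.
Proof. by apply: contraNneq => ->; rewrite mxE. Qed.

Lemma vspace_matrix (F : fieldType) n (U : {vspace 'rV[F]_n}) :
  exists B : 'M[F]_(\dim U, n), forall v, v \in U <-> (v <= B)%MS.
Proof.
exists (\matrix_a (vbasis U)`_a) => v; split=> [vU|/submxP[c ->]].
  apply/submxP; exists (\row_a coord (vbasis U) a v).
  rewrite mulmx_sum_row [LHS](coord_vbasis vU); apply: eq_bigr => a _.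
  by rewrite mxE rowK.
rewrite mulmx_sum_row; apply: memv_suml => a _; rewrite rowK; apply: memvZ.
by apply: vbasis_mem; apply: mem_nth; rewrite size_tuple.
Qed.

(** * Linear subvarieties: irreducibility and dimension *)

Section LinearSubvariety.
Variables (R : realType) (r : nat) (i : 'I_r.+1) (T : {vspace dualV R r}).
Notation C := R[i].
Notation N := r.+1.
Notation pnt := (pt R r).
Implicit Types (y z : pnt).
Variable v0 : 'rV[C]_N.
Hypotheses (Tv0 : v0 \in T) (v0i : v0 ord0 i != 0).

Lemma linear_subvarietyP y (v : 'rV[C]_N) : hcoord y v ->
  linear_subvariety T y <-> v \in T.
Proof. by move=> /hcoord_line yv; rewrite /linear_subvariety /= yv -memvE. Qed.

Lemma aff_linear (v : 'rV[C]_N) : aff i (linear_subvariety T) v <-> v \in T /\ v ord0 i = 1.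
Proof.
split=> [[y Ty [cy ->]]|[Tv v1]].
  by rewrite nv1 //; split=> //; apply/(linear_subvarietyP (hcoord_nv cy)).
have vN0 : v != 0 by apply: contra_eq_neq v1 => ->; rewrite mxE eq_sym oner_neq0.
have [y yv] := point_of vN0.
by apply: (affP v1 yv); apply/(linear_subvarietyP yv).
Qed.

(** On the line v + s v0 inside [T] the i-th coordinate is a nonzero polynomial in s, and its
    product with the restriction of [F] vanishes identically. *)
Lemma linear_dense (F : {mpoly C[N]}) :
  (forall v : 'rV[C]_N, v \in T -> v ord0 i != 0 -> mv v F = 0) ->
  forall v : 'rV[C]_N, v \in T -> mv v F = 0.
Proof.
move=> h v Tv; have [p hp _] := dder_line F v v0.
suff p0 : p = 0 by have := hp 0; rewrite p0 horner0 scale0r addr0.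
have l0 : (v ord0 i)%:P + v0 ord0 i *: 'X != 0 :> {poly C} by exact: lin_poly_neq0.
have : p * ((v ord0 i)%:P + v0 ord0 i *: 'X) = 0.
  apply: poly_eq0_forall => s; rewrite hornerM hornerD hornerC hornerZ hornerX hp.
  have Ts : v + s *: v0 \in T by rewrite memvD ?memvZ.
  have [E|E] := eqVneq ((v + s *: v0) ord0 i) 0; last by rewrite h // mul0r.
  by rewrite !mxE in E; rewrite [_ * s]mulrC E mulr0.
by move/eqP; rewrite mulf_eq0 (negPf l0) orbF => /eqP.
Qed.

Lemma dense_linear : dense_chart i (linear_subvariety T).
Proof.
move=> d F hF FA y v Ty vy.
have Tv : v \in T by apply: (subvP Ty).
apply: linear_dense Tv => w Tw w0.
have : ev F ((w ord0 i)^-1 *: w) = 0.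
  by apply: FA; apply/aff_linear; split; rewrite ?memvZ // mxE mulVf.
by move/eqP; rewrite /ev (mv_scale _ _ hF) mulf_eq0 expf_eq0 invr_eq0 (negPf w0) andbF /= => /eqP.
Qed.

(** The slice is parametrized polynomially by an affine space: a vector of [T] is projected along
    [u0] to the hyperplane where coordinate i is 0, and [u0] is added. Its ideal is thus the kernel
    of a substitution into a polynomial ring. *)
Lemma prime_linear : prime_set (aff i (linear_subvariety T)).
Proof.
pose u0 := (v0 ord0 i)^-1 *: v0.
have Tu0 : u0 \in T by rewrite memvZ.
have u01 : u0 ord0 i = 1 by rewrite mxE mulVf.
split; first by exists u0; apply/aff_linear.
have [B TB] := vspace_matrix T; set s := \dim T in B TB.
pose G j : {mpoly C[s]} := (u0 ord0 j)%:MP + \sum_a 'X_a * (B a j - B a i * u0 ord0 j)%:MP.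
have GE (c : 'rV[C]_s) : \row_j mv c (G j) = u0 + (c *m B - (c *m B) ord0 i *: u0).
  apply/rowP => j; rewrite [LHS]mxE mevalD mevalC mv_sumM proj_rowE; congr (_ + _).
  by apply: eq_bigr => a _; rewrite mevalXU mevalC.
have GA (c : 'rV[C]_s) : aff i (linear_subvariety T) (\row_j mv c (G j)).
  apply/aff_linear; rewrite GE; split.
    by rewrite memvD // memvB ?memvZ //; apply/TB; exact: submxMl.
  exact: flat_rowE u01.
move=> P Q PQ.
have : psub P G * psub Q G = 0.
  by rewrite -psubM; apply: meval_eq0_forall => c; rewrite mv_psub; exact: PQ _ (GA c).
have hG (S : {mpoly C[N]}) : psub S G = 0 -> forall v, aff i (linear_subvariety T) v -> mv v S = 0.
  move=> S0 v /aff_linear[Tv v1].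
  have /submxP[c cE] : (v - u0 <= B)%MS by apply/TB; rewrite memvB.
  have vi : (v - u0) ord0 i = 0 by rewrite 2!mxE v1 u01 subrr.
  have : \row_j mv c (G j) = v by rewrite GE -cE vi scale0r subr0 addrC subrK.
  by move=> <-; rewrite -mv_psub S0 meval0.
by move=> /eqP; rewrite mulf_eq0 => /orP[]/eqP/hG; [left | right].
Qed.

Lemma dim_tangent_linear y : linear_subvariety T y ->
  \dim (tangent (linear_subvariety T) y) = (\dim T).-1.
Proof.
move=> Ty; rewrite (tangent_linear_subvariety Ty).
have ly : \dim (line y) = 1%N by exact: (eqP (valP y)).
have dH (U : {vspace dualV R r}) : \dim {: 'Hom(subvs_of (line y), quo U)} = (N - \dim U)%N.
  rewrite dimvf [LHS](_ : _ = (\dim (line y) * \dim (U^C)%VS)%N) // ly mul1n.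
  by rewrite dimv_compl dimvf /dim /= mul1n.
have h1 : \dim (limg (normal_proj (line y) T)) = (N - \dim T)%N.
  exact: etrans (congr1 (fun U : {vspace 'Hom(_, _)} => \dim U) (limg_normal_proj Ty)) (dH T).
have h := etrans (limg_ker_dim (normal_proj (line y) T) fullv) (dH (line y)).
have hk := congr1 (fun U : {vspace tangentP y} => \dim U) (capfv (lker (normal_proj (line y) T))).
have {}h := etrans (f_equal2 addn (esym hk) (esym h1)) h.
rewrite ly in h.
have v0N : v0 != 0 by exact: row_entry_neq0 v0i.
have T1 : (\dim <[v0 : dualV R r]>%VS <= \dim T)%N by apply: dimvS; rewrite -memvE.
rewrite dim_vline v0N in T1.
have TN : (\dim T <= N)%N by have := dimvS (subvf T); rewrite dimvf /dim /= mul1n.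
move: h T1 TN; move: (\dim (lker _)) (\dim T) => a b; lia.
Qed.

Lemma has_dim_linear : has_dim (linear_subvariety T) (\dim T).-1.
Proof.
have [L [iota [eta [gen _]]]] := generic_point_subproof prime_linear.
apply/(has_dim_aff gen dense_linear).
have [Q Q0 hQ] := tsp_rank_generic gen.
have [y [Ty Qy Ay]] := gen_princ gen Q0.
by rewrite -(hQ _ Ay Qy.2) -(dim_tangent Qy.1 Ty) dim_tangent_linear.
Qed.

End LinearSubvariety.

(** * The tangent variety as a closure over a small open set *)

Section TangentVariety.
Variables (R : realType) (r : nat) (X : set (pt R r)).
Notation C := R[i].
Notation N := r.+1.
Notation pnt := (pt R r).
Implicit Types (x y z : pnt).
Hypothesis irrX : zirreducible X.
Variable k : nat.

Lemma tau_point x y : Uk X k x -> Tk X k x y -> tau X k y.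
Proof. by move=> Ux Ty Z [cZ TZ]; apply: TZ; exists x. Qed.

Section Chart.
Variables (i : 'I_N) (L : fieldType) (iota : {rmorphism C -> L}) (eta : 'rV[L]_N).
Hypothesis gen : generic (aff i X) iota eta.
Hypothesis dX : dense_chart i X.

Lemma That_frame_sub (Q0 Q : {mpoly C[N]}) s (P : 'M[{mpoly C[N]}]_(s, N)) g :
  That_frame X i k Q0 P g -> That_frame X i k (Q * Q0) P g.
Proof. by move=> fr y Xy; rewrite princM => -[_ Q0y]; apply: fr. Qed.

Lemma frame_exists :
  (forall u : L, exists P Q, mh iota eta Q != 0 /\ u = mh iota eta P / mh iota eta Q) ->
  exists (Q0 : {mpoly C[N]}) s (P : 'M[{mpoly C[N]}]_(s, N)) g,
  [/\ mh iota eta Q0 != 0, That_frame X i k Q0 P g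
    & forall y, X y -> princ i Q0 y -> exists2 v : 'rV[C]_N, v \in That X k y & v ord0 i != 0].
Proof.
move=> gfrac; have [Qu Qu0 hQu] := Uk_generic gen dX k.
have [x0 [Xx0 Qux0 Ax0]] := gen_princ gen Qu0.
have [q [D [P [Dx0 h]]]] := That_matrix gen gfrac dX (hQu x0 Xx0 Qux0) Qux0.1.
have [f [g [Q10 hQ1]]] := rank_point_eq gen P; set Q1 := \det _ in Q10 hQ1.
have hy y : X y -> princ i (Qu * (D * Q1)) y -> [/\ Uk X k y, princ i D y & princ i Q1 y].
  by move=> Xy; rewrite !princM => -[Quy [Dy Q1y]]; split=> //; apply: hQu.
exists (Qu * (D * Q1)), _, (rowsub f P), g; split.
- rewrite !mhM mulf_neq0 // mulf_neq0 //; exact: (gen_neq0 gen Ax0 Dx0.2).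
- move=> y Xy /(hy y Xy)[Uy Dy Q1y]; have [TE _ _] := h y Uy Dy.
  have [u rk] := hQ1 _ (aff_nv Xy Dy.1) Q1y.2.
  split=> //; last by rewrite -mxsubcr; exact: Q1y.2.
  move=> v; rewrite TE /mat map_mxsub; split=> hv; apply: submx_trans hv _.
    exact: minor_rowsub u rk.
  exact: rowsub_sub.
by move=> y Xy /(hy y Xy)[Uy Dy _]; have [] := h y Uy Dy.
Qed.

(** The point [x] may lie outside chart i and outside the open set of the frame. In a chart at [x],
    a vector c P(x) of [That] moves in the family c P(z), with z in [Uk]; [F] vanishes along this
    family for general z, hence at [x]. *)
Lemma That_dense (Q0 F : {mpoly C[N]}) : mh iota eta Q0 != 0 ->
  (forall x, X x -> princ i Q0 x -> forall v : 'rV[C]_N, v \in That X k x -> mv v F = 0) ->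
  forall x, Uk X k x -> forall v : 'rV[C]_N, v \in That X k x -> mv v F = 0.
Proof.
move=> Q00 F0 x Ux v Tv; have Xx := UkX Ux; have [j cx] := chart_ex x.
have [pA dXj] := irreducible_prime (i := j) irrX (ex_intro2 _ _ x Xx cx).
have [L' [iota' [eta' [gen' gfrac']]]] := generic_point_subproof pA.
have [q [D [P [Dx h]]]] := That_matrix gen' gfrac' dXj Ux cx.
have [TE _ _] := h x Ux Dx; have /submxP[c cE] := (TE v).1 Tv.
pose G l : {mpoly C[N]} := \sum_a (c ord0 a)%:MP * P a l.
have GE z : \row_l mv (nv j z) (G l) = c *m mat j P z.
  apply/rowP => l; rewrite [LHS]mxE mv_sumM [RHS]mxE; apply: eq_bigr => a _.
  by rewrite mevalC [X in _ = _ * X]mxE.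
rewrite cE -GE -mv_psub.
have [x1 [Xx1 Q0x1 _]] := gen_princ gen Q00.
have oW : open_in X (Uk X k `&` (X `&` princ i Q0)).
  by apply: open_inI; [exact: Uk_open | exists (princ i Q0) => //; exact: princ_open].
have [x2 [U2 [X2 Q2]]] : exists x, (Uk X k `&` (X `&` princ i Q0)) x.
  have [Qu Qu0 hQu] := Uk_generic gen dX k.
  have [|x2 [X2 QQ2 _]] := gen_princ gen (Q := Qu * Q0); first by rewrite mhM mulf_neq0.
  by move: QQ2; rewrite princM => -[Qu2 Q2]; exists x2; split; [exact: hQu | split].
have [Q [Q'0 QW]] := open_meets_chart gen' dXj oW (conj U2 (conj X2 Q2)).
apply: ((gen' (psub F G)).1 _ _ (aff_nv Xx cx)).
apply: (gen_dense gen' (Q := Q * D)) => [|_ [z Xz [cz ->]] QDz].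
  by rewrite mhM mulf_neq0 //; exact: (gen_neq0 gen' (aff_nv Xx cx) Dx.2).
have [Qz Dz] : princ j Q z /\ princ j D z.
  by apply: (_ : (princ j Q `&` princ j D) z); rewrite -princM; split.
have [Uz [_ Q0z]] := QW z Xz Qz; have [TEz _ _] := h z Uz Dz.
by rewrite mv_psub GE; apply: (F0 z Xz Q0z); apply/TEz; exact: submxMl.
Qed.

Lemma tauP (Q0 : {mpoly C[N]}) d (F : {mpoly C[N]}) : mh iota eta Q0 != 0 -> is_homog d F ->
  (forall x, X x -> princ i Q0 x -> forall v : 'rV[C]_N, v \in That X k x -> mv v F = 0) ->
  forall y (v : 'rV[C]_N), tau X k y -> v \in line y -> ev F v = 0.
Proof.
move=> Q00 hF F0 y v ty vy; have F1 := That_dense Q00 F0.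
have : zeros [set F] y.
  apply: ty; split; first exact: zclosed1 hF.
  move=> z [x Ux Tz] _ -> w wz; apply: (F1 x Ux).
  exact: (subvP Tz).
by apply.
Qed.

End Chart.

End TangentVariety.

Lemma frac_subst_both (C L : fieldType) (iota : {rmorphism C -> L}) n d
    (P : 'I_d -> {mpoly C[n]}) (Q : {mpoly C[n]}) (p : {mpoly C[d]}) :
  exists k H, (forall z : 'rV[L]_n, mh iota z Q != 0 ->
      mh iota z H = mh iota z Q ^+ k * mh iota (\row_l (mh iota z (P l) / mh iota z Q)) p) /\
    (forall z : 'rV[C]_n, mv z Q != 0 ->
      mv z H = mv z Q ^+ k * mv (\row_l (mv z (P l) / mv z Q)) p).
Proof.
have [k [H h]] := frac_subst P Q p; exists k, H; split=> z; first exact: h.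
exact: (h C [the {rmorphism C -> C} of idfun] z).
Qed.

Lemma frac_row (F : fieldType) n (a : 'I_n -> F) (v : 'rV[F]_n) i :
  (forall l, a l = v ord0 l) -> \row_l (a l / a i) = (v ord0 i)^-1 *: v.
Proof. by move=> h; apply/rowP => l; rewrite !mxE !h mulrC. Qed.

Lemma eq_neq0 (F : fieldType) (a b : F) : a = b -> b != 0 -> a != 0.
Proof. by move=> ->. Qed.

Section Lift.
Variables (F : comNzRingType) (n s : nat).

Definition lift1 (p : {mpoly F[n]}) : {mpoly F[n + s]} := psub p (fun l => 'X_(lshift s l)).

Lemma mv_lift1 (z : 'rV[F]_(n + s)) p : mv z (lift1 p) = mv (lsubmx z) p.
Proof.
by rewrite /lift1 mv_psub; congr (meval _ p); apply/funext => l; rewrite !mxE mevalXU.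
Qed.

Lemma mh_lift1 (K : comNzRingType) (j : {rmorphism F -> K}) (z : 'rV[K]_(n + s)) p :
  mh j z (lift1 p) = mh j (lsubmx z) p.
Proof.
by rewrite /lift1 mh_psub; congr (mmap _ _ p); apply/funext => l; rewrite !mxE mhX.
Qed.

Definition lin2 (M : 'M[{mpoly F[n]}]_(s, n)) (l : 'I_n) : {mpoly F[n + s]} :=
  \sum_a 'X_(rshift n a) * lift1 (M a l).

Lemma mv_lin2 M (z : 'rV[F]_(n + s)) l :
  mv z (lin2 M l) = (rsubmx z *m map_mx (mv (lsubmx z)) M) ord0 l.
Proof.
rewrite /lin2 mv_sumM [RHS]mxE; apply: eq_bigr => a _.
by rewrite mevalXU mv_lift1 [X in _ = X * _]mxE [X in _ = _ * X]mxE.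
Qed.

Lemma mh_lin2 (K : comNzRingType) (j : {rmorphism F -> K}) M (z : 'rV[K]_(n + s)) l :
  mh j z (lin2 M l) = (rsubmx z *m map_mx (mmap j (fun i => (lsubmx z) ord0 i)) M) ord0 l.
Proof.
rewrite /lin2 mh_sumM [RHS]mxE; apply: eq_bigr => a _.
by rewrite mhX mh_lift1 [X in _ = X * _]mxE [X in _ = _ * X]mxE.
Qed.

End Lift.

(** * Irreducibility of the parameter space of pairs (x, c) *)

Section PrimeBundle.
Variables (F : numFieldType) (n s : nat) (A : set 'rV[F]_n).

Definition fibre1 (p : {mpoly F[n + s]}) (c : 'rV[F]_s) : {mpoly F[n]} :=
  psub p (fun l => match split l with inl l => 'X_l | inr l => (c ord0 l)%:MP end).

Lemma mv_fibre1 p (a : 'rV[F]_n) c : mv a (fibre1 p c) = mv (row_mx a c) p.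
Proof.
rewrite /fibre1 mv_psub; congr (meval _ p); apply/funext => l; rewrite !mxE.
by case: (split l) => l'; rewrite ?mevalXU ?mevalC.
Qed.

Definition bundle : set 'rV[F]_(n + s) := [set z | A (lsubmx z)].

Lemma bundle_row a c : A a -> bundle (row_mx a c).
Proof. by rewrite /bundle /= row_mxKl. Qed.

(** If neither factor vanishes on the bundle, primality of [A] yields one point a over which both
    are nonzero polynomials on the fibre; their product is then nonzero too. *)
Lemma prime_bundle : prime_set A -> prime_set bundle.
Proof.
move=> [[a0 Aa0] hA]; split; first by exists (row_mx a0 0); apply: bundle_row.
move=> G H GH.
pose fib2 (p : {mpoly F[n + s]}) (a : 'rV[F]_n) : {mpoly F[s]} :=
  psub p (fun l => match split l with inl l => (a ord0 l)%:MP | inr l => 'X_l end).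
have fib2E p (c : 'rV[F]_s) (a : 'rV[F]_n) : mv c (fib2 p a) = mv (row_mx a c) p.
  rewrite /fib2 mv_psub; congr (meval _ p); apply/funext => l; rewrite !mxE.
  by case: (split l) => l'; rewrite ?mevalXU ?mevalC.
have [|hG] := EM (forall z : 'rV[F]_(n + s), bundle z -> mv z G = 0); first by left.
have [|hH] := EM (forall z : 'rV[F]_(n + s), bundle z -> mv z H = 0); first by right.
have ex p : ~ (forall z : 'rV[F]_(n + s), bundle z -> mv z p = 0) ->
    exists c, ~ (forall a : 'rV[F]_n, A a -> mv a (fibre1 p c) = 0).
  move=> hp; apply: contrapT => h; apply: hp => z Az.
  apply: contrapT => pz; apply: h; exists (rsubmx z) => h'; apply: pz.
  by have := h' _ Az; rewrite mv_fibre1 hsubmxK.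
have [c1 h1] := ex G hG; have [c2 h2] := ex H hH.
have [a Aa GHa] : exists2 a, A a & mv a (fibre1 G c1 * fibre1 H c2) != 0.
  apply: contrapT => h.
  have hfib (a : 'rV[F]_n) : A a -> mv a (fibre1 G c1 * fibre1 H c2) = 0.
    by move=> Aa; apply: contrapT => /eqP h'; apply: h; exists a.
  by case: (hA _ _ hfib) => h'; [exact: h1 h' | exact: h2 h'].
have : fib2 G a * fib2 H a = 0.
  apply: meval_eq0_forall => c; rewrite mevalM !fib2E -mevalM; apply: GH.
  exact: bundle_row.
move/eqP; rewrite mulf_eq0; case/orP => /eqP E; case/eqP: GHa; rewrite mevalM mv_fibre1 mv_fibre1.
  by rewrite -fib2E E meval0 mul0r.
by rewrite -[X in _ * X]fib2E E meval0 mulr0.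
Qed.

End PrimeBundle.

(** * A generic point of the tangent variety *)

Section GenericTangent.
Variables (R : realType) (r : nat) (X : set (pt R r)).
Notation C := R[i].
Notation N := r.+1.
Notation pnt := (pt R r).
Implicit Types (x y : pnt).
Hypothesis irrX : zirreducible X.
Variables (k : nat) (i : 'I_N) (Q0 : {mpoly C[N]}) (s : nat) (P : 'M[{mpoly C[N]}]_(s, N)).
Variable g : 'I_s -> 'I_N.
Hypothesis fr : That_frame X i k Q0 P g.
Hypothesis nz : forall y, X y -> princ i Q0 y ->
  exists2 v : 'rV[C]_N, v \in That X k y & v ord0 i != 0.
Hypothesis dX : dense_chart i X.
Variables (x0 : pnt).
Hypotheses (Xx0 : X x0) (Qx0 : princ i Q0 x0).
Variables (L : fieldType) (iota : {rmorphism C -> L}) (zeta : 'rV[L]_(N + s)).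
Local Notation A := (aff i X).
Local Notation A2 := (@bundle C N s A).
Hypothesis gen2 : generic A2 iota zeta.

Definition alpha : 'rV[L]_N := lsubmx zeta.
Local Notation Phi := (lin2 P).

Lemma gen_alpha : generic A iota alpha.
Proof.
move=> p; rewrite /alpha -mh_lift1 gen2; split=> h z Az.
  by have := h _ (bundle_row (0 : 'rV_s) Az); rewrite mv_lift1 row_mxKl.
by rewrite mv_lift1; apply: h.
Qed.

Lemma Q0_alpha : mh iota alpha Q0 != 0.
Proof. exact: (gen_neq0 gen_alpha (aff_nv Xx0 Qx0.1) Qx0.2). Qed.

Lemma mv_Phi x (c : 'rV[C]_s) l : mv (row_mx (nv i x) c) (Phi l) = (c *m mat i P x) ord0 l.
Proof. by rewrite mv_lin2 row_mxKl row_mxKr. Qed.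

Lemma Phi_i_neq0 : mh iota zeta (Phi i) != 0.
Proof.
have [v Tv vi] := nz Xx0 Qx0; have [_ hT _] := fr Xx0 Qx0.
have /submxP[c cE] := (hT v).1 Tv.
apply: (gen_neq0 gen2 (bundle_row c (aff_nv Xx0 Qx0.1))).
by rewrite mv_Phi -cE.
Qed.

Definition etat : 'rV[L]_N := \row_l (mh iota zeta (Phi l) / mh iota zeta (Phi i)).

Lemma tau_frame x (c : 'rV[C]_s) : X x -> princ i Q0 x -> (c *m mat i P x) ord0 i != 0 ->
  aff i (tau X k) (((c *m mat i P x) ord0 i)^-1 *: (c *m mat i P x)).
Proof.
move=> Xx Qx v0; have [Ux hT _] := fr Xx Qx.
set v := c *m mat i P x in v0 *.
have Tv : v \in That X k x by apply/hT; exact: submxMl.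
have [y yv] := point_of (row_entry_neq0 v0).
apply: (affP (y := y)); first by rewrite mxE mulVf.
  by apply: hcoordZ yv _; rewrite invr_eq0.
exact: (tau_point Ux ((linear_subvarietyP (That X k x) yv).2 Tv)).
Qed.

(** A polynomial is pulled back to the parameter space by clearing denominators. If it vanishes at
    [etat], its homogenization vanishes on [That] over the open set, hence on tau by [tauP]; if it
    vanishes on tau, the pullback vanishes on a dense open set of parameters. *)
Lemma gen_tau : generic (aff i (tau X k)) iota etat.
Proof.
move=> p; have [m [H [HL HC]]] := frac_subst_both iota Phi (Phi i) p.
have HE := HL zeta Phi_i_neq0; rewrite -/etat in HE.
have HCx x (c : 'rV[C]_s) : (c *m mat i P x) ord0 i != 0 -> mv (row_mx (nv i x) c) H
    = (c *m mat i P x) ord0 i ^+ m * mv (((c *m mat i P x) ord0 i)^-1 *: (c *m mat i P x)) p.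
  move=> v0; have E := mv_Phi x c.
  exact: etrans (HC _ (eq_neq0 (E i) v0))
    (f_equal2 (fun a (b : 'rV[C]_N) => a ^+ m * mv b p) (E i) (frac_row i E)).
split=> [p0 _ [y ty [cy ->]]|p0].
  have H0 : mh iota zeta H = 0 by rewrite HE p0 mulr0.
  have [d [F hF FE]] := homogenize_deg i p.
  have FT x : X x -> princ i Q0 x -> forall v : 'rV[C]_N, v \in That X k x -> mv v F = 0.
    move=> Xx Qx v Tv; have [E|v0] := eqVneq (v ord0 i) 0; first exact: (FE v).2.
    have [_ hT _] := fr Xx Qx; have /submxP[c cE] := (hT v).1 Tv.
    have := (gen2 H).1 H0 _ (bundle_row c (aff_nv Xx Qx.1)).
    rewrite cE in v0; rewrite HCx // => /eqP; rewrite mulf_eq0 expf_eq0 (negPf v0) andbF /=.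
    by move=> /eqP h; rewrite cE (FE _).1 // h mulr0.
  have := tauP irrX gen_alpha dX Q0_alpha hF FT ty (hcoord_nv cy).1.
  by rewrite /ev (FE _).1 nv1 // ?oner_neq0 // expr1n mul1r invr1 scale1r.
suff H0 : mh iota zeta H = 0.
  by move: HE; rewrite H0 => /esym/eqP; rewrite mulf_eq0 expf_eq0 (negPf Phi_i_neq0) andbF => /eqP.
apply: (gen_dense gen2 (Q := Phi i * lift1 s Q0)) => [|z Az].
  by rewrite mhM mulf_neq0 //; [exact: Phi_i_neq0 | rewrite mh_lift1; exact: Q0_alpha].
have [x Xx [cx xE]] := Az; rewrite -[z]hsubmxK xE mevalM mv_lift1 row_mxKl mulf_eq0 negb_or.
move=> /andP[Pi Qx]; rewrite mv_Phi in Pi; rewrite HCx //.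
by rewrite p0 ?mulr0 //; exact: (tau_frame Xx (conj cx Qx) Pi).
Qed.

Lemma dense_tau : dense_chart i (tau X k).
Proof.
move=> d F hF F0 y v ty vy.
apply: (tauP irrX gen_alpha dX Q0_alpha hF) ty vy => x Xx Qx w Tw.
have [v0 Tv0 v0i] := nz Xx Qx; have [Ux hT _] := fr Xx Qx.
apply: (linear_dense Tv0 v0i) Tw => u Tu u0.
have /submxP[c cE] := (hT u).1 Tu.
have := F0 _ (tau_frame (c := c) Xx Qx _); rewrite -cE => /(_ u0).
by rewrite /ev (mv_scale _ _ hF) => /eqP; rewrite mulf_eq0 expf_eq0 invr_eq0 (negPf u0) andbF /= => /eqP.
Qed.

End GenericTangent.

Section CoordinateExpansion.
Variables (C : numFieldType) (N : nat) (A : set 'rV[C]_N) (L : fieldType).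
Variables (iota : {rmorphism C -> L}) (eta : 'rV[L]_N) (b : 'rV[C]_N).
Variable psi : 'I_N -> {mpoly C[N]}.
Hypothesis gen : generic A iota eta.
Hypothesis ca : coord_at A iota eta b psi.
Local Notation e := (\rank (gtsp A iota eta)).

Lemma gcoord_expand (u : 'rV[L]_N) : (u <= gtsp A iota eta)%MS ->
  mh iota eta (\det (jac psi)) *: u
  = \sum_(i < N | (i < e)%N) hder iota (psi i) eta u *: gvec iota eta psi i.
Proof.
move=> /gtspP uT; have [psi0 _] := ca.
apply/rowP => j; rewrite summxE mxE.
rewrite [RHS](_ : _ = \sum_i (hder iota (psi i) eta u *: gvec iota eta psi i) ord0 j); last first.
  rewrite [RHS](bigID (fun i : 'I_N => (i < e)%N)) /= [X in _ + X]big1 ?addr0 // => i.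
  by rewrite -leqNgt => ie; rewrite (uT _ (psi0 _ ie)) scale0r mxE.
have -> : mh iota eta (\det (jac psi)) * u ord0 j
    = \sum_l mh iota eta ((\det (jac psi)) *+ (j == l)) * u ord0 l.
  rewrite (bigD1 j) //= eqxx big1 ?addr0 // => l /negPf; rewrite eq_sym => ->.
  by rewrite mmap0 mul0r.
under eq_bigr => l _ do rewrite -cder_dual raddf_sum mulr_suml.
rewrite exchange_big; apply: eq_bigr => i _ /=.
rewrite [RHS]mxE [gvec _ _ _ _ _ _]mxE /hder mulr_suml.
by apply: eq_bigr => l _; rewrite mhM /=; ring.
Qed.

End CoordinateExpansion.

Lemma der_0 (C : numFieldType) (L : fieldType) (iota : {rmorphism C -> L}) D :
  derivation iota D -> D 0 = 0.
Proof. by move=> dD; rewrite -{1}(rmorph0 iota) (derC dD). Qed.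

Lemma der_sum (C : numFieldType) (L : fieldType) (iota : {rmorphism C -> L}) D (I : Type)
    (t : seq I) (f : I -> L) : derivation iota D -> D (\sum_(l <- t) f l) = \sum_(l <- t) D (f l).
Proof. by move=> dD; apply: (big_morph D (derD dD) (der_0 dD)). Qed.

Lemma row_leibniz (C : numFieldType) (L : fieldType) (iota : {rmorphism C -> L}) D n
    (phi : 'I_n -> L) (eta u : 'rV[L]_n) c : derivation iota D ->
  (forall j, phi j = c * eta ord0 j) -> (forall j, D (eta ord0 j) = u ord0 j) ->
  c *: u = \row_j D (phi j) - D c *: eta.
Proof.
move=> dD pE DE; apply/rowP => j.
by rewrite [LHS]mxE -DE !mxE pE (derM dD) addrK.
Qed.

(** * Projection along a point onto the slice: rank comparisons *)

Section ProjectFlat.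
Variables (F : fieldType) (n : nat) (i : 'I_n).

Lemma flat_mxE (eta w : 'rV[F]_n) :
  w *m (1%:M - delta_mx i ord0 *m eta) = w - w ord0 i *: eta.
Proof.
rewrite mulmxBr mulmx1 mulmxA; congr (_ - _).
have -> : w *m delta_mx i ord0 = (w ord0 i)%:M.
  apply/matrixP => a b; rewrite (ord1 a) (ord1 b) mxE (bigD1 i) //= !mxE !eqxx mulr1.
  by rewrite big1 ?addr0 // => j ji; rewrite mxE (negPf ji) mulr0.
by rewrite mul_scalar_mx.
Qed.

Lemma flat_rank p (K : 'M[F]_(p, n)) (eta : 'rV[F]_n) :
  (\rank K <= (\rank (K *m (1%:M - delta_mx i ord0 *m eta))).+1)%N.
Proof.
have KE : K = K *m (1%:M - delta_mx i ord0 *m eta) + (K *m delta_mx i ord0) *m eta.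
  by rewrite mulmxBr mulmx1 mulmxA subrK.
rewrite [K in (\rank K <= _)%N]KE; apply: leq_trans (mxrank_add _ _) _.
rewrite -[X in (_ <= X)%N]addn1 leq_add2l.
exact: leq_trans (mxrankM_maxl _ _) (rank_leq_col _).
Qed.

(** The projection w - w_i eta lowers the rank by at most one, so if it maps [K] into a space of
    smaller rank than [K], it maps onto that space. *)
Lemma flat_sub p m (K : 'M[F]_(p, n)) (T : 'M[F]_(m, n)) (eta t : 'rV[F]_n) :
  (forall w : 'rV_n, (w <= K)%MS -> (w - w ord0 i *: eta <= T)%MS) ->
  (\rank T < \rank K)%N -> (t <= T)%MS ->
  exists2 w : 'rV_n, (w <= K)%MS & t = w - w ord0 i *: eta.
Proof.
move=> KT rk tT; set M := K *m (1%:M - delta_mx i ord0 *m eta).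
have sub : (M <= T)%MS.
  by apply/row_subP => a; rewrite row_mul flat_mxE; apply: KT; apply: row_sub.
have TM : (T <= M)%MS.
  rewrite -(mxrank_leqif_sup sub) eqn_leq (mxrankS sub) /= -ltnS.
  exact: leq_trans rk (flat_rank K eta).
have /submxP[D ->] := submx_trans tT TM; exists (D *m K); first exact: submxMl.
by rewrite -flat_mxE mulmxA.
Qed.

(** [eta] has i-th coordinate 1 and the vectors of [T] have 0, so [eta] adds a dimension to [T]
    inside [K]. *)
Lemma flat_rank_add (eta : 'rV[F]_n) p m (T : 'M[F]_(p, n)) (K : 'M[F]_(m, n)) :
  eta ord0 i = 1 -> (forall u : 'rV_n, (u <= T)%MS -> u ord0 i = 0) ->
  (T <= K)%MS -> (eta <= K)%MS -> (\rank T < \rank K)%N.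
Proof.
move=> e1 T0 TK eK; have TeK : (T + eta <= K)%MS by rewrite addsmx_sub TK eK.
have cap0 : (T :&: eta = 0)%MS.
  apply/eqP/rowV0P => v; rewrite sub_capmx => /andP[/T0 v0 /sub_rVP[a aE]].
  by move: v0; rewrite aE mxE e1 mulr1 => ->; rewrite scale0r.
apply: leq_trans (mxrankS TeK); rewrite (mxrank_disjoint_sum cap0).
rewrite -[X in (X < _)%N]addn0 ltn_add2l lt0n mxrank_eq0; apply: contra_eq_neq e1 => ->.
by rewrite mxE eq_sym oner_neq0.
Qed.

End ProjectFlat.

Lemma dmx_lin (F : numFieldType) n p q (M : 'M[{mpoly F[n]}]_(p, q)) (v : 'rV[F]_n) c u1 u2 :
  dmx M v (c *: u1 + u2) = c *: dmx M v u1 + dmx M v u2.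
Proof. by apply/matrixP => a b; rewrite !mxE dder_lin. Qed.

Lemma dmx_sum (F : numFieldType) n p q (M : 'M[{mpoly F[n]}]_(p, q)) (v : 'rV[F]_n)
    (I : finType) (Q : pred I) (a : I -> F) (u : I -> 'rV[F]_n) :
  dmx M v (\sum_(l | Q l) a l *: u l) = \sum_(l | Q l) a l *: dmx M v (u l).
Proof.
have h0 : dmx M v 0 = 0 by apply/matrixP => b c; rewrite !mxE dder0.
elim: (index_enum I) => [|l t IH]; first by rewrite !big_nil.
by rewrite !big_cons; case: ifP => // _; rewrite dmx_lin IH.
Qed.

Lemma flat_line1 (F : fieldType) n (v w : 'rV[F]_n) (t : F) i : v ord0 i = 1 ->
  (v + t *: (w - w ord0 i *: v)) ord0 i = 1.
Proof. by move=> v1; rewrite !mxE v1 mulr1 subrr mulr0 addr0. Qed.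

Section GenericDifferential.
Variables (C : numFieldType) (L : fieldType) (iota : {rmorphism C -> L}) (n : nat).
Implicit Types (P : {mpoly C[n]}) (eta u : 'rV[L]_n).

Lemma hderZ P eta c u : hder iota P eta (c *: u) = c * hder iota P eta u.
Proof. by rewrite -[c *: u]addr0 hder_lin hder0 addr0. Qed.

Lemma hder_sum P eta (I : finType) (Q : pred I) (a : I -> L) (u : I -> 'rV[L]_n) :
  hder iota P eta (\sum_(l | Q l) a l *: u l) = \sum_(l | Q l) a l * hder iota P eta (u l).
Proof.
elim: (index_enum I) => [|l t IH]; first by rewrite !big_nil hder0.
by rewrite !big_cons; case: ifP => // _; rewrite hder_lin IH.
Qed.

End GenericDifferential.

Lemma eq_submx (F : fieldType) p m n (u v : 'M[F]_(m, n)) (K : 'M[F]_(p, n)) :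
  u = v -> (v <= K)%MS -> (u <= K)%MS.
Proof. by move=> ->. Qed.

(** * The tangent space of the cone over the tangent variety *)

Section TangentCone.
Variables (R : realType) (r : nat) (X : set (pt R r)).
Notation C := R[i].
Notation N := r.+1.
Notation pnt := (pt R r).
Implicit Types (x y : pnt).
Hypothesis irrX : zirreducible X.
Variables (k : nat) (i : 'I_N) (Q0 : {mpoly C[N]}) (s : nat) (P : 'M[{mpoly C[N]}]_(s, N)).
Variable g : 'I_s -> 'I_N.
Hypothesis fr : That_frame X i k Q0 P g.
Hypothesis nz : forall y, X y -> princ i Q0 y ->
  exists2 v : 'rV[C]_N, v \in That X k y & v ord0 i != 0.
Hypothesis dX : dense_chart i X.
Variables (x0 : pnt).
Hypotheses (Xx0 : X x0) (Qx0 : princ i Q0 x0).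
Variables (L : fieldType) (iota : {rmorphism C -> L}) (zeta : 'rV[L]_(N + s)).
Local Notation A := (aff i X).
Local Notation A2 := (@bundle C N s A).
Hypothesis gen2 : generic A2 iota zeta.
Local Notation alpha := (alpha zeta).
Local Notation Phi := (lin2 P).
Local Notation gA := (gen_alpha gen2).
Local Notation e := (\rank (gtsp A iota alpha)).
Local Notation eta_tau := (etat i P iota zeta).
Variables (psi : 'I_N -> {mpoly C[N]}) (b0 : 'rV[C]_N).
Hypothesis Ab0 : A b0.
Hypothesis ca : coord_at A iota alpha b0 psi.

(* Its rows span the affine tangent space, at the point c P(a), of the cone
   over the union of the linear spaces That: those of P(a), and the
   derivatives of c P along a basis of the tangent space of X at a. *)
Definition conemx : 'M[{mpoly C[N + s]}]_(s + N, N) :=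
  col_mx (map_mx (@lift1 C N s) P)
    (\matrix_(l < N, j < N) if (l < e)%N then lin2 (map_mx (cder psi l) P) j else 0).

Local Notation conept x c := (map_mx (mv (row_mx (nv i x) c)) conemx).

Lemma coneptE x (c : 'rV[C]_s) : conept x c = col_mx (mat i P x)
  (\matrix_(l < N) if (l < e)%N then c *m dmx P (nv i x) (cvec psi l (nv i x)) else 0).
Proof.
rewrite /conemx map_col_mx; congr col_mx; apply/matrixP => l j; rewrite !mxE.
  by rewrite mv_lift1 row_mxKl.
case: ifP => _; last by rewrite meval0 mxE.
rewrite mv_lin2 row_mxKl row_mxKr [LHS]mxE [RHS]mxE; apply: eq_bigr => a _; congr (_ * _).
by rewrite !mxE mv_cder.
Qed.

Lemma coneptP x (c : 'rV[C]_s) (w : 'rV[C]_N) :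
  X x -> chart i x -> mv (nv i x) (\det (jac psi)) != 0 ->
  (w <= conept x c)%MS <-> exists c' xi, (xi <= tsp A (nv i x))%MS /\
    w = c' *m mat i P x + c *m dmx P (nv i x) xi.
Proof.
move=> Xx cx D0; have Ax := aff_nv Xx cx; rewrite coneptE.
set K2 := \matrix_(l < N) _.
have rK2 l : row l K2 = if (l < e)%N then c *m dmx P (nv i x) (cvec psi l (nv i x)) else 0.
  exact: rowK.
split=> [/submxP[B ->]|[c' [xi [xiT ->]]]].
  rewrite -[B]hsubmxK mul_row_col.
  exists (lsubmx B), (\sum_(l < N | (l < e)%N) rsubmx B ord0 l *: cvec psi l (nv i x)).
  split; first by apply: summx_sub => l le; apply: scalemx_sub; exact: (cvec_tangent gA Ab0 ca).
  congr (_ + _); rewrite dmx_sum mulmx_sumr mulmx_sum_row [LHS](bigID (fun l : 'I_N => (l < e)%N)) /=.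
  rewrite [X in _ + X]big1 ?addr0 => [|l /negPf le]; last by rewrite rK2 le scaler0.
  by apply: eq_bigr => l le; rewrite rK2 le -scalemxAr.
apply: addmx_sub; first by apply: submx_trans (submxMl _ _) _; rewrite -addsmxE addsmxSl.
have /(congr1 (fun u => c *m dmx P (nv i x) u)) := coord_expand ca Ax xiT.
have -> : mv (nv i x) (\det (jac psi)) *: xi = mv (nv i x) (\det (jac psi)) *: xi + 0 by rewrite addr0.
rewrite dmx_lin; have -> : dmx P (nv i x) 0 = 0 by apply/matrixP => a b; rewrite !mxE dder0.
rewrite addr0 -scalemxAr dmx_sum mulmx_sumr => h.
rewrite -(eqmx_scale _ D0) h; apply: summx_sub => l le.
rewrite -scalemxAr; apply: scalemx_sub; have := rK2 l; rewrite le => <-.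
by apply: submx_trans (row_sub l K2) _; rewrite -addsmxE addsmxSr.
Qed.


Local Notation e_tau := (\rank (gtsp (aff i (tau X k)) iota eta_tau)).
Local Notation conegen := (map_mx (mmap iota (fun l => zeta ord0 l)) conemx).

Lemma conegenE : conegen = col_mx (map_mx (mmap iota (fun l => alpha ord0 l)) P)
  (\matrix_(l < N) if (l < e)%N then
     \row_j \sum_a rsubmx zeta ord0 a * hder iota (P a j) alpha (gvec iota alpha psi l) else 0).
Proof.
rewrite /conemx map_col_mx; congr col_mx; apply/matrixP => l j; rewrite !mxE.
  by rewrite mh_lift1.
case: ifP => _; last by rewrite mmap0 mxE.
rewrite mh_lin2 [LHS]mxE [RHS]mxE; apply: eq_bigr => a _; congr (_ * _).
by rewrite !mxE mh_cder.
Qed.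

Lemma Phi_conegen (c : 'rV[L]_s) :
  (c *m map_mx (mmap iota (fun l => alpha ord0 l)) P <= conegen)%MS.
Proof. by rewrite conegenE; apply: submx_trans (submxMl _ _) _; rewrite -addsmxE addsmxSl. Qed.

(** Leibniz' rule for c P(alpha): the derivatives of c give rows of P, and those of [alpha] give
    derivatives of P along a vector tangent at the generic point of X, expanded in the dual vector
    fields. *)
Lemma der_conegen D : derivation iota D ->
  (\row_j D (mh iota zeta (Phi j)) <= conegen)%MS.
Proof.
move=> dD; pose cz := rsubmx zeta; pose xi := \row_j D (alpha ord0 j).
have PhiE j : D (mh iota zeta (Phi j)) = \sum_a cz ord0 a * hder iota (P a j) alpha xi
    + ((\row_a D (cz ord0 a)) *m map_mx (mmap iota (fun l => alpha ord0 l)) P) ord0 j.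
  rewrite mh_lin2 mxE (der_sum _ _ dD) [X in _ = _ + X]mxE -big_split; apply: eq_bigr => a _.
  rewrite (derM dD) [X in _ * D X + _]mxE (der_mmap _ _ dD) [X in D _ * X]mxE.
  by rewrite [X in _ = _ + X * _]mxE [X in _ = _ + _ * X]mxE.
have -> : \row_j D (mh iota zeta (Phi j)) = \row_j (\sum_a cz ord0 a * hder iota (P a j) alpha xi)
    + (\row_a D (cz ord0 a)) *m map_mx (mmap iota (fun l => alpha ord0 l)) P.
  by apply/rowP => j; rewrite [LHS]mxE PhiE [RHS]mxE [X in _ = X + _]mxE.
apply: addmx_sub (Phi_conegen _).
have D0 : mh iota alpha (\det (jac psi)) != 0 by case: ca => _ /(gen_neq0 gA Ab0).
rewrite -(eqmx_scale _ D0).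
have xiT : (xi <= gtsp A iota alpha)%MS := der_gtsp gA dD.
have -> : mh iota alpha (\det (jac psi)) *: \row_j (\sum_a cz ord0 a * hder iota (P a j) alpha xi)
    = \sum_(l < N | (l < e)%N) hder iota (psi l) alpha xi *:
      \row_j (\sum_a cz ord0 a * hder iota (P a j) alpha (gvec iota alpha psi l)).
  apply/rowP => j; rewrite summxE [LHS]mxE [X in _ * X = _]mxE mulr_sumr.
  transitivity (\sum_a cz ord0 a * (mh iota alpha (\det (jac psi)) * hder iota (P a j) alpha xi)).
    by apply: eq_bigr => a _; rewrite mulrCA.
  have hE a : mh iota alpha (\det (jac psi)) * hder iota (P a j) alpha xi
      = \sum_(l < N | (l < e)%N) hder iota (psi l) alpha xi * hder iota (P a j) alpha (gvec iota alpha psi l).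
    by rewrite -hderZ (gcoord_expand ca xiT) hder_sum.
  under eq_bigr => a _ do rewrite hE mulr_sumr.
  rewrite exchange_big; apply: eq_bigr => l _; rewrite [RHS]mxE [X in _ = _ * X]mxE mulr_sumr.
  by apply: eq_bigr => a _; rewrite mulrCA.
apply: summx_sub => l le; apply: scalemx_sub; rewrite conegenE.
set K2 := \matrix_(l < N) _.
have : row l K2 = \row_j (\sum_a cz ord0 a * hder iota (P a j) alpha (gvec iota alpha psi l)).
  by rewrite rowK le.
by move=> <-; apply: submx_trans (row_sub l K2) _; rewrite -addsmxE addsmxSr.
Qed.

(** A tangent vector at [etat] is the value of a derivation of [L]; applied to c P(alpha) this
    derivation shows that the vector lies in the cone space. So does [etat] itself, which is
    independent of the tangent space, whence the strict inequality. *)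
Lemma cone_rank_generic : (e_tau < \rank conegen)%N.
Proof.
have gT := gen_tau irrX fr nz dX Xx0 Qx0 gen2.
have Pi0 := Phi_i_neq0 fr nz Xx0 Qx0 gen2.
have eE : eta_tau = _ := frac_row i (fun l => mh_lin2 iota P zeta l).
have eK := eq_submx eE (scalemx_sub _ (Phi_conegen (rsubmx zeta))).
have e1 : eta_tau ord0 i = 1 by rewrite [LHS]mxE; exact: mulfV Pi0.
apply: (fun T0 TK => flat_rank_add e1 T0 TK eK) => [u /gtspP h|].
  have := h ('X_i - 1%:MP); rewrite hderB hderX hderC subr0; apply=> _ [z _ [cz ->]].
  by rewrite mevalB mevalXU mevalC nv1 // subrr.
apply/rV_subP => u /(gtsp_der gT)[D dD DE].
have : (mh iota zeta (Phi i) *: u <= conegen)%MS.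
  have PjE j : mh iota zeta (Phi j) = mh iota zeta (Phi i) * eta_tau ord0 j.
    by rewrite [X in _ = _ * X]mxE mulrC divfK.
  rewrite (row_leibniz dD PjE DE).
  apply: addmx_sub; first exact: der_conegen.
  by rewrite -scaleNr; apply: scalemx_sub.
by rewrite (eqmx_scale _ Pi0).
Qed.

(** A form vanishing on tau vanishes on each T_x, which settles the directions c' P(x), and on the
    family c P(z) for z in X, which settles c dP(xi) by the chain rule. Euler's relation disposes of
    the component along the point. *)
Lemma cone_tangent x (c c' : 'rV[C]_s) xi (w : 'rV[C]_N) : X x -> princ i Q0 x ->
  (c *m mat i P x) ord0 i = 1 -> (xi <= tsp A (nv i x))%MS ->
  w = c' *m mat i P x + c *m dmx P (nv i x) xi ->
  (w - w ord0 i *: (c *m mat i P x) <= tsp (aff i (tau X k)) (c *m mat i P x))%MS.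
Proof.
move=> Xx Qx v1 /tspP xiT wE; set v := c *m mat i P x in v1 *.
apply/tspP => p p0; have [d [F hF FE]] := homogenize_deg i p.
have FT x' : X x' -> princ i Q0 x' -> forall v' : 'rV[C]_N, v' \in That X k x' -> mv v' F = 0.
  move=> Xx' Qx' v' Tv'; have [E|v0] := eqVneq (v' ord0 i) 0; first exact: (FE v').2.
  have [_ hT _] := fr Xx' Qx'; have /submxP[b bE] := (hT v').1 Tv'.
  rewrite bE in v0; rewrite bE (FE _).1 // (p0 _ (tau_frame fr Xx' Qx' v0)).
  by rewrite mulr0.
have [_ hT _] := fr Xx Qx.
have Fv : mv v F = 0 by apply: (FT x Xx Qx); apply/hT; exact: submxMl.
have -> : dder p v (w - w ord0 i *: v) = dder F v (w - w ord0 i *: v).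
  apply: dder_eq_line => t; have w1 : (v + t *: (w - w ord0 i *: v)) ord0 i = 1.
    exact: flat_line1.
  by rewrite (FE _).1 w1 ?oner_neq0 // expr1n mul1r invr1 scale1r.
have -> : w - w ord0 i *: v = (- w ord0 i) *: v + w by rewrite scaleNr addrC.
rewrite dder_lin (dder_euler _ hF) Fv !mulr0 add0r.
rewrite wE; have -> : c' *m mat i P x = 1 *: (c' *m mat i P x) by rewrite scale1r.
rewrite dder_lin mul1r.
have -> : dder F v (c' *m mat i P x) = 0.
  rewrite -(dderC 0 v (c' *m mat i P x)); apply: dder_eq_line => t.
  rewrite mevalC; apply: (FT x Xx Qx); apply/hT; rewrite scalemxAl -mulmxDl.
  exact: submxMl.
pose G l : {mpoly C[N]} := \sum_a (c ord0 a)%:MP * P a l.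
have GE x' : \row_l mv (nv i x') (G l) = c *m mat i P x'.
  apply/rowP => l; rewrite [LHS]mxE mv_sumM [RHS]mxE; apply: eq_bigr => a _.
  by rewrite mevalC [X in _ = _ * X]mxE.
have dGE : \row_l dder (G l) (nv i x) xi = c *m dmx P (nv i x) xi.
  apply/rowP => l; rewrite [LHS]mxE dder_sum [RHS]mxE; apply: eq_bigr => a _.
  by rewrite dderM dderC mul0r add0r mevalC [X in _ = _ * X]mxE.
rewrite add0r -dGE -[v]GE -dder_psub; apply: xiT.
apply/gA; apply: (gen_dense gA (Q0_alpha Xx0 Qx0 gen2)) => _ [z Xz [cz ->]] Qz.
rewrite mv_psub GE; apply: (FT z Xz (conj cz Qz)).
by have [_ hTz _] := fr Xz (conj cz Qz); apply/hTz; exact: submxMl.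
Qed.

End TangentCone.

(** * The image of the fundamental form in the normal space *)

Section Image.
Variables (R : realType) (r : nat) (X : set (pt R r)).
Notation C := R[i].
Notation N := r.+1.
Notation pnt := (pt R r).
Variables (k : nat) (i : 'I_N) (L : fieldType) (iota : {rmorphism C -> L}) (eta : 'rV[L]_N).
Hypothesis gen : generic (aff i X) iota eta.
Hypothesis dX : dense_chart i X.
Variables (Q0 : {mpoly C[N]}) (s : nat) (P : 'M[{mpoly C[N]}]_(s, N)) (g : 'I_s -> 'I_N).
Hypothesis fr : That_frame X i k Q0 P g.
Variables (x y : pnt) (c : 'rV[C]_s).
Hypotheses (Xx : X x) (Qx : princ i Q0 x) (cy : chart i y).
Hypothesis yE : nv i y = c *m mat i P x.

Local Notation T := (That X k x).
Local Notation deriv u := (c *m dmx P (nv i x) (theta i u)).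

Lemma deriv_lin a (u1 u2 : tangentP x) : deriv (a *: u1 + u2) = a *: deriv u1 + deriv u2.
Proof. by rewrite linearP dmx_lin mulmxDr -scalemxAr. Qed.

Lemma fund_form_line (u : tangentP x) (v : subvs_of (line y)) : u \in tangent X x ->
  fund_form X k u (vsval v) = (vsval v : 'rV[C]_N) ord0 i *: quo_proj T (deriv u).
Proof.
move=> ux; have [m vE] := subvs_nvl cy v.
have vV : vsval v = m *: nv i y by rewrite vE -(vsval_nvl cy).
have mE : (vsval v : 'rV[C]_N) ord0 i = m by rewrite vV mxE nv1 // mulr1.
rewrite mE vV yE scalemxAl (fund_formE gen dX fr) // -scalemxAl.
by rewrite linearZ.
Qed.

(** [fund_form_at] applies [linfun] to functions defined through choices; their values are recovered
    once linearity has been proved. *)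
Lemma linfunE (K : fieldType) (aT rT : vectType K) (f : aT -> rT) : linear f ->
  forall u, linfun f u = f u.
Proof.
move=> lin u; pose h := GRing.isLinear.Build _ _ _ _ f lin.
pose fl : {linear aT -> rT} := HB.pack f h.
exact: (lfunE fl u).
Qed.

Lemma fund_form_atE (u : subvs_of (tangent X x)) (v : subvs_of (line y)) :
  fund_form_at X k x y u v
  = (vsval v : 'rV[C]_N) ord0 i *: quo_proj T (deriv (vsval u)).
Proof.
have inner (u' : subvs_of (tangent X x)) :
    linear (fun v : subvs_of (line y) => fund_form X k (vsval u') (vsval v)).
  move=> a v1 v2; rewrite !fund_form_line ?subvsP // linearP scalerA -scalerDl.
  by rewrite !mxE.
rewrite /fund_form_at linfunE; last first.
  move=> a u1 u2; apply/lfunP => w; rewrite add_lfunE scale_lfunE.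
  have E : deriv (vsval (a *: u1 + u2)) = a *: deriv (vsval u1) + deriv (vsval u2) by exact: deriv_lin.
  rewrite !(linfunE (inner _)) !fund_form_line ?subvsP // E linearP.
  by rewrite scalerDr !scalerA [_ * a]mulrC.
by rewrite (linfunE (inner u)) fund_form_line // subvsP.
Qed.

Lemma normal_proj_line (phi : tangentP y) (v : subvs_of (line y)) : nv i y \in T ->
  normal_proj (line y) T phi v = (vsval v : 'rV[C]_N) ord0 i *: quo_proj T (theta i phi).
Proof.
move=> Ty; rewrite normal_projE; have [m vE] := subvs_nvl cy v.
have mE : (vsval v : 'rV[C]_N) ord0 i = m.
  by rewrite vE linearZ /= vsval_nvl // mxE nv1 // mulr1.
rewrite mE vE; have [m' lE] := lift_tangent_scale phi m cy.
rewrite -/(lift_tangent phi _) lE linearZ; congr (_ *: _).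
apply/eqP; rewrite -subr_eq0 -linearB ker_quo_proj.
have -> : theta i phi + m' *: nv i y - theta i phi = m' *: nv i y by rewrite addrAC subrr add0r.
exact: memvZ.
Qed.

(** The two inclusions assumed describe the tangent space of [Y] as the set of projections of the
    vectors c' P(x) + c dP(xi). Modulo T_x the first term and the point [y] disappear, and what
    remains is the fundamental form at xi. *)
Lemma image_eq (Y : set pnt) : Y y ->
  (forall xi c' (w : 'rV[C]_N), (xi <= tsp (aff i X) (nv i x))%MS ->
     w = c' *m mat i P x + c *m dmx P (nv i x) xi ->
     (w - w ord0 i *: nv i y <= tsp (aff i Y) (nv i y))%MS) ->
  (forall t : 'rV[C]_N, (t <= tsp (aff i Y) (nv i y))%MS -> exists xi c',
     (xi <= tsp (aff i X) (nv i x))%MS /\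
     let w : 'rV[C]_N := c' *m mat i P x + c *m dmx P (nv i x) xi in
     t = w - w ord0 i *: nv i y) ->
  limg (fund_form_at X k x y) = (normal_proj (line y) T @: tangent Y y)%VS.
Proof.
move=> Yy h1 h2; have [_ hT _] := fr Xx Qx; have cx := Qx.1.
have Ty : nv i y \in T by apply/hT; rewrite yE submxMl.
have qE c' xi : let w : 'rV[C]_N := c' *m mat i P x + c *m dmx P (nv i x) xi in
    quo_proj T (w - w ord0 i *: nv i y) = quo_proj T (c *m dmx P (nv i x) xi).
  move=> w; apply/eqP; rewrite -subr_eq0 -linearB ker_quo_proj /w.
  rewrite addrAC addrK; apply: memvB; last exact: memvZ.
  by apply/hT; exact: submxMl.
apply/vspaceP => f; apply/memv_imgP/memv_imgP => -[].
  move=> u _ ->; have uT := (tangent_tsp cx (vsval u) Xx).1 (subvsP u).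
  have [phi pE] := theta_surj cy (tsp_i (h1 _ 0 _ uT erefl)).
  exists phi; first by apply/(tangent_tsp cy phi Yy); rewrite pE; exact: (h1 _ 0 _ uT erefl).
  by apply/lfunP => v; rewrite fund_form_atE normal_proj_line // pE qE.
move=> phi /(tangent_tsp cy phi Yy)/h2[xi [c' [xiT /= tE]]] ->.
have [u uE] := theta_surj cx (tsp_i xiT).
have ux : u \in tangent X x by apply/(tangent_tsp cx u Xx); rewrite uE.
exists (vsproj (tangent X x) u); first exact: memvf.
by apply/lfunP => v; rewrite fund_form_atE normal_proj_line // vsprojK // uE tE qE.
Qed.

End Image.

Section Fibres.
Variables (F : numFieldType) (n s : nat).

(* The polynomial v |-> p (a, v_g B), where v_g are the columns g of v. *)
Definition frame_sub (p : {mpoly F[n + s]}) (a : 'rV[F]_n) (g : 'I_s -> 'I_n) (B : 'M[F]_s) :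
    {mpoly F[n]} :=
  psub p (fun l => match split l with
    | inl l => (a ord0 l)%:MP
    | inr l => \sum_b 'X_(g b) * (B b l)%:MP end).

Lemma mv_frame_sub p a g B (v : 'rV[F]_n) :
  mv v (frame_sub p a g B) = mv (row_mx a (colsub g v *m B)) p.
Proof.
rewrite /frame_sub mv_psub; congr (meval _ p); apply/funext => l; rewrite [LHS]mxE [RHS]mxE.
case: (split l) => l'; first by rewrite mevalC.
rewrite mv_sumM [RHS]mxE; apply: eq_bigr => b _.
by rewrite mevalXU mevalC [X in _ = X * _]mxE.
Qed.

Lemma map_mx_frame_sub p q (K : 'M[{mpoly F[n + s]}]_(p, q)) a g B (v : 'rV[F]_n) :
  map_mx (mv v) (map_mx (fun p => frame_sub p a g B) K)
  = map_mx (mv (row_mx a (colsub g v *m B))) K.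
Proof.
by apply/matrixP => b c; rewrite [LHS]mxE [X in mv v X]mxE mv_frame_sub [RHS]mxE.
Qed.

Lemma frame_coordK (M : 'M[F]_(s, n)) (g : 'I_s -> 'I_n) (c : 'rV[F]_s) :
  \det (colsub g M) != 0 -> colsub g (c *m M) *m invmx (colsub g M) = c.
Proof. by move=> u; rewrite -mulmx_colsub mulmxK // unitmxE unitfE. Qed.

End Fibres.

Lemma mul4_neq0 (F : fieldType) (a b c d : F) : a * (b * (c * d)) != 0 ->
  [/\ a != 0, b != 0, c != 0 & d != 0].
Proof. by rewrite !mulf_eq0 !negb_or => /and4P. Qed.

Lemma mul_neq0_r (F : fieldType) (a b c : F) : a = b * c -> a != 0 -> c != 0.
Proof. by move=> ->; rewrite mulf_eq0 negb_or => /andP[]. Qed.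

(** * Choice of the open sets and conclusion *)

Section Main.
Variables (R : realType) (r : nat) (X : set (pt R r)).
Notation C := R[i].
Notation N := r.+1.
Notation pnt := (pt R r).
Implicit Types (x y : pnt).
Hypothesis irrX : zirreducible X.
Variables (k : nat) (i : 'I_N) (Q0 : {mpoly C[N]}) (s : nat) (P : 'M[{mpoly C[N]}]_(s, N)).
Variable g : 'I_s -> 'I_N.
Hypothesis fr : That_frame X i k Q0 P g.
Hypothesis nz : forall y, X y -> princ i Q0 y ->
  exists2 v : 'rV[C]_N, v \in That X k y & v ord0 i != 0.
Hypothesis dX : dense_chart i X.
Variables (x0 : pnt).
Hypotheses (Xx0 : X x0) (Qx0 : princ i Q0 x0).
Variables (L : fieldType) (iota : {rmorphism C -> L}) (zeta : 'rV[L]_(N + s)).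
Local Notation A := (aff i X).
Local Notation A2 := (@bundle C N s A).
Hypothesis gen2 : generic A2 iota zeta.
Local Notation alpha := (alpha zeta).
Local Notation Phi := (lin2 P).
Local Notation gA := (gen_alpha gen2).
Local Notation eta_tau := (etat i P iota zeta).
Variables (psi : 'I_N -> {mpoly C[N]}) (b0 : 'rV[C]_N).
Hypothesis Ab0 : A b0.
Hypothesis ca : coord_at A iota alpha b0 psi.
Hypothesis Qpsi : forall x, princ i Q0 x -> mv (nv i x) (\det (jac psi)) != 0.
Local Notation tau := (tau X k).
Local Notation e_tau := (\rank (gtsp (aff i tau) iota eta_tau)).
Local Notation conemx := (conemx X i P iota zeta psi).
Local Notation conept x c := (map_mx (mv (row_mx (nv i x) c)) conemx).
Local Notation gT := (gen_tau irrX fr nz dX Xx0 Qx0 gen2).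
Local Notation dT := (dense_tau irrX fr nz dX Xx0 Qx0 gen2).

(** By [cone_tangent] the cone space projects into the tangent space of tau, and its larger rank
    makes the projection onto. The dimension formula is rank-nullity for [normal_proj], whose kernel
    is the tangent space of T_x and lies in that of tau. *)
Lemma tau_at x y (c : 'rV[C]_s) : X x -> princ i Q0 x -> Tk X k x y -> chart i y ->
  nv i y = c *m mat i P x -> \rank (tsp (aff i tau) (nv i y)) = e_tau ->
  (e_tau < \rank (conept x c))%N ->
  [/\ nonsingular_at tau y,
      limg (fund_form_at X k x y) = (normal_proj (line y) (That X k x) @: tangent tau y)%VS
    & exists2 t, has_dim (Tk X k x) t & has_dim tau (t + \dim (limg (fund_form_at X k x y)))].
Proof.
move=> Xx Qx Ty cy yE rT rK; have [Ux hT _] := fr Xx Qx.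
have ty : tau y := tau_point Ux Ty.
have v1 : (c *m mat i P x) ord0 i = 1 by rewrite -yE nv1.
have im : limg (fund_form_at X k x y) = (normal_proj (line y) (That X k x) @: tangent tau y)%VS.
  apply: (image_eq gA dX fr Xx Qx cy yE ty) => [xi c' w xiT wE|t tT].
    by rewrite yE; exact: (cone_tangent fr Xx0 Qx0 gen2 Xx Qx v1 xiT wE).
  have KT (w : 'rV[C]_N) : (w <= conept x c)%MS -> (w - w ord0 i *: nv i y <= tsp (aff i tau) (nv i y))%MS.
    move=> /(coneptP P gen2 Ab0 ca c w Xx Qx.1 (Qpsi Qx))[c' [xi [xiT wE]]].
    by rewrite yE; exact: (cone_tangent fr Xx0 Qx0 gen2 Xx Qx v1 xiT wE).
  rewrite -rT in rK; have [w wK tE] := flat_sub KT rK tT.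
  have [c' [xi [xiT wE]]] := (coneptP P gen2 Ab0 ca c w Xx Qx.1 (Qpsi Qx)).1 wK.
  by exists xi, c'; split; [exact: xiT | rewrite wE in tE; exact: tE].
have ns : nonsingular_at tau y by apply/(nonsingularP gT dT ty cy).
split=> //; have Tyv : nv i y \in That X k x by apply/hT; rewrite yE submxMl.
have yi : nv i y ord0 i != 0 by rewrite nv1 // oner_neq0.
exists (\dim (That X k x)).-1; first exact: has_dim_linear Tyv yi.
have [_ dt] := ns; rewrite im -(dim_tangent_linear Tyv yi Ty).
rewrite (tangent_linear_subvariety Ty).
have hk : (tangent tau y :&: lker (normal_proj (line y) (That X k x))
    = lker (normal_proj (line y) (That X k x)))%VS.
  apply/capv_idPr; rewrite -(tangent_linear_subvariety Ty).
  apply/subvP => phi /mem_tangent h; apply/mem_tangent => d F hF Ft; apply: (h d F hF) => z v Tz.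
  by apply: Ft; exact: (tau_point Ux Tz).
have hd := etrans (f_equal2 addn (congr1 (fun U : {vspace tangentP y} => \dim U) (esym hk)) erefl)
  (limg_ker_dim (normal_proj (line y) (That X k x)) (tangent tau y)).
by rewrite hd.
Qed.

Lemma conept_scale x a (c : 'rV[C]_s) : X x -> princ i Q0 x -> a != 0 ->
  (\rank (conept x c) <= \rank (conept x (a *: c)))%N.
Proof.
move=> Xx Qx a0; apply: mxrankS; apply/rV_subP => w.
move=> /(coneptP P gen2 Ab0 ca c w Xx Qx.1 (Qpsi Qx))[c' [xi [xiT ->]]].
apply/(coneptP P gen2 Ab0 ca (a *: c) _ Xx Qx.1 (Qpsi Qx)).
exists c', (a^-1 *: xi); split; first exact: scalemx_sub.
congr (_ + _); have -> : a^-1 *: xi = a^-1 *: xi + 0 by rewrite addr0.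
rewrite dmx_lin; have -> : dmx P (nv i x) 0 = 0 by apply/matrixP => p q; rewrite !mxE dder0.
by rewrite addr0 -scalemxAl -scalemxAr scalerA mulfV // scale1r.
Qed.

Lemma main_chart : exists U : set (pt R r),
  [/\ open_in X U, U !=set0, U `<=` Uk X k &
   forall x, U x -> exists Ux : set (pt R r),
     [/\ open_in (Tk X k x) Ux, Ux !=set0 &
      forall y, Ux y ->
        [/\ nonsingular_at tau y,
            limg (fund_form_at X k x y) =
              (normal_proj (line y) (That X k x) @: tangent tau y)%VS &
            exists2 t, has_dim (Tk X k x) t &
              has_dim tau (t + \dim (limg (fund_form_at X k x y)))]]].
Proof.
have [Qt Qt0 hQt] := tsp_rank_generic gT.
have [f [h [H0 hH]]] := rank_point_eq gen2 conemx; set H := \det _ in H0 hH.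
have rkH := cone_rank_generic irrX fr nz dX Xx0 Qx0 gen2 Ab0 ca.
have [m [G [GL GC]]] := frac_subst_both iota Phi (Phi i) Qt.
have Pi0 := Phi_i_neq0 fr nz Xx0 Qx0 gen2.
have G0 : mh iota zeta G != 0.
  apply: (eq_neq0 (GL zeta Pi0)); exact: (mulf_neq0 (expf_neq0 m Pi0) Qt0).
(* [H] controls the rank of the cone matrix, and [G] is the numerator of [Qt] at the point c P(x).
   Only the second component [c1] of the point found is kept: with c frozen to [c1], the four
   conditions become the condition [Rp] on x alone. *)
have [z Az] : exists2 z, A2 z & mv z (Phi i * (H * (G * lift1 s Q0))) != 0.
  apply: (gen_point gen2); rewrite !mhM mulf_neq0 // mulf_neq0 // mulf_neq0 //.
  by rewrite mh_lift1; exact: (Q0_alpha Xx0 Qx0 gen2).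
have [x1 Xx1 [cx1 xE]] := Az; pose c1 := rsubmx z.
have zE : z = row_mx (nv i x1) c1 by rewrite -xE hsubmxK.
rewrite zE -mv_fibre1; set Rp := fibre1 _ c1 => Rx1.
have RP x : princ i Rp x -> [/\ princ i Q0 x, (c1 *m mat i P x) ord0 i != 0,
    mv (row_mx (nv i x) c1) H != 0 & mv (row_mx (nv i x) c1) G != 0].
  move=> [cx]; rewrite mv_fibre1 !mevalM mv_lift1 row_mxKl mv_Phi => /mul4_neq0[h1 h2 h3 h4].
  by split; [exact: (conj cx h4) | exact: h1 | exact: h2 | exact: h3].
exists (X `&` princ i Rp); split.
- by exists (princ i Rp); [exact: princ_open | ].
- by exists x1; split; [exact: Xx1 | exact: (conj cx1 Rx1)].
- by move=> x [Xx /RP[Qx _ _ _]]; have [] := fr Xx Qx.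
move=> x [Xx /RP[Qx v0 Hx Gx]]; have [Ux hT u] := fr Xx Qx.
(* Rescaling [c1] puts the point c P(x) on the slice and does not lower the rank of the cone
   matrix. *)
pose a := ((c1 *m mat i P x) ord0 i)^-1; pose c0 := a *: c1.
have a0 : a != 0 by rewrite invr_eq0.
have rk0 : (e_tau < \rank (conept x c0))%N.
  apply: leq_trans (conept_scale c1 Xx Qx a0).
  by have [_ ->] := hH _ (bundle_row c1 (aff_nv Xx Qx.1)) Hx.
have v1E : c0 *m mat i P x = a *: (c1 *m mat i P x) by rewrite -scalemxAl.
have v1i : (c0 *m mat i P x) ord0 i = 1 by rewrite v1E mxE mulVf.
have vQt : mv (c0 *m mat i P x) Qt != 0.
  have E l : mv (row_mx (nv i x) c1) (Phi l) = (c1 *m mat i P x) ord0 l by exact: mv_Phi.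
  have GE := etrans (GC _ (eq_neq0 (E i) v0))
    (f_equal2 (fun b (w : 'rV[C]_N) => b ^+ m * mv w Qt) (E i) (frac_row i E)).
  by rewrite v1E; exact: mul_neq0_r GE Gx.
(* For fixed [x], c is a linear function of v = c P(x), read off the columns [g]. A maximal minor of
   the cone matrix at [c0] thereby becomes a polynomial [Hx'] in v; its nonvanishing defines an open
   subset of T_x, nonempty because of [c0]. *)
have [f' [g' u']] := unit_minor (conept x c0).
pose B := invmx (colsub g (mat i P x)).
pose Hx' := \det (mxsub f' g' (map_mx (fun p => frame_sub p (nv i x) g B) conemx)).
have gu : \det (colsub g (mat i P x)) != 0 by move: u; rewrite -map_mxsub -det_map_mx.
have HxE (v : 'rV[C]_N) c : v = c *m mat i P x -> mv v Hx' = \det (mxsub f' g' (conept x c)).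
  by move=> vE; rewrite /Hx' -det_map_mx map_mxsub map_mx_frame_sub vE (frame_coordK _ gu).
exists (Tk X k x `&` princ i (Qt * Hx')); split.
- by exists (princ i (Qt * Hx')); [exact: princ_open | ].
- have vN : c0 *m mat i P x != 0 by apply: (row_entry_neq0 (i := i)); rewrite v1i oner_neq0.
  have [y yv] := point_of vN; have [cy yE] := nv_eq yv v1i.
  exists y; split; first by apply/(linear_subvarietyP _ yv)/hT; exact: submxMl.
  have H1 : mv (c0 *m mat i P x) Hx' != 0 by rewrite (HxE _ c0 erefl) -unitfE -unitmxE; exact: u'.
  by apply: princ_mul; split; [exact: cy | rewrite yE; exact: vQt | exact: cy | rewrite yE; exact: H1].
move=> y [Ty]; rewrite princM => -[Qty Hy]; have cy := Qty.1.
have Tyv : nv i y \in That X k x by apply/(linear_subvarietyP _ (hcoord_nv cy)).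
have /submxP[c yE] := (hT _).1 Tyv.
apply: (tau_at Xx Qx Ty cy yE).
  by apply: (hQt _ _ Qty.2); exact: (aff_nv (tau_point Ux Ty) cy).
apply: leq_trans rk0 _; apply: (unit_minor_rank (f := f') (g := g')).
by rewrite unitmxE unitfE -(HxE _ _ yE); exact: Hy.2.
Qed.

End Main.

Theorem theorem4p2 (R : realType) (r n k : nat) (X : set (pt R r)) :
  quasi_projective_variety X -> has_dim X n -> (1 <= n)%N -> (1 <= k)%N ->
  exists U : set (pt R r),
    [/\ open_in X U, U !=set0, U `<=` Uk X k &
     forall x, U x ->
       exists Ux : set (pt R r),
         [/\ open_in (Tk X k x) Ux, Ux !=set0 &
          forall y, Ux y ->
            [/\ nonsingular_at (tau X k) y,
                limg (fund_form_at X k x y) =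
                  (normal_proj (line y) (That X k x) @: tangent (tau X k) y)%VS &
                exists2 t, has_dim (Tk X k x) t &
                  has_dim (tau X k)
                    (t + \dim (limg (fund_form_at X k x y)))]]].
Proof.
move=> [irrX _] _ _ _; have [x Xx] := irrX.1; have [i cx] := chart_ex x.
have [pA dX] := irreducible_prime irrX (ex_intro2 _ _ x Xx cx).
have [L [iota [eta [gen gfrac]]]] := generic_point_subproof pA.
have [Q0 [s [P [g [Q00 fr nz]]]]] := frame_exists k gen dX gfrac.
have [x0 [Xx0 Qx0 Ax0]] := gen_princ gen Q00.
(* The generic point of the space of pairs (x, c) projects to a generic point of the slice of [X],
   with respect to which the coordinates [psi] are taken, so that a single field carries all
   derivations. *)
have [L2 [iota2 [zeta [gen2 _]]]] := generic_point_subproof (prime_bundle s pA).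
have [Ux0 _ _] := fr x0 Xx0 Qx0.
have gA := gen_alpha gen2.
have [psi ca] := coord_exists Ax0 ((nonsingularP gA dX Xx0 Qx0.1).1 (Uk_nonsingular Ux0)).
have J0 : princ i (\det (jac psi)) x0 by split; [exact: Qx0.1 | case: ca].
have Qp x' : princ i (\det (jac psi) * Q0) x' -> princ i (\det (jac psi)) x' /\ princ i Q0 x'.
  by rewrite princM.
have nz' y : X y -> princ i (\det (jac psi) * Q0) y -> exists2 v : 'rV_r.+1, v \in That X k y & v ord0 i != 0.
  by move=> Xy /Qp[_ Q0y]; exact: nz.
have Qpsi y : princ i (\det (jac psi) * Q0) y -> mv (nv i y) (\det (jac psi)) != 0.
  by move=> /Qp[[]].
exact: (main_chart irrX (That_frame_sub (Q := \det (jac psi)) fr) nz' dX Xx0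
  (princ_mul J0 Qx0) gen2 Ax0 ca Qpsi).
Qed.
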